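(* Let $n\ge 2$ be an integer, let $1<p\le n$, let $\Omega\subseteq\mathbb{R}^n$ be a domain such that $0$ is an isolated point of the boundary of $\Omega$ in the one-point compactification $\mathbb{R}^n\cup\{\infty\}$, and let $H$ be a norm on $\mathbb{R}^n$ (independent of $x$) such that $(\mathbb{R}^n,H)$ is uniformly convex and $H$ is differentiable in $\mathbb{R}^n\setminus\{0\}$. Put $\mathcal{A}(\xi)=\nabla_\xi\big(H(\xi)^p/p\big)$. Assume that $\mathcal{A}\in C^1(\mathbb{R}^n\setminus\{0\})$ and that there exist positive constants $\Lambda_1,\Lambda_2$ such that for all $\xi\in\mathbb{R}^n\setminus\{0\}$ and all $\eta\in\mathbb{R}^n$, $$D\mathcal{A}(\xi)\eta\cdot\eta\ge\Lambda_1|\xi|^{p-2}|\eta|^2,\qquad |D\mathcal{A}(\xi)|\le\Lambda_2|\xi|^{p-2}.$$ Then $0$ is regular with respect to the operator $Q_0'[u]=-\mathrm{div}\,\mathcal{A}(\nabla u)$ in $\Omega$.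
   Context: A domain is a nonempty connected open set. $D\mathcal{A}(\xi)$ is the derivative (matrix) of $\mathcal{A}$ at $\xi$. For an open set $U\subseteq\mathbb{R}^n$, a function $v\in W^{1,p}_{\mathrm{loc}}(U)$ is a (weak) solution of $-\mathrm{div}\,\mathcal{A}(\nabla u)=0$ in $U$ if $\int_U\mathcal{A}(\nabla v)\cdot\nabla\phi\,dx=0$ for all $\phi\in C_c^\infty(U)$; solutions are identified with their continuous representatives. Regularity of $0$: let $\mathcal{G}_0$ be the set of all positive solutions of $Q'_0[u]=0$ in connected punctured neighborhoods $\Omega'\subseteq\Omega$ of $0$ (the neighborhood may depend on the solution). The point $0$ is regular with respect to $Q'_0$ if for all $u,v\in\mathcal{G}_0$ the limit $\lim_{x\to0}u(x)/v(x)$ exists in the wide sense, i.e. in $[0,\infty]$. (In the paper, this notion is introduced for operators that are nonnegative in $\Omega$, i.e. for which the equation has a positive (super)solution in $\Omega$; here constants are positive solutions.) *)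

(* Defs.v *)
From HB Require Import structures.
From mathcomp Require Import all_boot all_order all_algebra.
From mathcomp Require Import all_classical all_reals all_analysis.

Set Implicit Arguments.
Unset Strict Implicit.
Unset Printing Implicit Defensive.
Import Order.TTheory GRing.Theory Num.Theory.
Import numFieldNormedType.Exports.

Local Open Scope classical_set_scope.
Local Open Scope ring_scope.

(* 'rV[R]_n carries the sigma-algebra generated by the coordinates, that is,
   its Borel sigma-algebra. *)
Definition measure_rV_display : measure_display -> measure_display.
Proof. exact. Qed.

Section measurable_rV.
Context {R : realType}.
Variable n : nat.

Let coord (i : 'I_n) (x : 'rV[R]_n) : R := x ord0 i.

Let rV_set0 : g_sigma_preimage coord set0.
Proof. exact: sigma_algebra0. Qed.

Let rV_setC A : g_sigma_preimage coord A -> g_sigma_preimage coord (~` A).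
Proof. exact: sigma_algebraC. Qed.

Let rV_bigcup (F : _^nat) : (forall i, g_sigma_preimage coord (F i)) ->
  g_sigma_preimage coord (\bigcup_i (F i)).
Proof. exact: sigma_algebra_bigcup. Qed.

HB.instance Definition _ := @isMeasurable.Build
  (measure_rV_display default_measure_display)
  'rV[R]_n (g_sigma_preimage coord) rV_set0 rV_setC rV_bigcup.

End measurable_rV.

Section lebesgue_rV.
Context {R : realType}.

Lemma measurable_rV_coord n (i : 'I_n) :
  measurable_fun [set: 'rV[R]_n] (fun x => x ord0 i).
Proof.
move=> _ Y mY; rewrite setTI; apply: sub_sigma_algebra => /=.
rewrite -bigcup_seq/=; exists i => /=; first by rewrite mem_index_enum.
by exists Y => //; rewrite setTI.
Qed.

Lemma measurable_fun_rVP d (T : measurableType d) n (f : T -> 'rV[R]_n) :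
  measurable_fun [set: T] f <->
  forall i, measurable_fun [set: T] (fun t => f t ord0 i).
Proof.
apply: (@iff_trans _ (g_sigma_preimage (fun i t => f t ord0 i)
    `<=` measurable)).
  rewrite (g_sigma_preimage_comp (fun i (x : 'rV[R]_n) => x ord0 i) f).
  split=> [mf A [/= C preC <-]|prefS]; first exact: mf.
  by move=> _ A mA; apply: prefS; exists A.
split=> [fS i|mf].
- move=> _ A mA; apply: fS; apply: sub_sigma_algebra.
  rewrite -bigcup_seq/=; exists i => /=; first by rewrite mem_index_enum.
  by exists A.
- apply: smallest_sub; first exact: sigma_algebra_measurable.
  rewrite -bigcup_seq/=; apply: bigcup_sub => i Ii A [B mB <-]; exact: mf.
Qed.

Definition rV_cons n (xv : measurableTypeR R * 'rV[R]_n) : 'rV[R]_n.+1 :=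
  \row_i if unlift ord0 i is Some j then xv.2 ord0 j else xv.1.

Definition rV_uncons n (v : 'rV[R]_n.+1) : measurableTypeR R * 'rV[R]_n :=
  (v ord0 ord0, \row_i v ord0 (lift ord0 i)).

Lemma rV_consK n : cancel (@rV_cons n) (@rV_uncons n).
Proof.
move=> [x v]; rewrite /rV_uncons /rV_cons mxE unlift_none/=; congr pair.
by apply/rowP => i; rewrite !mxE liftK.
Qed.

Lemma rV_unconsK n : cancel (@rV_uncons n) (@rV_cons n).
Proof.
by move=> v; apply/rowP => i; rewrite !mxE; case: unliftP => [j|] -> //; rewrite mxE.
Qed.

Lemma measurable_rV_cons n : measurable_fun [set: _] (@rV_cons n).
Proof.
apply/measurable_fun_rVP => i; under eq_fun do rewrite mxE.
case: unliftP => [j|] _; last exact: measurable_fst.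
exact: (measurableT_comp (measurable_rV_coord j) measurable_snd).
Qed.

Lemma measurable_rV_uncons n : measurable_fun [set: _] (@rV_uncons n).
Proof.
apply: measurable_fun_pair; first exact: measurable_rV_coord.
apply/measurable_fun_rVP => i; under eq_fun do rewrite mxE.
exact: measurable_rV_coord.
Qed.

HB.instance Definition _ n := isMeasurableFun.Build _ _
  (measurableTypeR R * 'rV[R]_n)%type 'rV[R]_n.+1 (@rV_cons n)
  (@measurable_rV_cons n).

Section lebesgue_cons.
Variables (n : nat) (mu : {sigma_finite_measure set 'rV[R]_n -> \bar R}).

Definition lebesgue_cons : set 'rV[R]_n.+1 -> \bar R :=
  pushforward (lebesgue_measure \x mu)%E (@rV_cons n).

Let lebesgue_cons0 : lebesgue_cons set0 = 0%E.
Proof. exact: measure0. Qed.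

Let lebesgue_cons_ge0 A : (0 <= lebesgue_cons A)%E.
Proof. exact: measure_ge0. Qed.

Let lebesgue_cons_sigma_additive : semi_sigma_additive lebesgue_cons.
Proof. exact: measure_semi_sigma_additive. Qed.

HB.instance Definition _ := isMeasure.Build _ _ _ lebesgue_cons
  lebesgue_cons0 lebesgue_cons_ge0 lebesgue_cons_sigma_additive.

Let lebesgue_cons_sigma_finite : sigma_finite setT lebesgue_cons.
Proof.
have /sigma_finiteP[F [FT ndF Foo]] :=
  sigma_finiteT [the sigma_finite_content _ _ of @lebesgue_measure R].
have /sigma_finiteP[G [GT ndG Goo]] := sigma_finiteT mu.
exists (fun k => @rV_uncons n @^-1` (F k `*` G k)).
  rewrite -preimage_bigcup (_ : \bigcup_k _ = setT) ?preimage_setT//.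
  rewrite -setXTT FT GT; apply/seteqP; split => -[x y]/=.
    by move=> [k _ []/= ? ?]; split; exists k.
  move=> [[k _ Fx] [l _ Gy]]; exists (maxn k l) => //; split.
  - by move: x Fx; exact/subsetPset/ndF/leq_maxl.
  - by move: y Gy; exact/subsetPset/ndG/leq_maxr.
move=> k; have [mF Fk] := Foo k; have [mG Gk] := Goo k.
have mFG : measurable (F k `*` G k) by exact: measurableX.
split.
  by rewrite -[X in measurable X]setTI; exact: measurable_rV_uncons.
rewrite /lebesgue_cons /pushforward -comp_preimage.
rewrite (_ : _ \o _ = id); last exact/funext/rV_consK.
by rewrite preimage_id product_measure1E// lte_mul_pinfty// ge0_fin_numE.
Qed.

HB.instance Definition _ := Measure_isSigmaFinite.Build _ _ _ lebesgue_cons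
  lebesgue_cons_sigma_finite.

End lebesgue_cons.

(* Lebesgue measure on R^n, by iterated products; see lebesgue_rV_box. *)
Fixpoint lebesgue_rV n : {sigma_finite_measure set 'rV[R]_n -> \bar R} :=
  if n is n'.+1 then lebesgue_cons (lebesgue_rV n') else \d_(0 : 'rV[R]_0).

Lemma lebesgue_rV_box n (A : 'I_n -> set R) : (forall i, measurable (A i)) ->
  lebesgue_rV n [set v | forall i, A i (v ord0 i)] =
  (\prod_(i < n) lebesgue_measure (A i))%E.
Proof.
elim: n A => [|n IH] A mA.
  by rewrite big_ord0 /= diracE mem_set// => -[].
set B := [set v : 'rV[R]_n | forall i, A (lift ord0 i) (v ord0 i)].
have mB : measurable B.
  rewrite (_ : B = \bigcap_(i in [set: 'I_n])
      ((fun v : 'rV[R]_n => v ord0 i) @^-1` A (lift ord0 i))).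
    apply: fin_bigcap_measurable => // i _.
    by rewrite -[X in measurable X]setTI; exact: measurable_rV_coord.
  by apply/seteqP; split => v Bv i => [_|]; exact: Bv.
rewrite big_ord_recl -IH// -[RHS]product_measure1E//; last exact: (mA ord0).
rewrite /= /lebesgue_cons /pushforward; congr (_ _).
apply/seteqP; split => -[x v] /=.
  move=> Av; split => /=.
    by have := Av ord0; rewrite mxE unlift_none.
  by move=> i; have := Av (lift ord0 i); rewrite mxE liftK.
by move=> [Ax Av] i; rewrite mxE; case: unliftP => [j|] ->; [exact: Av|].
Qed.

End lebesgue_rV.

Section euclidean.
Context {R : realType}.

(* The library's norm `|_| on 'M[R]_(m, n) is the sup norm; the Euclidean norm
   (Frobenius norm for matrices) is needed here. *)
Definition enorm m n (M : 'M[R]_(m, n)) : R :=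
  Num.sqrt (\sum_i \sum_j M i j ^+ 2).

Definition dotv n (x y : 'rV[R]_n) : R := \sum_i x ord0 i * y ord0 i.

Definition partial n (i : 'I_n) (f : 'rV[R]_n -> R) (x : 'rV[R]_n) : R :=
  'D_(delta_mx ord0 i) f x.

Definition grad n (f : 'rV[R]_n -> R) (x : 'rV[R]_n) : 'rV[R]_n :=
  \row_i partial i f x.

Definition boundary (T : topologicalType) (A : set T) : set T :=
  closure A `\` interior A.

Definition is_domain n (U : set 'rV[R]_n) : Prop :=
  [/\ U !=set0, open U & connected U].

End euclidean.

Section norms.
Context {R : realType} {n : nat}.
Implicit Types (H : 'rV[R]_n -> R) (A : 'rV[R]_n -> 'rV[R]_n).

Definition is_norm H : Prop :=
  [/\ forall x, 0 <= H x,
      forall x, H x = 0 -> x = 0,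
      forall (a : R) x, H (a *: x) = `|a| * H x &
      forall x y, H (x + y) <= H x + H y].

Definition uniformly_convex H : Prop :=
  forall eps : R, 0 < eps -> exists2 delta : R, 0 < delta &
    forall x y, H x = 1 -> H y = 1 -> eps <= H (x - y) ->
      H (2^-1 *: (x + y)) <= 1 - delta.

Definition flux H (p : R) : 'rV[R]_n -> 'rV[R]_n :=
  grad (fun xi => H xi `^ p / p).

Definition C1_punctured A : Prop :=
  forall xi, xi != 0 -> differentiable A xi /\ {for xi, continuous (jacobian A)}.

(* jacobian acts on row vectors from the right: eta *m jacobian A xi is the
   derivative of A at xi in the direction eta. *)
Definition structure_conditions A (p : R) : Prop :=
  exists L1 L2 : R, [/\ 0 < L1, 0 < L2 &
    forall xi, xi != 0 ->
      (forall eta, L1 * enorm xi `^ (p - 2) * enorm eta ^+ 2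
                   <= dotv (eta *m jacobian A xi) eta) /\
      enorm (jacobian A xi) <= L2 * enorm xi `^ (p - 2)].

End norms.

Section sobolev.
Context {R : realType} {n : nat}.
Implicit Types (U : set 'rV[R]_n) (u v phi : 'rV[R]_n -> R).
Implicit Types (G A : 'rV[R]_n -> 'rV[R]_n).
Local Notation mu := (lebesgue_rV n).

Fixpoint Ck (k : nat) phi : Prop :=
  if k is k'.+1 then
    (forall x, differentiable phi x) /\ (forall i, Ck k' (partial i phi))
  else continuous phi.

Definition test_function U phi : Prop :=
  let supp := closure [set x | phi x != 0] in
  [/\ forall k, Ck k phi, compact supp & supp `<=` U].

Definition Lp_loc (p : R) U u : Prop :=
  forall K, compact K -> K `<=` U -> (u \_ K) \in Lfun mu p%:E.

Definition weak_gradient U u G : Prop :=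
  forall phi, test_function U phi -> forall i,
    \int[mu]_(x in U) (u x * partial i phi x) =
    - \int[mu]_(x in U) (G x ord0 i * phi x).

(* u is in W^{1,p}_loc(U), with weak gradient (a representative of) G *)
Definition W1p_loc (p : R) U u G : Prop :=
  [/\ Lp_loc p U u, forall i, Lp_loc p U (fun x => G x ord0 i) &
      weak_gradient U u G].

(* Solutions are identified with their continuous representatives. Functions
   are total, but only their values on U matter. *)
Definition solution A (p : R) U v : Prop :=
  (forall x, U x -> {for x, continuous v}) /\
  exists2 G, W1p_loc p U v G &
    forall phi, test_function U phi ->
      \int[mu]_(x in U) dotv (A (G x)) (grad phi x) = 0.

Definition punctured_nbhd0 U : Prop :=
  [/\ open U, ~ U 0 & \forall x \near (0 : 'rV[R]_n)^', U x].

Definition positive_germs A (p : R) (Omega : set 'rV[R]_n) :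
    set ('rV[R]_n -> R) :=
  [set u | exists U, [/\ punctured_nbhd0 U, connected U, U `<=` Omega,
    solution A p U u & forall x, U x -> 0 < u x]].

Definition regular0 A (p : R) (Omega : set 'rV[R]_n) : Prop :=
  forall u v, positive_germs A p Omega u -> positive_germs A p Omega v ->
    exists2 l : \bar R, (0 <= l)%E &
      (u x / v x)%:E @[x --> (0 : 'rV[R]_n)^'] --> l.

End sobolev.

(* Main.v *)
(** Let N be the norm dual to H and Gamma(s) the primitive of -s^(-(n-1)/(p-1)),
    which tends to +oo at 0 because p <= n. The functions a + b Gamma(N) solve the
    equation off 0: grad N(x) lies on the unit sphere of H and is mapped by grad H
    to x / N(x), so their flux is a multiple of the divergence-free field
    N(x)^(-n) x. For a positive solution u, comparison with these functions on
    annuli shows that the minimum m(r) of u on {N = r} is concave in Gamma(r).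
    Hence there are ga >= 0 and a radial solution w = a + ga Gamma(N) <= u with
    m - w = o(Gamma). Harnack's inequality on spheres holds for u - w with a
    constant independent of w: where |grad w| is comparable to kappa, the field
    A(grad u) - A(grad w) has Orlicz growth (kappa + t)^(p-2) t with structure
    constants independent of kappa, and De Giorgi's method applies. Therefore
    u / Gamma(N) tends to ga. If ga = 0, then u is bounded, m increases to some
    c > 0 as r decreases to 0, and Harnack's inequality for u - (c - e) shows that
    u tends to c. In all cases the quotient of two positive solutions has a limit
    in [0, +oo]. *)

Require Import Defs.
From HB Require Import structures.
From mathcomp Require Import all_boot all_order all_algebra.
From mathcomp Require Import all_classical all_reals all_analysis.
From mathcomp Require Import measurable_realfun.
From mathcomp Require Import ring lra.

Set Implicit Arguments.
Unset Strict Implicit.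
Unset Printing Implicit Defensive.
Import Order.TTheory GRing.Theory Num.Theory.
Import numFieldNormedType.Exports.

Local Open Scope classical_set_scope.
Local Open Scope ring_scope.

(** * Lebesgue measure and calculus on R^n *)

Section rV_measure.
Context {R : realType}.
Local Notation leb := (@lebesgue_measure R).

(** The radial solution [w] is fixed while the radius tends to 0, and its gradient on [{N = r}] has
    size about [ga * r^(-q)] with [q = (n-1)/(p-1)]. So [kappa] takes unbounded values, or is 0 when
    [ga = 0]; uniformity in [kappa] is what lets one Harnack constant serve all spheres, without
    blow-up limits and without regularity of [grad u] beyond integrability. The growth function of
    the difference of fluxes is not homogeneous, so differences of solutions cannot be normalized by
    scaling and the levels enter all estimates explicitly. Instead of a Sobolev inequality, testing
    gives L^1 bounds for gradients of truncations, and averaging the bound of [|f(x+h) - f(x)|] by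
    [n |h| |grad f|], both integrated, over a cube of [h] gives the two inequalities of De Giorgi's
    method. Solutions are tested with smooth functions only, while the method needs
    [Phi(u - w) eta]. The gap is bridged by C^1 approximations of [u], uniformly close and with
    gradients close in L^1 for the weight [(1 + |G|)^(p-1)], which is the growth of the flux. *)

Lemma ball_rVE n (x y : 'rV[R]_n) (e : R) : ball x e y = (`|x - y| < e) :> Prop.
Proof. by rewrite -ball_normE. Qed.

Lemma rV_norm_ltP n (x : 'rV[R]_n) (e : R) : 0 < e ->
  (`|x| < e) <-> (forall i, `|x ord0 i| < e).
Proof.
move=> e0; split=> [xe i|xe].
  apply: le_lt_trans xe; rewrite /Num.norm/= mx_normrE.
  by apply: (le_bigmax _ (fun ij => `|x ij.1 ij.2|) (ord0, i)).
rewrite /Num.norm/= mx_normrE; apply/bigmax_ltP; split=> // -[i j] _ /=.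
by rewrite (ord1 i).
Qed.

Lemma rV_norm_leP n (x : 'rV[R]_n) (e : R) : 0 <= e ->
  (`|x| <= e) <-> (forall i, `|x ord0 i| <= e).
Proof.
move=> e0; split=> [xe i|xe].
  apply: le_trans xe; rewrite /Num.norm/= mx_normrE.
  by apply: (le_bigmax _ (fun ij => `|x ij.1 ij.2|) (ord0, i)).
rewrite /Num.norm/= mx_normrE; apply/bigmax_leP; split=> // -[i j] _ /=.
by rewrite (ord1 i).
Qed.

Lemma rV_coord_le n (x : 'rV[R]_n) i : `|x ord0 i| <= `|x|.
Proof. by have /rV_norm_leP := lexx `|x|; apply. Qed.

Lemma measurable_rV_ball n (x : 'rV[R]_n) e : measurable (ball x e).
Proof.
have [e0|e0] := ltP 0 e; last first.
  rewrite (_ : ball x e = set0)//; apply/seteqP; split=> // y.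
  by rewrite /= ball_rVE => /(le_lt_trans (normr_ge0 _))/lt_geF; rewrite e0.
rewrite (_ : ball x e = \bigcap_(i in [set: 'I_n])
   ((fun v : 'rV[R]_n => v ord0 i) @^-1` ball (x ord0 i) e)); last first.
  apply/seteqP; split=> y /=; rewrite ball_rVE.
    by move=> /(rV_norm_ltP _ e0) h i _; have := h i; rewrite !mxE -ball_normE.
  move=> h; apply/(rV_norm_ltP _ e0) => i.
  by have := h i I; rewrite !mxE -ball_normE.
apply: fin_bigcap_measurable => // i _.
rewrite -[X in measurable X]setTI; apply: measurable_rV_coord => //.
exact: measurable_ball.
Qed.

(** The sigma-algebra is generated by the coordinates, so open sets have to be reached from boxes:
    [U] is the union of the countably many balls with rational centre and radius [1/(k+1)] that it
    contains. *)
Lemma open_measurable_rV n (U : set 'rV[R]_n) : open U -> measurable U.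
Proof.
move=> oU.
pose Q : set ('rV[rat]_n * nat) :=
  [set q | ball (map_mx ratr q.1 : 'rV[R]_n) q.2.+1%:R^-1 `<=` U].
pose F q := if `[< Q q >] then
   ball (map_mx ratr q.1 : 'rV[R]_n) (q.2.+1%:R^-1 : R) else set0.
rewrite (_ : U = \bigcup_q F q).
  apply: countable_bigcupT_measurable; first exact: countableP.
  move=> q; rewrite /F; case: ifP => _ //; exact: measurable_rV_ball.
apply/seteqP; split=> [x Ux|x [q _]]; last first.
  by rewrite /F; case: asboolP => // Qq; exact: Qq.
have /nbhs_ballP[e /= e0 xe] : nbhs x U by exact: open_nbhs_nbhs.
have [k ke] : exists k : nat, k.+1%:R^-1 < e / 2.
  have [k _ /(_ _ (leqnn k))] := near_infty_natSinv_lt (PosNum (divr_gt0 e0 (@ltr0Sn R 1))).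
  by exists k.
have k0 : (0 : R) < k.+1%:R^-1 by rewrite invr_gt0.
have /choice[q hq] (i : 'I_n) : exists q : rat, `|x ord0 i - ratr q| < k.+1%:R^-1.
  have [|q] := @rat_in_itvoo R (x ord0 i - k.+1%:R^-1) (x ord0 i + k.+1%:R^-1).
    by rewrite ltrD2l (lt_trans _ k0)// oppr_lt0.
  by rewrite in_itv/= => /andP[q1 q2]; exists q; rewrite distrC ltr_distl q1 q2.
have xq : `|x - map_mx ratr (\row_i q i)| < k.+1%:R^-1.
  by apply/(rV_norm_ltP _ k0) => i; rewrite !mxE.
exists (\row_i q i, k) => //; rewrite /F asboolT /= ?ball_rVE.
  by rewrite distrC.
move=> y /=; rewrite ball_rVE => qy; apply: xe; rewrite /= ball_rVE.
rewrite (_ : x - y = (x - map_mx ratr (\row_i q i)) + (map_mx ratr (\row_i q i) - y)).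
  by rewrite (le_lt_trans (ler_normD _ _))// [ltRHS]splitr ltrD// (lt_trans _ ke).
by rewrite addrA subrK.
Qed.

Lemma closed_measurable_rV n (U : set 'rV[R]_n) : closed U -> measurable U.
Proof.
move=> cU; rewrite -[U]setCK; apply: measurableC; apply: open_measurable_rV.
exact: closed_openC.
Qed.

Lemma compact_measurable_rV n (U : set 'rV[R]_n) : compact U -> measurable U.
Proof.
by move=> cU; apply: closed_measurable_rV; apply: compact_closed => //; exact: norm_hausdorff.
Qed.

Lemma continuous_measurable_rV n (U : set 'rV[R]_n) (f : 'rV[R]_n -> R) : open U ->
  (forall x, U x -> {for x, continuous f}) -> measurable_fun U f.
Proof.
move=> oU cf; apply: (measurability _ (RGenOpens.measurableE R)) => _ [_ [a [b ->] <-]].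
apply: open_measurable_rV; rewrite openE => x [Ux /= fx].
rewrite /interior; apply: filterI; first exact: open_nbhs_nbhs.
by apply: (cf x Ux); apply: open_nbhs_nbhs; split => //; exact: interval_open.
Qed.

Lemma lebesgue_shift (a : R) (A : set R) : measurable A ->
  pushforward leb (fun x : R => x + a : measurableTypeR R) A = leb A.
Proof.
move=> mA; apply/esym/lebesgue_measure_unique => //=.
  exact: measurable_funD.
move=> _ _ [[c b]] _ <-.
rewrite /pushforward (_ : _ @^-1` _ = `](c - a), (b - a)]%classic).
  rewrite !lebesgue_measure_itv/= !lte_fin ltrD2r.
  by rewrite -!EFinB opprB addrA addrNK.
by apply/seteqP; split=> x /=; rewrite !in_itv/= ltrBlDr lerBrDr.
Qed.

Lemma ge0_integral_shift (a : R) (f : R -> \bar R) :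
  measurable_fun [set: R] f -> (forall r, 0 <= f r)%E ->
  (\int[leb]_x f (x + a)%R = \int[leb]_x f x)%E.
Proof.
move=> mf f0; have ma : measurable_fun [set: R] (fun x : R => x + a : measurableTypeR R).
  exact: measurable_funD.
transitivity (\int[pushforward leb (fun x : R => (x + a)%R : measurableTypeR R)]_x f x)%E.
  by rewrite ge0_integral_pushforward.
by apply: eq_measure_integral => //= A mA AS; exact: lebesgue_shift.
Qed.

Lemma rV_consD n (x y : R) (v w : 'rV[R]_n) :
  rV_cons (x, v) + rV_cons (y, w) = rV_cons (x + y, v + w).
Proof. by apply/rowP => i; rewrite !mxE; case: unliftP => [j|] _; rewrite ?mxE. Qed.

Lemma measurable_rV_shift n (a : 'rV[R]_n) :
  measurable_fun [set: 'rV[R]_n] (fun x => x + a).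
Proof.
apply/measurable_fun_rVP => i; under eq_fun do rewrite mxE.
by apply: measurable_funD => //; exact: measurable_rV_coord.
Qed.

(** Induction on the dimension: the measure on [n.+1] coordinates is the pushforward of a product,
    so Tonelli splits off the first coordinate and [ge0_integral_shift] moves it. *)
Lemma ge0_integral_rV_shift n (a : 'rV[R]_n) (f : 'rV[R]_n -> \bar R) :
  measurable_fun [set: _] f -> (forall r, 0 <= f r)%E ->
  (\int[lebesgue_rV n]_x f (x + a)%R = \int[lebesgue_rV n]_x f x)%E.
Proof.
elim: n a f => [a f mf f0|n IH a f mf f0].
  by apply: eq_integral => x _; congr f; rewrite !thinmx0.
have mc := @measurable_rV_cons R n.
have E (g : 'rV[R]_n.+1 -> \bar R) : measurable_fun [set: _] g -> (forall r, 0 <= g r)%E ->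
  (\int[lebesgue_rV n.+1]_x g x = \int[leb]_x \int[lebesgue_rV n]_v g (rV_cons (x, v)))%E.
  move=> mg g0; rewrite /= /lebesgue_cons ge0_integral_pushforward//.
  have mgc : measurable_fun [set: measurableTypeR R * 'rV[R]_n] (g \o @rV_cons R n).
    exact: (measurableT_comp mg mc).
  rewrite -(@fubini_tonelli1 _ _ _ _ _ leb (lebesgue_rV n) (g \o @rV_cons R n) mgc)//.
  by move=> ?; exact: g0.
have mfc : measurable_fun [set: measurableTypeR R * 'rV[R]_n] (f \o @rV_cons R n).
  exact: (measurableT_comp mf mc).
rewrite E//; last by apply: measurableT_comp => //; exact: measurable_rV_shift.
rewrite (E f mf f0).
have [a0 ->] : exists aw, a = rV_cons aw by exists (rV_uncons a); rewrite rV_unconsK.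
case: a0 => a0 w.
under eq_integral => x _ do (under eq_integral => v _ do rewrite rV_consD).
transitivity (\int[leb]_x \int[lebesgue_rV n]_v f (rV_cons (x + a0, v)%R))%E.
  apply: eq_integral => x _.
  rewrite (IH w (fun v => f (rV_cons (x + a0, v)%R)))//.
  by apply: measurableT_comp => //; apply: measurableT_comp => //; exact: pair1_measurable.
rewrite (ge0_integral_shift a0 (f := fun x => \int[lebesgue_rV n]_v f (rV_cons (x, v)))%E)//.
  apply: (measurable_fun_fubini_tonelli_F (m2 := lebesgue_rV n) (f \o @rV_cons R n)) => //.
  by move=> ?; exact: f0.
by move=> r; exact: integral_ge0.
Qed.

(** The closed ball of the sup norm. Its volume is exactly [(2 * r) ^+ n], which keeps the constants
    explicit. *)
Definition cube n (x : 'rV[R]_n) (r : R) : set 'rV[R]_n := [set y | `|y - x| <= r].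

Lemma cube_closed n (x : 'rV[R]_n) r : closed (cube x r).
Proof.
have c : continuous (fun y : 'rV[R]_n => `|y - x|).
  move=> y; apply: (@continuous_comp _ _ _ (fun y : 'rV[R]_n => y - x) (@Num.norm _ _)).
    by apply: (@continuousB _ _ _ id (cst x)); [move=> A|exact: cst_continuous].
  exact: norm_continuous.
rewrite (_ : cube x r = (fun y => `|y - x|) @^-1` [set z | z <= r])//.
by apply: closed_comp; [move=> y _; exact: c|exact: closed_le].
Qed.

Lemma cube_compact n (x : 'rV[R]_n) r : compact (cube x r).
Proof.
apply: bounded_closed_compact; last exact: cube_closed.
exists (`|x| + r); split; first exact: num_real.
move=> z xrz y /= yx; rewrite -[y](subrK x).
by rewrite (le_trans (ler_normD _ _))// (le_trans _ (ltW xrz))// addrC lerD2l.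
Qed.

Lemma measurable_cube n (x : 'rV[R]_n) r : measurable (cube x r).
Proof. by apply: closed_measurable_rV; exact: cube_closed. Qed.

Lemma cube_measure n (x : 'rV[R]_n) r : 0 <= r ->
  lebesgue_rV n (cube x r) = ((2 * r) ^+ n)%:E.
Proof.
move=> r0; pose A (i : 'I_n) := `[x ord0 i - r, x ord0 i + r]%classic.
have -> : cube x r = [set v | forall i, A i (v ord0 i)].
  apply/seteqP; split=> y; rewrite /A/=.
    move=> /(rV_norm_leP _ r0) h i; have := h i; rewrite !mxE ler_norml.
    by rewrite in_itv/= => /andP[? ?]; apply/andP; split; lra.
  move=> h; apply/(rV_norm_leP _ r0) => i; rewrite !mxE ler_norml.
  by have := h i; rewrite in_itv/= => /andP[? ?]; apply/andP; split; lra.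
have mA i : measurable (A i) by exact: measurable_itv.
rewrite lebesgue_rV_box//.
have E i : lebesgue_measure (A i) = (2 * r)%:E.
  rewrite lebesgue_measure_itv/= lte_fin.
  case: ifPn => [_|]; first by rewrite -EFinB; congr EFin; ring.
  by rewrite -leNgt => h; congr EFin; lra.
under eq_bigr => i _ do rewrite E.
by rewrite prodEFin big_const cardT size_enum_ord iter_mulr_1.
Qed.

Lemma integral_cube_cst n (x : 'rV[R]_n) r (c : R) : 0 <= r ->
  (\int[lebesgue_rV n]_(y in cube x r) c%:E = (c * (2 * r) ^+ n)%:E)%E.
Proof.
move=> r0; rewrite integral_cst; last exact: measurable_cube.
by rewrite EFinM; congr (_ * _)%E; exact: cube_measure.
Qed.

Lemma compact_sub_cube n (K : set 'rV[R]_n) : compact K ->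
  exists2 r, 0 < r & K `<=` cube 0 r.
Proof.
move=> /compact_bounded [M [_ hM]]; exists (`|M| + 1).
  by rewrite ltr_pwDr.
move=> x Kx; rewrite /cube/= subr0; apply: hM => //.
by rewrite (le_lt_trans (ler_norm _))// ltrDl.
Qed.

Lemma compact_measure_fin n (K : set 'rV[R]_n) : compact K ->
  (lebesgue_rV n K < +oo)%E.
Proof.
move=> cK; have [r r0 Kr] := compact_sub_cube cK.
apply: (@le_lt_trans _ _ (lebesgue_rV n (cube 0 r))).
  by apply: le_measure; rewrite ?inE//; [exact: compact_measurable_rV|exact: measurable_cube].
by rewrite cube_measure ?ltry// ltW.
Qed.

(** The covering form of compactness, for the filter of small positive [d]; monotonicity in [d]
    turns the local radii into a common one. *)
Lemma compact_unif n (K : set 'rV[R]_n) (P : 'rV[R]_n -> R -> Prop) :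
  compact K -> (forall x d d', d' <= d -> P x d -> P x d') ->
  (forall x, K x -> exists2 e, 0 < e & forall y, `|y - x| < e -> P y e) ->
  exists2 e, 0 < e & forall x, K x -> P x e.
Proof.
move=> /compact_near_coveringP cK mP hP.
have [] : \forall d \near (0:R)^'+, K `<=` P ^~ d; last first.
  move=> e /= e0 he; exists (e / 2); first by rewrite divr_gt0.
  move=> x; apply: he; rewrite /= ?divr_gt0// sub0r normrN gtr0_norm ?divr_gt0//.
  by rewrite ltr_pdivrMr// ltr_pMr// ltr1n.
apply: (cK _ _ (fun d x => P x d)) => x Kx; have [e e0 xe] := hP x Kx.
exists (ball x e, [set d | d < e]) => /=.
  by split; [exact: nbhsx_ballx|exact: nbhs_right_lt].
move=> [y d] /= [xy de]; apply: (mP _ e); first exact: ltW.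
by apply: xe; rewrite distrC -ball_rVE.
Qed.

Lemma compact_nbhd n (K U : set 'rV[R]_n) : compact K -> open U -> K `<=` U ->
  exists2 d, 0 < d & forall x, K x -> forall y, `|y| <= d -> U (x + y).
Proof.
move=> cK oU KU.
apply: (@compact_unif n K (fun x d => forall y, `|y| <= d -> U (x + y)) cK).
  by move=> x d d' dd' h y yd; apply: h; exact: le_trans dd'.
move=> x Kx.
have /nbhs_ballP[e /= e0 xe] : nbhs x U by apply: open_nbhs_nbhs; split => //; exact: KU.
exists (e / 2); first by rewrite divr_gt0.
move=> y yx z ze; apply: xe; rewrite /= ball_rVE (_ : x - _ = - ((y - x) + z)).
  by rewrite normrN (le_lt_trans (ler_normD _ _))// [ltRHS]splitr ltr_leD.
by rewrite addrAC opprB.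
Qed.

Lemma compact_unif_continuous n (K : set 'rV[R]_n) (f : 'rV[R]_n -> R) (eps : R) :
  compact K -> 0 < eps -> (forall x, K x -> {for x, continuous f}) ->
  exists2 d, 0 < d & forall x, K x -> forall y, `|y| <= d -> `|f (x + y) - f x| <= eps.
Proof.
move=> cK eps0 cf.
apply: (@compact_unif n K (fun x d => forall y, `|y| <= d -> `|f (x + y) - f x| <= eps) cK).
  by move=> x d d' dd' h y yd; apply: h; exact: le_trans dd'.
move=> x Kx.
have /cvgrPdist_lt/(_ (eps / 2)) := cf x Kx; rewrite divr_gt0// => /(_ isT).
move=> /nbhs_ballP[e /= e0 xe]; exists (e / 2); first by rewrite divr_gt0.
have e2 : e / 2 < e by rewrite ltr_pdivrMr// ltr_pMr// ltr1n.
move=> y yx z ze.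
have h1 : `|f x - f y| < eps / 2.
  by apply: xe; rewrite /= ball_rVE distrC (lt_trans yx).
have h2 : `|f x - f (y + z)| < eps / 2.
  apply: xe; rewrite /= ball_rVE (_ : x - _ = - ((y - x) + z)).
    by rewrite normrN (le_lt_trans (ler_normD _ _))// [ltRHS]splitr ltr_leD.
  by rewrite addrAC opprB.
rewrite (_ : f _ - _ = (f x - f y) - (f x - f (y + z))); last by ring.
by rewrite (le_trans (ler_normB _ _))// [leRHS]splitr ltW// ltrD.
Qed.

End rV_measure.

(** * Differentiability and gradients on row vectors *)

Section calculus.
Context {R : realType}.
Variable n : nat.
Implicit Types (f g : 'rV[R]_n -> R) (x v h : 'rV[R]_n).

Lemma continuous_epsP (V W : normedModType R) (F : V -> W) (x : V) :
  {for x, continuous F} <->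
  (forall e, 0 < e -> exists2 d, 0 < d & forall y, `|y| < d -> `|F (x + y) - F x| <= e).
Proof.
split=> [cF e e0|h].
  have /cvgrPdist_le/(_ e e0) := cF.
  move=> /nbhs_ballP[d /= d0 hd]; exists d => // y yd; rewrite distrC; apply: hd.
  by rewrite -ball_normE/= opprD addNKr normrN.
apply/cvgrPdist_le => e e0; have [d d0 hd] := h e e0.
apply/nbhs_ballP; exists d => //= y; rewrite -ball_normE/= => xy.
have := hd (y - x); rewrite [x + _]addrC subrK distrC => h1.
by rewrite distrC; exact: h1.
Qed.

(** [dotv v L] with [L] as the parameter, so that the linear structure in [v] can be attached to
    it. *)
Definition dotvr (L v : 'rV[R]_n) := dotv v L.

Lemma dotv_linear (L : 'rV[R]_n) : linear (dotvr L).
Proof.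
move=> a u v; rewrite /dotvr /dotv /GRing.scale/= mulr_sumr -big_split/=.
by apply: eq_bigr => i _; rewrite !mxE mulrDl mulrA.
Qed.

HB.instance Definition _ (L : 'rV[R]_n) :=
  GRing.isLinear.Build R 'rV[R]_n R *:%R (dotvr L) (dotv_linear L).

Lemma dotvDl (u v L : 'rV[R]_n) : dotv (u + v) L = dotv u L + dotv v L.
Proof. exact: (linearD (dotvr L)). Qed.

Lemma dotvZl a (v L : 'rV[R]_n) : dotv (a *: v) L = a * dotv v L.
Proof. by rewrite /dotv mulr_sumr; apply: eq_bigr => i _; rewrite !mxE mulrA. Qed.

Lemma dotvNl (v L : 'rV[R]_n) : dotv (- v) L = - dotv v L.
Proof. exact: (linearN (dotvr L)). Qed.

Lemma dotvBl (u v L : 'rV[R]_n) : dotv (u - v) L = dotv u L - dotv v L.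
Proof. exact: (linearB (dotvr L)). Qed.

Lemma dotv0l (L : 'rV[R]_n) : dotv 0 L = 0.
Proof. exact: (linear0 (dotvr L)). Qed.

Lemma dotvC (u v : 'rV[R]_n) : dotv u v = dotv v u.
Proof. by apply: eq_bigr => i _; rewrite mulrC. Qed.

Lemma dotvDr (u v L : 'rV[R]_n) : dotv L (u + v) = dotv L u + dotv L v.
Proof. by rewrite dotvC dotvDl !(dotvC L). Qed.

Lemma dotvZr a (v L : 'rV[R]_n) : dotv L (a *: v) = a * dotv L v.
Proof. by rewrite dotvC dotvZl (dotvC L). Qed.

Lemma dotvNr (v L : 'rV[R]_n) : dotv L (- v) = - dotv L v.
Proof. by rewrite dotvC dotvNl (dotvC L). Qed.

Lemma dotvBr (u v L : 'rV[R]_n) : dotv L (u - v) = dotv L u - dotv L v.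
Proof. by rewrite dotvDr dotvNr. Qed.

Lemma dotv0r (L : 'rV[R]_n) : dotv L 0 = 0.
Proof. by rewrite dotvC dotv0l. Qed.

Lemma dotv_delta i (L : 'rV[R]_n) : dotv (delta_mx ord0 i) L = L ord0 i.
Proof.
rewrite /dotv (bigD1 i)//= big1 ?addr0 ?mxE ?eqxx ?mul1r// => j ji.
by rewrite mxE (negPf ji) andbF mul0r.
Qed.

Lemma dotv_bound (u v : 'rV[R]_n) : `|dotv u v| <= n%:R * `|u| * `|v|.
Proof.
rewrite (le_trans (ler_norm_sum _ _ _))//.
rewrite (le_trans (ler_sum _ (G := fun=> `|u| * `|v|) _))//.
  by move=> i _; rewrite normrM ler_pM// rV_coord_le.
by rewrite sumr_const card_ord mulr_natl mulrnAl.
Qed.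

Lemma dotv_continuous (L : 'rV[R]_n) : continuous (dotvr L).
Proof.
move=> x; apply/continuous_epsP => e e0.
have N0 : 0 < n%:R * `|L| + 1 by rewrite ltr_wpDl// mulr_ge0.
exists (e / (n%:R * `|L| + 1)); first by rewrite divr_gt0.
move=> y; rewrite ltr_pdivlMr// => xy; rewrite /dotvr dotvDl addrAC subrr add0r.
rewrite (le_trans (dotv_bound _ _))// (le_trans _ (ltW xy))//.
by rewrite mulrAC mulrC ler_wpM2l// lerDl.
Qed.

(** In finite dimension the candidate differential is continuous, so a single first-order estimate
    yields differentiability and identifies the gradient. *)
Lemma differentiable_epsP f x (L : 'rV[R]_n) :
  (forall e, 0 < e -> exists2 d, 0 < d & forall v, `|v| < d ->
     `|f (x + v) - f x - dotv v L| <= e * `|v|) ->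
  differentiable f x /\ grad f x = L.
Proof.
move=> H.
have Ho : f \o shift x = cst (f x) + dotvr L +o_ (0 : 'rV[R]_n) id.
  apply/eqaddoP => e e0; have [d d0 hd] := H e e0.
  apply/nbhs_ballP; exists d => //= v; rewrite ball_rVE sub0r normrN => vd.
  rewrite [X in `|X|](_ : _ = f (x + v) - f x - dotv v L); first exact: hd.
  by rewrite [LHS](_ : _ = f (v + x) - (f x + dotv v L))// [v + x]addrC; ring.
have dE : 'd f x = dotvr L :> ('rV[R]_n -> R).
  by apply: diff_unique => //; exact: dotv_continuous.
have df : differentiable f x.
  by apply/diff_locallyP; rewrite dE; split => //; exact: dotv_continuous.
split=> //; apply/rowP => i; rewrite mxE /partial deriveE// dE.
by rewrite /dotvr dotv_delta.
Qed.

Lemma derive_dotv f x v : differentiable f x -> 'D_v f x = dotv v (grad f x).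
Proof.
move=> df; rewrite deriveE// {1}(row_sum_delta v) linear_sum /dotv.
by apply: eq_bigr => i _; rewrite linearZ/= mxE /partial deriveE.
Qed.

Lemma differentiable_eps f x : differentiable f x ->
  forall e, 0 < e -> exists2 d, 0 < d & forall v, `|v| < d ->
     `|f (x + v) - f x - dotv v (grad f x)| <= e * `|v|.
Proof.
move=> df e e0; have /diff_locallyP[_ /eqaddoP/(_ e e0)] := df.
move=> /nbhs_ballP[d /= d0 hd]; exists d => // v vd.
have := hd v; rewrite /= ball_rVE sub0r normrN => /(_ vd).
rewrite [X in `|X| <= _](_ : _ = f (x + v) - f x - dotv v (grad f x))//.
rewrite -derive_dotv// deriveE//.
by rewrite [LHS](_ : _ = f (v + x) - (f x + 'd f x v))// [v + x]addrC; ring.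
Qed.

Lemma near_eq_differentiable f g x : {near x, f =1 g} ->
  differentiable f x -> differentiable g x /\ grad g x = grad f x.
Proof.
move=> fg df; apply: differentiable_epsP => e e0.
have fgx := nbhs_singleton fg.
have [d d0 hd] := differentiable_eps df e0.
have /nbhs_ballP[d' /= d'0 hd'] := fg.
exists (Num.min d d'); first by rewrite lt_min d0.
move=> v; rewrite lt_min => /andP[vd vd'].
rewrite -hd' ?fgx -?fgx; first exact: hd.
by rewrite ball_rVE opprD addNKr normrN.
Qed.

Lemma is_derive_line f x v (s : R) : differentiable f (x + s *: v) ->
  is_derive s 1 (fun t : R => f (x + t *: v)) (dotv v (grad f (x + s *: v))).
Proof.
move=> df; have df' : derivable f (x + s *: v) v by exact: diff_derivable.
have E : (fun h : R => h^-1 *: (((fun t : R => f (x + t *: v)) \o shift s) (h *: (1:R)) - f (x + s *: v)))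
  = (fun h : R => h^-1 *: ((f \o shift (x + s *: v)) (h *: v) - f (x + s *: v))).
  apply/funext => h/=; have -> : h%:A = h :> R by rewrite /GRing.scale/= mulr1.
  by rewrite scalerDl addrCA.
by split; rewrite /derivable /derive E// -derive_dotv.
Qed.

Lemma mvt_line f x v : (forall s : R, 0 <= s <= 1 -> differentiable f (x + s *: v)) ->
  exists2 c : R, 0 <= c <= 1 & f (x + v) - f x = dotv v (grad f (x + c *: v)).
Proof.
move=> df.
have [||] := @MVT_segment R (fun t : R => f (x + t *: v))
   (fun s => dotv v (grad f (x + s *: v))) 0 1 ler01.
- by move=> s; rewrite in_itv/= => /andP[/ltW s0 /ltW s1]; apply: is_derive_line; apply: df; rewrite s0.
- apply: derivable_within_continuous => s; rewrite in_itv/= => s01.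
  by have [] := is_derive_line (df s s01).
- move=> c; rewrite in_itv/= => c01 E; exists c => //.
  by move: E; rewrite scale1r scale0r addr0 subr0 mulr1.
Qed.

Lemma mvt_bound f (K : set 'rV[R]_n) (B : R) x v :
  (forall s : R, 0 <= s <= 1 -> differentiable f (x + s *: v) /\ `|grad f (x + s *: v)| <= B) ->
  `|f (x + v) - f x| <= n%:R * B * `|v|.
Proof.
move=> h; have [c c01 ->] := @mvt_line f x v (fun s s01 => (h s s01).1).
rewrite (le_trans (dotv_bound _ _))// mulrAC ler_wpM2r// ler_wpM2l//.
by have [] := h c c01.
Qed.

Definition C1 f := Ck 1 f.

Lemma C1P f : C1 f <-> (forall x, differentiable f x) /\ (forall i, continuous (partial i f)).
Proof. by []. Qed.

Lemma C1_diff f x : C1 f -> differentiable f x.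
Proof. by move=> [df _]; exact: df. Qed.

Lemma C1_continuous f : C1 f -> continuous f.
Proof. by move=> [df _] x; exact: differentiable_continuous. Qed.

Lemma derivable_partial f x i : differentiable f x ->
  is_derive x (delta_mx ord0 i) f (grad f x ord0 i).
Proof. by move=> df; rewrite mxE /partial; apply: derivableP; exact: diff_derivable. Qed.

Lemma gradE f x (L : 'rV[R]_n) : (forall i, is_derive x (delta_mx ord0 i) f (L ord0 i)) ->
  grad f x = L.
Proof. by move=> h; apply/rowP => i; rewrite mxE /partial; have [_ ->] := h i. Qed.

Lemma gradD f g x : differentiable f x -> differentiable g x ->
  grad (f \+ g) x = grad f x + grad g x.
Proof.
move=> df dg; apply: gradE => i; rewrite mxE.
by apply: is_deriveD; exact: derivable_partial.
Qed.

Lemma gradB f g x : differentiable f x -> differentiable g x ->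
  grad (f \- g) x = grad f x - grad g x.
Proof.
move=> df dg; apply: gradE => i; rewrite !mxE -![partial i _ x]/(_).
by have := is_deriveB (derivable_partial i df) (derivable_partial i dg); rewrite !mxE.
Qed.

Lemma gradM f g x : differentiable f x -> differentiable g x ->
  grad (f \* g) x = f x *: grad g x + g x *: grad f x.
Proof.
move=> df dg; apply: gradE => i; rewrite !mxE.
by have := is_deriveM (derivable_partial i df) (derivable_partial i dg); rewrite !mxE.
Qed.

Lemma gradZ (a : R) f x : differentiable f x -> grad (fun y => a * f y) x = a *: grad f x.
Proof.
move=> df; apply: gradE => i; rewrite !mxE.
by have := is_deriveZ a (derivable_partial i df); rewrite !mxE.
Qed.

Lemma grad_comp (phi : R -> R) (a : R) f x : differentiable f x ->
  is_derive (f x) 1 phi a ->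
  differentiable (phi \o f) x /\ grad (phi \o f) x = a *: grad f x.
Proof.
move=> df [dphi phiE].
have dphi' : differentiable phi (f x) by exact/derivable1_diffP.
have dc : differentiable (phi \o f) x by exact: differentiable_comp.
split => //; apply/rowP => i; rewrite !mxE /partial deriveE// diff_comp//=.
rewrite -deriveE//; set b := 'D_ _ _ _.
rewrite /b deriveE// (_ : 'd f x _ = ('d f x (delta_mx ord0 i)) *: (1:R)).
  have dE : 'd phi (f x) (1:R) = a by rewrite -deriveE.
  by rewrite linearZ/= dE /GRing.scale/= mulrC (deriveE (delta_mx ord0 i) df).
by rewrite /GRing.scale/= mulr1.
Qed.

Lemma continuous_gradP f x :
  (forall i, {for x, continuous (partial i f)}) <-> {for x, continuous (grad f)}.
Proof.
split=> [h|/continuous_epsP h i]; apply/continuous_epsP => e e0.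
  have /choice[d hd] (i : 'I_n) : exists d : R, 0 < d /\ forall y, `|y| < d ->
      `|partial i f (x + y) - partial i f x| <= e.
    by have /continuous_epsP/(_ e e0)[d d0 hd] := h i; exists d.
  exists (\big[Num.min/1]_i d i); first by apply/bigmin_gtP; split => // i _; have [] := hd i.
  move=> y /bigmin_gtP[_ hy]; apply/(rV_norm_leP _ (ltW e0)) => i.
  by rewrite !mxE; apply: (hd i).2; exact: hy.
have [d d0 hd] := h e e0; exists d => // y yd.
have := hd y yd; move=> /(rV_norm_leP _ (ltW e0))/(_ i).
by rewrite !mxE.
Qed.

End calculus.

Import HBSimple.

(** * Translations and mollification *)

Section shift_continuity.
Context {R : realType}.
Variable n : nat.
Local Notation mu := (@lebesgue_rV R n).
Implicit Types (f g : 'rV[R]_n -> R) (A B : set 'rV[R]_n).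

(** Continuity of translations in L^1, restricted to cubes: the property then makes sense for
    indicators of sets of infinite measure and is stable under complements, as an induction over the
    sigma-algebra requires. *)
Definition shiftc f := forall r e : R, 0 < e -> exists2 d, 0 < d &
  forall y, `|y| <= d ->
    (\int[mu]_(x in cube 0 r) `|f (x + y)%R - f x|%:E <= e%:E)%E.

Lemma measurable_funrV_shift d (T : measurableType d) (f : 'rV[R]_n -> T) y :
  measurable_fun [set: 'rV[R]_n] f -> measurable_fun [set: 'rV[R]_n] (fun x => f (x + y)).
Proof. by move=> mf; apply: (measurableT_comp mf); exact: measurable_rV_shift. Qed.

Lemma shift_integral_cube f r y : measurable_fun [set: _] f -> `|y| <= 1 ->
  (\int[mu]_(x in cube 0 r) `|f (x + y)%R|%:E <= \int[mu]_(x in cube 0 (r + 1)) `|f x|%:E)%E.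
Proof.
move=> mf y1.
have mF : measurable_fun [set: 'rV[R]_n] (fun x => ((`|f x| * \1_(cube 0 (r + 1)) x)%:E)%E).
  apply/measurable_EFinP; apply: measurable_funM; first exact: measurableT_comp.
  by apply: measurable_indic; exact: measurable_cube.
rewrite (@integral_mkcond _ _ _ _ (cube 0 (r + 1))).
rewrite [leRHS](_ : _ = \int[mu]_x (`|f x| * \1_(cube 0 (r + 1)) x)%:E)%E; last first.
  apply: eq_integral => x _; rewrite patchE indicE.
  by case: ifP => _; rewrite /= ?mulr1 ?mulr0.
rewrite -(ge0_integral_rV_shift y mF); last by move=> x; rewrite lee_fin mulr_ge0.
rewrite integral_mkcond; apply: ge0_le_integral => //.
- by move=> x _; rewrite patchE; case: ifP => _; rewrite ?lee_fin.
- apply/(measurable_restrictT _ (measurable_cube _ _)); apply: measurable_funTS.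
  apply/measurable_EFinP; apply: measurableT_comp => //; exact: measurable_funrV_shift.
- exact: (measurable_funrV_shift y mF).
- move=> x _; rewrite patchE; case: ifPn => [|_]; last by rewrite lee_fin mulr_ge0.
  rewrite inE /cube/= subr0 => xr; rewrite lee_fin indicE mem_set ?mulr1//=.
  by rewrite subr0 (le_trans (ler_normD _ _))// lerD.
Qed.

Lemma integral_cube_normD f g r : measurable_fun [set: _] f -> measurable_fun [set: _] g ->
  (\int[mu]_(x in cube 0 r) `|f x + g x|%:E <=
   \int[mu]_(x in cube 0 r) `|f x|%:E + \int[mu]_(x in cube 0 r) `|g x|%:E)%E.
Proof.
move=> mf mg; have mc := @measurable_cube R n 0 r.
have m1 (h : 'rV[R]_n -> R) : measurable_fun [set: 'rV[R]_n] h -> measurable_fun (cube 0 r) (fun x => `|h x|%:E).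
  by move=> mh; apply/measurable_funTS/measurable_EFinP; apply: measurableT_comp.
rewrite -ge0_integralD//; [|exact: m1..].
apply: ge0_le_integral => //.
- by apply: m1; exact: measurable_funD.
- by apply: emeasurable_funD; exact: m1.
- by move=> x _; rewrite -EFinD lee_fin ler_normD.
Qed.

(** A three-term estimate. The approximation is taken on the cube of radius [r + 1], because a
    translation by at most 1 moves the cube of radius [r] inside it. *)
Lemma shiftc_lim f : measurable_fun [set: _] f ->
  (forall r e, 0 < e -> exists g, [/\ measurable_fun [set: _] g, shiftc g &
     (\int[mu]_(x in cube 0 r) `|f x - g x|%:E <= e%:E)%E]) -> shiftc f.
Proof.
move=> mf h r e e0; have e3 : 0 < e / 3 by rewrite divr_gt0.
have [g [mg sg fg]] := h (r + 1) _ e3.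
have [d d0 hd] := sg r _ e3.
exists (Num.min d 1); first by rewrite lt_min d0 ltr01.
move=> y; rewrite le_min => /andP[yd y1].
pose k x := f x - g x.
have mk : measurable_fun [set: 'rV[R]_n] k by exact: measurable_funB.
have E x : f (x + y) - f x = k (x + y) + ((g (x + y) - g x) + - k x) by rewrite /k; ring.
under eq_integral do rewrite E.
have mgd : measurable_fun [set: 'rV[R]_n] (fun x => g (x + y) - g x).
  by apply: measurable_funB => //; exact: measurable_funrV_shift.
apply: le_trans (integral_cube_normD _ _ _) _.
- exact: measurable_funrV_shift.
- by apply: measurable_funD => //; exact: measurable_funN.
have -> : e%:E = (e / 3)%:E + ((e / 3)%:E + (e / 3)%:E) by rewrite -!EFinD; congr EFin; field.
apply: leeD.
  by apply: le_trans (shift_integral_cube _ mk y1) _.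
apply: le_trans (integral_cube_normD _ mgd (measurable_funN mk)) _.
apply: leeD; first exact: hd.
under eq_integral do rewrite normrN.
apply: le_trans fg; apply: ge0_subset_integral.
- exact: measurable_cube.
- exact: measurable_cube.
- by apply/measurable_funTS/measurable_EFinP; exact: measurableT_comp.
- by [].
- by move=> x /le_trans; apply; rewrite lerDl.
Qed.

Lemma shiftcD f g : measurable_fun [set: _] f -> measurable_fun [set: _] g ->
  shiftc f -> shiftc g -> shiftc (f \+ g).
Proof.
move=> mf mg sf sg r e e0; have e2 : 0 < e / 2 by rewrite divr_gt0.
have [d d0 hd] := sf r _ e2; have [d' d'0 hd'] := sg r _ e2.
exists (Num.min d d'); first by rewrite lt_min d0.
move=> y; rewrite le_min => /andP[yd yd'].
have E x : (f \+ g) (x + y) - (f \+ g) x = (f (x + y) - f x) + (g (x + y) - g x).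
  by rewrite /=; ring.
under eq_integral do rewrite E.
apply: le_trans (integral_cube_normD _ _ _) _.
- by apply: measurable_funB => //; exact: measurable_funrV_shift.
- by apply: measurable_funB => //; exact: measurable_funrV_shift.
by rewrite [e]splitr EFinD; apply: leeD; [exact: hd|exact: hd'].
Qed.

Lemma shiftcZ (c : R) f : measurable_fun [set: _] f ->
  shiftc f -> shiftc (fun x => c * f x).
Proof.
move=> mf sf r e e0; have c0 : 0 < `|c| + 1 by rewrite ltr_wpDl.
have [d d0 hd] := sf r _ (divr_gt0 e0 c0); exists d => // y yd.
under eq_integral => x _ do rewrite -mulrBr normrM EFinM.
rewrite ge0_integralZl//.
- apply: (@le_trans _ _ ((`|c|%:E * (e / (`|c| + 1))%:E)%E)).
    by apply: lee_wpmul2l => //; exact: hd.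
  by rewrite -EFinM lee_fin mulrCA ler_piMr ?ltW// ltr_pdivrMr// mul1r ltrDl.
- exact: measurable_cube.
- apply/measurable_funTS/measurable_EFinP; apply: measurableT_comp => //.
  by apply: measurable_funB => //; exact: measurable_funrV_shift.
Qed.

Lemma shiftc_setC A : shiftc \1_A -> shiftc \1_(~` A).
Proof.
move=> sA r e e0; have [d d0 hd] := sA r e e0; exists d => // y yd.
apply: le_trans (hd y yd); rewrite le_eqVlt; apply/orP; left; apply/eqP.
apply: eq_integral => x _; rewrite !indicE !in_setC.
by do 2 case: (_ \in A); rewrite //= ?subrr ?sub0r ?subr0 ?normrN.
Qed.

Lemma shiftc_setI A B : measurable A -> measurable B ->
  shiftc \1_A -> shiftc \1_B -> shiftc \1_(A `&` B).
Proof.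
move=> mA mB sA sB r e e0.
have mi C : measurable C -> measurable_fun [set: 'rV[R]_n] (\1_C : _ -> R) by exact: measurable_indic.
have e2 : 0 < e / 2 by rewrite divr_gt0.
have [d d0 hd] := sA r _ e2; have [d' d'0 hd'] := sB r _ e2.
exists (Num.min d d'); first by rewrite lt_min d0.
move=> y; rewrite le_min => /andP[yd yd'].
have mc := @measurable_cube R n 0 r.
have md C : measurable C -> measurable_fun (cube 0 r) (fun x => `|\1_C (x + y) - \1_C x|%:E : \bar R).
  move=> mC; apply/measurable_funTS/measurable_EFinP; apply: measurableT_comp => //.
  by apply: measurable_funB; [apply: measurable_funrV_shift|]; exact: mi.
apply: (@le_trans _ _ (\int[mu]_(x in cube 0 r) (`|\1_A (x + y)%R - \1_A x|%:E + `|\1_B (x + y)%R - \1_B x|%:E))%E).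
  apply: ge0_le_integral => //.
  - by apply: md; exact: measurableI.
  - by apply: emeasurable_funD; exact: md.
  - move=> x _; rewrite -EFinD lee_fin !indicE !in_setI.
    by do 4 case: (_ \in _); rewrite /= ?subrr ?sub0r ?subr0 ?normrN ?normr1 ?normr0 ?addr0 ?add0r ?ler01 ?lerDl ?ler01.
rewrite ge0_integralD//; [|exact: md..].
by rewrite [e]splitr EFinD; apply: leeD; [exact: hd|exact: hd'].
Qed.

(** Inside a cube, the part of the union missed by the first [m] sets has finite measure and
    decreases to the empty set, so its measure tends to 0; [shiftc_lim] applies to the finite
    unions. *)
Lemma shiftc_bigcup (F : (set 'rV[R]_n)^nat) : (forall k, measurable (F k)) ->
  (forall k, shiftc \1_(F k)) -> shiftc \1_(\bigcup_k F k).
Proof.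
move=> mF sF; pose B m := \big[setU/set0]_(k < m) F k.
have mB m : measurable (B m) by apply: bigsetU_measurable.
have sB m : shiftc \1_(B m).
  rewrite /B; elim: m => [|m IH].
    by rewrite big_ord0 => r e e0; exists 1 => // y _; rewrite indic0; under eq_integral do rewrite subrr normr0; rewrite integral0 lee_fin ltW.
  rewrite big_ord_recr/= -[X in \1_X]setCK setCU; apply: shiftc_setC.
  by apply: shiftc_setI; [by apply: measurableC; exact: mB|exact: measurableC|exact: shiftc_setC..].
have mU : measurable (\bigcup_k F k) by exact: bigcup_measurable.
apply: shiftc_lim; first exact: measurable_indic.
move=> r e e0.
pose D m := cube 0 r `&` ((\bigcup_k F k) `\` B m).
have mD m : measurable (D m) by apply: measurableI; [exact: measurable_cube|exact: measurableD].
have : mu (D m) @[m --> \oo] --> mu (\bigcap_m D m).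
  apply: nonincreasing_cvg_mu => //.
  - rewrite (@le_lt_trans _ _ (mu (cube 0 r)))//.
      by apply: le_measure; rewrite ?inE//; [exact: measurable_cube|move=> ? []].
    by apply: compact_measure_fin; exact: cube_compact.
  - exact: bigcap_measurable.
  - move=> m k mk; apply/subsetPset; apply: setIS; apply: setDS.
    by rewrite /B -!bigcup_mkord => z [j /= jm Fz]; exists j => //=; exact: leq_trans mk.
rewrite (_ : \bigcap_m D m = set0); last first.
  apply/seteqP; split=> // x h; have [_ [[k _ Fx] _]] := h 0%N I.
  have [_ [_]] := h k.+1 I; apply; rewrite /B big_ord_recr/=; right => //.
rewrite measure0 => /fine_cvgP[_ /cvgrPdist_le/(_ e e0)[m _ /(_ m (leqnn m))]].
rewrite /= sub0r normrN => hm; exists \1_(B m); split => //.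
have fD : mu (D m) \is a fin_num.
  rewrite ge0_fin_numE// (@le_lt_trans _ _ (mu (cube 0 r)))//.
    by apply: le_measure; rewrite ?inE//; [exact: measurable_cube|move=> ? []].
  by apply: compact_measure_fin; exact: cube_compact.
rewrite (_ : \int[mu]_(x in _) _ = mu (D m))%E.
  by rewrite -(fineK fD) lee_fin (le_trans _ hm)// ler_norm.
rewrite /D setIC -integral_indic//; [|exact: measurable_cube|exact: measurableD].
apply: eq_integral => x _; congr EFin; rewrite !indicE in_setD.
have sub : B m `<=` \bigcup_k F k by rewrite /B -bigcup_mkord => z [k _ Fz]; exists k.
case: (boolP (x \in B m)) => [/set_mem/sub/mem_set ->|_]; rewrite ?andbF ?subrr ?normr0//.
by rewrite subr0 andbT ger0_norm.
Qed.

Lemma shiftc_halfspace i (c : R) : shiftc \1_[set x : 'rV[R]_n | x ord0 i < c].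
Proof.
move=> r e e0.
have [r0|r0] := ltP r 0.
  exists 1 => // y _; rewrite (_ : cube 0 r = set0) ?integral_set0 ?lee_fin ?ltW//.
  by apply/seteqP; split => // x /= /(le_trans (normr_ge0 _)); rewrite leNgt r0.
(* The indicators differ only in the slab where [x ord0 i] is within [d] of [c]. Sides bounded by
   [2 * r + 1], which is at least 1, let the product of the other [n - 1] sides be bounded by an
   [n]-th power. *)
pose M := (2 * r + 1) ^+ n + 1.
have M0 : 0 < M by rewrite ltr_wpDl// exprn_ge0// addr_ge0// mulr_ge0.
exists (e / (2 * M)); first by rewrite divr_gt0// mulr_gt0.
set d := e / _; move=> y yd; have d0 : 0 <= d by exact: le_trans yd.
pose A j := if j == i then `[c - d, c + d]%classic else `[- r, r]%classic.
pose S := [set x : 'rV[R]_n | forall j, A j (x ord0 j)].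
have mS' j : measurable (A j) by rewrite /A; case: ifP.
have mS : measurable S.
  rewrite (_ : S = \bigcap_(j in [set: 'I_n]) ((fun v : 'rV[R]_n => v ord0 j) @^-1` A j)).
    apply: fin_bigcap_measurable => // j _.
    by rewrite -[X in measurable X]setTI; exact: measurable_rV_coord.
  by apply/seteqP; split => v Bv j => [_|]; exact: Bv.
apply: (@le_trans _ _ (mu S)).
  rewrite -(setIT S) -integral_indic// [X in (X <= _)%E]integral_mkcond.
  have mc := @measurable_cube R n 0 r.
  apply: ge0_le_integral => //.
  - by move=> x _; rewrite patchE; case: ifP.
  - apply/(measurable_restrictT _ mc)/measurable_funTS/measurable_EFinP.
    have mh : measurable_fun [set: 'rV[R]_n] (\1_[set x : 'rV[R]_n | x ord0 i < c] : _ -> R).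
      apply: measurable_indic.
      have /= := @measurable_rV_coord R n i measurableT `]-oo, c[%classic (measurable_itv _).
      by rewrite setTI; congr measurable.
    by apply: measurableT_comp => //; apply: measurable_funB => //; exact: measurable_funrV_shift.
  - by apply/measurable_EFinP; exact: measurable_indic.
  - move=> x _; rewrite patchE; case: ifPn => [|_]; last by rewrite lee_fin.
    rewrite inE /cube/= subr0 => /(rV_norm_leP _ r0) xr; rewrite lee_fin.
    have [Sx|nSx] := pselect (S x).
      by rewrite [in leRHS]indicE mem_set// !indicE; do 2 case: (_ \in _); rewrite /= ?subrr ?sub0r ?subr0 ?normrN ?normr1 ?normr0.
    rewrite [in leRHS]indicE memNset// !indicE.
    have yi : `|y ord0 i| <= d by exact: le_trans (rV_coord_le _ _) yd.
    suff -> : (x + y \in [set x : 'rV[R]_n | x ord0 i < c]) = (x \in [set x : 'rV[R]_n | x ord0 i < c]).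
      by rewrite subrr normr0.
    have hS : ~~ (c - d <= x ord0 i <= c + d).
      apply/negP => h; apply: nSx => j; rewrite /A; case: ifP => [/eqP ->|_]; rewrite /= in_itv//=.
      by rewrite -ler_norml.
    move: yi; rewrite ler_norml => /andP[y1 y2].
    by apply/idP/idP; rewrite !inE/= mxE => h;
       move: hS; rewrite negb_and -!ltNge => /orP[] ?; lra.
rewrite lebesgue_rV_box// (bigD1 i)//= {1}/A eqxx.
have r1 : (1 <= 2 * r + 1) by rewrite lerDr mulr_ge0.
apply: (@le_trans _ _ (((2 * d) * (2 * r + 1) ^+ n)%:E)).
  rewrite EFinM; apply: lee_pmul; rewrite ?measure_ge0//.
  - by apply: prode_ge0 => j _; exact: measure_ge0.
  - rewrite lebesgue_measure_itv/=; case: ifP => _; rewrite -?EFinB lee_fin; lra.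
  - apply: (@le_trans _ _ (\prod_(j < n | j != i) (2 * r + 1)%:E)%E).
      suff [] : (0 <= \prod_(j < n | j != i) lebesgue_measure (A j) /\
        \prod_(j < n | j != i) lebesgue_measure (A j) <=
        \prod_(j < n | j != i) (2 * r + 1)%:E)%E by [].
      elim/big_ind2 : _ => [|x1 x2 y1 y2 [x10 x12] [y10 y12]|j ji]; first by [].
        by split; [exact: mule_ge0|exact: lee_pmul].
      split; first exact: measure_ge0.
      rewrite /A (negPf ji) lebesgue_measure_itv/=.
      by case: ifP => _; rewrite -?EFinB lee_fin; lra.
    rewrite prodEFin lee_fin prodr_const ler_weXn2l//.
    by rewrite -[leqRHS](card_ord n) max_card.
rewrite lee_fin /d (_ : 2 * (e / (2 * M)) * _ = e * ((2 * r + 1) ^+ n / M)); last by field; rewrite gt_eqF.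
by rewrite ler_piMr ?ltW// ltr_pdivrMr// mul1r /M ltrDl.
Qed.

(** Two inductions over generators: half-spaces have the property, hence so do preimages of Borel
    sets under a coordinate, hence all sets generated by these. *)
Lemma shiftc_indic A : measurable A -> shiftc \1_A.
Proof.
move=> mA; suff [] : measurable A /\ shiftc \1_A by [].
move: A mA; apply: smallest_sub.
  split.
  - by split=> // r e e0; exists 1 => // y _; rewrite indic0; under eq_integral do rewrite subrr normr0; rewrite integral0 lee_fin ltW.
  - by move=> A [mA sA]; rewrite setTD; split; [exact: measurableC|exact: shiftc_setC].
  - by move=> F hF; split; [apply: bigcup_measurable => k _; exact: (hF k).1|apply: shiftc_bigcup => k; have [] := hF k].
rewrite -bigcup_seq; apply: bigcup_sub => i _ _ [B mB <-]; rewrite setTI; split.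
  by rewrite -[X in measurable X]setTI; exact: measurable_rV_coord.
suff [] : measurable B /\ shiftc \1_((fun x : 'rV[R]_n => x ord0 i) @^-1` B) by [].
have mpre (C : set R) : measurable C -> measurable ((fun x : 'rV[R]_n => x ord0 i) @^-1` C).
  by move=> mC; rewrite -[X in measurable X]setTI; exact: measurable_rV_coord.
have mB' : (@RGenInftyO.G R).-sigma.-measurable B by rewrite -RGenInftyO.measurableE.
move: B mB' {mB}; apply: smallest_sub.
  split.
  - split=> //; rewrite preimage_set0 => r e e0; exists 1 => // y _; rewrite indic0.
    by under eq_integral do rewrite subrr normr0; rewrite integral0 lee_fin ltW.
  - move=> A [mA sA]; rewrite setTD preimage_setC; split; [exact: measurableC|exact: shiftc_setC].
  - move=> F hF; split; first by apply: bigcup_measurable => k _; exact: (hF k).1.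
    rewrite preimage_bigcup; apply: shiftc_bigcup => k; last by have [] := hF k.
    by apply: mpre; exact: (hF k).1.
move=> _ [c ->]; split; first exact: measurable_itv.
rewrite (_ : _ @^-1` _ = [set x : 'rV[R]_n | x ord0 i < c]); first exact: shiftc_halfspace.
by apply/seteqP; split=> x /=; rewrite in_itv.
Qed.

(** Integrable functions are limits in L^1 of simple functions, which are finite combinations of
    indicators. *)
Lemma shiftc_integrable f : mu.-integrable [set: _] (EFin \o f) -> shiftc f.
Proof.
move=> fi; have mf : measurable_fun [set: _] f by apply/measurable_EFinP; exact: measurable_int fi.
have [g [gi _ gf]] := approximation_sfun_integrable measurableT fi.
apply: shiftc_lim => // r e e0.
have /fine_cvgP[[N _ hN] /cvgrPdist_le/(_ e e0)[M _ hM]] := gf.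
pose m := maxn N M; have := hM m (leq_maxr _ _); have := hN m (leq_maxl _ _).
rewrite /= sub0r normrN => fin hm; exists (g m : _ -> R); split.
- exact: measurable_funP.
- rewrite (_ : (g m : _ -> R) = (fun x => \sum_(a <- finmap.enum_fset (fset_set (range (g m)))) a * \1_(g m @^-1` [set a]) x)); last first.
    by apply/funext => x; rewrite fimfunE fsbig_finite//=.
  elim: (finmap.enum_fset _) => [|a s IH].
    move=> r' e' e'0; exists 1 => // y _.
    by under eq_integral do rewrite !big_nil subrr normr0; rewrite integral0 lee_fin ltW.
  have -> : (fun x => \sum_(b <- a :: s) b * \1_(g m @^-1` [set b]) x) =
     (fun x => a * \1_(g m @^-1` [set a]) x) \+ (fun x => \sum_(b <- s) b * \1_(g m @^-1` [set b]) x).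
    by apply/funext => x; rewrite big_cons.
  have mi b : measurable_fun [set: 'rV[R]_n] (\1_(g m @^-1` [set b]) : _ -> R).
    by apply: measurable_indic.
  apply: shiftcD => //.
  + by apply: measurable_funM.
  + by apply: measurable_sum => b; apply: measurable_funM.
  + by apply: shiftcZ => //; exact: shiftc_indic.
- apply: (@le_trans _ _ (\int[mu]_x `|(EFin \o f) x - (g m x)%:E|)%E).
    apply: ge0_subset_integral => //; first exact: measurable_cube.
    by apply/measurable_EFinP; apply: measurableT_comp => //; apply: measurable_funB.
  by rewrite -(fineK fin) lee_fin (le_trans (ler_norm _)).
Qed.

End shift_continuity.

(** * Differences under translation estimated by the gradient *)

Section translation_estimate.
Context {R : realType}.
Variable n : nat.
Local Notation mu := (@lebesgue_rV R n).
Local Notation leb := (@lebesgue_measure R).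
Implicit Types (f : 'rV[R]_n -> R) (x h : 'rV[R]_n).

Lemma measurable_normrV : measurable_fun [set: 'rV[R]_n] (fun x => `|x|).
Proof.
apply: (continuous_measurable_rV openT) => x _; exact: norm_continuous.
Qed.

Lemma measurable_fun_normrV d (T : measurableType d) (D : set T) (F : T -> 'rV[R]_n) :
  measurable_fun D F -> measurable_fun D (fun t => `|F t|).
Proof. by move=> mF; apply: (measurableT_comp measurable_normrV). Qed.

Lemma measurable_dotv d (T : measurableType d) (F G : T -> 'rV[R]_n) :
  measurable_fun [set: T] F -> measurable_fun [set: T] G ->
  measurable_fun [set: T] (fun t => dotv (F t) (G t)).
Proof.
move=> /measurable_fun_rVP mF /measurable_fun_rVP mG.
by apply: measurable_sum => i; apply: measurable_funM.
Qed.

Lemma measurable_scale d (T : measurableType d) (a : T -> R) (F : T -> 'rV[R]_n) :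
  measurable_fun [set: T] a -> measurable_fun [set: T] F ->
  measurable_fun [set: T] (fun t => a t *: F t).
Proof.
move=> ma /measurable_fun_rVP mF; apply/measurable_fun_rVP => i.
by under eq_fun do rewrite mxE; apply: measurable_funM.
Qed.

Lemma measurable_addrV d (T : measurableType d) (F G : T -> 'rV[R]_n) :
  measurable_fun [set: T] F -> measurable_fun [set: T] G ->
  measurable_fun [set: T] (fun t => F t + G t).
Proof.
move=> /measurable_fun_rVP mF /measurable_fun_rVP mG; apply/measurable_fun_rVP => i.
by under eq_fun do rewrite mxE; apply: measurable_funD.
Qed.

Lemma C1_measurable f : C1 f -> measurable_fun [set: _] f.
Proof.
move=> cf; apply: (continuous_measurable_rV openT) => x _; exact: C1_continuous.
Qed.

Lemma C1_measurable_grad f : C1 f -> measurable_fun [set: _] (grad f).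
Proof.
move=> [_ cf]; apply/measurable_fun_rVP => i; under eq_fun do rewrite mxE.
apply: (continuous_measurable_rV openT) => x _; exact: cf.
Qed.

Lemma C1_grad_continuous f : C1 f -> continuous (grad f).
Proof. by move=> [_ cf] x; apply/continuous_gradP => i; exact: cf. Qed.

Lemma C1_FTC f x h : C1 f ->
  (\int[leb]_(s in `[0%R, 1%R]) (dotv h (grad f (x + s *: h)))%:E = (f (x + h) - f x)%:E)%E.
Proof.
move=> cf.
have cl : continuous (fun s : R => x + s *: h).
  move=> s; apply: (@continuousD _ _ _ (cst x) (fun s : R => s *: h)); first exact: cst_continuous.
  exact: scalel_continuous.
have cg : continuous (fun s : R => dotv h (grad f (x + s *: h))).
  move=> s; apply: (@continuous_comp _ _ _ (fun s : R => grad f (x + s *: h)) (fun v => dotv h v)).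
    by apply: (@continuous_comp _ _ _ (fun s : R => x + s *: h) (grad f)); [exact: cl|exact: C1_grad_continuous].
  have -> : dotv h = dotvr h by apply/funext => v; rewrite /dotvr dotvC.
  exact: dotv_continuous.
have cF : continuous (fun s : R => f (x + s *: h)).
  by move=> s; apply: (@continuous_comp _ _ _ (fun s : R => x + s *: h) f); [exact: cl|exact: C1_continuous].
rewrite (@continuous_FTC2 R _ (fun s : R => f (x + s *: h)) 0 1 ltr01).
- by rewrite scale1r scale0r addr0 EFinB.
- exact: continuous_subspaceT.
- split.
  + by move=> s _; have [] := is_derive_line (C1_diff (x + s *: h) cf).
  + exact/cvg_at_right_filter/cF.
  + exact/cvg_at_left_filter/cF.
- by move=> s _; rewrite derive1E; have [_ ->] := is_derive_line (C1_diff (x + s *: h) cf).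
Qed.

Definition convex_setrV (Q : set 'rV[R]_n) :=
  forall x h (s : R), 0 <= s <= 1 -> Q x -> Q (x + h) -> Q (x + s *: h).

Lemma convex_setrVT : convex_setrV setT.
Proof. by []. Qed.

Lemma convex_cube x0 (r : R) : convex_setrV (cube x0 r).
Proof.
move=> x h s /andP[s0 s1]; rewrite /cube/= => xr xhr.
rewrite (_ : _ - x0 = (1 - s) *: (x - x0) + s *: (x + h - x0)).
  rewrite (le_trans (ler_normD _ _))// !normrZ !ger0_norm ?subr_ge0//.
  rewrite (_ : r = (1 - s) * r + s * r); last by ring.
  by rewrite lerD// ler_wpM2l// subr_ge0.
by apply/rowP => i; rewrite !mxE; ring.
Qed.

(** The fundamental theorem of calculus on the segment from [x] to [x + h], which stays in the
    convex set [Q], followed by Tonelli and translation invariance. The factor [n] comes from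
    bounding [dotv] by sup norms. Both [isoperimetric] and [poincare] rest on estimates of this
    form. *)
Lemma translation_estimate f (Q : set 'rV[R]_n) h : C1 f -> measurable Q ->
  convex_setrV Q ->
  (\int[mu]_x (`|f (x + h)%R - f x| * (\1_Q x * \1_Q (x + h)%R))%:E <=
   (n%:R * `|h|)%:E * \int[mu]_(x in Q) `|grad f x|%:E)%E.
Proof.
move=> cf mQ cQ; set c := n%:R * `|h|; have c0 : 0 <= c by rewrite mulr_ge0.
have mg := C1_measurable_grad cf; have mf := C1_measurable cf.
have m1Q : measurable_fun [set: 'rV[R]_n] (\1_Q : _ -> R) by exact: measurable_indic.
pose k y := `|grad f y| * \1_Q y.
have k0 y : 0 <= k y by rewrite mulr_ge0.
have mk : measurable_fun [set: 'rV[R]_n] k.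
  by apply: measurable_funM => //; exact: measurable_fun_normrV.
pose F (z : 'rV[R]_n * measurableTypeR R) : \bar R :=
  ((c * k (z.1 + (z.2 : R) *: h)) * \1_(`[0%R, 1%R]%classic) (z.2 : R))%:E.
have F0 z : (0 <= F z)%E by rewrite lee_fin !mulr_ge0.
have mF : measurable_fun [set: 'rV[R]_n * measurableTypeR R] F.
  apply/measurable_EFinP; apply: measurable_funM.
    apply: measurable_funM => //; apply: (measurableT_comp mk).
    apply: measurable_addrV; first exact: measurable_fst.
    by apply: measurable_scale => //; exact: measurable_snd.
  by apply: (measurableT_comp _ measurable_snd); apply: measurable_indic; exact: measurable_itv.
apply: (@le_trans _ _ (\int[mu]_x \int[leb]_s F (x, s))%E).
  apply: ge0_le_integral => //.
  - apply/measurable_EFinP; apply: measurable_funM.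
      apply: measurableT_comp => //; apply: measurable_funB => //.
      by apply: (measurableT_comp mf); exact: measurable_rV_shift.
    by apply: measurable_funM => //; apply: (measurableT_comp m1Q); exact: measurable_rV_shift.
  - by apply: (measurable_fun_fubini_tonelli_F (m2 := leb) F).
  - move=> x _; have [Qx|nQx] := pselect (Q x); last first.
      by rewrite !indicE (memNset nQx) mul0r mulr0 integral_ge0.
    have [Qxh|nQxh] := pselect (Q (x + h)); last first.
      by rewrite !indicE (memNset nQxh) !mulr0 integral_ge0.
    rewrite !indicE !mem_set// !mulr1 -abse_EFin -(C1_FTC x h cf).
    have m1 : measurable_fun [set: measurableTypeR R] (fun s : R => dotv h (grad f (x + s *: h))).
      apply: measurable_dotv => //; apply: (measurableT_comp mg).
      by apply: measurable_addrV => //; apply: measurable_scale.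
    apply: le_trans (le_abse_integral _ _ _) _ => //.
      by apply/measurable_EFinP; exact: measurable_funTS.
    rewrite integral_mkcond; apply: ge0_le_integral => //.
    + by move=> s _; rewrite patchE; case: ifP.
    + apply/(measurable_restrictT _ (measurable_itv _)); apply: measurable_funTS.
      by apply/measurable_EFinP; exact: measurableT_comp.
    + by apply: (measurableT_comp mF); exact: pair1_measurable.
    + move=> s _; rewrite patchE; case: ifPn => [|_]; last exact: F0.
      move=> s01; rewrite /F/= lee_fin [\1__ s]indicE s01 mulr1 /k.
      rewrite indicE mem_set ?mulr1; first by rewrite dotv_bound.
      by apply: cQ => //; move: s01; rewrite inE/= in_itv.
have L1 : (\int[leb]_x (\1_(`[0%R, 1%R]%classic) x)%:E = 1)%E.
  rewrite integral_indic ?setIT//; transitivity (leb `[0%R, 1%R]%classic) => //.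
  by rewrite lebesgue_measure_itv/= lte_fin ltr01 oppr0 adde0.
rewrite fubini_tonelli//.
apply: (@le_trans _ _ (\int[leb]_s ((\1_(`[0%R, 1%R]%classic) s)%:E * (c%:E * \int[mu]_(x in Q) `|grad f x|%:E)))%E).
  rewrite le_eqVlt; apply/orP; left; apply/eqP; apply: eq_integral => s _.
  under eq_integral => x _ do rewrite /F/= mulrC EFinM EFinM.
  have mks : measurable_fun [set: 'rV[R]_n] (fun x => (k (x + s *: h))%:E).
    by apply/measurable_EFinP; apply: (measurableT_comp mk); exact: measurable_rV_shift.
  rewrite ge0_integralZl//; last first.
  - by move=> x _; rewrite mule_ge0// lee_fin.
  - by apply: emeasurable_funM.
  congr (_ * _)%E; rewrite ge0_integralZl//; last by move=> x _; rewrite lee_fin.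
  congr (_ * _)%E.
  rewrite (ge0_integral_rV_shift (s *: h) (f := fun x => (k x)%:E))//; last first.
    exact/measurable_EFinP.
  rewrite [RHS]integral_mkcond; apply: eq_integral => x _; rewrite patchE /k indicE.
  by case: ifP => _; rewrite ?mulr1 ?mulr0.
rewrite ge0_integralZr//.
- by rewrite [X in (X * _)%E](_ : _ = 1%E) ?mul1e//; exact: L1.
- by apply/measurable_EFinP; apply: measurable_indic; exact: measurable_itv.
- by rewrite mule_ge0// integral_ge0.
Qed.

End translation_estimate.

(** * Smooth bump functions *)

Section bump.
Context {R : realType}.

(** The derivative of each of these functions is a combination of two others of the family
    ([is_derive_flat]), so that smoothness follows without computing higher derivatives of
    [exp(-1/t)]. *)
Definition flat (j : nat) (t : R) : R := if 0 < t then t^-1 ^+ j * expR (- t^-1) else 0.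

Lemma flat_ge0 j t : 0 <= flat j t.
Proof.
rewrite /flat; case: ifP => // t0.
by rewrite mulr_ge0 ?expR_ge0// exprn_ge0// invr_ge0 ltW.
Qed.

Lemma flat_gt0 j t : 0 < t -> 0 < flat j t.
Proof. by move=> t0; rewrite /flat t0 mulr_gt0 ?expR_gt0// exprn_gt0// invr_gt0. Qed.

Lemma flat_le0 j t : t <= 0 -> flat j t = 0.
Proof. by move=> t0; rewrite /flat ltNge t0. Qed.

(** From [(s/k)^k <= exp s] with [s = 1/t] and [k = j + 2]. The two spare powers of [t] give the
    quadratic bound from which the derivative at 0 is read off. *)
Lemma flat_bound j t : flat j t <= j.+2%:R ^+ j.+2 * t ^+ 2.
Proof.
rewrite /flat; case: ifPn => [t0|_]; last by rewrite mulr_ge0// sqr_ge0.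
have k0 : (0 : R) < j.+2%:R by rewrite ltr0n.
have h : (t^-1 / j.+2%:R) ^+ j.+2 <= expR t^-1.
  rewrite -[X in expR X](@mulfVK _ j.+2%:R) ?gt_eqF// expRM_natr.
  apply: lerXn2r; rewrite ?nnegrE ?expR_ge0// ?divr_ge0 ?invr_ge0 ?ltW//.
  by rewrite (lt_le_trans _ (expR_ge1Dx _))// ltrDr.
rewrite expRN -(ler_pM2l (exprn_gt0 j t0)) mulrA -exprMn mulfV ?gt_eqF// expr1n mul1r.
rewrite -(ler_pM2r (expR_gt0 t^-1)) mulVf ?gt_eqF ?expR_gt0//.
apply: (@le_trans _ _ (t ^+ j * (j.+2%:R ^+ j.+2 * t ^+ 2) * (t^-1 / j.+2%:R) ^+ j.+2)).
  rewrite [leRHS](_ : _ = ((t * j.+2%:R) * (t^-1 / j.+2%:R)) ^+ j.+2).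
    by rewrite (_ : _ * _ = 1) ?expr1n//; field; rewrite !gt_eqF.
  have E : t ^+ j.+2 = t ^+ 2 * t ^+ j by rewrite -exprD.
  by rewrite !exprMn E; ring.
by apply: ler_wpM2l => //; apply: mulr_ge0; [|apply: mulr_ge0]; apply: exprn_ge0; rewrite ltW.
Qed.

Lemma is_derive_quad (f : R -> R) (x C : R) :
  (forall h, `|f (x + h) - f x| <= C * h ^+ 2) -> is_derive x (1:R) f 0.
Proof.
move=> hf.
have cv : h^-1 *: ((f \o shift x) (h *: (1:R)) - f x) @[h --> 0^'] --> (0 : R).
  apply/cvgrPdist_le => e e0; have C0 : 0 < `|C| + 1 by rewrite ltr_wpDl.
  near=> h; have h0 : h != 0 by near: h; exact: nbhs_dnbhs_neq.
  have hC : `|h| < e / (`|C| + 1) by near: h; apply: dnbhs0_lt; rewrite divr_gt0.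
  rewrite sub0r normrN /= /GRing.scale/= mulr1 normrM normfV [h + x]addrC.
  rewrite ler_pdivrMl ?normr_gt0// (le_trans (hf _))// -real_normK ?num_real// expr2.
  rewrite mulrA [leLHS]mulrC ler_wpM2l//.
  rewrite (@le_trans _ _ ((`|C| + 1) * `|h|))// ?ler_wpM2r//.
    by rewrite (le_trans (ler_norm C))// lerDl.
  by rewrite mulrC -ler_pdivlMr// ltW.
split; first by apply/cvg_ex; exists 0.
exact/cvg_lim.
Unshelve. all: by end_near. Qed.

Lemma is_derive_flat j t : is_derive t (1:R) (flat j) (flat j.+2 t - j%:R * flat j.+1 t).
Proof.
have [t0|t0|->] := ltgtP t 0.
- rewrite !flat_le0 ?(ltW t0)// mulr0 subrr.
  have h0 : is_derive t (1:R) (cst (0:R)) 0 by exact: is_derive_cst.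
  apply: near_eq_is_derive h0.
  by near=> s; rewrite /= flat_le0// ltW//; near: s; exact: lt_nbhsl.
- apply: (@near_eq_is_derive _ _ _ (fun s : R => s^-1 ^+ j * expR (- s^-1))).
    by near=> s; rewrite /flat ifT//; near: s; exact: lt_nbhsr.
  have hV : is_derive t 1 (fun s : R => s^-1) (- t ^- 2).
    have h := is_deriveV (f := id) (lt0r_neq0 t0) (is_derive_id t (1:R)).
    by apply: is_derive_eq; rewrite /GRing.scale/= mulr1.
  have h1 := @is_deriveX R _ (fun s : R => s^-1) j t 1 _ hV.
  have h2 : is_derive t 1 (fun s : R => expR (- s^-1)) (expR (- t^-1) * - - t ^- 2).
    apply: (@is_derive1_comp R expR (fun s : R => - s^-1)).
  have h3 := @is_deriveM R _ _ _ t 1 _ _ h1 h2.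
  rewrite (_ : (fun s : R => _) = (fun s : R => s^-1) ^+ j * (fun s => expR (- s^-1))); last first.
    by apply/funext => s; rewrite !fctE.
  apply: is_derive_eq h3 _.
  rewrite /flat t0 /GRing.scale/=.
  rewrite !fctE -!exprVn; set a := t^-1; set E := expR _.
  by case: j {h1 h2} => [|j] /=; rewrite !exprS ?expr0; ring.
- rewrite !flat_le0// mulr0 subrr; apply: (is_derive_quad (C := j.+2%:R ^+ j.+2)) => h.
  by rewrite add0r (flat_le0 _ (lexx 0)) subr0 ger0_norm ?flat_ge0// flat_bound.
Unshelve. all: by end_near. Qed.

Variable n : nat.
Implicit Types (f g : 'rV[R]_n -> R).

(** An algebra of functions closed under partial derivatives; [Ck k] then follows for every [k] by a
    plain induction. *)
Inductive smooth : ('rV[R]_n -> R) -> Prop :=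
| smooth_flat i j a s : smooth (fun x => flat j (a + s * x ord0 i))
| smooth_cst c : smooth (fun=> c)
| smoothD f g : smooth f -> smooth g -> smooth (f \+ g)
| smoothM f g : smooth f -> smooth g -> smooth (f \* g).

Lemma smooth_differentiable f : smooth f ->
  (forall x, differentiable f x) /\ (forall i, smooth (partial i f)).
Proof.
elim=> {f} [i j a s|c|f g _ [df pf] _ [dg pg]|f g sf [df pf] sg [dg pg]].
- have dc x : differentiable (fun y : 'rV[R]_n => a + s * y ord0 i) x /\
      grad (fun y : 'rV[R]_n => a + s * y ord0 i) x = s *: delta_mx ord0 i.
    apply: differentiable_epsP => e e0; exists 1 => // v _.
    rewrite dotvZr dotvC dotv_delta !mxE [X in `|X|](_ : _ = 0); last by ring.
    by rewrite normr0 mulr_ge0// ltW.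
  have hc x := grad_comp (dc x).1 (is_derive_flat j (a + s * x ord0 i)).
  split=> [x|k]; first exact: (hc x).1.
  have -> : partial k (fun x => flat j (a + s * x ord0 i)) =
    (fun x => (s * (k == i)%:R) * flat j.+2 (a + s * x ord0 i) + (s * (k == i)%:R * - j%:R) * flat j.+1 (a + s * x ord0 i)).
    apply/funext => x; have [_ h] := hc x.
    have := congr1 (fun M : 'rV[R]_n => M ord0 k) h.
    by rewrite mxE => ->; rewrite (dc x).2 !mxE eqxx/=; ring.
  apply: (@smoothD (fun x => _ * _) (fun x => _ * _)).
    by apply: (@smoothM (fun=> _) (fun x => _)); [exact: smooth_cst|exact: smooth_flat].
  by apply: (@smoothM (fun=> _) (fun x => _)); [exact: smooth_cst|exact: smooth_flat].
- split=> [x|i]; first exact: differentiable_cst.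
  have -> : partial i (fun=> c) = (fun=> 0).
    by apply/funext => x; rewrite /partial derive_cst.
  exact: smooth_cst.
- split=> [x|i]; first exact: differentiableD.
  have -> : partial i (f \+ g) = partial i f \+ partial i g.
    by apply/funext => x; rewrite /partial/= (@deriveD _ _ _ f g)//; exact: diff_derivable.
  exact: smoothD.
- split=> [x|i]; first exact: differentiableM.
  have -> : partial i (f \* g) = (f \* partial i g) \+ (g \* partial i f).
    by apply/funext => x; rewrite /partial/= (@deriveM _ _ f g)//; exact: diff_derivable.
  by apply: smoothD; exact: smoothM.
Qed.

Lemma smooth_Ck f k : smooth f -> Ck k f.
Proof.
elim: k f => [|k IH] f sf; have [df pf] := smooth_differentiable sf.
  by move=> x; exact: differentiable_continuous.
by split => // i; exact: IH.
Qed.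

(** A product over the coordinates suffices because balls of the sup norm are cubes: [b i] is
    positive exactly where [x ord0 i] lies between [- e] and [e]. *)
Lemma exists_mollifier (e : R) : 0 < e -> exists rho : 'rV[R]_n -> R,
  [/\ forall k, Ck k rho, forall x, 0 <= rho x, forall x, e <= `|x| -> rho x = 0 &
      (\int[lebesgue_rV n]_x (rho x)%:E = 1)%E].
Proof.
move=> e0; pose b i (x : 'rV[R]_n) := flat 0 (e + 1 * x ord0 i) * flat 0 (e + -1 * x ord0 i).
pose r (x : 'rV[R]_n) := \prod_(i < n) b i x.
have sb i : smooth (b i) by apply: (@smoothM (fun x => _) (fun x => _)); exact: smooth_flat.
have sr : smooth r.
  have : forall s : seq 'I_n, smooth (fun x => \prod_(i <- s) b i x).
    elim=> [|i s IH].
      rewrite (_ : (fun x => _) = (fun=> 1)); first exact: smooth_cst.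
      by apply/funext => x; rewrite big_nil.
    rewrite (_ : (fun x => _) = b i \* (fun x => \prod_(i <- s) b i x)); first exact: smoothM.
    by apply/funext => x; rewrite big_cons.
  by apply.
have r0 x : 0 <= r x by apply: prodr_ge0 => i _; rewrite mulr_ge0// flat_ge0.
have rs x : e <= `|x| -> r x = 0.
  move=> ex; have : ~ (forall i, `|x ord0 i| < e).
    by move/(rV_norm_ltP _ e0); rewrite ltNge ex.
  move=> /existsNP[i] /negP; rewrite -leNgt => exi.
  rewrite /r (bigD1 i)//= /b; have [xi|xi] := leP 0 (x ord0 i).
    by rewrite [flat 0 (e + -1 * _)]flat_le0 ?mulr0 ?mul0r//; move: exi; rewrite ger0_norm// => ?; lra.
  by rewrite [flat 0 (e + 1 * _)]flat_le0 ?mul0r//; move: exi; rewrite ltr0_norm// => ?; lra.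
have mr : measurable_fun [set: 'rV[R]_n] r.
  apply: (continuous_measurable_rV openT) => x _.
  by have /(_ x) := smooth_Ck 0 sr.
pose I := (\int[lebesgue_rV n]_x (r x)%:E)%E.
have cr := smooth_Ck 0 sr.
have rc : r 0 > 0.
  by apply: prodr_gt0 => i _; rewrite /b !mxE !mulr0 addr0 mulr_gt0// flat_gt0.
have I0 : (0 < I)%E.
  have := cr 0; move=> /continuous_epsP/(_ (r 0 / 2)); rewrite divr_gt0// => /(_ isT)[d d0 hd].
  have d20 : 0 < d / 2 by rewrite divr_gt0.
  apply: (@lt_le_trans _ _ (\int[lebesgue_rV n]_(x in cube 0 (d / 2)) (r 0 / 2)%:E)%E).
    by rewrite integral_cube_cst ?ltW// lte_fin mulr_gt0 ?divr_gt0// exprn_gt0// mulr_gt0.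
  apply: (@le_trans _ _ (\int[lebesgue_rV n]_(x in cube 0 (d / 2)) (r x)%:E)%E).
    apply: ge0_le_integral => //.
    - exact: measurable_cube.
    - by move=> x _; rewrite lee_fin divr_ge0.
    - by apply/measurable_EFinP; exact: measurable_funTS.
    - move=> x; rewrite /cube/= subr0 lee_fin => xd.
      have := hd x; rewrite add0r (le_lt_trans xd) ?ltr_pdivrMr ?ltr_pMr ?ltr1n// => /(_ isT).
      by rewrite ler_distl => /andP[h _]; lra.
  apply: ge0_subset_integral => //; first exact: measurable_cube.
    exact/measurable_EFinP.
  by move=> x _; rewrite lee_fin.
have Ioo : (I < +oo)%E.
  have [M hM] : exists M : R, forall x, r x <= M.
    have [c cQ hc] : exists2 c, c \in cube 0 e & forall t, t \in cube 0 e -> r t <= r c.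
      apply: EVT_max_rV.
      - by exists 0; rewrite /cube/= subrr normr0 ltW.
      - exact: cube_compact.
      - exact: continuous_subspaceT.
    exists (r c) => x; have [xe|xe] := leP `|x| e.
      by apply: hc; rewrite inE /cube/= subr0.
    by rewrite rs ?r0// ltW.
  apply: (@le_lt_trans _ _ (\int[lebesgue_rV n]_(x in cube 0 e) M%:E)%E).
    rewrite [leRHS]integral_mkcond; apply: ge0_le_integral => //.
    - by move=> x _; rewrite lee_fin.
    - exact/measurable_EFinP.
    - by apply/(measurable_restrictT _ (measurable_cube _ _)).
    - move=> x _; rewrite patchE; case: ifPn => [_|]; first by rewrite lee_fin.
      by rewrite notin_setE /cube/= subr0 => /negP; rewrite -ltNge => /ltW /rs ->.
  by rewrite integral_cube_cst ?ltW// ltry.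
have If : I \is a fin_num by rewrite ge0_fin_numE// ltW.
pose c := (fine I)^-1.
have c0 : 0 < c by rewrite invr_gt0 fine_gt0// I0.
exists (fun x => c * r x); split.
- by move=> k; apply: (@smooth_Ck (fun x => c * r x)); apply: (@smoothM (fun=> c)) => //; exact: smooth_cst.
- by move=> x; rewrite mulr_ge0// ltW.
- by move=> x /rs ->; rewrite mulr0.
- under eq_integral do rewrite EFinM; rewrite ge0_integralZl//.
  + by rewrite -/I -(fineK If) -EFinM mulVf// gt_eqF// fine_gt0// I0.
  + exact/measurable_EFinP.
  + by move=> x _; rewrite lee_fin.
  + by rewrite lee_fin ltW.
Qed.

End bump.

(** * Convolution with mollifiers *)

Section convolution.
Context {R : realType}.
Variable n : nat.
Local Notation mu := (@lebesgue_rV R n).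
Implicit Types (f g rho : 'rV[R]_n -> R).

Lemma integral_rV_shift (a : 'rV[R]_n) (F : 'rV[R]_n -> \bar R) :
  measurable_fun [set: _] F ->
  (\int[mu]_x F (x + a)%R = \int[mu]_x F x)%E.
Proof.
move=> mF; rewrite integralE [RHS]integralE; congr (_ - _)%E.
  transitivity (\int[mu]_x (F^\+ (x + a)%R))%E; first by apply: eq_integral => x _; rewrite !funeposE.
  apply: (ge0_integral_rV_shift a (measurable_funepos mF)) => x; exact: funepos_ge0.
transitivity (\int[mu]_x (F^\- (x + a)%R))%E; first by apply: eq_integral => x _; rewrite !funenegE.
apply: (ge0_integral_rV_shift a (measurable_funeneg mF)) => x; exact: funeneg_ge0.
Qed.

Lemma Rintegral_rV_shift (a : 'rV[R]_n) f :
  measurable_fun [set: _] f -> \int[mu]_x f (x + a) = \int[mu]_x f x.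
Proof.
move=> mf; rewrite /Rintegral (integral_rV_shift a (F := fun x => (f x)%:E))//.
exact/measurable_EFinP.
Qed.

Definition intb f := mu.-integrable [set: _] (EFin \o f).

Lemma intb_measurable f : intb f -> measurable_fun [set: _] f.
Proof. by move=> fi; apply/measurable_EFinP; exact: measurable_int fi. Qed.

Lemma intbD f g : intb f -> intb g -> intb (fun x => f x + g x).
Proof. by move=> fi gi; apply: eq_integrable (integrableD measurableT fi gi). Qed.

Lemma intbB f g : intb f -> intb g -> intb (fun x => f x - g x).
Proof. by move=> fi gi; apply: eq_integrable (integrableB measurableT fi gi). Qed.

Lemma intbZ (c : R) f : intb f -> intb (fun x => c * f x).
Proof. by move=> fi; apply: eq_integrable (integrableZl measurableT c fi). Qed.

Lemma intb_norm f : intb f -> intb (fun x => `|f x|).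
Proof. by move=> fi; exact: (integrable_norm fi). Qed.

Lemma intb_le f g : measurable_fun [set: _] f -> intb g -> (forall x, `|f x| <= g x) -> intb f.
Proof.
move=> mf gi fg; apply: le_integrable gi => //; first exact/measurable_EFinP.
by move=> x _; rewrite /= lee_fin (le_trans (fg x))// ler_norm.
Qed.

Lemma intb_sum (I : Type) (s : seq I) (F : I -> 'rV[R]_n -> R) :
  (forall i, intb (F i)) -> intb (fun x => \sum_(i <- s) F i x).
Proof.
move=> Fi; elim: s => [|i s IH].
  rewrite (_ : (fun x => _) = cst 0); first exact: integrable0.
  by apply/funext => x; rewrite big_nil.
rewrite (_ : (fun x => _) = (fun x => F i x + \sum_(j <- s) F j x)); first exact: intbD.
by apply/funext => x; rewrite big_cons.
Qed.

Lemma Rint_sum (I : Type) (s : seq I) (F : I -> 'rV[R]_n -> R) : (forall i, intb (F i)) ->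
  \int[mu]_x (\sum_(i <- s) F i x) = \sum_(i <- s) \int[mu]_x F i x.
Proof.
move=> Fi; elim: s => [|i s IH].
  rewrite big_nil; under eq_Rintegral do rewrite big_nil.
  by rewrite /Rintegral integral0.
rewrite big_cons -IH -RintegralD//; [|exact: Fi|exact: intb_sum].
by apply: eq_Rintegral => x _; rewrite big_cons.
Qed.

Lemma intb_mul_bounded f g (B : R) : intb f ->
  measurable_fun [set: _] g -> (forall x, `|g x| <= B) -> intb (fun x => f x * g x).
Proof.
move=> fi mg gB; have mf := intb_measurable fi.
apply: (intb_le _ (intbZ B (intb_norm fi))); first exact: measurable_funM.
by move=> x; rewrite normrM mulrC ler_wpM2r.
Qed.

Lemma intb_cube x0 r : intb (\1_(cube x0 r)).
Proof.
apply/integrableP; split.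
  by apply/measurable_EFinP; apply: measurable_indic; exact: measurable_cube.
rewrite (eq_integral (fun x => (\1_(cube x0 r) x)%:E)); last first.
  by move=> x _; rewrite /= ger0_norm.
rewrite integral_indic ?setIT//; last exact: measurable_cube.
by apply: compact_measure_fin; exact: cube_compact.
Qed.

Lemma intb_indic (K : set 'rV[R]_n) : compact K -> intb (\1_K : _ -> R).
Proof.
move=> cK; have [r r0 Kr] := compact_sub_cube cK.
apply: (intb_le _ (intb_cube 0 r)).
  by apply: measurable_indic; exact: compact_measurable_rV.
move=> x; rewrite ger0_norm// !indicE; case: (boolP (x \in K)) => // /set_mem/Kr h0.
by rewrite mem_set.
Qed.

Lemma Rint_cube x0 r : 0 <= r -> \int[mu]_x \1_(cube x0 r) x = (2 * r) ^+ n.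
Proof.
move=> r0; rewrite /Rintegral integral_indic ?setIT//; last exact: measurable_cube.
by rewrite (_ : _ (cube x0 r) = ((2 * r) ^+ n)%:E)//; exact: cube_measure.
Qed.

Definition Cc (r : R) rho := (forall k, Ck k rho) /\ (forall x, r < `|x| -> rho x = 0).

Lemma Cc_C1 r rho : Cc r rho -> C1 rho.
Proof. by move=> [h _]; exact: h. Qed.

Lemma near_norm_gt (r : R) (x : 'rV[R]_n) : r < `|x| -> \forall y \near x, r < `|y|.
Proof.
move=> rx; apply/nbhs_ballP; exists (`|x| - r); first by rewrite /= subr_gt0.
move=> y /=; rewrite ball_rVE => h; rewrite ltrBrDl in h.
have := ler_normD (x - y) y; rewrite subrK => h2; rewrite -(ltrD2l `|x - y|).
by rewrite (lt_le_trans _ h2)// addrC.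
Qed.

Lemma partial_out r f i : (forall x, r < `|x| -> f x = 0) ->
  forall x, r < `|x| -> partial i f x = 0.
Proof.
move=> h x rx; rewrite /partial (@near_eq_derive _ _ _ f (cst 0)) ?derive_cst//.
by have := near_norm_gt rx; apply: filterS => y /h.
Qed.

Lemma Cc_partial r rho i : Cc r rho -> Cc r (partial i rho).
Proof.
move=> [h0 h1]; split=> [k|]; last exact: partial_out.
by have [_ /(_ i)] := h0 k.+1.
Qed.

Lemma bounded_support r g : continuous g -> (forall x, r < `|x| -> g x = 0) ->
  exists2 B, 0 <= B & forall x, `|g x| <= B.
Proof.
move=> cg gr.
have [c cQ hc] : exists2 c, c \in cube 0 `|r| & forall t, t \in cube 0 `|r| -> `|g t| <= `|g c|.
  apply: (@EVT_max_rV R n (fun x => `|g x|)).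
  - by exists 0; rewrite /cube/= subrr normr0.
  - exact: cube_compact.
  - apply: continuous_subspaceT => x; apply: continuous_comp; first exact: cg.
    exact: norm_continuous.
exists `|g c| => // x; have [xe|xe] := leP `|x| `|r|.
  by apply: hc; rewrite inE /cube/= subr0.
by rewrite gr ?normr0// (le_lt_trans (ler_norm _)).
Qed.

Lemma Cc_bounded r rho : Cc r rho -> exists2 B, 0 <= B & forall x, `|rho x| <= B.
Proof. by move=> [h0 h1]; apply: (bounded_support (r := r)) => //; exact: (h0 0%N). Qed.

Lemma Cc_measurable r rho : Cc r rho -> measurable_fun [set: _] rho.
Proof. by move=> /Cc_C1/C1_measurable. Qed.

Lemma Cc_grad_lip r rho : Cc r rho -> exists2 C, 0 <= C &
  forall z v, `|grad rho (z + v) - grad rho z| <= C * `|v|.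
Proof.
move=> cr.
have /choice[B hB] (ij : 'I_n * 'I_n) : exists B, 0 <= B /\
    forall x, `|partial ij.2 (partial ij.1 rho) x| <= B.
  by have [B B0 hB] := Cc_bounded (Cc_partial ij.2 (Cc_partial ij.1 cr)); exists B.
pose C := \sum_ij B ij.
have C0 : 0 <= C by apply: sumr_ge0 => ij _; exact: (hB ij).1.
exists (n%:R * C) => [|z v]; first by rewrite mulr_ge0.
apply/rV_norm_leP => [|i]; first by rewrite !mulr_ge0.
rewrite !mxE; apply: (mvt_bound setT) => s _; split.
  exact/C1_diff/Cc_C1/Cc_partial/cr.
apply/rV_norm_leP => // j; rewrite mxE.
rewrite (le_trans ((hB (i, j)).2 _))// /C (bigD1 (i, j))//= lerDl.
by apply: sumr_ge0 => ij _; exact: (hB ij).1.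
Qed.

(** The remainder is uniform in the base point [z]; this takes the place of dominated convergence
    when a convolution is differentiated. *)
Lemma Cc_taylor r rho : Cc r rho -> exists2 C, 0 <= C &
  forall z v, `|rho (z + v) - rho z - dotv v (grad rho z)| <= C * `|v| ^+ 2.
Proof.
move=> cr; have [C C0 hC] := Cc_grad_lip cr.
exists (n%:R * C) => [|z v]; first by rewrite mulr_ge0.
have [s _|c /andP[c0 c1] ->] := @mvt_line _ _ rho z v; first exact/C1_diff/Cc_C1/cr.
rewrite -dotvBr (le_trans (dotv_bound _ _))// expr2 -!mulrA ler_wpM2l//.
rewrite mulrCA ler_wpM2l// (le_trans (hC _ _))// ler_wpM2l// normrZ ger0_norm//.
by rewrite ler_piMl.
Qed.

(** Convolution with the reflected kernel: [fun y => rho (y - x)] can then serve directly as a test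
    function, at the cost of a minus sign in [mconv_grad]. *)
Definition mconv f rho x := \int[mu]_y (f y * rho (y - x)).

Lemma measurable_shiftN g x : measurable_fun [set: _] g ->
  measurable_fun [set: 'rV[R]_n] (fun y => g (y - x)).
Proof. exact: measurable_funrV_shift. Qed.

Lemma mconv_integrable f rho r x : intb f -> Cc r rho ->
  intb (fun y => f y * rho (y - x)).
Proof.
move=> fi cr; have [B B0 hB] := Cc_bounded cr.
apply: (intb_mul_bounded fi) => //; apply: measurable_shiftN.
exact: Cc_measurable cr.
Qed.

Lemma mconv_grad f rho r x : intb f -> Cc r rho ->
  differentiable (mconv f rho) x /\ grad (mconv f rho) x = \row_i (- mconv f (partial i rho) x).
Proof.
move=> fi cr; have [C C0 hC] := Cc_taylor cr.
apply: differentiable_epsP => e e0.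
have mf := intb_measurable fi.
pose I := \int[mu]_y `|f y|.
have I0 : 0 <= I by exact: Rintegral_ge0.
have D0 : 0 < I * C + 1 by rewrite ltr_wpDl// mulr_ge0.
exists (e / (I * C + 1)) => [|v]; first by rewrite divr_gt0.
rewrite ltr_pdivlMr// => hv.
have ii i := mconv_integrable x fi (Cc_partial i cr).
have i1 := mconv_integrable (x + v) fi cr; have i2 := mconv_integrable x fi cr.
pose k y := rho (y - (x + v)) - rho (y - x) - dotv (- v) (grad rho (y - x)).
have mr := Cc_measurable cr.
have mk : measurable_fun [set: 'rV[R]_n] k.
  apply: measurable_funB; first by apply: measurable_funB; exact: measurable_shiftN.
  apply: measurable_dotv => //; apply: (measurable_funrV_shift (f := grad rho)).
  by apply: C1_measurable_grad; exact: Cc_C1 cr.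
have hk y : `|k y| <= C * `|v| ^+ 2.
  rewrite /k (_ : y - (x + v) = (y - x) + - v) ?opprD ?addrA//.
  by rewrite (le_trans (hC _ _))// normrN.
have ki := intb_mul_bounded fi mk hk.
have -> : mconv f rho (x + v) - mconv f rho x - dotv v (\row_i - mconv f (partial i rho) x)
    = \int[mu]_y (f y * k y).
  have iv i : intb (fun y => (- v ord0 i) * (f y * partial i rho (y - x))) by exact: intbZ.
  have isum := intb_sum (index_enum 'I_n) iv.
  transitivity (\int[mu]_y (f y * rho (y - (x + v)) - f y * rho (y - x) -
      \sum_i (- v ord0 i) * (f y * partial i rho (y - x)))); last first.
    apply: eq_Rintegral => y _; rewrite /k mulrBr mulrBr; congr (_ - _).
    rewrite /dotv mulr_sumr; apply: eq_bigr => i _; rewrite !mxE; ring.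
  rewrite RintegralB//; last exact: intbB.
  rewrite RintegralB//; congr (_ - _).
  rewrite (Rint_sum _ iv) /dotv; apply: eq_bigr => i _; rewrite RintegralZl//; last exact: ii.
  by rewrite !mxE /mconv mulrN mulNr.
rewrite (le_trans (le_normr_Rintegral _ _))//.
apply: (@le_trans _ _ (\int[mu]_y ((C * `|v| ^+ 2) * `|f y|))).
  apply: le_Rintegral => //.
  - exact: (integrable_norm ki).
  - exact: (intbZ _ (intb_norm fi)).
  - by move=> y _; rewrite normrM mulrC ler_wpM2r.
rewrite RintegralZl//; last exact: (integrable_norm fi).
rewrite -/I expr2 mulrAC mulrC -mulrA [X in _ * X]mulrCA mulrA mulrC.
rewrite ler_wpM2r// (le_trans _ (ltW hv))// (_ : C * `|v| * I = `|v| * (I * C)); last by ring.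
by rewrite ler_wpM2l// lerDl.
Qed.

Lemma mconv_Ck f rho r k : intb f -> Cc r rho ->
  Ck k (mconv f rho).
Proof.
move=> fi; elim: k rho => [|k IH] rho cr.
  by move=> x; apply: differentiable_continuous; exact: (mconv_grad x fi cr).1.
split=> [x|i]; first exact: (mconv_grad x fi cr).1.
have -> : partial i (mconv f rho) = (fun x => -1 * mconv f (partial i rho) x).
  apply/funext => x; have [_ /(congr1 (fun M : 'rV[R]_n => M ord0 i))] := mconv_grad x fi cr.
  by rewrite !mxE mulN1r.
move: (IH _ (Cc_partial i cr)); elim: k (mconv _ _) {IH} => [|k IH] g.
  by move=> cg x; apply: (@continuousM _ _ (cst (-1)) g); [exact: cst_continuous|exact: cg].
move=> [dg pg]; split=> [x|j]; first by apply: (@differentiableM _ _ (cst (-1)) g).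
have -> : partial j (fun x => -1 * g x) = (fun x => -1 * partial j g x).
  apply/funext => x; have /(congr1 (fun M : 'rV[R]_n => M ord0 j)) := gradZ (-1) (dg x).
  by rewrite !mxE.
exact: (IH _ (pg j)).
Qed.

Lemma mconv_shiftE f rho r x : intb f -> Cc r rho ->
  mconv f rho x = \int[mu]_y (f (x + y) * rho y).
Proof.
move=> fi cr; have mf := intb_measurable fi.
have mr := Cc_measurable cr.
rewrite /mconv -(Rintegral_rV_shift x); last first.
  by apply: measurable_funM => //; exact: measurable_shiftN.
by apply: eq_Rintegral => y _; rewrite addrK addrC.
Qed.

Lemma mconv_near g rho (ep e : R) x : intb g -> Cc ep rho -> (forall x, 0 <= rho x) ->
  (\int[mu]_x (rho x)%:E = 1)%E ->
  (forall y, `|y| <= ep -> `|g (x + y) - g x| <= e) -> `|mconv g rho x - g x| <= e.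
Proof.
move=> iu0 cr r0' rI hdu; rewrite (mconv_shiftE x iu0 cr).
have ir : intb rho.
  apply/integrableP; split; first by apply/measurable_EFinP; exact: Cc_measurable cr.
  by under eq_integral do rewrite /= ger0_norm//; rewrite rI ltry.
have [B B0 hB] := Cc_bounded cr.
have mu0 := intb_measurable iu0.
have iux : intb (fun y => g (x + y) * rho y).
  apply: (intb_mul_bounded _ (Cc_measurable cr) hB).
  rewrite (_ : (fun y => _) = (fun y => g (y + x))); last by apply/funext => y; rewrite addrC.
  apply/integrableP; split; first by apply/measurable_EFinP; exact: measurable_funrV_shift.
  rewrite (ge0_integral_rV_shift x (f := fun y => `|(g y)%:E|%E))//; last first.
    by apply: measurableT_comp => //; exact/measurable_EFinP.
  by have /integrableP[] := iu0.
have -> : \int[mu]_y (g (x + y) * rho y) - g x = \int[mu]_y (g (x + y) * rho y - g x * rho y).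
  rewrite RintegralB//; last exact: intbZ.
  by rewrite RintegralZl//; congr (_ - _); rewrite /Rintegral rI mulr1.
have id' := intbB iux (intbZ (g x) ir).
rewrite (le_trans (le_normr_Rintegral _ id'))//.
apply: (@le_trans _ _ (\int[mu]_y (e * rho y))).
  apply: le_Rintegral => //; [exact: intb_norm id'|exact: intbZ|].
  move=> y _; rewrite -mulrBl normrM [`|rho y|]ger0_norm//.
  have [ye|ye] := leP `|y| ep; last by rewrite cr.2// !mulr0.
  by apply: ler_wpM2r => //; exact: hdu.
by rewrite RintegralZl// /Rintegral rI mulr1.
Qed.

(** [mconv f rho x - f x] is an average of [f (x + y) - f x] over [|y| <= e], and Tonelli exchanges
    this average with the weighted integral. The weight stays at [x], so that only [f] is
    translated. *)
Lemma mconv_L1 f rho (e c : R) (K : set 'rV[R]_n) (w : 'rV[R]_n -> R) :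
  intb f -> Cc e rho -> (forall x, 0 <= rho x) ->
  (\int[mu]_x (rho x)%:E = 1)%E -> measurable K -> measurable_fun [set: _] w ->
  (forall x, 0 <= w x) ->
  (forall y, `|y| <= e -> (\int[mu]_(x in K) (w x * `|f (x + y)%R - f x|)%:E <= c%:E)%E) ->
  (\int[mu]_(x in K) (w x * `|mconv f rho x - f x|)%:E <= c%:E)%E.
Proof.
move=> fi cr r0 r1 mK mw w0 hc.
have mf := intb_measurable fi.
have mr := Cc_measurable cr.
have [B B0 hB] := Cc_bounded cr.
have ri : intb rho.
  apply/integrableP; split; first exact/measurable_EFinP.
  under eq_integral do rewrite /= ger0_norm//.
  by rewrite r1 ltry.
have mc : measurable_fun [set: _] (mconv f rho).
  by apply: C1_measurable; exact: mconv_Ck fi cr.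
pose F (z : 'rV[R]_n * 'rV[R]_n) : \bar R := ((w z.1 * `|f (z.1 + z.2) - f z.1| * \1_K z.1) * rho z.2)%:E.
have F0 z : (0 <= F z)%E by rewrite lee_fin !mulr_ge0.
have mF : measurable_fun [set: _] F.
  apply/measurable_EFinP; apply: measurable_funM; last by apply: (measurableT_comp mr); exact: measurable_snd.
  apply: measurable_funM; last first.
    by apply: (measurableT_comp _ measurable_fst); exact: measurable_indic.
  apply: measurable_funM; first by apply: (measurableT_comp mw); exact: measurable_fst.
  apply: measurableT_comp => //; apply: measurable_funB; last by apply: (measurableT_comp mf); exact: measurable_fst.
  by apply: (measurableT_comp mf); apply: measurable_addrV; [exact: measurable_fst|exact: measurable_snd].
apply: (@le_trans _ _ (\int[mu]_x \int[mu]_y F (x, y))%E).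
  rewrite integral_mkcond; apply: ge0_le_integral => //.
  - by move=> x _; rewrite patchE; case: ifP => // _; rewrite lee_fin mulr_ge0.
  - apply/(measurable_restrictT _ mK); apply: measurable_funTS; apply/measurable_EFinP.
    apply: measurable_funM => //; apply: measurableT_comp => //; exact: measurable_funB.
  - by apply: (measurable_fun_fubini_tonelli_F (m2 := mu) F).
  - move=> x _; rewrite patchE; case: ifPn => [xK|_]; last exact: integral_ge0.
    rewrite (mconv_shiftE x fi cr).
    have mfx : measurable_fun [set: 'rV[R]_n] (fun y => f (x + y)).
      apply: (measurableT_comp mf); rewrite (_ : +%R x = fun y => y + x); first exact: measurable_rV_shift.
      by apply/funext => y; rewrite addrC.
    have i1 : intb (fun y => f (x + y) * rho y).
      apply: (@intb_mul_bounded (fun y => f (x + y)) rho B) => //.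
      apply/integrableP; split; first exact/measurable_EFinP.
      rewrite (eq_integral (fun y : 'rV[R]_n => `|(f (y + x)%R)%:E|%E)); last by move=> y _; rewrite /= addrC.
      rewrite (ge0_integral_rV_shift x (f := fun y => `|(f y)%:E|%E))//; last first.
        by apply: measurableT_comp => //; exact/measurable_EFinP.
      by have /integrableP[] := fi.
    have i2 : intb (fun y => f x * rho y) by exact: intbZ.
    have -> : \int[mu]_y (f (x + y) * rho y) - f x = \int[mu]_y ((f (x + y) - f x) * rho y).
      under [RHS]eq_Rintegral do rewrite mulrBl.
      rewrite RintegralB// RintegralZl//; congr (_ - _).
      by rewrite /Rintegral r1 mulr1.
    have i3 : intb (fun y => (f (x + y) - f x) * rho y).
      rewrite (_ : (fun y => _) = (fun y => f (x + y) * rho y - f x * rho y)); first exact: intbB.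
      by apply/funext => y; rewrite mulrBl.
    rewrite EFinM; apply: (@le_trans _ _ ((w x)%:E * \int[mu]_y (`|(f (x + y)%R - f x) * rho y|)%:E)%E).
      apply: lee_wpmul2l; first by rewrite lee_fin.
      rewrite EFin_normr_Rintegral//.
      by apply: le_abse_integral => //; exact: measurable_int i3.
    rewrite -ge0_integralZl//; last 2 first.
    + apply/measurable_EFinP; apply: measurableT_comp => //.
      exact: intb_measurable i3.
    + by rewrite lee_fin.
    apply: ge0_le_integral => //.
    + by move=> y _; rewrite mule_ge0// lee_fin.
    + apply: emeasurable_funM => //; apply/measurable_EFinP; apply: measurableT_comp => //.
      exact: intb_measurable i3.
    + by apply: (measurableT_comp mF); exact: pair1_measurable.
    + by move=> y _; rewrite /F/= -EFinM lee_fin indicE xK mulr1 normrM [`|rho y|]ger0_norm// mulrA.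
rewrite fubini_tonelli//.
apply: (@le_trans _ _ (\int[mu]_y (c%:E * (rho y)%:E))%E).
  apply: ge0_le_integral => //.
  - by move=> y _; exact: integral_ge0.
  - by apply: (measurable_fun_fubini_tonelli_G (m1 := mu) F).
  - by apply: emeasurable_funM => //; exact/measurable_EFinP.
  - move=> y _; rewrite /F/=; under eq_integral do rewrite EFinM.
    rewrite ge0_integralZr//; last 3 first.
    + apply/measurable_EFinP; apply: measurable_funM; last exact: measurable_indic.
      apply: measurable_funM => //; apply: measurableT_comp => //; apply: measurable_funB => //.
      exact: measurable_funrV_shift.
    + by move=> x _; rewrite lee_fin !mulr_ge0.
    + by rewrite lee_fin.
    have [ye|ye] := leP `|y| e; last by rewrite cr.2// !mule0.
    apply: lee_wpmul2r; first by rewrite lee_fin.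
    apply: le_trans (hc y ye); rewrite [leRHS]integral_mkcond.
    apply: ge0_le_integral => //.
    + by move=> x _; rewrite lee_fin !mulr_ge0.
    + apply/measurable_EFinP; apply: measurable_funM; last exact: measurable_indic.
      apply: measurable_funM => //; apply: measurableT_comp => //; apply: measurable_funB => //.
      exact: measurable_funrV_shift.
    + apply/(measurable_restrictT _ mK); apply: measurable_funTS; apply/measurable_EFinP.
      apply: measurable_funM => //; apply: measurableT_comp => //; apply: measurable_funB => //.
      exact: measurable_funrV_shift.
    + by move=> x _; rewrite patchE indicE; case: ifP => _; rewrite ?mulr1 ?mulr0.
(* The hypothesis at [y = 0] gives the sign; for a negative radius [e] the kernel would vanish,
   against its integral 1. *)
have c0 : 0 <= c.
  have [e0|e0] := leP 0 e.
    have := hc 0; rewrite normr0 => /(_ e0); rewrite -lee_fin; apply: le_trans.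
    by apply: integral_ge0 => x _; rewrite lee_fin mulr_ge0.
  have : (\int[mu]_x (rho x)%:E = 0)%E.
    rewrite (eq_integral (fun=> 0%E)) ?integral0// => x _.
    by rewrite cr.2// (lt_le_trans e0).
  by rewrite r1 => /eqP; rewrite onee_eq0.
rewrite ge0_integralZl//; last 2 first.
- exact/measurable_EFinP.
- by move=> x _; rewrite lee_fin.
by rewrite r1 mule1.
Qed.

(** The difference quotient in direction [i] has integral 0 by translation invariance, and it tends
    to the partial derivative uniformly on a fixed cube outside which both vanish. *)
Lemma integral_partial0 g r i : C1 g -> (forall x, r < `|x| -> g x = 0) ->
  \int[mu]_x partial i g x = 0.
Proof.
move=> cg gr; have [dg pg] := cg.
have po := partial_out i gr.
have [B B0 hB] := bounded_support (pg i) po.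
have [B' B'0 hB'] := bounded_support (C1_continuous cg) gr.
pose r1 := `|r| + 1; have r10 : 0 <= r1 by rewrite addr_ge0.
have bi (h : 'rV[R]_n -> R) (b : R) : measurable_fun [set: _] h -> (forall x, `|h x| <= b) ->
    (forall x, r1 < `|x| -> h x = 0) -> intb h.
  move=> mh hb h0; have h1 : h = (fun x => \1_(cube 0 r1) x * h x).
    apply/funext => x; rewrite indicE; have [xr|xr] := leP `|x| r1.
      by rewrite mem_set ?mul1r//= /cube/= subr0.
    by rewrite h0// mulr0.
  by rewrite h1; apply: (intb_mul_bounded _ mh hb); exact: intb_cube.
have mp : measurable_fun [set: _] (partial i g).
  by apply: (continuous_measurable_rV openT) => x _; exact: pg.
have mg := C1_measurable cg.
have i1 : intb (partial i g).
  by apply: bi hB _ => // x xr; apply: po; rewrite (le_lt_trans _ xr)// (le_trans (ler_norm _))// lerDl.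
apply/eqP; rewrite -normr_le0; apply/ler_addgt0Pr => e e0; rewrite add0r.
pose M := (2 * r1) ^+ n + 1; have M0 : 0 < M by rewrite ltr_wpDl// exprn_ge0// mulr_ge0.
have [d d0 hd] := @compact_unif_continuous R n (cube 0 r1) (partial i g) (e / M)
  (@cube_compact _ _ _ _) (divr_gt0 e0 M0) (fun x _ => pg i x).
pose t := Num.min d 1; have t0 : 0 < t by rewrite lt_min d0 ltr01.
have td : t <= d by rewrite ge_min lexx. have t1 : t <= 1 by rewrite ge_min lexx orbT.
pose v := t *: delta_mx ord0 i : 'rV[R]_n.
have nv : `|v| <= t.
  apply/rV_norm_leP => [|j]; first exact: ltW.
  rewrite !mxE eqxx/=; case: (j == i); rewrite ?mulr1 ?mulr0 ?normr0 ?(ltW t0)//.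
  by rewrite gtr0_norm.
have out x : r1 < `|x| -> g (x + v) = 0.
  move=> xr; apply: gr; have := ler_normD (x + v) (- v); rewrite addrK normrN => h.
  rewrite (le_lt_trans (ler_norm r))// -(ltrD2r 1) (lt_le_trans xr)// (le_trans h)// lerD2l.
  exact: le_trans nv t1.
have i2 : intb (fun x => g (x + v)).
  apply: bi (fun x => hB' (x + v)) _; first exact: measurable_funrV_shift.
  by move=> x /out.
have gr1 x : r1 < `|x| -> g x = 0.
  by move=> xr; apply: gr; rewrite (le_lt_trans _ xr)// (le_trans (ler_norm _))// lerDl.
have i3 : intb g by exact: bi hB' gr1.
have E : \int[mu]_x partial i g x = \int[mu]_x (partial i g x - t^-1 * (g (x + v) - g x)).
  rewrite RintegralB//; last by apply: intbZ; exact: intbB.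
  rewrite RintegralZl//; last exact: intbB.
  by rewrite RintegralB// (Rintegral_rV_shift v)// subrr mulr0 subr0.
rewrite E.
have i4 : intb (fun x => partial i g x - t^-1 * (g (x + v) - g x)).
  by apply: intbB => //; apply: intbZ; exact: intbB.
rewrite (le_trans (le_normr_Rintegral _ i4))//.
apply: (@le_trans _ _ (\int[mu]_x (e / M * \1_(cube 0 r1) x))).
  apply: le_Rintegral => //.
  - exact: (intb_norm i4).
  - by apply: intbZ; exact: intb_cube.
  - move=> x _; rewrite indicE; have [xr|xr] := leP `|x| r1; last first.
      rewrite memNset/=; last by rewrite /cube/= subr0 leNgt xr.
      by rewrite po ?out ?gr1// ?subrr ?mulr0 ?subrr ?normr0// (le_lt_trans _ xr)// (le_trans (ler_norm _))// lerDl.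
    rewrite mem_set ?mulr1/=; last by rewrite /cube/= subr0.
    have [s _|c /andP[c0 c1] ->] := @mvt_line _ _ g x v; first exact: dg.
    rewrite /v dotvZl dotv_delta mxE mulKf ?gt_eqF// distrC.
    apply: hd; first by rewrite /cube/= subr0.
    by rewrite -/v normrZ ger0_norm// (le_trans _ td)// (le_trans _ nv)// ler_piMl.
rewrite RintegralZl//; last exact: intb_cube.
rewrite Rint_cube//.
by rewrite mulrAC -mulrA ler_piMr ?(ltW e0)// ler_pdivrMr// mul1r lerDl.
Qed.

End convolution.

(** * Inequalities between real powers *)

Section powers.
Context {R : realType}.
Implicit Types (a b p r : R).

Lemma powR_mono a b r : 0 <= r -> 0 <= a -> a <= b -> a `^ r <= b `^ r.
Proof.
by move=> r0 a0 ab; apply: ge0_ler_powR => //; rewrite nnegrE// (le_trans a0).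
Qed.

Lemma powR_add_le a b p : 0 <= p -> 0 <= a -> 0 <= b ->
  (a + b) `^ p <= 2 `^ p * (a `^ p + b `^ p).
Proof.
move=> p0 a0 b0; wlog ab : a b a0 b0 / a <= b.
  move=> h; have [ab|/ltW ba] := leP a b; first exact: h.
  by rewrite addrC [X in _ * X]addrC; exact: h.
apply: (@le_trans _ _ ((2 * b) `^ p)).
  by apply: powR_mono; rewrite ?addr_ge0//; lra.
by rewrite powRM// ler_wpM2l ?powR_ge0// lerDr powR_ge0.
Qed.

Lemma powR_superadd a b p : 1 <= p -> 0 <= a -> 0 <= b ->
  a `^ p + b `^ p <= (a + b) `^ p.
Proof.
move=> p1 a0 b0; have p0 : 0 < p by exact: lt_le_trans p1.
rewrite -[leRHS]mulr_powRB1 ?addr_ge0// mulrDl -(mulr_powRB1 a0 p0) -(mulr_powRB1 b0 p0).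
apply: lerD; apply: ler_wpM2l => //; apply: powR_mono; rewrite ?subr_ge0// ?lerDl ?lerDr//.
Qed.

Definition spow p a := Num.sg a * `|a| `^ p.

Lemma spow_norm p a : p != 0 -> `|spow p a| = `|a| `^ p.
Proof.
move=> p0; rewrite /spow normrM normr_sg (ger0_norm (powR_ge0 _ _)).
by have [->|a0] := eqVneq a 0; rewrite ?normr0 ?powR0 ?mulr0 ?mul1r.
Qed.

Lemma spowN p a : spow p (- a) = - spow p a.
Proof. by rewrite /spow sgrN normrN mulNr. Qed.

(** This converts continuity of translations in L^1 into continuity in L^p, since [spow p] maps L^p
    to L^1. By symmetry [b <= a] and [0 <= a]; the sign of [b] then decides between superadditivity
    and doubling. *)
Lemma spow_dist p a b : 1 <= p -> `|a - b| `^ p <= 2 `^ p * `|spow p a - spow p b|.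
Proof.
move=> p1; have p0 : 0 <= p by exact: le_trans p1.
have pn : p != 0 by rewrite gt_eqF// (lt_le_trans _ p1).
have two1 : 1 <= 2 `^ p by rewrite -[X in X <= _](powRr0 2) ler_powR// ler1n.
wlog ab : a b / b <= a.
  move=> h; have [/h//|/ltW/h] := leP b a.
  by rewrite distrC [X in _ * X]distrC.
wlog a0 : a b ab / 0 <= a.
  move=> h; have [/(h _ _ ab)//|/ltW a0] := leP 0 a.
  have /h : - a <= - b by rewrite lerN2.
  rewrite oppr_ge0 (le_trans ab a0) => /(_ isT).
  by rewrite !spowN !opprK ![- _ + _]addrC distrC [X in _ * X]distrC.
have [b0|b0] := leP 0 b.
  have E c : 0 <= c -> spow p c = c `^ p.
    rewrite /spow le_eqVlt => /predU1P[<-|c0]; first by rewrite sgr0 mul0r powR0.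
    by rewrite gtr0_sg// mul1r gtr0_norm.
  rewrite !E// !ger0_norm ?subr_ge0//; last exact: powR_mono.
  apply: (@le_trans _ _ (a `^ p - b `^ p)).
    by rewrite lerBrDr -[in leRHS](subrK b a) powR_superadd// subr_ge0.
  by rewrite ler_peMl// subr_ge0 powR_mono.
have sa : 0 <= spow p a by rewrite /spow mulr_ge0 ?powR_ge0// sgr_ge0.
have sb : spow p b = - (- b) `^ p by rewrite /spow ltr0_sg// mulN1r ltr0_norm.
have sb' : `|spow p a - spow p b| = `|a| `^ p + (- b) `^ p.
  by rewrite sb opprK ger0_norm ?addr_ge0 ?powR_ge0// -spow_norm// ger0_norm.
rewrite sb' ger0_norm ?subr_ge0// (ger0_norm a0).
by apply: powR_add_le => //; rewrite oppr_ge0 ltW.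
Qed.

(** Either [b <= d * a], and the first term suffices, or [a < b / d], and the second does; no
    conjugate exponent appears. *)
Lemma young_powR p (d : R) : 1 < p -> 0 < d -> exists2 C, 0 <= C &
  forall a b, 0 <= a -> 0 <= b -> a `^ (p - 1) * b <= d * a `^ p + C * b `^ p.
Proof.
move=> p1 d0; have p0 : 0 < p by exact: lt_trans p1.
exists (d^-1 `^ (p - 1)) => [|a b a0 b0]; first exact: powR_ge0.
have [bd|bd] := leP b (d * a).
  apply: (@le_trans _ _ (d * a `^ p)); last by rewrite lerDl mulr_ge0 ?powR_ge0.
  by rewrite -(mulr_powRB1 a0 p0) mulrA [leRHS]mulrC ler_wpM2l ?powR_ge0.
apply: (@le_trans _ _ (d^-1 `^ (p - 1) * b `^ p)); last by rewrite lerDr mulr_ge0 ?powR_ge0// ltW.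
rewrite -(mulr_powRB1 b0 p0) mulrCA [leRHS]mulrC ler_wpM2r//.
rewrite -powRM ?invr_ge0 ?(ltW d0)//; apply: powR_mono => //; first by rewrite subr_ge0 ltW.
by rewrite -ler_pdivrMl ?invr_gt0// invrK ltW.
Qed.

End powers.

(** * Approximation of Sobolev functions and test functions *)

Section sobolev_approximation.
Context {R : realType}.
Variable n : nat.
Local Notation mu := (@lebesgue_rV R n).
Implicit Types (f u : 'rV[R]_n -> R) (G : 'rV[R]_n -> 'rV[R]_n) (K U : set 'rV[R]_n).

Lemma measurable_powR_fun d (T : measurableType d) (f : T -> R) (r : R) :
  measurable_fun [set: T] f -> measurable_fun [set: T] (fun x => f x `^ r).
Proof. by move=> mf; apply: (measurableT_comp (measurable_powR r)). Qed.

Lemma rV_coordB (x y : 'rV[R]_n) i : (x - y) ord0 i = x ord0 i - y ord0 i.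
Proof. by rewrite !mxE. Qed.

Lemma shift_Lp f (p r e : R) : 1 <= p -> 0 < e -> measurable_fun [set: _] f ->
  intb (fun x => `|f x| `^ p) -> exists2 d, 0 < d & forall y, `|y| <= d ->
    (\int[mu]_(x in cube 0 r) (`|f (x + y)%R - f x| `^ p)%:E <= e%:E)%E.
Proof.
move=> p1 e0 mf fp; have p0 : p != 0 by rewrite gt_eqF// (lt_le_trans _ p1).
have msp : measurable_fun [set: R] (spow p).
  apply: measurable_funM; last by apply: measurable_powR_fun; exact: normr_measurable.
  apply: measurable_fun_ifT => //.
    by apply: measurable_fun_eqr.
  by apply: measurable_fun_ifT => //; apply: measurable_fun_ltr.
have sf : shiftc (fun x => spow p (f x)).
  apply: shiftc_integrable; apply: (intb_le _ fp).
    exact: (measurableT_comp msp).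
  by move=> x; rewrite spow_norm.
have t0 : 0 < 2 `^ p by rewrite powR_gt0.
have [d d0 hd] := sf r _ (divr_gt0 e0 t0); exists d => // y yd.
have mfy : measurable_fun [set: _] (fun x : 'rV[R]_n => f (x + y)) by exact: measurable_funrV_shift.
have mc := @measurable_cube R n 0 r.
apply: (@le_trans _ _ (\int[mu]_(x in cube 0 r) ((2 `^ p)%:E * `|spow p (f (x + y)%R) - spow p (f x)|%:E))%E).
  apply: ge0_le_integral => //.
  - apply/measurable_funTS/measurable_EFinP; apply: measurable_powR_fun.
    by apply: measurableT_comp => //; exact: measurable_funB.
  - apply/measurable_funTS/emeasurable_funM => //; apply/measurable_EFinP.
    apply: measurableT_comp => //; apply: measurable_funB; exact: (measurableT_comp msp).
  - by move=> x _; rewrite -EFinM lee_fin spow_dist.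
rewrite ge0_integralZl//; last first.
  apply/measurable_funTS/measurable_EFinP.
  by apply: measurableT_comp => //; apply: measurable_funB; exact: (measurableT_comp msp).
apply: (@le_trans _ _ ((2 `^ p)%:E * (e / 2 `^ p)%:E)%E).
  by apply: lee_wpmul2l; [rewrite lee_fin ltW|exact: hd].
by rewrite -EFinM mulrC divfK// gt_eqF.
Qed.

Lemma compact_thicken K U : compact K -> open U -> K `<=` U ->
  exists2 d, 0 < d & exists K0, [/\ compact K0, K0 `<=` U &
    forall x, K x -> cube x d `<=` K0].
Proof.
move=> cK oU KU; have [d d0 hd] := compact_nbhd cK oU KU.
exists d => //; exists ((fun z : 'rV[R]_n * 'rV[R]_n => z.1 + z.2) @` (K `*` cube 0 d)); split.
- apply: continuous_compact; last by apply: compact_setX => //; exact: cube_compact.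
  by apply: continuous_subspaceT => z; exact: add_continuous.
- by move=> _ [[x y] /= [Kx yd] <-]; apply: hd => //; move: yd; rewrite /cube/= subr0.
- move=> x Kx y xy; exists (x, y - x); last by rewrite /= addrC subrK.
  by split => //=; rewrite /cube/= subr0.
Qed.

(** A weak gradient is controlled on compact subsets of [U] only; cut off by 0 it becomes measurable
    with integrable [p]-th power on the whole space. *)
Definition restr (K : set 'rV[R]_n) G x : 'rV[R]_n := if x \in K then G x else 0.

Lemma restrE K G x i : (restr K G x) ord0 i = ((fun x => G x ord0 i) \_ K) x.
Proof. by rewrite /restr patchE; case: ifP => // _; rewrite mxE. Qed.

Lemma Lp_loc_restr (p : R) U G K : 1 <= p -> (forall i, Lp_loc p U (fun x => G x ord0 i)) ->
  compact K -> K `<=` U ->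
  measurable_fun [set: _] (restr K G) /\ intb (fun x => `|restr K G x| `^ p).
Proof.
move=> p1 hG cK KU; have p0 : 0 <= p by exact: le_trans p1.
have hi i := hG i K cK KU.
have mi i : measurable_fun [set: _] ((fun x => G x ord0 i) \_ K).
  by have /andP[+ _] := hi i; rewrite inE.
have mG : measurable_fun [set: _] (restr K G).
  by apply/measurable_fun_rVP => i; under eq_fun do rewrite restrE; exact: mi.
split => //.
have ii i : intb (fun x => `|((fun x => G x ord0 i) \_ K) x| `^ p) by exact: Lfun_integrable.
apply: (intb_le _ (intb_sum (index_enum 'I_n) ii)).
  by apply: measurable_powR_fun; exact: measurable_fun_normrV.
move=> x; rewrite ger0_norm ?powR_ge0//.
have s0 i : 0 <= `|((fun x => G x ord0 i) \_ K) x| `^ p by exact: powR_ge0.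
have [->|Gx] := eqVneq (restr K G x) 0.
  by rewrite normr0 powR0 ?sumr_ge0// gt_eqF// (lt_le_trans ltr01).
have [i hi'] : exists i, `|restr K G x| = `|restr K G x ord0 i|.
  have /mx_norm_neq0[[a i] /= E] : mx_norm (restr K G x) != 0 by move: Gx; rewrite -normr_eq0.
  by exists i; move: E; rewrite (ord1 a).
rewrite hi' restrE (bigD1 i)//= lerDl; exact: sumr_ge0.
Qed.

(* The flux is at most a constant times [wgt p G], so approximation in [L^1] with
   this weight suffices to pass to the limit in the equation. *)
Definition wgt (p : R) G x := (1 + `|G x|) `^ (p - 1).

(** Uniform closeness of the values is available because [u] is continuous. It controls [Phi] and
    [Phi'] along the approximants pointwise, so that only gradients need an integral norm. *)
Definition sapprox K (w : 'rV[R]_n -> R) u G := forall e, 0 < e -> exists v,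
  [/\ C1 v, forall x, K x -> `|v x - u x| <= e &
   (\int[mu]_(x in K) (w x * `|grad v x - G x|)%:E <= e%:E)%E].

Lemma Ck_shift k f x : Ck k f -> Ck k (fun y => f (y - x)).
Proof.
have P y g : differentiable g (y - x) ->
    differentiable (fun y => g (y - x)) y /\ grad (fun y => g (y - x)) y = grad g (y - x).
  move=> dg; apply: differentiable_epsP => e e0.
  have [d d0 hd] := differentiable_eps dg e0; exists d => // v vd.
  by rewrite (addrAC y); exact: hd.
elim: k f => [|k IH] f cf.
  move=> y; apply/continuous_epsP => e e0; have /continuous_epsP/(_ e e0)[d d0 hd] := cf (y - x).
  by exists d => // z zd; rewrite addrAC; exact: hd.
case: cf => df pf; split=> [y|i]; first exact: (P _ _ (df _)).1.
rewrite (_ : partial i _ = (fun y => partial i f (y - x))); first exact: (IH _ (pf i)).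
apply/funext => y; have [_ /(congr1 (fun M : 'rV[R]_n => M ord0 i))] := P y _ (df _).
by rewrite !mxE.
Qed.

Lemma partial_shift f x i y : C1 f ->
  partial i (fun z => f (z - x)) y = partial i f (y - x).
Proof.
move=> [df _].
have [_ /(congr1 (fun M : 'rV[R]_n => M ord0 i))] : differentiable (fun y => f (y - x)) y /\ grad (fun y => f (y - x)) y = grad f (y - x).
  apply: differentiable_epsP => e e0.
  have [d d0 hd] := differentiable_eps (df (y - x)) e0; exists d => // v vd.
  by rewrite (addrAC y); exact: hd.
by rewrite !mxE.
Qed.

Lemma test_functionW U (K0 : set 'rV[R]_n) phi : compact K0 -> K0 `<=` U ->
  (forall k, Ck k phi) -> (forall x, ~ K0 x -> phi x = 0) -> test_function U phi.
Proof.
move=> cK KU cp p0.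
have clK : closed K0 by apply: compact_closed => //; exact: norm_hausdorff.
have sub : closure [set x | phi x != 0] `<=` K0.
  rewrite [X in _ `<=` X]((closure_id _).1 clK); apply: closureS => x /= px.
  by apply: contrapT => /p0 h; rewrite h eqxx in px.
split=> //; last exact: subset_trans KU.
by apply: (subclosed_compact _ cK) => //; exact: closed_closure.
Qed.

(** Mollification of [u] cut off to [K0]. On [K] its gradient is the mollification of [G], by the
    definition of weak gradients. Young's inequality separates the weight, leaving [(1 + |G|)^p]
    with a small factor and a translation distance in L^p. *)
Lemma sobolev_approx (p : R) U u G K : 1 < p -> open U ->
  (forall x, U x -> {for x, continuous u}) -> W1p_loc p U u G ->
  compact K -> K `<=` U ->
  exists2 d, 0 < d & exists K0, [/\ compact K0, K0 `<=` U, forall x, K x -> cube x d `<=` K0 &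
    sapprox K (wgt p (restr K0 G)) u (restr K0 G)].
Proof.
move=> p1 oU cu [Lu LG wG] cK KU; have p1' := ltW p1.
have [d d0 [K0 [cK0 K0U KK0]]] := compact_thicken cK oU KU.
exists d => //; exists K0; split => //; set G0 := restr K0 G.
have [mG0 iG0] := Lp_loc_restr p1' LG cK0 K0U.
have mK := compact_measurable_rV cK.
have mK0 := compact_measurable_rV cK0.
have iu0 : intb (u \_ K0).
  have iL := Lfun_integrable p1' (Lu K0 cK0 K0U).
  have mu0 : measurable_fun [set: _] (u \_ K0).
    by have /andP[+ _] := Lu K0 cK0 K0U; rewrite inE.
  have [r r0 hr] := compact_sub_cube cK0.
  apply: (intb_le mu0 (intbD (intb_cube 0 r) iL)) => x.
  rewrite patchE; case: ifPn => [|_]; last by rewrite normr0 addr_ge0// powR_ge0.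
  move=> /set_mem xK; rewrite indicE mem_set/=; last exact: hr.
  have [x1|x1] := leP `|u x| 1; first by rewrite (le_trans x1)// lerDl powR_ge0.
  rewrite (@le_trans _ _ (`|u x| `^ p))// ?lerDr//.
  by rewrite -[leLHS]powRr1// ler_powR// ltW.
move=> e e0.
have [du du0 hdu] := compact_unif_continuous cK e0 (fun x Kx => cu x (KU x Kx)).
pose q := p - 1; have q0 : 0 < q by rewrite subr_gt0.
pose I := \int[mu]_x ((1 + `|restr K0 G x|) `^ p * \1_K x).
have iI : intb (fun x => (1 + `|G0 x|) `^ p * \1_K x).
  have [r r0 hr] := compact_sub_cube cK.
  apply: (intb_le _ (intbZ (2 `^ p) (intbD (intb_cube 0 r) iG0))).
    apply: measurable_funM; last exact: measurable_indic.
    by apply: measurable_powR_fun; apply: measurable_funD => //; exact: measurable_fun_normrV.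
  move=> x; rewrite ger0_norm ?mulr_ge0 ?powR_ge0// indicE; case: (boolP (x \in K)) => [/set_mem xK|_]; last first.
    by rewrite mulr0 mulr_ge0 ?powR_ge0// addr_ge0 ?powR_ge0.
  rewrite mulr1 indicE mem_set; last exact: hr.
  by rewrite (le_trans (powR_add_le _ _ _))// ?powR1// ltW// (lt_trans _ p1).
have I0 : 0 <= I by apply: Rintegral_ge0 => x _; rewrite mulr_ge0// powR_ge0.
pose N := n%:R + 1 : R; have N0 : 0 < N by rewrite ltr_wpDl.
(* Each of the [n] components may cost [e / N]: one half comes from [dl] times the integral [I], the
   other from Young's constant [C] times the translation term. *)
pose dl := e / (N * 2 * (I + 1)); have dl0 : 0 < dl by rewrite divr_gt0// !mulr_gt0// ltr_wpDl.
have [C C0 hC] := young_powR p1 dl0.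
have [r r0 hr] := compact_sub_cube cK.
have /choice[ds hds] (i : 'I_n) : exists ds : R, 0 < ds /\ forall y, `|y| <= ds ->
    (\int[mu]_(x in cube 0 r) (`|G0 (x + y)%R ord0 i - G0 x ord0 i| `^ p)%:E <= (e / (N * 2 * (C + 1)))%:E)%E.
  have mi : measurable_fun [set: _] (fun x => G0 x ord0 i) by move/measurable_fun_rVP : mG0.
  have [||ds ds0 h] := @shift_Lp (fun x => G0 x ord0 i) p r (e / (N * 2 * (C + 1))) p1' _ mi.
  - by rewrite divr_gt0// !mulr_gt0// ltr_wpDl.
  - apply: (intb_le _ iG0); first by apply: measurable_powR_fun; exact: measurableT_comp.
    move=> x; rewrite ger0_norm ?powR_ge0//; apply: powR_mono => //; first exact: le_trans p1'.
    exact: rV_coord_le.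
  - by exists ds.
pose ep := Num.min d (Num.min du (\big[Num.min/1]_i ds i)).
have ep0 : 0 < ep.
  rewrite !lt_min d0 du0/=; apply/bigmin_gtP; split => // i _; exact: (hds i).1.
have epd : ep <= d by rewrite ge_min lexx.
have epu : ep <= du by rewrite !ge_min lexx orbT.
have eps i : ep <= ds i.
  by rewrite /ep !ge_min (bigmin_le_cond _ (fun i => ds i)) ?orbT.
have [rho [ck r0' r1 rI]] := @exists_mollifier R n ep ep0.
have cr : Cc ep rho by split => // x /ltW; exact: r1.
pose u0 : 'rV[R]_n -> R := u \_ K0.
pose g i : 'rV[R]_n -> R := (fun x => G x ord0 i) \_ K0.
have gE' i x : g i x = if x \in K0 then G x ord0 i else 0 by rewrite /g patchE.
have u0E x : u0 x = if x \in K0 then u x else 0 by rewrite /u0 patchE.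
have G0g x i : G0 x ord0 i = g i x by rewrite /G0 restrE.
exists (mconv u0 rho); split.
- exact: mconv_Ck iu0 cr.
- move=> x Kx; have uE y : cube x d y -> u0 y = u y.
    by move=> xy; rewrite u0E mem_set//; exact: (KK0 x Kx).
  rewrite -(uE x); last by rewrite /cube/= subrr normr0 ltW.
  apply: (mconv_near iu0 cr) => // y ye; rewrite -/u0 !uE.
  + by apply: hdu => //; exact: le_trans epu.
  + by rewrite /cube/= subrr normr0 ltW.
  + by rewrite /cube/= addrAC subrr add0r (le_trans ye).
have gE x i : K x -> grad (mconv u0 rho) x ord0 i = mconv (g i) rho x.
  move=> Kx; have [_ ->] := mconv_grad x iu0 cr; rewrite mxE.
  (* As a function of [y], the kernel centred at a point [x] of [K] is an admissible test function,
     since its support lies in [cube x d] and hence in [K0]. *)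
  pose phi y := rho (y - x).
  have out y : ~ K0 y -> ep < `|y - x|.
    move=> nK; rewrite ltNge; apply/negP => h; apply: nK; apply: (KK0 x Kx).
    by rewrite /cube/= (le_trans h).
  have tphi : test_function U phi.
    apply: (test_functionW cK0) => // [k|y /out h]; first exact: Ck_shift.
    by rewrite /phi cr.2.
  have := wG phi tphi i; rewrite /mconv => E.
  have -> : \int[mu]_y ((g i) y * rho (y - x)) = \int[mu]_(y in U) (G y ord0 i * phi y).
    rewrite [RHS]Rintegral_mkcond; apply: eq_Rintegral => y _; rewrite patchE ?gE' ?u0E.
    case: ifPn => [/set_mem yK|/negP yK]; first by rewrite mem_set//; exact: K0U.
    rewrite mul0r; case: ifP => // _; rewrite /phi cr.2 ?mulr0//; apply: out => h; exact/yK/mem_set.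
  suff -> : \int[mu]_y ((u \_ K0) y * partial i rho (y - x)) =
      \int[mu]_(y in U) (u y * partial i phi y) by rewrite E opprK.
  rewrite [RHS]Rintegral_mkcond; apply: eq_Rintegral => y _; rewrite -/(u0 y) u0E [RHS]patchE.
  case: ifPn => [/set_mem yK|/negP yK].
    by rewrite mem_set ?partial_shift//; [exact: Cc_C1 cr|exact: K0U].
  rewrite mul0r; case: ifP => // _; rewrite partial_shift; last exact: Cc_C1 cr.
  by rewrite (Cc_partial i cr).2 ?mulr0//; apply: out => h; exact/yK/mem_set.
have w0 x : 0 <= wgt p G0 x by exact: powR_ge0.
have mw : measurable_fun [set: _] (wgt p G0).
  by apply: measurable_powR_fun; apply: measurable_funD => //; exact: measurable_fun_normrV.
have iG i : intb (g i).
  have iL := Lfun_integrable p1' (LG i K0 cK0 K0U).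
  have mu0 : measurable_fun [set: _] (g i).
    by have /andP[+ _] := LG i K0 cK0 K0U; rewrite inE.
  have [s s0 hs] := compact_sub_cube cK0.
  apply: (intb_le mu0 (intbD (intb_cube 0 s) iL)) => x.
  rewrite gE'; case: ifPn => [|_]; last by rewrite normr0 addr_ge0// powR_ge0.
  move=> /set_mem xK; rewrite indicE mem_set/=; last exact: hs.
  have [x1|x1] := leP `|G x ord0 i| 1; first by rewrite (le_trans x1)// lerDl powR_ge0.
  rewrite (@le_trans _ _ (`|G x ord0 i| `^ p))//; last by rewrite -/(g i x) gE' mem_set// lerDr.
  by rewrite -[leLHS]powRr1// ler_powR// ltW.
have mcv i : measurable_fun [set: _] (mconv (g i) rho).
  by apply: C1_measurable; exact: mconv_Ck (iG i) cr.
have key i : (\int[mu]_(x in K) (wgt p G0 x * `|mconv (g i) rho x - (g i) x|)%:E <= (e / N)%:E)%E.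
  apply: (mconv_L1 (iG i) cr) => // y ye.
  have mgi : measurable_fun [set: _] (g i) by exact: intb_measurable (iG i).
  have mgy : measurable_fun [set: _] (fun x : 'rV[R]_n => (g i) (x + y)) by exact: measurable_funrV_shift.
  set k := fun x : 'rV[R]_n => `|(g i) (x + y) - (g i) x|.
  have mk : measurable_fun [set: 'rV[R]_n] k by apply: measurableT_comp => //; exact: measurable_funB.
  apply: (@le_trans _ _ (\int[mu]_(x in K) ((dl * (1 + `|G0 x|) `^ p)%:E + (C * k x `^ p)%:E))%E).
    apply: ge0_le_integral => //.
    - by move=> x _; rewrite lee_fin mulr_ge0.
    - by apply/measurable_funTS/measurable_EFinP; exact: measurable_funM.
    - apply/measurable_funTS/emeasurable_funD; apply/measurable_EFinP; apply: measurable_funM => //.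
        by apply: measurable_powR_fun; apply: measurable_funD => //; exact: measurable_fun_normrV.
      exact: measurable_powR_fun.
    - by move=> x _; rewrite -EFinD lee_fin hC// addr_ge0.
  rewrite ge0_integralD//; last 4 first.
  - by move=> x _; rewrite lee_fin mulr_ge0 ?powR_ge0// ltW.
  - apply/measurable_funTS/measurable_EFinP; apply: measurable_funM => //.
    by apply: measurable_powR_fun; apply: measurable_funD => //; exact: measurable_fun_normrV.
  - by move=> x _; rewrite lee_fin mulr_ge0 ?powR_ge0.
  - by apply/measurable_funTS/measurable_EFinP; apply: measurable_funM => //; exact: measurable_powR_fun.
  have -> : (e / N)%:E = ((e / (N * 2))%:E + (e / (N * 2))%:E)%E.
    by rewrite -EFinD; congr EFin; field; rewrite gt_eqF.
  apply: leeD.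
    have -> : (\int[mu]_(x in K) (dl * (1 + `|G0 x|) `^ p)%:E = (dl * I)%:E)%E.
      rewrite integral_mkcond /I -RintegralZl//.
      rewrite /Rintegral fineK; last by apply: integrable_fin_num => //; exact: intbZ.
      apply: eq_integral => x _; rewrite patchE indicE.
      by case: ifP => _; rewrite ?mulr1 ?mulr0.
    rewrite lee_fin /dl (_ : e / _ * I = e / (N * 2) * (I / (I + 1))); last first.
      by field; rewrite !gt_eqF// ltr_wpDl.
    rewrite ler_piMr// ?divr_ge0 ?mulr_ge0 ?(ltW e0) ?(ltW N0)//.
    by rewrite ler_pdivrMr ?ltr_wpDl// mul1r lerDl.
  under eq_integral do rewrite EFinM.
  rewrite ge0_integralZl//; last 2 first.
  - by apply/measurable_funTS/measurable_EFinP; exact: measurable_powR_fun.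
  - by move=> x _; rewrite lee_fin powR_ge0.
  apply: (@le_trans _ _ (C%:E * (e / (N * 2 * (C + 1)))%:E)%E).
    apply: lee_wpmul2l; first by rewrite lee_fin.
    apply: le_trans ((hds i).2 y (le_trans ye (eps i))).
    rewrite (eq_integral (fun x : 'rV[R]_n => (`|G0 (x + y)%R ord0 i - G0 x ord0 i| `^ p)%:E)); last first.
      by move=> x _; rewrite /k !G0g.
    apply: ge0_subset_integral => //; first exact: measurable_cube.
    apply/measurable_funTS/measurable_EFinP; apply: measurable_powR_fun; apply: measurableT_comp => //.
    by apply: measurable_funB; under eq_fun do rewrite G0g.
  rewrite -EFinM lee_fin (_ : C * _ = e / (N * 2) * (C / (C + 1))); last first.
    by field; rewrite !gt_eqF// ltr_wpDl.
  rewrite ler_piMr// ?divr_ge0 ?mulr_ge0 ?(ltW e0) ?(ltW N0)//.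
  by rewrite ler_pdivrMr ?ltr_wpDl// mul1r lerDl.
have mterm i : measurable_fun [set: 'rV[R]_n] (fun x => (wgt p G0 x * `|mconv (g i) rho x - (g i) x|)%:E).
  apply/measurable_EFinP; apply: measurable_funM => //; apply: measurableT_comp => //.
  by apply: measurable_funB => //; exact: intb_measurable (iG i).
apply: (@le_trans _ _ (\int[mu]_(x in K) (\sum_i (wgt p G0 x * `|mconv (g i) rho x - (g i) x|)%:E))%E).
  apply: ge0_le_integral => //.
  - by move=> x _; rewrite lee_fin mulr_ge0.
  - apply/measurable_funTS/measurable_EFinP; apply: measurable_funM => //; apply: measurable_fun_normrV.
    apply/measurable_fun_rVP => i; under eq_fun do rewrite rV_coordB.
    have cv := @mconv_Ck R n _ _ _ 1 iu0 cr.
    have /measurable_fun_rVP/(_ i) m1 := C1_measurable_grad cv.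
    by apply: measurable_funB => //; move/measurable_fun_rVP : mG0.
  - by apply/measurable_funTS; apply: emeasurable_sum => i; exact: mterm.
  - move=> x Kx; rewrite sumEFin lee_fin -mulr_sumr ler_wpM2l//.
    apply/rV_norm_leP => [|i]; first by apply: sumr_ge0.
    rewrite rV_coordB gE// G0g (bigD1 i)//= lerDl; exact: sumr_ge0.
rewrite ge0_integral_sum//; last 2 first.
- by move=> i; apply/measurable_funTS; exact: mterm.
- by move=> i x _; rewrite lee_fin mulr_ge0.
apply: (@le_trans _ _ (\sum_(i < n) (e / N)%:E)%E); first by apply: lee_sum => i _; exact: key.
rewrite sumEFin lee_fin sumr_const card_ord -mulr_natr mulrAC -mulrA.
by rewrite ler_piMr ?(ltW e0)// ler_pdivrMr// mul1r lerDl.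
Qed.

End sobolev_approximation.

(** * Functions of class C^1 on an open set *)

Section C1on.
Context {R : realType}.
Variable n : nat.
Implicit Types (f g : 'rV[R]_n -> R) (U K : set 'rV[R]_n).

Lemma near_eq_cont (V W : normedModType R) (F G : V -> W) x : {near x, F =1 G} ->
  {for x, continuous F} -> {for x, continuous G}.
Proof.
move=> FG cF; have FGx := nbhs_singleton FG.
have h : G @ x --> F x by apply: cvg_trans cF; exact: near_eq_cvg.
by rewrite FGx in h.
Qed.

(** Local to [U] because the radial solutions are singular at the origin, whereas [Ck] speaks of the
    whole space. *)
Definition C1on U f := forall x, U x -> differentiable f x /\ {for x, continuous (grad f)}.

Lemma C1onT f : C1on setT f <-> C1 f.
Proof.
split=> [h|cf x _].
  apply/C1P; split=> [x|i x]; first exact: (h x I).1.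
  exact: (continuous_gradP f x).2 (h x I).2 i.
by split; [exact: C1_diff|exact: C1_grad_continuous].
Qed.

Lemma C1onW U V f : V `<=` U -> C1on U f -> C1on V f.
Proof. by move=> VU h x /VU; exact: h. Qed.

Lemma C1on_cont U f x : C1on U f -> U x -> {for x, continuous f}.
Proof. by move=> h /h[df _]; exact: differentiable_continuous. Qed.

Lemma near_grad f g (x : 'rV[R]_n) : {near x, f =1 g} -> (\forall y \near x, differentiable f y) ->
  {near x, grad f =1 grad g}.
Proof.
move=> /near_join fg; apply: filterS2 fg => y fg df.
by have [_ ->] := near_eq_differentiable fg df.
Qed.

Lemma C1on_near f g x U : open U -> U x -> C1on U f -> {near x, f =1 g} ->
  differentiable g x /\ {for x, continuous (grad g)}.
Proof.
move=> oU Ux cf fg; have [dfx gfx] := cf x Ux.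
split; first exact: (near_eq_differentiable fg dfx).1.
apply: near_eq_cont gfx; apply: near_grad => //.
by have : nbhs x U by [exact: open_nbhs_nbhs]; apply: filterS => y /cf[].
Qed.

Lemma C1on_eq U f g : open U -> (forall x, U x -> f x = g x) -> C1on U f -> C1on U g.
Proof.
move=> oU fg cf x Ux; apply: (C1on_near oU Ux cf).
by have : nbhs x U by [exact: open_nbhs_nbhs]; apply: filterS => y /fg.
Qed.

Lemma C1onM U f g : open U -> C1on U f -> C1on U g -> C1on U (f \* g).
Proof.
move=> oU cf cg x Ux; have [df gf] := cf x Ux; have [dg gg] := cg x Ux.
split; first exact: differentiableM.
have c : {for x, continuous (fun y => f y *: grad g y + g y *: grad f y)}.
  exact: (cvgD (cvgZ (differentiable_continuous df) gg) (cvgZ (differentiable_continuous dg) gf)).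
apply: near_eq_cont c; have : nbhs x U by exact: open_nbhs_nbhs.
by apply: filterS => y Uy; rewrite gradM//; [exact: (cf y Uy).1|exact: (cg y Uy).1].
Qed.

Lemma C1onD U f g : open U -> C1on U f -> C1on U g -> C1on U (f \+ g).
Proof.
move=> oU cf cg x Ux; have [df gf] := cf x Ux; have [dg gg] := cg x Ux.
split; first exact: differentiableD.
have c : {for x, continuous (fun y => grad f y + grad g y)} by exact: cvgD gf gg.
apply: near_eq_cont c; have : nbhs x U by exact: open_nbhs_nbhs.
by apply: filterS => y Uy; rewrite gradD//; [exact: (cf y Uy).1|exact: (cg y Uy).1].
Qed.

Lemma C1onB U f g : open U -> C1on U f -> C1on U g -> C1on U (f \- g).
Proof.
move=> oU cf cg x Ux; have [df gf] := cf x Ux; have [dg gg] := cg x Ux.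
split; first exact: differentiableB.
have c : {for x, continuous (fun y => grad f y - grad g y)} by exact: cvgB gf gg.
apply: near_eq_cont c; have : nbhs x U by exact: open_nbhs_nbhs.
by apply: filterS => y Uy; rewrite gradB//; [exact: (cf y Uy).1|exact: (cg y Uy).1].
Qed.

Lemma grad_cst (c : R) x : grad (fun _ : 'rV[R]_n => c) x = 0.
Proof. by apply/rowP => i; rewrite !mxE /partial derive_cst. Qed.

Lemma C1on_cst U (c : R) : C1on U (fun=> c).
Proof.
move=> x _; split; first exact: differentiable_cst.
by rewrite (_ : grad _ = cst 0); [exact: cst_continuous|apply/funext => y; rewrite grad_cst].
Qed.

Lemma C1on_comp U (phi phi' : R -> R) f : open U -> C1on U f ->
  (forall x, U x -> is_derive (f x) (1:R) phi (phi' (f x))) ->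
  (forall x, U x -> {for f x, continuous phi'}) -> C1on U (phi \o f).
Proof.
move=> oU cf dp cp x Ux; have [df gf] := cf x Ux.
have cfx : {for x, continuous f} by exact: differentiable_continuous.
split; first exact: (grad_comp df (dp x Ux)).1.
have c : {for x, continuous (fun y => phi' (f y) *: grad f y)}.
  by apply: continuousZ => //; apply: continuous_comp => //; exact: cp.
apply: near_eq_cont c; have : nbhs x U by exact: open_nbhs_nbhs.
by apply: filterS => y Uy; rewrite (grad_comp (cf y Uy).1 (dp y Uy)).2.
Qed.

Lemma near_zero_out K f x : closed K -> (forall x, ~ K x -> f x = 0) -> ~ K x ->
  {near x, (fun=> 0) =1 f}.
Proof.
move=> cK f0 nKx; have : nbhs x (~` K).
  by apply: open_nbhs_nbhs; split => //; exact: closed_openC.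
by apply: filterS => y /f0.
Qed.

Lemma grad_out K f x : closed K -> (forall x, ~ K x -> f x = 0) -> ~ K x -> grad f x = 0.
Proof.
move=> cK f0 /(near_zero_out cK f0) h.
by have [_ ->] := near_eq_differentiable h (differentiable_cst _ _); rewrite grad_cst.
Qed.

Lemma C1on_glue U K f : open U -> closed K -> K `<=` U -> C1on U f ->
  (forall x, ~ K x -> f x = 0) -> C1 f.
Proof.
move=> oU cK KU cf f0; apply/C1onT => x _.
have [Kx|/(near_zero_out cK f0)] := EM (K x); first exact: cf (KU _ Kx).
exact: (C1on_near openT I (C1on_cst (0:R))).
Qed.

Lemma grad_coord i (x : 'rV[R]_n) : differentiable (fun y : 'rV[R]_n => y ord0 i) x /\
  grad (fun y : 'rV[R]_n => y ord0 i) x = delta_mx ord0 i.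
Proof.
apply: differentiable_epsP => e e0; exists 1 => // v _.
by rewrite mxE (addrAC (x _ _)) subrr add0r dotvC dotv_delta subrr normr0 mulr_ge0// ltW.
Qed.

Lemma C1on_coord U i : C1on U (fun y : 'rV[R]_n => y ord0 i).
Proof.
move=> x _; split; first exact: (grad_coord i x).1.
rewrite (_ : grad _ = cst (delta_mx ord0 i)); first exact: cst_continuous.
by apply/funext => y; rewrite (grad_coord i y).2.
Qed.

End C1on.

(** * The equation tested with C^1 functions *)

Section C1_test.
Context {R : realType}.
Variable n : nat.
Local Notation mu := (@lebesgue_rV R n).
Implicit Types (f g : 'rV[R]_n -> R) (U K : set 'rV[R]_n).

Lemma intb_Cc f r : continuous f -> (forall x, r < `|x| -> f x = 0) -> intb f.
Proof.
move=> cf fr; have [B B0 hB] := bounded_support cf fr.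
apply: (intb_le _ (intbZ B (intb_cube 0 r))).
  by apply: (continuous_measurable_rV openT) => x _; exact: cf.
move=> x; rewrite indicE; have [xr|/fr->] := leP `|x| r.
  by rewrite mem_set ?mulr1// /cube/= subr0.
by rewrite normr0 mulr_ge0.
Qed.

(** Integration by parts in [y], that is, [integral_partial0] for the product of [z] and the shifted
    kernel. *)
Lemma mconv_partial (z rho : 'rV[R]_n -> R) r ep x i : C1 z -> (forall x, r < `|x| -> z x = 0) ->
  Cc ep rho -> partial i (mconv z rho) x = mconv (partial i z) rho x.
Proof.
move=> cz zr cr; have iz := intb_Cc (C1_continuous cz) zr.
have [_ /(congr1 (fun M : 'rV[R]_n => M ord0 i))] := mconv_grad x iz cr.
rewrite !mxE => ->; have cc := cz; have [dz pz] := cz.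
have cri := Cc_partial i cr.
have c1 : C1 (fun y => rho (y - x)) by apply: Ck_shift; exact: Cc_C1 cr.
have c2 : C1 (z \* (fun y => rho (y - x))).
  by apply/C1onT; apply: C1onM; [exact: openT|exact/C1onT|exact/C1onT].
have c0 y : r < `|y| -> (z \* (fun y => rho (y - x))) y = 0 by move=> yr; rewrite /= zr// mul0r.
have := integral_partial0 i c2 c0.
have E y : partial i (z \* (fun y => rho (y - x))) y =
    z y * partial i rho (y - x) + partial i z y * rho (y - x).
  have := congr1 (fun M : 'rV[R]_n => M ord0 i) (gradM (C1_diff y cz) (C1_diff y c1)).
  by rewrite !mxE => ->; rewrite (partial_shift _ _ _ (Cc_C1 cr)) [X in _ + X]mulrC.
under eq_Rintegral do rewrite E.
rewrite RintegralD//; last 2 first.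
- exact: (mconv_integrable x iz cri).
- by apply: (mconv_integrable x _ cr); apply: (intb_Cc (pz i)); exact: partial_out zr.
rewrite -/(mconv z (partial i rho) x) -/(mconv (partial i z) rho x) => h.
by apply/eqP; rewrite eq_sym -subr_eq0 opprK addrC; apply/eqP/h.
Qed.

(** The mollified [z] is a smooth test function supported in the thickened set [K0], and its
    gradient is uniformly close to that of [z]; integrability of [X0] makes the integrals close. *)
Lemma C1_test U K K0 (Y X0 : 'rV[R]_n -> 'rV[R]_n) (d : R) z :
  0 < d -> compact K -> compact K0 -> K0 `<=` U -> (forall x, K x -> cube x d `<=` K0) ->
  measurable_fun [set: _] X0 -> intb (fun x => `|X0 x|) ->
  (forall x, K0 x -> X0 x = Y x) ->
  (forall phi, test_function U phi -> \int[mu]_(x in U) dotv (Y x) (grad phi x) = 0) ->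
  C1 z -> (forall x, ~ K x -> z x = 0) ->
  intb (fun x => dotv (X0 x) (grad z x)) /\ \int[mu]_x dotv (X0 x) (grad z x) = 0.
Proof.
move=> d0 cK cK0 K0U KK0 mX iX XY hY cz zK.
have [r r0 Kr] := compact_sub_cube cK.
have zr x : r < `|x| -> z x = 0.
  by move=> xr; apply: zK => /Kr; rewrite /cube/= subr0 leNgt xr.
have iz := intb_Cc (C1_continuous cz) zr.
have clK0 : closed K0 by apply: compact_closed => //; exact: norm_hausdorff.
have [dz pz] := cz.
have bd (g : 'rV[R]_n -> R) B : C1 g -> (forall x, `|grad g x| <= B) ->
    intb (fun x => dotv (X0 x) (grad g x)) /\
    `|\int[mu]_x dotv (X0 x) (grad g x)| <= n%:R * B * \int[mu]_x `|X0 x|.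
  move=> cg hB.
  have le x : `|dotv (X0 x) (grad g x)| <= n%:R * B * `|X0 x|.
    rewrite (le_trans (dotv_bound _ _))// mulrAC ler_wpM2r// ler_wpM2l//.
  have ii : intb (fun x => dotv (X0 x) (grad g x)).
    apply: (intb_le _ (intbZ (n%:R * B) iX)) => //.
    by apply: measurable_dotv => //; exact: C1_measurable_grad.
  split => //; rewrite (le_trans (le_normr_Rintegral _ ii))//.
  rewrite -RintegralZl//; apply: le_Rintegral => //; [exact: intb_norm|exact: intbZ].
have gb : exists B, forall x, `|grad z x| <= B.
  have /choice[B hB] (i : 'I_n) : exists B, 0 <= B /\ forall x, `|partial i z x| <= B.
    by have [B B0 hB] := bounded_support (pz i) (partial_out i zr); exists B.
  exists (\sum_i B i) => x; apply/rV_norm_leP; first by apply: sumr_ge0 => i _; have [] := hB i.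
  move=> i; rewrite mxE (le_trans ((hB i).2 x))// (bigD1 i)//= lerDl.
  by apply: sumr_ge0 => j _; have [] := hB j.
have [B hB] := gb; have [i1 _] := bd z B cz hB; split => //.
set J := \int[mu]_x `|X0 x|; have J0 : 0 <= J by apply: Rintegral_ge0.
apply/eqP; rewrite -normr_le0; apply/ler_addgt0Pl => e e0; rewrite addr0.
pose e' := e / (n%:R * J + 1).
have D0 : 0 < n%:R * J + 1 by rewrite ltr_wpDl// mulr_ge0.
have e'0 : 0 < e' by rewrite divr_gt0.
have /choice[dl hdl] (i : 'I_n) : exists dl, 0 < dl /\ forall x, cube 0 (r + 1) x ->
   forall y, `|y| <= dl -> `|partial i z (x + y) - partial i z x| <= e'.
  have [dl dl0 h] := compact_unif_continuous (@cube_compact R n 0 (r + 1)) e'0 (fun x _ => pz i x).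
  by exists dl.
pose ep := Num.min d (Num.min 1 (\big[Num.min/1]_i dl i)).
have ep0 : 0 < ep.
  rewrite !lt_min d0 ltr01/=; apply/bigmin_gtP; split => // i _; exact: (hdl i).1.
have epd : ep <= d by rewrite ge_min lexx.
have ep1 : ep <= 1 by rewrite !ge_min lexx orbT.
have epi i : ep <= dl i.
  by rewrite /ep !ge_min (bigmin_le_cond _ (fun i => dl i)) ?orbT.
have [rho [ck r0' r1 rI]] := @exists_mollifier R n ep ep0.
have cr : Cc ep rho by split => // x /ltW; exact: r1.
pose phi := mconv z rho.
have cphi k : Ck k phi by exact: mconv_Ck iz cr.
have phi0 x : ~ K0 x -> phi x = 0.
  move=> nx; rewrite /phi (mconv_shiftE x iz cr) /Rintegral integral0_eq// => y _.
  have [ye|ye] := leP `|y| ep; last by rewrite cr.2// mulr0.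
  rewrite zK ?mul0r// => Kxy; apply: nx; apply: (KK0 _ Kxy).
  by rewrite /cube/= opprD addrA subrr sub0r normrN (le_trans ye).
have tphi : test_function U phi by exact: test_functionW cK0 K0U cphi phi0.
have dphi x : `|grad z x - grad phi x| <= e'.
  apply/(rV_norm_leP _ (ltW e'0)) => i; rewrite rV_coordB !mxE distrC.
  rewrite (mconv_partial x i cz zr cr); apply: (mconv_near _ cr) => //.
    by apply: (intb_Cc (pz i)); exact: partial_out zr.
  move=> y ye; have [xr|xr] := leP `|x| (r + 1).
    by apply: (hdl i).2; [rewrite /cube/= subr0|exact: le_trans (epi i)].
  rewrite (partial_out i zr (_ : r < `|x|)) ?(partial_out i zr (_ : r < `|x + y|)) ?subrr ?normr0 ?ltW//.
    by have := lerB_normD x y; lra.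
  by lra.
have c1 : C1 (z \- phi).
  by apply/C1onT; apply: C1onB; [exact: openT|exact/C1onT|apply/C1onT; exact: (cphi 1%N)].
have gE x : grad (z \- phi) x = grad z x - grad phi x.
  exact: (gradB (C1_diff x cz) (C1_diff x (cphi 1%N))).
have [i3 h3] := bd (z \- phi) e' c1 (fun x => eq_ind_r (fun v => `|v| <= e') (dphi x) (gE x)).
have E0 : \int[mu]_x dotv (X0 x) (grad phi x) = 0.
  rewrite -(hY phi tphi) [RHS]Rintegral_mkcond; apply: eq_Rintegral => x _; rewrite patchE.
  have [Kx|nK] := EM (K0 x); first by rewrite mem_set ?XY//; exact: K0U.
  by rewrite (grad_out clK0 phi0 nK) !dotv0r; case: ifP.
have [B2 hB2] : exists B2, forall x, `|grad phi x| <= B2.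
  exists (e' + B) => x; rewrite -[grad phi x](subrK (grad z x)).
  by rewrite (le_trans (ler_normD _ _))// lerD// distrC.
have [i2 _] := bd phi B2 (cphi 1%N) hB2.
have -> : \int[mu]_x dotv (X0 x) (grad z x) = \int[mu]_x dotv (X0 x) (grad (z \- phi) x).
  rewrite -[LHS]subr0 -[in LHS]E0 -RintegralB//; apply: eq_Rintegral => x _.
  by rewrite gE dotvBr.
rewrite (le_trans h3)// -/J /e' [leLHS](_ : _ = e * (n%:R * J / (n%:R * J + 1))); last first.
  by field; rewrite gt_eqF.
by rewrite ler_piMr ?(ltW e0)// ler_pdivrMr// mul1r lerDl.
Qed.

End C1_test.

(** * Limits of C^1 functions supported in a compact set *)

Section W0.
Context {R : realType}.
Variable n : nat.
Local Notation mu := (@lebesgue_rV R n).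
Implicit Types (f u v w : 'rV[R]_n -> R) (F G X : 'rV[R]_n -> 'rV[R]_n) (U K : set 'rV[R]_n).

Lemma compact_bound (W : normedModType R) (g : 'rV[R]_n -> W) K : compact K ->
  (forall x, K x -> {for x, continuous g}) -> exists2 B, 0 <= B & forall x, K x -> `|g x| <= B.
Proof.
move=> cK cg; have c : {within K, continuous g}.
  by apply: continuous_in_subspaceT => x /set_mem; exact: cg.
have /compact_bounded [M [_ hM]] := continuous_compact c cK.
exists (`|M| + 1); first by rewrite addr_ge0.
move=> x Kx; apply: hM; last by exists x.
by rewrite (le_lt_trans (ler_norm _))// ltrDl.
Qed.

Lemma ge0_int_le (f g : 'rV[R]_n -> R) : measurable_fun [set: _] f ->
  measurable_fun [set: _] g -> (forall x, 0 <= f x <= g x) ->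
  (\int[mu]_x (f x)%:E <= \int[mu]_x (g x)%:E)%E.
Proof.
move=> mf mg fg; apply: ge0_le_integral => //.
- by move=> x _; rewrite lee_fin; have /andP[] := fg x.
- exact/measurable_EFinP.
- exact/measurable_EFinP.
- by move=> x _; rewrite lee_fin; have /andP[] := fg x.
Qed.

Lemma ge0_intDE (f g : 'rV[R]_n -> R) : measurable_fun [set: _] f ->
  measurable_fun [set: _] g -> (forall x, 0 <= f x) -> (forall x, 0 <= g x) ->
  (\int[mu]_x (f x + g x)%:E = \int[mu]_x (f x)%:E + \int[mu]_x (g x)%:E)%E.
Proof.
move=> mf mg f0 g0; under eq_integral do rewrite EFinD.
rewrite ge0_integralD//; (try exact/measurable_EFinP); by move=> x _; rewrite lee_fin.
Qed.

Lemma ge0_intZE (c : R) (f : 'rV[R]_n -> R) : measurable_fun [set: _] f ->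
  (forall x, 0 <= f x) -> 0 <= c ->
  (\int[mu]_x (c * f x)%:E = c%:E * \int[mu]_x (f x)%:E)%E.
Proof.
move=> mf f0 c0; under eq_integral do rewrite EFinM.
rewrite ge0_integralZl//; (try exact/measurable_EFinP); by move=> x _; rewrite lee_fin.
Qed.

Lemma intbE (f : 'rV[R]_n -> R) : intb f -> (\int[mu]_x (f x)%:E = (\int[mu]_x f x)%:E)%E.
Proof. by move=> fi; rewrite /Rintegral fineK//; exact: integrable_fin_num. Qed.

(** A substitute for the Sobolev space of functions vanishing off [K]: values converge uniformly,
    gradients in L^1 with weight [w]. The equation ([W0_test]) and the translation estimate
    ([W0_translation]) both survive this limit. *)
Definition W0 K w f F := forall e, 0 < e -> exists g,
  [/\ C1 g, forall x, ~ K x -> g x = 0, forall x, `|g x - f x| <= e &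
   (\int[mu]_x (w x * `|grad g x - F x|)%:E <= e%:E)%E].

Lemma lip_derive (Phi Phi' : R -> R) (L B e a b : R) :
  (forall t, is_derive t (1:R) Phi (Phi' t)) ->
  (forall s t, `|Phi' s - Phi' t| <= L * `|s - t|) -> `|Phi' b| <= B ->
  e <= 1 -> `|a - b| <= e -> 0 <= L ->
  [/\ `|Phi' a| <= B + L, `|Phi' a - Phi' b| <= L * e & `|Phi a - Phi b| <= (B + L) * e].
Proof.
move=> dP lP PB e1 ab L0.
have P1 c : `|c - b| <= e -> `|Phi' c| <= B + L.
  move=> cb; rewrite -[Phi' c](subrK (Phi' b)) (le_trans (ler_normD _ _))// addrC lerD//.
  by rewrite (le_trans (lP _ _))// ler_piMr// (le_trans cb).
split; [exact: P1|by rewrite (le_trans (lP _ _))// ler_wpM2l|].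
have B0 : 0 <= B + L by rewrite (le_trans _ (P1 a ab)).
have main x y : x <= y -> `|x - b| <= e -> `|y - b| <= e -> `|y - x| <= e ->
    `|Phi y - Phi x| <= (B + L) * e.
  move=> xy xb yb yx.
  have [|c /= cxy ->] := @MVT_segment R Phi Phi' x y xy.
    apply: continuous_subspaceT => z; apply: differentiable_continuous.
    by apply/derivable1_diffP; have [] := dP z.
  rewrite normrM ler_pM// P1//; move: cxy; rewrite in_itv/= => /andP[xc cy].
  move: xb yb; rewrite !ler_norml => /andP[? ?] /andP[? ?]; apply/andP; split; lra.
have e0 : 0 <= e by exact: le_trans ab.
have [h|/ltW h] := leP a b.
  by rewrite distrC; apply: main; rewrite ?subrr ?normr0// distrC.
by apply: main; rewrite ?subrr ?normr0.
Qed.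

(** The truncations of De Giorgi's method are not twice differentiable; a Lipschitz derivative is
    what the passage to the limit requires. *)
Definition C11 (Phi Phi' : R -> R) (L : R) := [/\ 0 <= L,
  forall t, is_derive t (1:R) Phi (Phi' t) &
  forall s t, `|Phi' s - Phi' t| <= L * `|s - t|].

Lemma C11_continuous (Phi Phi' : R -> R) L : C11 Phi Phi' L -> continuous Phi /\ continuous Phi'.
Proof.
move=> [L0 dP lP]; split => t.
  by apply: differentiable_continuous; apply/derivable1_diffP; have [] := dP t.
apply/continuous_epsP => e e0; exists (e / (L + 1)); first by rewrite divr_gt0// ltr_wpDl.
move=> s se; rewrite (le_trans (lP _ _))// addrAC subrr add0r.
rewrite (@le_trans _ _ ((L + 1) * `|s|)) ?ler_wpM2r ?lerDl// mulrC -ler_pdivlMr ?ltr_wpDl//.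
exact: ltW.
Qed.

(** The approximants are [Phi (ut - v) * eta] with [ut] from [sapprox]. They are of class C^1 on [U]
    only, and the vanishing of [eta] off [K] extends them by 0. *)
Lemma W0_comp U K w u v G (Phi Phi' : R -> R) (L : R) (eta d : 'rV[R]_n -> R) D :
  open U -> compact K -> K `<=` U -> (forall x, U x -> {for x, continuous u}) ->
  C1on U v -> measurable_fun [set: _] G -> measurable_fun [set: _] w -> (forall x, 0 <= w x) ->
  intb (fun x => w x * (1 + `|G x|) * \1_K x) -> sapprox K w u G ->
  measurable_fun [set: _] d -> measurable_fun [set: _] D ->
  (forall x, K x -> d x = u x - v x) -> (forall x, K x -> D x = G x - grad v x) ->
  (forall t, is_derive t (1:R) Phi (Phi' t)) ->
  (forall s t, `|Phi' s - Phi' t| <= L * `|s - t|) -> 0 <= L ->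
  C1 eta -> (forall x, ~ K x -> eta x = 0) ->
  W0 K w (fun x => Phi (d x) * eta x)
    (fun x => (Phi' (d x) * eta x) *: D x + Phi (d x) *: grad eta x).
Proof.
move=> oU cK KU cu cv mG mw w0 iw apx md mD dE DE dP lP L0 ce e0K.
have clK : closed K by apply: compact_closed => //; exact: norm_hausdorff.
have mK := compact_measurable_rV cK.
have [cP cP'] := C11_continuous (And3 L0 dP lP).
have [B1 B10 hB1] : exists2 B, 0 <= B & forall x, K x -> `|eta x| <= B.
  exact: compact_bound cK (fun x _ => C1_continuous ce (x := x)).
have [B2 B20 hB2] := compact_bound cK (fun x _ => C1_grad_continuous ce (x := x)).
have [B3 B30 hB3] : exists2 B, 0 <= B & forall x, K x -> `|Phi' (u x - v x)| <= B.
  apply: (compact_bound (g := fun x => Phi' (u x - v x)) cK) => x Kx.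
  apply: (@continuous_comp _ _ _ (fun x => u x - v x) Phi'); last exact: cP'.
  apply: continuousB; [exact/cu/KU|exact: C1on_cont cv (KU _ Kx)].
have [B4 B40 hB4] := compact_bound cK (fun x Kx => (cv x (KU x Kx)).2).
pose B := (B3 + L) * B1 + L * B1 * (1 + B4) + (B3 + L) * B2.
have BB0 : 0 <= B by rewrite !addr_ge0 ?mulr_ge0// !addr_ge0.
set J := \int[mu]_x (w x * (1 + `|G x|) * \1_K x).
have J0 : 0 <= J by apply: Rintegral_ge0 => x _; rewrite !mulr_ge0// addr_ge0.
move=> e e0.
(* Covers the uniform error, at most [B1 * (B3 + L) * e1], and the weighted gradient error, at most
   [B * (1 + J) * e1]. *)
pose e1 := Num.min 1 (e / (B * (2 + J) + B1 * (B3 + L) + 1)).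
have D0 : 0 < B * (2 + J) + B1 * (B3 + L) + 1 by rewrite ltr_wpDl// addr_ge0// mulr_ge0// addr_ge0.
have e10 : 0 < e1 by rewrite lt_min ltr01 divr_gt0.
have e11 : e1 <= 1 by rewrite ge_min lexx.
have e1e : e1 * (B * (2 + J) + B1 * (B3 + L) + 1) <= e by rewrite -ler_pdivlMr// ge_min lexx orbT.
have [ut [cut utu utG]] := apx e1 e10.
have est x : K x -> [/\ `|Phi' (ut x - v x)| <= B3 + L,
    `|Phi' (ut x - v x) - Phi' (u x - v x)| <= L * e1 &
    `|Phi (ut x - v x) - Phi (u x - v x)| <= (B3 + L) * e1].
  move=> Kx; apply: (lip_derive dP lP (hB3 x Kx) e11 _ L0).
  by rewrite opprB addrA subrK; exact: utu.
have cut' : C1on U ut by apply: (C1onW (@subsetT _ U)); exact/C1onT.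
have ce' : C1on U eta by apply: (C1onW (@subsetT _ U)); exact/C1onT.
pose g := (Phi \o (ut \- v)) \* eta.
have gK x : ~ K x -> g x = 0 by move=> /e0K h; rewrite /g/= h mulr0.
have cd : C1on U (ut \- v) by exact: C1onB.
have cpd : C1on U (Phi \o (ut \- v)).
  exact: (C1on_comp oU cd (fun x _ => dP _) (fun x _ => cP' _)).
have cg : C1on U g by exact: C1onM.
have cg1 : C1 g by exact: (C1on_glue oU clK KU cg gK).
exists g; split => //.
  move=> x; rewrite /g/= -mulrBl normrM.
  have [Kx|/e0K->] := EM (K x); last by rewrite normr0 mulr0 ltW.
  rewrite dE//.
  have [_ _ h] := est x Kx.
  rewrite (le_trans (ler_pM _ _ h (hB1 x Kx)))//.
  apply: le_trans e1e; rewrite -mulrA mulrC -mulrA ler_wpM2l ?(ltW e10)// mulrC.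
  have : 0 <= B * (2 + J) by rewrite mulr_ge0// addr_ge0.
  have : 0 <= B1 * (B3 + L) by rewrite mulr_ge0// addr_ge0.
  by lra.
pose F x := (Phi' (d x) * eta x) *: D x + Phi (d x) *: grad eta x; rewrite -/F.
have ptw x : w x * `|grad g x - F x| <= B * (w x * `|grad ut x - G x| * \1_K x) + (B * e1) * (w x * (1 + `|G x|) * \1_K x).
  rewrite indicE; have [Kx|nK] := EM (K x); last first.
    rewrite (grad_out clK gK nK) /F e0K// (grad_out clK e0K nK) mulr0 scale0r scaler0 addr0 subrr normr0 mulr0.
    by rewrite memNset// !mulr0 addr0.
  rewrite mem_set// [leRHS](_ : _ = w x * (B * `|grad ut x - G x| + B * e1 * (1 + `|G x|))); last by rewrite /=; ring.
  rewrite ler_wpM2l//.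
  have Ux := KU x Kx; have [dut _] := cut' x Ux; have [dv _] := cv x Ux.
  have [dgd gde] := grad_comp (differentiableB dut dv) (dP _).
  rewrite /g gradM//; last exact: (ce' x Ux).1.
  rewrite gde gradB// /F dE// DE//=.
  set a := Phi' (ut x - v x); set b := Phi' (u x - v x); set c := Phi _; set c' := Phi (u x - v x).
  have [ha hab hc] := est x Kx; rewrite -/a -/b -/c -/c' in ha hab hc.
  (* The first term carries the gradient error of [ut]. The other two are of order [e1] and grow at
     most like [1 + |G x|], which the weight integrates over [K]. *)
  have -> : c *: grad eta x + eta x *: (a *: (grad ut x - grad v x)) -
     ((b * eta x) *: (G x - grad v x) + c' *: grad eta x) =
     (a * eta x) *: (grad ut x - G x) + ((a - b) * eta x) *: (G x - grad v x) + (c - c') *: grad eta x.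
    by apply/rowP => i; rewrite !mxE; ring.
  apply: (le_trans (ler_normD _ _)); apply: (le_trans (lerD (ler_normD _ _) (lexx _))); rewrite !normrZ.
  set g1 := `|_ - G x|; have hGv : `|G x - grad v x| <= `|G x| + B4.
    by rewrite (le_trans (ler_normB _ _))// lerD// hB4.
  have g10 : 0 <= g1 by exact: normr_ge0.
  have he := hB1 x Kx; have hg := hB2 x Kx.
  have t1 : `|a| * `|eta x| * g1 <= (B3 + L) * B1 * g1 by apply: ler_wpM2r => //; apply: ler_pM.
  have t2 : `|a - b| * `|eta x| * `|G x - grad v x| <= L * e1 * B1 * (`|G x| + B4).
    by apply: ler_pM => //; apply: ler_pM.
  have t3 : `|c - c'| * `|grad eta x| <= (B3 + L) * e1 * B2 by exact: (ler_pM (normr_ge0 _) (normr_ge0 _) hc hg).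
  apply: (le_trans (lerD (lerD t1 t2) t3)).
  set y := `|G x|; have y0 : 0 <= y by exact: normr_ge0.
  rewrite /B -subr_ge0.
  have -> : ((B3 + L) * B1 + L * B1 * (1 + B4) + (B3 + L) * B2) * g1 +
    ((B3 + L) * B1 + L * B1 * (1 + B4) + (B3 + L) * B2) * e1 * (1 + y) -
    ((B3 + L) * B1 * g1 + L * e1 * B1 * (y + B4) + (B3 + L) * e1 * B2) =
    (L * B1 * (1 + B4) + (B3 + L) * B2) * g1 + e1 * ((B3 + L) * B1 * (1 + y) + L * B1 * (1 + B4 * y) + (B3 + L) * B2 * y).
    by ring.
  have e1' := ltW e10.
  by rewrite addr_ge0 ?mulr_ge0 ?addr_ge0 ?mulr_ge0 ?addr_ge0 ?mulr_ge0.
have mgu : measurable_fun [set: _] (fun x => `|grad ut x - G x|).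
  apply: measurable_fun_normrV; apply/measurable_fun_rVP => i; under eq_fun do rewrite rV_coordB.
  apply: measurable_funB; first by move/measurable_fun_rVP : (C1_measurable_grad cut).
  by move/measurable_fun_rVP : mG.
pose a1 x := w x * `|grad ut x - G x| * \1_K x.
have m1 : measurable_fun [set: _] a1.
  apply: measurable_funM; last exact: measurable_indic.
  exact: measurable_funM.
pose a2 x := w x * (1 + `|G x|) * \1_K x; have m2 : measurable_fun [set: _] a2 := intb_measurable iw.
have a10 x : 0 <= a1 x by rewrite !mulr_ge0.
have a20 x : 0 <= a2 x by rewrite !mulr_ge0// addr_ge0.
have mF : measurable_fun [set: _] (fun x => w x * `|grad g x - F x|).
  have mP' : measurable_fun [set: R] Phi' by exact: continuous_measurable_fun.
  have mP : measurable_fun [set: R] Phi by exact: continuous_measurable_fun.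
  apply: measurable_funM => //; apply: measurable_fun_normrV; apply/measurable_fun_rVP => i.
  under eq_fun do rewrite rV_coordB; apply: measurable_funB.
    by move/measurable_fun_rVP : (C1_measurable_grad cg1).
  move: i; apply/measurable_fun_rVP; apply: measurable_addrV; apply: measurable_scale => //.
  - by apply: measurable_funM; [exact: (measurableT_comp mP' md)|exact: C1_measurable].
  - exact: (measurableT_comp mP md).
  - exact: C1_measurable_grad.
apply: (@le_trans _ _ (\int[mu]_x (B * a1 x + (B * e1) * a2 x)%:E)%E).
  apply: ge0_int_le => //.
    by apply: measurable_funD; exact: measurable_funM.
  by move=> x; rewrite mulr_ge0//=; exact: ptw.
rewrite ge0_intDE//; last 4 first.
- exact: measurable_funM.
- exact: measurable_funM.
- by move=> x; rewrite mulr_ge0.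
- by move=> x; rewrite !mulr_ge0// ltW.
rewrite !ge0_intZE// ?mulr_ge0 ?(ltW e10)// [X in (_ + _ * X)%E](_ : _ = J%:E); last exact: intbE iw.
have le1 : (\int[mu]_x (a1 x)%:E <= e1%:E)%E.
  apply: le_trans utG; rewrite [leRHS]integral_mkcond; apply: ge0_le_integral => //.
  - by move=> x _; rewrite lee_fin.
  - exact/measurable_EFinP.
  - apply/(measurable_restrictT _ mK)/measurable_funTS/measurable_EFinP; exact: measurable_funM.
  - by move=> x _; rewrite /a1 patchE indicE; case: ifP; rewrite ?mulr1 ?mulr0.
apply: (@le_trans _ _ (B%:E * e1%:E + (B * e1)%:E * J%:E)%E).
  by apply: leeD => //; apply: lee_wpmul2l.
rewrite -!EFinM -EFinD lee_fin; apply: le_trans e1e.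
rewrite -subr_ge0 (_ : _ - _ = e1 * (B + B1 * (B3 + L) + 1)); last by ring.
by rewrite mulr_ge0 ?(ltW e10)// addr_ge0// addr_ge0// mulr_ge0// addr_ge0.
Qed.

Lemma W0_test K w f F X (C : R) : W0 K w f F -> measurable_fun [set: _] w ->
  (forall x, 0 <= w x) -> measurable_fun [set: _] X -> measurable_fun [set: _] F ->
  0 <= C -> (forall x, `|X x| <= C * w x) -> intb (fun x => dotv (X x) (F x)) ->
  (forall g, C1 g -> (forall x, ~ K x -> g x = 0) ->
    intb (fun x => dotv (X x) (grad g x)) /\ \int[mu]_x dotv (X x) (grad g x) = 0) ->
  \int[mu]_x dotv (X x) (F x) = 0.
Proof.
move=> hW mw w0 mX mF C0 XC iXF hX; apply/eqP; rewrite -normr_le0; apply/ler_addgt0Pl => e e0; rewrite addr0.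
pose c := n%:R * C; have c0 : 0 <= c by rewrite mulr_ge0.
have D0 : 0 < c + 1 by rewrite ltr_wpDl.
have [g [cg gK _ hg]] := hW _ (divr_gt0 e0 D0).
have [i1 E1] := hX g cg gK.
have -> : \int[mu]_x dotv (X x) (F x) = \int[mu]_x (dotv (X x) (F x) - dotv (X x) (grad g x)).
  by rewrite RintegralB// E1 subr0.
have ii := intbB iXF i1.
rewrite (le_trans (le_normr_Rintegral _ ii))// -lee_fin -(intbE (intb_norm ii)).
have mgu : measurable_fun [set: _] (fun x => w x * `|grad g x - F x|).
  apply: measurable_funM => //; apply: measurable_fun_normrV; apply/measurable_fun_rVP => i; under eq_fun do rewrite rV_coordB.
  apply: measurable_funB; first by move/measurable_fun_rVP : (C1_measurable_grad cg).
  by move/measurable_fun_rVP : mF.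
apply: (@le_trans _ _ (\int[mu]_x (c * (w x * `|grad g x - F x|))%:E)%E).
  apply: ge0_int_le => //; first exact: (intb_measurable (intb_norm ii)).
    exact: measurable_funM.
  move=> x; rewrite normr_ge0/= -dotvBr (le_trans (dotv_bound _ _))// distrC.
  have -> : c * (w x * `|grad g x - F x|) = n%:R * (C * w x) * `|grad g x - F x| by rewrite /c; ring.
  by apply: ler_wpM2r => //; apply: ler_wpM2l.
rewrite ge0_intZE//; last by move=> x; rewrite mulr_ge0.
apply: (@le_trans _ _ (c%:E * (e / (c + 1))%:E)%E); first exact: lee_wpmul2l.
rewrite -EFinM lee_fin mulrCA ler_piMr ?(ltW e0)// ler_pdivrMr// mul1r lerDl//.
Qed.

(** The estimate holds for the approximants. Values are uniformly close on the compact set [K] and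
    vanish off it, and [1 <= w] lets the weighted norm dominate the plain L^1 norm of the
    gradients. *)
Lemma W0_translation K w f F (S : set 'rV[R]_n) h : W0 K w f F -> compact K ->
  measurable_fun [set: _] w -> (forall x, 1 <= w x) -> measurable_fun [set: _] f ->
  (forall x, ~ K x -> f x = 0) -> measurable_fun [set: _] F -> measurable S -> convex_setrV S ->
  (\int[mu]_x (`|f (x + h)%R - f x| * (\1_S x * \1_S (x + h)%R))%:E <=
   (n%:R * `|h|)%:E * \int[mu]_(x in S) `|F x|%:E)%E.
Proof.
move=> hW cK mw w1 mf fK mF mS cS; apply/lee_addgt0Pr => e e0.
have mK := compact_measurable_rV cK.
have [r r0 Kr] := compact_sub_cube cK.
have ik := intb_indic cK.
pose k := \int[mu]_x (\1_K x : R).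
have k0 : 0 <= k by apply: Rintegral_ge0.
pose c := n%:R * `|h|; have c0 : 0 <= c by rewrite mulr_ge0.
have D0 : 0 < c + (k + k) + 1 by rewrite ltr_wpDl// !addr_ge0.
pose e1 := e / (c + (k + k) + 1); have e10 : 0 < e1 by rewrite divr_gt0.
have [g [cg gK gf hg]] := hW _ e10.
have mg := C1_measurable cg.
have msh (a : 'rV[R]_n -> R) : measurable_fun [set: _] a -> measurable_fun [set: _] (fun x : 'rV[R]_n => a (x + h)).
  by move=> ma; exact: measurable_funrV_shift.
have mS1 : measurable_fun [set: _] (fun x : 'rV[R]_n => \1_S x * \1_S (x + h) : R).
  by apply: measurable_funM; [exact: measurable_indic|apply: msh; exact: measurable_indic].
have mdf (a : 'rV[R]_n -> R) : measurable_fun [set: _] a ->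
    measurable_fun [set: _] (fun x : 'rV[R]_n => `|a (x + h) - a x| * (\1_S x * \1_S (x + h))).
  move=> ma; apply: measurable_funM => //; apply: measurableT_comp => //.
  by apply: measurable_funB => //; exact: msh.
have m1K : measurable_fun [set: _] (\1_K : 'rV[R]_n -> R) by exact: measurable_indic.
have mk : measurable_fun [set: _] (fun x : 'rV[R]_n => \1_K x + \1_K (x + h) : R).
  by apply: measurable_funD => //; exact: msh.
have fg x : `|f x - g x| <= e1 * \1_K x.
  rewrite indicE; have [Kx|nK] := EM (K x); first by rewrite mem_set// mulr1 distrC.
  by rewrite gK// fK// subrr normr0 memNset// mulr0.
apply: (@le_trans _ _ (\int[mu]_x (`|g (x + h) - g x| * (\1_S x * \1_S (x + h)) + e1 * (\1_K x + \1_K (x + h)))%:E)%E).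
  apply: ge0_int_le; [exact: mdf|by apply: measurable_funD; [exact: mdf|exact: measurable_funM]|].
  move=> x; rewrite !mulr_ge0//=.
  have s01 : 0 <= (\1_S x * \1_S (x + h) : R) <= 1.
    by rewrite !indicE; do 2 case: (_ \in S); rewrite /= ?mulr1 ?mulr0 ?ler01 ?lexx.
  have h1 := fg x; have h2 := fg (x + h); move: s01 => /andP[s0 s1].
  have t : `|f (x + h) - f x| <= `|g (x + h) - g x| + e1 * (\1_K x + \1_K (x + h)).
    rewrite (_ : f (x + h) - f x = (g (x + h) - g x) + ((f (x + h) - g (x + h)) + (g x - f x))); last by ring.
    rewrite (le_trans (ler_normD _ _))// lerD2l (le_trans (ler_normD _ _))// mulrDr [leRHS]addrC lerD//.
    by rewrite distrC.
  apply: (le_trans (ler_wpM2r s0 t)); rewrite mulrDl lerD2l; apply: ler_piMr => //.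
  by apply: mulr_ge0; [exact: ltW|rewrite addr_ge0].
rewrite ge0_intDE; [|exact: mdf|exact: measurable_funM|by move=> x; rewrite !mulr_ge0|]; last first.
  by move=> x; rewrite mulr_ge0 ?(ltW e10)// addr_ge0.
rewrite ge0_intZE ?(ltW e10)//.
rewrite ge0_intDE//; last exact: msh.
rewrite (ge0_integral_rV_shift h (f := fun x => (\1_K x : R)%:E))//; last exact/measurable_EFinP.
rewrite (intbE ik) -/k -EFinD -EFinM.
have mGF : measurable_fun [set: _] (fun x => `|grad g x - F x|).
  apply: measurable_fun_normrV; apply/measurable_fun_rVP => i; under eq_fun do rewrite rV_coordB.
  apply: measurable_funB; first by move/measurable_fun_rVP : (C1_measurable_grad cg).
  by move/measurable_fun_rVP : mF.
have gS : (\int[mu]_(x in S) `|grad g x|%:E <= \int[mu]_(x in S) `|F x|%:E + e1%:E)%E.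
  apply: (@le_trans _ _ (\int[mu]_(x in S) (`|F x|%:E + `|grad g x - F x|%:E))%E).
    apply: ge0_le_integral => //.
    - by apply/measurable_funTS/measurable_EFinP/measurable_fun_normrV; exact: C1_measurable_grad.
    - apply/measurable_funTS/emeasurable_funD; apply/measurable_EFinP => //.
      exact: measurable_fun_normrV.
    - by move=> x _; rewrite -EFinD lee_fin -[in leLHS](subrK (F x) (grad g x)) addrC ler_normD.
  rewrite ge0_integralD//; last 2 first.
  - by apply/measurable_funTS/measurable_EFinP/measurable_fun_normrV.
  - exact/measurable_funTS/measurable_EFinP.
  apply: leeD => //; apply: le_trans hg; rewrite integral_mkcond.
  apply: ge0_le_integral => //.
  - by move=> x _; rewrite patchE; case: ifP.
  - by apply/(measurable_restrictT _ mS)/measurable_funTS/measurable_EFinP.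
  - by apply/measurable_EFinP; exact: measurable_funM.
  - move=> x _; rewrite patchE; have w1x := w1 x.
    by case: ifP => _; rewrite lee_fin ?ler_peMl// mulr_ge0// (le_trans ler01).
apply: (@le_trans _ _ (c%:E * (\int[mu]_(x in S) `|F x|%:E + e1%:E) + (e1 * (k + k))%:E)%E).
  apply: leeD => //; apply: (le_trans (translation_estimate h cg mS cS)).
  by apply: lee_wpmul2l; rewrite ?lee_fin.
rewrite ge0_muleDr ?integral_ge0 ?lee_fin ?(ltW e10)//.
rewrite -addeA leeD2l// -EFinM -EFinD lee_fin.
have : e1 * (c + (k + k) + 1) = e by rewrite /e1 divfK// gt_eqF.
by have := ltW e10; lra.
Qed.

End W0.

(** * Truncations with Lipschitz derivative *)

Section positive_part.
Context {R : realType}.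
Implicit Types (s t : R).

Definition pos t := Num.max 0 t.

Lemma pos_ge0 t : 0 <= pos t. Proof. by rewrite /pos le_max lexx. Qed.

Lemma pos_id t : 0 <= t -> pos t = t. Proof. by move=> t0; rewrite /pos max_r. Qed.

Lemma pos_out t : t <= 0 -> pos t = 0. Proof. by move=> t0; rewrite /pos max_l. Qed.

Lemma pos_gt0 t : (0 < pos t) = (0 < t).
Proof. by rewrite /pos lt_max ltxx. Qed.

Lemma pos_lip s t : `|pos s - pos t| <= `|s - t|.
Proof.
rewrite /pos /Num.max; case: ltP => h1; case: ltP => h2;
  rewrite ?subrr ?normr0 ?normr_ge0//.
  by rewrite subr0 !gtr0_norm// ?subr_gt0; lra.
by rewrite sub0r normrN gtr0_norm// distrC ger0_norm; lra.
Qed.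

Lemma is_derive_quad1 (f : R -> R) (x a C : R) :
  (forall h, `|f (x + h) - f x - a * h| <= C * h ^+ 2) -> is_derive x (1:R) f a.
Proof.
move=> hf; pose g t := f t - a * t.
have dg : is_derive x (1:R) g 0.
  apply: (is_derive_quad (C := C)) => h; rewrite /g.
  by rewrite (_ : _ - _ = f (x + h) - f x - a * h); [exact: hf|ring].
have da : is_derive x (1:R) (fun t : R => a * t) a.
  by have := is_deriveZ a (is_derive_id x (1:R)); rewrite /GRing.scale/= mulr1.
have := is_deriveD dg da; rewrite add0r.
rewrite (_ : g + _ = f)//; apply/funext => t; rewrite /g !fctE; ring.
Qed.

(** Squaring makes the positive part differentiable with a Lipschitz derivative. *)
Definition psq t := pos t ^+ 2.

Lemma C11_psq : C11 psq (fun t => 2 * pos t) 2.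
Proof.
split=> // [t|s t]; last by rewrite -mulrBr normrM ger0_norm// ler_wpM2l// pos_lip.
apply: (is_derive_quad1 (C := 1)) => h; rewrite mul1r /psq /pos /Num.max.
case: ltP => h1; case: ltP => h2; rewrite ler_norml; apply/andP; split; nra.
Qed.

Lemma C11_aff Phi Phi' L (a b c : R) : C11 Phi Phi' L ->
  C11 (fun t => c * Phi (a * t + b)) (fun t => c * (a * Phi' (a * t + b))) (`|c| * a ^+ 2 * L).
Proof.
move=> [L0 dP lP]; split => [|t|s t].
- by apply: mulr_ge0 => //; apply: mulr_ge0 => //; exact: sqr_ge0.
- have da : is_derive t (1:R) (fun t : R => a * t + b) a.
    have := is_deriveD (is_deriveZ a (is_derive_id t (1:R))) (is_derive_cst b t (1:R)).
    by rewrite /GRing.scale/= mulr1 addr0.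
  have := is_deriveZ c (@is_derive1_comp R Phi (fun t => a * t + b) t _ _ (dP (a * t + b)) da).
  by move=> h; rewrite (mulrC a (Phi' _)); exact: h.
- rewrite -!mulrBr !normrM.
  rewrite (_ : `|c| * a ^+ 2 * L * _ = `|c| * (`|a| * (L * (`|a| * `|s - t|)))); last first.
    by rewrite -[a ^+ 2]real_normK ?num_real//; ring.
  have E : a * s + b - (a * t + b) = a * (s - t) by ring.
  by do 2 apply: ler_wpM2l => //; apply: (le_trans (lP _ _)); rewrite E normrM.
Qed.

Lemma C11D Phi Phi' L Psi Psi' L' : C11 Phi Phi' L -> C11 Psi Psi' L' ->
  C11 (fun t => Phi t + Psi t) (fun t => Phi' t + Psi' t) (L + L').
Proof.
move=> [L0 dP lP] [L'0 dP' lP']; split => [|t|s t]; first exact: addr_ge0.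
  exact: is_deriveD.
rewrite (_ : _ - _ = (Phi' s - Phi' t) + (Psi' s - Psi' t)); last by ring.
by rewrite (le_trans (ler_normD _ _))// mulrDl lerD.
Qed.

(* Its derivative is a hat function of height [2 b] supported in [a, a + 2 b]. *)
Definition ramp (a b t : R) := psq (t - a) - 2 * psq (t - a - b) + psq (t - a - 2 * b).

Definition ramp' (a b t : R) := 2 * (pos (t - a) - 2 * pos (t - a - b) + pos (t - a - 2 * b)).

Lemma C11_ramp a b : exists L, C11 (ramp a b) (ramp' a b) L.
Proof.
have h1 := C11_aff 1 (- a) 1 C11_psq.
have h2 := C11_aff 1 (- a - b) (-2) C11_psq.
have h3 := C11_aff 1 (- a - 2 * b) 1 C11_psq.
have := C11D (C11D h1 h2) h3; set L := (X in C11 _ _ X) => h; exists L.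
rewrite (_ : ramp a b = fun t => 1 * psq (1 * t - a) + -2 * psq (1 * t + (- a - b)) + 1 * psq (1 * t + (- a - 2 * b))); last first.
  by apply/funext => t; rewrite /ramp !mul1r !addrA mulNr.
rewrite (_ : ramp' a b = (fun t => 1 * (1 * (2 * pos (1 * t - a))) +
  -2 * (1 * (2 * pos (1 * t + (- a - b)))) + 1 * (1 * (2 * pos (1 * t + (- a - 2 * b))))))//.
by apply/funext => t; rewrite /ramp' !mul1r !addrA; ring.
Qed.

Lemma ramp0 a b t : 0 <= b -> t <= a -> ramp a b t = 0 /\ ramp' a b t = 0.
Proof.
move=> b0 ta; rewrite /ramp /ramp' /psq !pos_out; [split; ring|lra|lra|lra].
Qed.

Lemma ramp1 a b t : 0 <= b -> a + 2 * b <= t -> ramp a b t = 2 * b ^+ 2 /\ ramp' a b t = 0.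
Proof.
move=> b0 ta; rewrite /ramp /ramp' /psq !pos_id; [split; ring|lra|lra|lra].
Qed.

Lemma ramp'_bound a b t : 0 <= b -> 0 <= ramp' a b t <= 2 * b.
Proof.
move=> b0; rewrite /ramp' /pos /Num.max.
by case: ltP => h1; case: ltP => h2; case: ltP => h3; apply/andP; split; lra.
Qed.

Lemma ramp_bound a b t : 0 <= b -> 0 <= ramp a b t <= 2 * b ^+ 2.
Proof.
move=> b0; rewrite /ramp /psq /pos /Num.max.
by case: ltP => h1; case: ltP => h2; case: ltP => h3; apply/andP; split; nra.
Qed.

End positive_part.

(** * Cutoff functions between two cubes *)

Section cutoff.
Context {R : realType}.
Variable n : nat.
Implicit Types (x y : 'rV[R]_n).

Lemma C11_C1on (Phi Phi' : R -> R) L U (f : 'rV[R]_n -> R) : open U -> C11 Phi Phi' L ->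
  C1on U f -> C1on U (Phi \o f).
Proof.
move=> oU cP cf; have [_ dP _] := cP; have [_ cP'] := C11_continuous cP.
exact: (C1on_comp oU cf (fun x _ => dP _) (fun x _ => cP' _)).
Qed.

Lemma C1on_sum (I : Type) (s : seq I) U (f : I -> 'rV[R]_n -> R) : open U ->
  (forall i, C1on U (f i)) -> C1on U (fun x => \sum_(i <- s) f i x).
Proof.
move=> oU cf; elim: s => [|i s IH].
  by rewrite (_ : (fun x => _) = cst 0); [exact: C1on_cst|apply/funext => x; rewrite big_nil].
by apply: (C1on_eq oU _ (C1onD oU (cf i) IH)) => x _; rewrite big_cons.
Qed.

Lemma grad_sum (s : seq 'I_n) (f : 'I_n -> 'rV[R]_n -> R) x :
  (forall i, C1 (f i)) ->
  grad (fun x => \sum_(i <- s) f i x) x = \sum_(i <- s) grad (f i) x.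
Proof.
move=> cf; elim: s => [|i s IH].
  rewrite big_nil (_ : (fun x => _) = cst 0); first exact: grad_cst.
  by apply/funext => y; rewrite big_nil.
rewrite big_cons -IH -gradD; [|exact: C1_diff|].
  by congr (grad _ _); apply/funext => y; rewrite big_cons.
by have [] := C1on_sum s openT (fun j => (C1onT (f j)).2 (cf j)) (x := x) I.
Qed.

(** [T] sums the squared excesses of [|x_i - x0_i|] over [a], in units of [b - a]: it vanishes on
    the inner cube and is at least 1 off the outer one, so a ramp in [1 - T] is the required
    function. *)
Lemma exists_cutoff x0 (a b : R) : 0 <= a -> a < b -> exists eta : 'rV[R]_n -> R,
  [/\ C1 eta, forall x, 0 <= eta x <= 1,
    forall x, cube x0 a x -> eta x = 1 /\ grad eta x = 0,
    forall x, ~ cube x0 b x -> eta x = 0 &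
    forall x, `|grad eta x| <= 4 / (b - a)].
Proof.
move=> a0 ab; pose c := (b - a)^-1; have c0 : 0 < c by rewrite invr_gt0 subr_gt0.
pose th i (x : 'rV[R]_n) := psq (c * x ord0 i + (- c * (x0 ord0 i + a))) + psq (- c * x ord0 i + c * (x0 ord0 i - a)).
pose th' i (x : 'rV[R]_n) := 2 * c * (pos (c * x ord0 i + (- c * (x0 ord0 i + a))) - pos (- c * x ord0 i + c * (x0 ord0 i - a))).
have gth i x : C1 (th i) /\ grad (th i) x = th' i x *: delta_mx ord0 i.
  have h1 := C11_aff c (- c * (x0 ord0 i + a)) 1 C11_psq.
  have h2 := C11_aff (- c) (c * (x0 ord0 i - a)) 1 C11_psq.
  have := C11D h1 h2; set P := fun t => _; set P' := fun t => _; move: (_ + _) => L h.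
  have E : th i = P \o (fun y : 'rV[R]_n => y ord0 i).
    by apply/funext => y; rewrite /th/= /P !mul1r.
  rewrite E; split.
    by apply/C1onT; apply: (C11_C1on openT h); exact: C1on_coord.
  have [_ dP _] := h; have [dc gc] := grad_coord i x.
  rewrite (grad_comp dc (dP _)).2 gc; congr (_ *: _); rewrite /P' /th'; ring.
have th0 i x : 0 <= th i x by rewrite addr_ge0// sqr_ge0.
have thQ i x : `|x ord0 i - x0 ord0 i| <= a -> th i x = 0 /\ th' i x = 0.
  rewrite ler_norml => /andP[h1 h2]; rewrite /th /th' /psq !pos_out; first by split; ring.
    by rewrite mulNr -mulNr; nra.
  by nra.
have thn i x : b <= `|x ord0 i - x0 ord0 i| -> 1 <= th i x.
  have cb : c * (b - a) = 1 by rewrite mulVf// gt_eqF// subr_gt0.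
  rewrite ler_normr => /orP[h|h].
    have h1 : 1 <= pos (c * x ord0 i + - c * (x0 ord0 i + a)) by rewrite /pos le_max; apply/orP; right; nra.
    rewrite /th (@le_trans _ _ (psq (c * x ord0 i + - c * (x0 ord0 i + a))))// ?lerDl ?sqr_ge0//.
    by rewrite /psq -[leLHS](expr1n _ 2) lerXn2r// nnegrE// pos_ge0.
  have h1 : 1 <= pos (- c * x ord0 i + c * (x0 ord0 i - a)) by rewrite /pos le_max; apply/orP; right; nra.
  rewrite /th (@le_trans _ _ (psq (- c * x ord0 i + c * (x0 ord0 i - a))))// ?lerDr ?sqr_ge0//.
  by rewrite /psq -[leLHS](expr1n _ 2) lerXn2r// nnegrE// pos_ge0.
have th'b i x : th i x <= 1 -> `|th' i x| <= 2 * c.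
  rewrite /th /th' => h; rewrite normrM ger0_norm ?mulr_ge0 ?(ltW c0)//.
  apply: ler_piMr; first by rewrite mulr_ge0// ltW.
  move: h; rewrite /psq; set A := pos _; set B := pos _.
  have A0 : 0 <= A by exact: pos_ge0. have B0 : 0 <= B by exact: pos_ge0.
  move=> h; rewrite ler_norml; apply/andP; split; nra.
pose T (x : 'rV[R]_n) := \sum_i th i x.
(* This ramp climbs from 0 at 0 to 1/2 at 1 with slope at most 1; the factor 2 normalizes it and,
   together with [th'b], gives the gradient bound [2 * (2 * c)]. *)
pose eta x := 2 * ramp 0 (1 / 2) (1 - T x).
have [L [L0 dR lR]] := @C11_ramp R 0 (1 / 2).
have cT : C1on setT (fun x => 1 - T x).
  rewrite (_ : (fun x => 1 - T x) = (fun=> 1) \- T) //; apply: C1onB; [exact: openT|exact: C1on_cst|].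
  by apply: C1on_sum; [exact: openT|move=> i; apply/C1onT; exact: (gth i 0).1].
have h2 : C11 (fun t => 2 * ramp 0 (1 / 2) (1 * t + 0)) (fun t => 2 * (1 * ramp' 0 (1 / 2) (1 * t + 0))) (`|2| * 1 ^+ 2 * L).
  exact: C11_aff.
have gT x : grad (fun x => 1 - T x) x = - \sum_i grad (th i) x.
  rewrite -grad_sum; last by move=> i; exact: (gth i 0).1.
  rewrite (_ : (fun x => 1 - T x) = (fun=> 1) \- T)// gradB ?grad_cst ?sub0r//.
  have /C1onT h : C1on setT T by apply: C1on_sum; [exact: openT|move=> i; apply/C1onT; exact: (gth i 0).1].
  exact: C1_diff.
have etaE : eta = (fun t => 2 * ramp 0 (1 / 2) (1 * t + 0)) \o (fun x => 1 - T x).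
  by apply/funext => x; rewrite [RHS]/comp (mul1r (1 - T x)) addr0.
have ce : C1 eta by rewrite etaE; apply/C1onT; apply: (C11_C1on openT h2).
have ge x : grad eta x = - (2 * ramp' 0 (1 / 2) (1 - T x)) *: \sum_i grad (th i) x.
  have [_ dP _] := h2; rewrite etaE (grad_comp (cT x I).1 (dP _)).2 gT.
  by rewrite scalerN scaleNr (mul1r (1 - T x)) addr0 (mul1r (ramp' _ _ _)).
have T0 x : 0 <= T x by apply: sumr_ge0 => i _.
have geC x i : (grad eta x) ord0 i = - (2 * ramp' 0 (1 / 2) (1 - T x)) * th' i x.
  rewrite ge mxE; congr (_ * _); rewrite summxE (bigD1 i)//= big1 ?addr0.
    by rewrite (gth i x).2 !mxE !eqxx mulr1.
  by move=> j ji; rewrite (gth j x).2 !mxE eqxx eq_sym (negPf ji) mulr0.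
have half0 : (0 : R) <= 1 / 2 by rewrite divr_ge0.
exists eta; split => //.
- by move=> x; have := ramp_bound 0 (1 - T x) half0; rewrite /eta; lra.
- move=> x; rewrite /cube/= => /(rV_norm_leP _ a0) hx.
  have hx' i : `|x ord0 i - x0 ord0 i| <= a by have := hx i; rewrite rV_coordB.
  have TE : T x = 0 by rewrite /T big1// => i _; exact: (thQ i x (hx' i)).1.
  split.
    by rewrite /eta TE subr0 (ramp1 half0 _).1; [field|lra].
  by apply/rowP => i; rewrite geC (thQ i x (hx' i)).2 mulr0 mxE.
- move=> x; rewrite /cube/= => /negP; rewrite -ltNge => hx.
  have [i hi] : exists i, b <= `|x ord0 i - x0 ord0 i|.
    apply: contrapT => /forallNP h; move: hx; rewrite ltNge => /negP; apply.
    apply/rV_norm_leP; first by rewrite ltW// (le_lt_trans a0).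
    by move=> i; rewrite rV_coordB ltW// ltNge; apply/negP/h.
  rewrite /eta (ramp0 half0 _).1 ?mulr0// subr_le0 (le_trans (thn i x hi))//.
  by rewrite /T (bigD1 i)//= lerDl sumr_ge0.
- move=> x; rewrite -/c; apply/rV_norm_leP; first by rewrite mulr_ge0// ltW.
  move=> i; rewrite geC normrM normrN.
  have [r0 r1] := andP (ramp'_bound 0 (1 - T x) half0).
  have z0 : 0 <= 2 * ramp' 0 (1 / 2) (1 - T x) by exact: mulr_ge0.
  rewrite (ger0_norm z0).
  have [Tx|Tx] := leP (T x) 1; last first.
    by rewrite (ramp0 half0 _).2 ?mulr0 ?mul0r ?mulr_ge0 ?(ltW c0)//; lra.
  have hi : th i x <= 1 by rewrite (le_trans _ Tx)// /T (bigD1 i)//= lerDl sumr_ge0.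
  have hh := th'b i x hi.
  have -> : 4 * c = 2 * (2 * c) by ring.
  by apply: ler_pM => //; lra.
Qed.

End cutoff.

(** * De Giorgi's method for differences of solutions *)

Section volumes.
Context {R : realType}.
Variable n : nat.
Local Notation mu := (@lebesgue_rV R n).
Implicit Types (A B S : set 'rV[R]_n) (f : 'rV[R]_n -> R).

(** A real number, with the default value 0 when the measure is infinite; hence the integrability
    hypotheses on indicators. *)
Definition vol A : R := \int[mu]_x \1_A x.

Lemma intb_ind A x0 r : measurable A -> A `<=` cube x0 r -> intb (\1_A : _ -> R).
Proof.
move=> mA Ar; apply: (intb_le _ (intb_cube x0 r)); first exact: measurable_indic.
move=> x; rewrite ger0_norm// !indicE; case: (boolP (x \in A)) => // /set_mem/Ar h0.
by rewrite mem_set.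
Qed.

Lemma vol_ge0 A : 0 <= vol A. Proof. exact: Rintegral_ge0. Qed.

Lemma vol_le A B : intb (\1_A : _ -> R) -> intb (\1_B : _ -> R) -> A `<=` B -> vol A <= vol B.
Proof.
move=> iA iB AB; apply: le_Rintegral => // x _; rewrite !indicE.
by case: (boolP (x \in A)) => // /set_mem/AB h0; rewrite mem_set.
Qed.

Lemma vol_cube x0 r : 0 <= r -> vol (cube x0 r) = (2 * r) ^+ n.
Proof. exact: Rint_cube. Qed.

(** The translation estimate is integrated over all [h] in the cube of radius [s]; by Tonelli the
    result dominates the integral over [B] of an inner integral that is at least [c]. *)
Lemma translation_avg f S B (I s c : R) : measurable_fun [set: _] f -> measurable S ->
  0 <= s -> 0 <= I -> 0 <= c ->
  (forall h, `|h| <= s ->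
    (\int[mu]_x (`|f (x + h)%R - f x| * (\1_S x * \1_S (x + h)%R))%:E <= (n%:R * `|h| * I)%:E)%E) ->
  intb (\1_B : _ -> R) ->
  (forall x, B x -> (c%:E <=
     \int[mu]_h (`|f (x + h)%R - f x| * (\1_S x * \1_S (x + h)%R) * \1_(cube 0 s) h)%:E)%E) ->
  c * vol B <= (2 * s) ^+ n * (n%:R * s * I).
Proof.
move=> mf mS s0 I0 c0 hI iB hB.
have mB := intb_measurable iB.
pose F (z : 'rV[R]_n * 'rV[R]_n) : \bar R :=
  (`|f (z.1 + z.2) - f z.1| * (\1_S z.1 * \1_S (z.1 + z.2)) * \1_(cube 0 s) z.2)%:E.
have F0 z : (0 <= F z)%E by rewrite lee_fin !mulr_ge0.
have m12 : measurable_fun [set: 'rV[R]_n * 'rV[R]_n] (fun z => z.1 + z.2).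
  by apply: measurable_addrV; [exact: measurable_fst|exact: measurable_snd].
have m1S : measurable_fun [set: 'rV[R]_n] (\1_S : _ -> R) by exact: measurable_indic.
have mF : measurable_fun [set: _] F.
  apply/measurable_EFinP; apply: measurable_funM; last first.
    apply: (measurableT_comp _ measurable_snd); apply: measurable_indic; exact: measurable_cube.
  apply: measurable_funM.
    apply: measurableT_comp => //; apply: measurable_funB; first exact: (measurableT_comp mf m12).
    by apply: (measurableT_comp mf); exact: measurable_fst.
  apply: measurable_funM; last exact: (measurableT_comp m1S m12).
  by apply: (measurableT_comp m1S); exact: measurable_fst.
rewrite -lee_fin; apply: (@le_trans _ _ (\int[mu]_x \int[mu]_y F (x, y))%E).
  rewrite EFinM -(intbE iB) -ge0_integralZl//; last exact/measurable_EFinP.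
  apply: ge0_le_integral => //.
  - by move=> x _; rewrite -EFinM lee_fin mulr_ge0.
  - by apply: emeasurable_funM => //; exact/measurable_EFinP.
  - by apply: (measurable_fun_fubini_tonelli_F (m2 := mu) F).
  - move=> x _; rewrite indicE; case: (boolP (x \in B)) => [/set_mem/hB|_].
      by rewrite mule1.
    by rewrite mule0; exact: integral_ge0.
rewrite fubini_tonelli//.
apply: (@le_trans _ _ (\int[mu]_y ((n%:R * s * I) * \1_(cube 0 s) y)%:E)%E); last first.
  rewrite (intbE (intbZ (n%:R * s * I) (intb_cube 0 s))) lee_fin RintegralZl//; last exact: intb_cube.
  by rewrite -/(vol (cube 0 s)) vol_cube// mulrC.
apply: ge0_le_integral => //.
- by move=> y _; exact: integral_ge0.
- by apply: (measurable_fun_fubini_tonelli_G (m1 := mu) F).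
- by apply/measurable_EFinP; apply: measurable_funM => //; apply: measurable_indic; exact: measurable_cube.
move=> y _; rewrite /F/= indicE; case: (boolP (y \in cube 0 s)) => [/set_mem|_]; last first.
  by rewrite mulr0; under eq_integral do rewrite mulr0; rewrite integral0.
rewrite /cube/= subr0 => ys; under eq_integral do rewrite mulr1.
by rewrite mulr1 (le_trans (hI y ys))// lee_fin ler_wpM2r// ler_wpM2l.
Qed.

Lemma ge0_int_shift (f : 'rV[R]_n -> R) x : measurable_fun [set: _] f -> (forall y, 0 <= f y) ->
  (\int[mu]_h (f (x + h)%R)%:E = \int[mu]_h (f h)%:E)%E.
Proof.
move=> mf f0; rewrite -(ge0_integral_rV_shift x (f := fun y => (f y)%:E))//.
- by apply: eq_integral => y _; rewrite addrC.
- exact/measurable_EFinP.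
Qed.

Lemma measurable_shiftl d (T : measurableType d) (f : 'rV[R]_n -> T) x :
  measurable_fun [set: _] f -> measurable_fun [set: 'rV[R]_n] (fun h => f (x + h)).
Proof.
move=> mf; rewrite (_ : (fun h => _) = fun h => f (h + x)); first exact: measurable_funrV_shift.
by apply/funext => h; rewrite addrC.
Qed.

(** A point of [E] sees values at most [lam / 2] in at least half of the cube of radius [r] around
    it, because [E'] fills at most half of such a cube; so the average oscillation there is at least
    [lam / 4]. With [r] adapted to the volume of [E'], this takes the place of Sobolev's
    inequality. *)
Lemma isoperimetric f E E' (I r lam : R) : measurable_fun [set: _] f -> 0 < lam -> 0 < r -> 0 <= I ->
  (forall h, (\int[mu]_x (`|f (x + h)%R - f x|)%:E <= (n%:R * `|h| * I)%:E)%E) ->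
  intb (\1_E : _ -> R) -> intb (\1_E' : _ -> R) ->
  (forall x, E x -> lam <= f x) -> (forall x, lam / 2 < f x -> E' x) ->
  2 * vol E' <= (2 * r) ^+ n -> lam * vol E <= 4 * (n%:R * r * I).
Proof.
move=> mf l0 r0 I0 hI iE iE' El E'l vr.
have r2 : 0 < (2 * r) ^+ n by rewrite exprn_gt0// mulr_gt0.
pose c := lam / 4 * (2 * r) ^+ n.
have c0 : 0 <= c by rewrite mulr_ge0 ?divr_ge0// ltW.
suff h : c * vol E <= (2 * r) ^+ n * (n%:R * r * I).
  rewrite -(ler_pM2l r2) mulrCA [leRHS]mulrCA -ler_pdivrMl// mulrA; apply: le_trans h.
  by rewrite /c le_eqVlt -subr_eq0 (_ : _ - _ = 0) ?eqxx//; field.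
apply: (translation_avg mf measurableT (ltW r0) I0 c0 _ iE) => [h _|x Ex].
  apply: le_trans (hI h); rewrite le_eqVlt; apply/orP; left; apply/eqP.
  by apply: eq_integral => x _; rewrite !indicT/= !mulr1.
have mc : measurable_fun [set: 'rV[R]_n] (\1_(cube 0 r) : _ -> R).
  by apply: measurable_indic; exact: measurable_cube.
set J := (\int[mu]_h _)%E.
have mE' := intb_measurable iE'.
have mEx : measurable_fun [set: 'rV[R]_n] (fun h => \1_E' (x + h) : R) by exact: measurable_shiftl.
have mP : measurable_fun [set: 'rV[R]_n] (fun h => `|f (x + h) - f x| * \1_(cube 0 r) h).
  apply: measurable_funM => //; apply: measurableT_comp => //; apply: measurable_funB => //.
  exact: measurable_shiftl.
have JE : J = (\int[mu]_h (`|f (x + h)%R - f x| * \1_(cube 0 r) h)%:E)%E.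
  by apply: eq_integral => h _; rewrite !indicT/= !mulr1.
have l2 : 0 <= lam / 2 by rewrite divr_ge0// ltW.
have e1 : ((lam / 2 * (2 * r) ^+ n)%:E = \int[mu]_h (lam / 2 * \1_(cube 0 r) h)%:E)%E.
  by rewrite ge0_intZE// (intbE (intb_cube 0 r)) -EFinM -(vol_cube 0 (ltW r0)).
have e2 : ((lam / 2 * vol E')%:E = \int[mu]_h (lam / 2 * \1_E' (x + h)%R)%:E)%E.
  by rewrite ge0_intZE// (ge0_int_shift x mE')// (intbE iE') -EFinM.
have : ((lam / 2 * (2 * r) ^+ n)%:E <= J + (lam / 2 * vol E')%:E)%E.
  rewrite e1 e2 JE -ge0_intDE//; last 2 first.
  - exact: measurable_funM.
  - by move=> h; rewrite mulr_ge0.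
  apply: ge0_int_le; first exact: measurable_funM.
    by apply: measurable_funD => //; exact: measurable_funM.
  move=> h; rewrite mulr_ge0//= indicE; case: (boolP (h \in cube 0 r)) => _; last first.
    by rewrite !mulr0 add0r mulr_ge0.
  rewrite !mulr1 indicE; have [h1|h1] := ltP (lam / 2) (f (x + h)).
    by rewrite mem_set ?mulr1 ?lerDr//; exact: E'l.
  apply: (@le_trans _ _ `|f (x + h) - f x|); last by rewrite lerDl mulr_ge0.
  by rewrite distrC (le_trans _ (ler_norm _))//; have := El _ Ex; lra.
rewrite -leeBlDr//; apply: le_trans; rewrite -EFinB lee_fin /c.
have : lam / 2 * vol E' <= lam / 2 * ((2 * r) ^+ n / 2) by rewrite ler_wpM2l//; lra.
by lra.
Qed.

(** From a point of [B] every point of [A] is reached by some [h] in the cube of radius [2 * r],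
    with a jump of at least [lam]; so the inner integral is at least [lam * vol A]. *)
Lemma poincare f x0 A B (I r lam a : R) : measurable_fun [set: _] f -> 0 <= lam -> 0 < r -> 0 <= I ->
  (forall h, (\int[mu]_x (`|f (x + h)%R - f x| * (\1_(cube x0 r) x * \1_(cube x0 r) (x + h)%R))%:E <=
     (n%:R * `|h| * I)%:E)%E) ->
  measurable A -> measurable B -> A `<=` cube x0 r -> B `<=` cube x0 r ->
  (forall x, A x -> f x <= a) -> (forall x, B x -> a + lam <= f x) ->
  lam * vol A * vol B <= (4 * r) ^+ n * (n%:R * (2 * r) * I).
Proof.
move=> mf l0 r0 I0 hI mA mB AQ BQ fA fB.
have -> : 4 * r = 2 * (2 * r) by ring.
have c0 : 0 <= lam * vol A by rewrite mulr_ge0// vol_ge0.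
have r20 : 0 <= 2 * r by rewrite mulr_ge0// ltW.
have mQ := @measurable_cube R n x0 r.
have mc : measurable_fun [set: 'rV[R]_n] (\1_(cube 0 (2 * r)) : _ -> R).
  by apply: measurable_indic; exact: measurable_cube.
have mQ1 : measurable_fun [set: 'rV[R]_n] (\1_(cube x0 r) : _ -> R) by exact: measurable_indic.
apply: (translation_avg mf mQ r20 I0 c0 (fun h _ => hI h) (intb_ind mB BQ)) => x Bx.
have iA := intb_ind mA AQ.
rewrite EFinM -(intbE iA) -(ge0_int_shift x (intb_measurable iA))//.
have mAx : measurable_fun [set: 'rV[R]_n] (fun h => \1_A (x + h) : R).
  exact: measurable_shiftl (intb_measurable iA).
rewrite -ge0_intZE//; apply: ge0_int_le; first exact: measurable_funM.
  apply: measurable_funM => //; apply: measurable_funM.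
    apply: measurableT_comp => //; apply: measurable_funB => //; exact: measurable_shiftl.
  by apply: measurable_funM => //; apply: (measurable_shiftl x mQ1).
move=> h; rewrite mulr_ge0//= indicE; case: (boolP (x + h \in A)) => [/set_mem Ah|_]; last first.
  by rewrite mulr0 !mulr_ge0.
have Qx := BQ _ Bx; have Qh := AQ _ Ah.
rewrite !indicE !mem_set//=; last first.
  rewrite /cube/= subr0 (_ : h = (x + h - x0) - (x - x0)); last by rewrite opprB addrA subrK addrC addKr.
  by rewrite (le_trans (ler_normB _ _))// mulr_natl mulr2n lerD.
by rewrite !mulr1 distrC (le_trans _ (ler_norm _))//; have := fA _ Ah; have := fB _ Bx; lra.
Qed.

End volumes.

(** * Energy estimates for differences of solutions *)

Section pairs.
Context {R : realType}.
Variable n : nat.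
Local Notation mu := (@lebesgue_rV R n).
Implicit Types (d : 'rV[R]_n -> R) (D X : 'rV[R]_n -> 'rV[R]_n) (K : set 'rV[R]_n).

(* [d] stands for the difference of two solutions, [D] for its weak gradient and
   [X] for the difference of the fluxes: [Phi(d) eta] is an admissible test
   function, and satisfies the integrated form of [f(x+h) - f(x) = int grad f]. *)
Definition diffpair K d D X := [/\ measurable_fun [set: _] d,
  measurable_fun [set: _] D, measurable_fun [set: _] X &
  forall Phi Phi' L eta, C11 Phi Phi' L -> C1 eta -> (forall x, ~ K x -> eta x = 0) ->
  let F x := (Phi' (d x) * eta x) *: D x + Phi (d x) *: grad eta x in
  [/\ intb (fun x => `|F x|), intb (fun x => dotv (X x) (F x)),
      \int[mu]_x dotv (X x) (F x) = 0 &
   forall S h, measurable S -> convex_setrV S ->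
   (\int[mu]_x (`|Phi (d (x + h)%R) * eta (x + h)%R - Phi (d x) * eta x| *
       (\1_S x * \1_S (x + h)%R))%:E <=
    (n%:R * `|h| * \int[mu]_x (`|F x| * \1_S x))%:E)%E]].

(** A truncation of [a * d + b] is a truncation of [d], by composing [Phi] with an affine map. The
    case [a = -1] exchanges superlevel and sublevel sets. *)
Lemma diffpair_aff K d D X (a b : R) : diffpair K d D X ->
  diffpair K (fun x => a * d x + b) (fun x => a *: D x) (fun x => a *: X x).
Proof.
move=> [md mD mX h]; split.
- by apply: measurable_funD => //; exact: measurable_funM.
- by apply: (measurable_scale (a := cst a)).
- by apply: (measurable_scale (a := cst a)).
move=> Phi Phi' L eta cP ce eK; have cP' := C11_aff a b 1 cP.
have [] := h _ _ _ eta cP' ce eK.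
set F1 := fun x => `|_|; set F2 := fun x => dotv _ _ => i1 i2 E0 TE F.
have EF x : (1 * (a * Phi' (a * d x + b)) * eta x) *: D x + (1 * Phi (a * d x + b)) *: grad eta x = F x.
  by rewrite /F !mul1r scalerA; congr (_ *: _ + _); ring.
have E1 : F1 = fun x => `|F x| by apply/funext => x; rewrite /F1 EF.
have E2 : F2 = fun x => dotv (X x) (F x) by apply/funext => x; rewrite /F2 EF.
have i2' : intb (fun x => dotv (X x) (F x)) by rewrite -E2.
split.
- by rewrite -E1.
- rewrite (_ : (fun x => _) = fun x => a * dotv (X x) (F x)); first exact: intbZ.
  by apply/funext => x; rewrite dotvZl.
- under eq_Rintegral do rewrite dotvZl.
  by rewrite RintegralZl// -E2 E0 mulr0.
- move=> S v mS cS; have := TE S v mS cS.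
  have -> : \int[mu]_x (F1 x * \1_S x) = \int[mu]_x (`|F x| * \1_S x) by rewrite E1.
  by under eq_integral do rewrite !mul1r.
Qed.

(** The test function is [pos d ^ 2 * e ^ q]. The exponent will be the upper growth exponent of the
    flux, so that the derivative of the cutoff, of order [e ^ (q - 1)], can be absorbed in
    [energy_ptw]. *)
Lemma energy_field K d D X e (q : nat) : diffpair K d D X -> C1 e -> (1 < q)%N ->
  (forall x, ~ K x -> e x = 0) ->
  let F x := (2 * pos (d x) * e x ^+ q) *: D x + (pos (d x) ^+ 2 * (q%:R * e x ^+ q.-1)) *: grad e x in
  [/\ intb (fun x => `|F x|), intb (fun x => dotv (X x) (F x)),
      \int[mu]_x dotv (X x) (F x) = 0 &
   forall h, (\int[mu]_x (`|psq (d (x + h)%R) * e (x + h)%R ^+ q - psq (d x) * e x ^+ q|)%:E <=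
    (n%:R * `|h| * \int[mu]_x `|F x|)%:E)%E].
Proof.
move=> [_ _ _ h] ce q1 eK.
have dX (t : R) : is_derive t (1:R) (fun t => t ^+ q) (q%:R * t ^+ q.-1).
  have := is_deriveX q (is_derive_id t (1:R)); rewrite /GRing.scale/= mulr1 => h1.
  by rewrite (_ : (fun t => t ^+ q) = (id : R -> R) ^+ q)//; apply/funext => s; rewrite exprfctE.
have ceq : C1 (fun x => e x ^+ q).
  have ce' : C1on setT e by exact/C1onT.
  apply/C1onT; apply: (@C1on_comp R n setT _ (fun t => q%:R * t ^+ q.-1) e openT ce' (fun x _ => dX _)) => x _.
  by apply: (@continuousM _ _ (cst q%:R)); [exact: cst_continuous|exact: exprn_continuous].
have gq x : grad (fun x => e x ^+ q) x = (q%:R * e x ^+ q.-1) *: grad e x.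
  by have [_ <-] := grad_comp (C1_diff x ce) (dX _).
have eqK x : ~ K x -> e x ^+ q = 0.
  by move=> /eK ->; rewrite expr0n; case: q q1 {dX ceq gq}.
have [] := h _ _ _ _ (@C11_psq R) ceq eqK.
set F1 := fun x => `|_|; set F2 := fun x => dotv _ _ => i1 i2 E0 TE F.
have EF x : (2 * pos (d x) * e x ^+ q) *: D x + psq (d x) *: grad (fun x => e x ^+ q) x = F x.
  by rewrite /F gq scalerA.
have E1 : F1 = fun x => `|F x| by apply/funext => x; rewrite /F1 EF.
have E2 : F2 = fun x => dotv (X x) (F x) by apply/funext => x; rewrite /F2 EF.
split; [by rewrite -E1|by rewrite -E2|by rewrite -E2|move=> v].
have := TE setT v measurableT (@convex_setrVT R n).
have -> : \int[mu]_x (F1 x * \1_setT x) = \int[mu]_x (`|F x|).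
  by rewrite E1; apply: eq_Rintegral => x _; rewrite indicT/= mulr1.
move=> h1; apply: le_trans h1; rewrite le_eqVlt; apply/orP; left; apply/eqP.
by apply: eq_integral => x _; rewrite !indicT/= !mulr1.
Qed.

(** The product [t * g t] grows with exponents between [m] and [q]. The lower bound makes [g]
    increase by a prescribed factor under dilation; the upper bound allows cutoffs to be
    absorbed. *)
Definition orlicz (m : R) (q : nat) (g : R -> R) :=
  [/\ forall t, 0 < t -> 0 < g t, g 0 = 0,
   forall l t, 1 <= l -> 0 <= t -> l `^ (m - 1) * g t <= g (l * t) &
   forall l t, 1 <= l -> 0 <= t -> g (l * t) <= l ^+ q.-1 * g t].

Lemma orlicz_ge0 m q g t : orlicz m q g -> 0 <= t -> 0 <= g t.
Proof. by move=> [h g0 _ _]; rewrite le_eqVlt => /predU1P[<-|/h/ltW//]; rewrite g0. Qed.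

Lemma orlicz_mono m q g s t : 1 <= m -> orlicz m q g -> 0 <= s -> s <= t -> g s <= g t.
Proof.
move=> m1 og s0 st; have [_ g0 h _] := og.
have t0 := le_trans s0 st; move: s0; rewrite le_eqVlt => /predU1P[<-|s0].
  by rewrite g0 (orlicz_ge0 og).
have l1 : 1 <= t / s by rewrite ler_pdivlMr// mul1r.
have := h (t / s) s l1 (ltW s0); rewrite divfK ?gt_eqF//; apply: le_trans.
rewrite -[leLHS]mul1r ler_wpM2r ?(orlicz_ge0 og (ltW s0))//.
by rewrite -[X in X <= _](powRr0 (t / s)) ler_powR// subr_ge0.
Qed.

(** The base of the power [q.-1] is the threshold [A] of the case distinction in [energy_ptw]. *)
Definition energy_const (q : nat) (c0 C0 : R) : R :=
  q%:R * n%:R * C0 * (q%:R * n%:R * C0 / c0 + 1) ^+ q.-1.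

Lemma energy_const_ge0 q c0 C0 : 0 < c0 -> 0 <= C0 -> 0 <= energy_const q c0 C0.
Proof.
move=> c00 C00; rewrite /energy_const mulr_ge0 ?mulr_ge0// exprn_ge0// addr_ge0//.
by rewrite divr_ge0 ?mulr_ge0// ltW.
Qed.

(** First claim: either the cutoff term is absorbed by half of the coercive term, or [|D|] is at
    most a multiple of [v * L / e], and the upper growth of [g] then cancels the powers of [e].
    Second claim: [|F|] is at most a multiple of [dotv X F], whose integral will vanish, plus a
    constant; so integration yields an L^1 bound for the gradient of the truncation. *)
Lemma energy_ptw m q g (c0 C0 v e L M : R) (D X E : 'rV[R]_n) : 1 <= m -> (1 < q)%N ->
  orlicz m q g -> 0 < c0 -> 0 <= C0 -> 0 <= v <= M -> 0 <= e <= 1 -> `|E| <= L -> 0 < L -> 0 < M ->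
  c0 * (g `|D| * `|D|) <= dotv X D -> `|X| <= C0 * g `|D| ->
  let F := (2 * v * e ^+ q) *: D + (v ^+ 2 * (q%:R * e ^+ q.-1)) *: E in
  let C1 := energy_const q c0 C0 in
  c0 * v * e ^+ q * (g `|D| * `|D|) <= dotv X F + C1 * M * (g (M * L) * (M * L)) /\
  `|F| <= 2 / (c0 * g (M * L)) * dotv X F + (2 + 2 * C1 / c0 + q%:R) * (M ^+ 2 * L).
Proof.
move=> m1 q1 og c00 C00 /andP[v0 vM] /andP[e0 e1] EL L0 M0 XD XC F C1.
have [gp g0 _ gq] := og.
have [L0' M0' c00'] : [/\ 0 <= L, 0 <= M & 0 <= c0] by split; rewrite // ltW.
have D0 : 0 <= `|D| by [].
have gD0 : 0 <= g `|D| by exact: orlicz_ge0 og _.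
have s0 : 0 < M * L by exact: mulr_gt0.
have gs0 : 0 < g (M * L) by exact: gp.
have gs0' := ltW gs0; have s0' := ltW s0.
have eq0 : 0 <= e ^+ q by exact: exprn_ge0.
have eq0' : 0 <= e ^+ q.-1 by exact: exprn_ge0.
pose A := q%:R * n%:R * C0 / c0 + 1.
have B0 : 0 <= q%:R * n%:R * C0 by rewrite !mulr_ge0.
have A1 : 1 <= A by rewrite lerDr divr_ge0.
have A0 : 0 < A by rewrite (lt_le_trans ltr01).
have gvL : g (v * L) <= g (M * L).
  by apply: (orlicz_mono m1 og); rewrite ?mulr_ge0 ?ler_wpM2r.
have gvL0 : 0 <= g (v * L) by apply: orlicz_ge0 og _; rewrite mulr_ge0.
have key : q%:R * n%:R * C0 * e ^+ q.-1 * g `|D| * (v * L) <=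
    c0 * e ^+ q * (g `|D| * `|D|) + C1 * (g (M * L) * (M * L)).
  have C10 : 0 <= C1 by exact: energy_const_ge0.
  have vL0 : 0 <= v * L by rewrite mulr_ge0.
  have vLs : v * L <= M * L by rewrite ler_wpM2r.
  have T0 : 0 <= C1 * (g (M * L) * (M * L)) by rewrite mulr_ge0// mulr_ge0.
  have [h|h] := leP (A * (v * L)) (e * `|D|).
    apply: (@le_trans _ _ (c0 * e ^+ q * (g `|D| * `|D|))); last by rewrite lerDl.
    have -> : e ^+ q = e ^+ q.-1 * e by rewrite -exprSr prednK// ltnW.
    rewrite (_ : _ * (v * L) = e ^+ q.-1 * g `|D| * (q%:R * n%:R * C0 * (v * L))); last by ring.
    rewrite (_ : c0 * _ * _ = e ^+ q.-1 * g `|D| * (c0 * (e * `|D|))); last by ring.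
    apply: ler_wpM2l; first exact: mulr_ge0.
    apply: (@le_trans _ _ (c0 * (A * (v * L)))); last by rewrite ler_wpM2l.
    rewrite /A [leRHS](_ : _ = (q%:R * n%:R * C0 + c0) * (v * L)); last by field; rewrite gt_eqF.
    by rewrite ler_wpM2r// lerDl.
  apply: (@le_trans _ _ (C1 * (g (M * L) * (M * L)))); last first.
    by rewrite lerDr !mulr_ge0.
  have [ez|en] := eqVneq e 0.
    rewrite ez expr0n (_ : (q.-1 == 0)%N = false) ?mulr0 ?mul0r//.
    by case: (q) q1 => // -[].
  have ep : 0 < e by rewrite lt_neqAle eq_sym en.
  have h1 : `|D| <= A / e * (v * L).
    by rewrite ltW// mulrAC ltr_pdivlMr// mulrC.
  have Ae : 1 <= A / e by rewrite ler_pdivlMr// mul1r (le_trans e1).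
  have h2 : e ^+ q.-1 * g `|D| <= A ^+ q.-1 * g (M * L).
    have : g `|D| <= (A / e) ^+ q.-1 * g (M * L).
      apply: (le_trans (orlicz_mono m1 og D0 h1)).
      apply: (le_trans (gq _ _ Ae vL0)); apply: ler_wpM2l => //.
      by rewrite exprn_ge0// (le_trans ler01).
    rewrite expr_div_n => h3; rewrite -ler_pdivlMl ?exprn_gt0//.
    by rewrite mulrA [_^-1 * _]mulrC.
  rewrite /C1 /energy_const -/A.
  rewrite (_ : q%:R * n%:R * C0 * _ * _ * _ = q%:R * n%:R * C0 * (e ^+ q.-1 * g `|D|) * (v * L)); last by ring.
  rewrite (_ : _ * A ^+ _ * _ = q%:R * n%:R * C0 * (A ^+ q.-1 * g (M * L)) * (M * L)); last by ring.
  apply: ler_pM => //; first by rewrite !mulr_ge0.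
  exact: ler_wpM2l.
have XE : `|dotv X E| <= n%:R * C0 * g `|D| * L.
  rewrite (le_trans (dotv_bound _ _))//.
  by apply: ler_pM => //; rewrite -mulrA; apply: ler_wpM2l.
have XF : dotv X F = 2 * v * e ^+ q * dotv X D + v * (q%:R * e ^+ q.-1) * (v * dotv X E).
  by rewrite /F dotvDr !dotvZr; ring.
have P1 : c0 * v * e ^+ q * (g `|D| * `|D|) <= dotv X F + C1 * M * (g (M * L) * (M * L)).
  rewrite XF.
  have t1 : 2 * v * e ^+ q * (c0 * (g `|D| * `|D|)) <= 2 * v * e ^+ q * dotv X D.
    by rewrite ler_wpM2l// !mulr_ge0.
  have t2 : - (v * (q%:R * n%:R * C0 * e ^+ q.-1 * g `|D| * (v * L))) <= v * (q%:R * e ^+ q.-1) * (v * dotv X E).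
    rewrite -[leRHS]mulrA -mulrN; apply: ler_wpM2l => //.
    rewrite (_ : - _ = q%:R * e ^+ q.-1 * (v * - (n%:R * C0 * g `|D| * L))); last by ring.
    rewrite ler_wpM2l ?mulr_ge0// ler_wpM2l//.
    by move: XE; rewrite ler_norml => /andP[].
  have t3 := ler_wpM2l v0 key.
  have t4 : v * (C1 * (g (M * L) * (M * L))) <= C1 * M * (g (M * L) * (M * L)).
    rewrite mulrA; apply: ler_wpM2r; first by rewrite mulr_ge0.
    by rewrite mulrC ler_wpM2l// energy_const_ge0.
  move: t3 t2 t1; rewrite mulrDr => t3 t2 t1.
  rewrite -subr_ge0.
  have : v * (c0 * e ^+ q * (g `|D| * `|D|)) = c0 * v * e ^+ q * (g `|D| * `|D|) by ring.
  have : 2 * v * e ^+ q * (c0 * (g `|D| * `|D|)) = 2 * (c0 * v * e ^+ q * (g `|D| * `|D|)) by ring.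
  by lra.
split => //.
(* Where [|D|] exceeds [M * L], monotonicity of [g] bounds it by [g |D| * |D| / g (M * L)], a
   multiple of the energy density. *)
have hD : `|D| <= M * L + g `|D| * `|D| / g (M * L).
  have [h|h] := leP `|D| (M * L).
    by rewrite (le_trans h)// lerDl divr_ge0// ?mulr_ge0.
  rewrite (@le_trans _ _ (g `|D| * `|D| / g (M * L)))// ?lerDr //.
  rewrite ler_pdivlMr// mulrC ler_wpM2r//.
  by apply: (orlicz_mono m1 og); rewrite // ltW.
rewrite /F (le_trans (ler_normD _ _))// normrZ [X in _ + X]normrZ (ger0_norm (_ : 0 <= 2 * v * e ^+ q)) ?mulr_ge0//.
rewrite (ger0_norm (_ : 0 <= v ^+ 2 * (q%:R * e ^+ q.-1))) ?mulr_ge0 ?sqr_ge0//.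
have t1 : v ^+ 2 * (q%:R * e ^+ q.-1) * `|E| <= q%:R * (M ^+ 2 * L).
  rewrite [leRHS](_ : _ = M ^+ 2 * (q%:R * 1) * L); last by ring.
  apply: ler_pM => //; first by rewrite !mulr_ge0 ?sqr_ge0.
  apply: ler_pM => //; first exact: sqr_ge0.
  - by rewrite mulr_ge0.
  - by rewrite lerXn2r// nnegrE.
  - by rewrite ler_wpM2l// exprn_ile1.
have t2 : 2 * v * e ^+ q * `|D| <= 2 * M * (M * L) + 2 / (c0 * g (M * L)) * (c0 * v * e ^+ q * (g `|D| * `|D|)).
  apply: (le_trans (ler_wpM2l _ hD)); first by rewrite !mulr_ge0.
  rewrite mulrDr; apply: lerD.
    rewrite ler_wpM2r //; apply: (@le_trans _ _ (2 * v * 1)).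
      by rewrite ler_wpM2l ?mulr_ge0// exprn_ile1.
    by rewrite mulr1 ler_wpM2l.
  rewrite le_eqVlt (_ : _ == _) //; apply/eqP; field.
  by rewrite !gt_eqF.
have cg0 : 0 < 2 / (c0 * g (M * L)) by rewrite divr_gt0// mulr_gt0.
have t3 := ler_wpM2l (ltW cg0) P1.
have E3 : 2 / (c0 * g (M * L)) * (C1 * M * (g (M * L) * (M * L))) = 2 * C1 / c0 * (M ^+ 2 * L).
  by field; rewrite !gt_eqF.
rewrite mulrDr E3 in t3.
have -> : (2 + 2 * C1 / c0 + q%:R) * (M ^+ 2 * L) = 2 * M * (M * L) + 2 * C1 / c0 * (M ^+ 2 * L) + q%:R * (M ^+ 2 * L) by ring.
lra.
Qed.

End pairs.

Ltac posit := match goal with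
 | |- is_true (0 < _) => first [done | solve [auto] | apply: mulr_gt0; posit |
     rewrite invr_gt0; posit | apply: exprn_gt0; posit | apply: powR_gt0; posit |
     apply: ltr_wpDl; posit | apply: ltr_pwDl; posit ]
 | |- is_true (0 <= _) => first [done | solve [auto] | (apply: ltW; solve [auto]) |
     apply: mulr_ge0; posit | rewrite invr_ge0; posit | apply: exprn_ge0; posit |
     apply: addr_ge0; posit | exact: powR_ge0 | exact: normr_ge0 | exact: sqr_ge0 ]
 end.

(** * Upper bounds from small superlevel sets *)

Section degiorgi.
Context {R : realType}.
Variable n : nat.
Hypothesis n0 : (0 < n)%N.
Local Notation mu := (@lebesgue_rV R n).
Variables (m c0 C0 : R) (q : nat).
Hypotheses (m1 : 1 < m) (q1 : (1 < q)%N) (c00 : 0 < c0) (C00 : 0 <= C0).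
Implicit Types (g : R -> R) (d : 'rV[R]_n -> R) (D X : 'rV[R]_n -> 'rV[R]_n) (K : set 'rV[R]_n).

(** [m], [c0], [C0] and [q] are fixed in the section while [g] varies with the pair, so that the
    constants obtained below do not depend on [g]. *)
Definition gpair g K d D X := [/\ orlicz m q g, diffpair K d D X &
  forall x, K x -> c0 * (g `|D x| * `|D x|) <= dotv (X x) (D x) /\ `|X x| <= C0 * g `|D x|].

(** Only [|a| = 1]: as [g] is not homogeneous, another scaling of [d] would change it. *)
Lemma gpair_aff g K d D X (a b : R) : gpair g K d D X -> `|a| = 1 ->
  gpair g K (fun x => a * d x + b) (fun x => a *: D x) (fun x => a *: X x).
Proof.
move=> [og dp hb] a1; split; [exact: og|exact: diffpair_aff|].
move=> x /hb; rewrite !normrZ a1 !mul1r dotvZl dotvZr.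
by rewrite [a * (a * _)]mulrA -expr2 -[a ^+ 2]real_normK ?num_real// a1 expr1n mul1r.
Qed.

Let cE1 := energy_const n q c0 C0.
Let cE2 := 2 + 2 * cE1 / c0 + q%:R.

Let cE1_ge0 : 0 <= cE1. Proof. exact: energy_const_ge0. Qed.

Let cE2_gt0 : 0 < cE2.
Proof.
have h : 0 <= 2 * cE1 / c0 by apply: divr_ge0; [exact: mulr_ge0|exact: ltW].
by rewrite /cE2 -addrA ltr_pwDl// addr_ge0.
Qed.

Let exp0q : 0 ^+ q = 0 :> R. Proof. by rewrite expr0n; case: (q) q1. Qed.

Let exp0q1 : 0 ^+ q.-1 = 0 :> R.
Proof. by rewrite expr0n; case: (q) q1 => // -[]. Qed.

(** The multiple of [dotv X F] in [energy_ptw] integrates to 0, which leaves a constant on [B], a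
    set outside which the field vanishes. *)
Lemma energy_int g K d D X e B (L M : R) : gpair g K d D X -> C1 e ->
  (forall x, ~ K x -> e x = 0) -> (forall x, 0 <= e x <= 1) -> (forall x, `|grad e x| <= L) ->
  0 < L -> 0 < M -> intb (\1_B : _ -> R) -> (forall x, e x != 0 -> 0 < d x -> B x) ->
  (forall x, B x -> K x /\ d x <= M) ->
  \int[mu]_x `|(2 * pos (d x) * e x ^+ q) *: D x + (pos (d x) ^+ 2 * (q%:R * e x ^+ q.-1)) *: grad e x|
    <= cE2 * (M ^+ 2 * L) * vol B.
Proof.
move=> [og dp hb] ce eK e01 eL L0 M0 iB dB BK.
move: (energy_field dp ce q1 eK) => /[let] F [i1 i2 E0 _].
pose a := 2 / (c0 * g (M * L)).
have -> : cE2 * (M ^+ 2 * L) * vol B = \int[mu]_x (a * dotv (X x) (F x) + cE2 * (M ^+ 2 * L) * \1_B x).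
  rewrite RintegralD//; [|exact: intbZ|exact: intbZ].
  by rewrite !RintegralZl// E0 mulr0 add0r.
apply: le_Rintegral => //; first by apply: intbD; exact: intbZ.
move=> x _; rewrite indicE; have [Bx|nB] := EM (B x).
  rewrite mem_set// mulr1; have [Kx dM] := BK x Bx; have [h1 h2] := hb x Kx.
  have vM : 0 <= pos (d x) <= M by rewrite pos_ge0/= /pos ge_max (ltW M0) dM.
  by have [_] := energy_ptw (ltW m1) q1 og c00 C00 vM (e01 x) (eL x) L0 M0 h1 h2.
rewrite memNset// mulr0 addr0.
have F0 : F x = 0.
  rewrite /F; have [ez|en] := eqVneq (e x) 0.
    by rewrite ez exp0q exp0q1 !mulr0 !scale0r addr0.
  have d0 : d x <= 0 by rewrite leNgt; apply/negP => h; exact/nB/dB.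
  by rewrite pos_out// expr2 !mulr0 !mul0r !scale0r addr0.
by rewrite -/(F x) F0 normr0 dotv0r mulr0.
Qed.

Lemma half_small (C e : R) : 0 < e -> exists j, C * (2^-1) ^+ j < e.
Proof.
move=> e0; have [j hj] : exists j : nat, `|C| / e < j%:R.
  by exists (Num.bound (`|C| / e)); apply: archi_boundP; rewrite divr_ge0// ltW.
exists j; apply: (@le_lt_trans _ _ (`|C| * 2^-1 ^+ j)).
  by rewrite ler_wpM2r ?ler_norm// exprn_ge0// invr_ge0.
rewrite exprVn ltr_pdivrMr ?exprn_gt0//; move: hj; rewrite ltr_pdivrMr// => hj.
rewrite (lt_le_trans hj)// mulrC ler_wpM2l ?(ltW e0)//.
by rewrite -natrX ler_nat ltnW// ltn_expl.
Qed.

Lemma measurable_cut d (P : R -> bool) K : measurable_fun [set: _] d -> measurable K ->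
  measurable [set t : R | P t] -> measurable ([set x | P (d x)] `&` K).
Proof.
move=> md mK mP; apply: measurableI => //.
rewrite (_ : [set x | P (d x)] = setT `&` d @^-1` [set t | P t]); first exact: md.
by rewrite setTI.
Qed.

Lemma measurable_gtcut d (k : R) K : measurable_fun [set: _] d -> measurable K ->
  measurable ([set x | k < d x] `&` K).
Proof.
move=> md mK; apply: (measurable_cut (P := fun t => k < t) md mK).
rewrite (_ : mkset _ = `]k, +oo[%classic); first exact: measurable_itv.
by apply/seteqP; split => t/=; rewrite in_itv/= ?andbT.
Qed.

Lemma measurable_ltcut d (k : R) K : measurable_fun [set: _] d -> measurable K ->
  measurable ([set x | d x < k] `&` K).
Proof.
move=> md mK; apply: (measurable_cut (P := fun t => t < k) md mK).
rewrite (_ : mkset _ = `]-oo, k[%classic); first exact: measurable_itv.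
by apply/seteqP; split => t/=; rewrite in_itv/=.
Qed.

Lemma measurable_gecut d (k : R) K : measurable_fun [set: _] d -> measurable K ->
  measurable ([set x | k <= d x] `&` K).
Proof.
move=> md mK; apply: (measurable_cut (P := fun t => k <= t) md mK).
rewrite (_ : mkset _ = `[k, +oo[%classic); first exact: measurable_itv.
by apply/seteqP; split => t/=; rewrite in_itv/= ?andbT.
Qed.

Lemma cube_mono (x0 : 'rV[R]_n) (r s : R) : r <= s -> cube x0 r `<=` cube x0 s.
Proof. by move=> rs x; rewrite /cube/= => /le_trans; exact. Qed.

(* The superlevel sets at the levels [lam M (1 - 2^-j)] on shrinking cubes have
   volume at most [(2 tau rho 8^-j)^n / 2]. *)
Lemma degiorgi (lam : R) : 0 < lam -> exists2 nu, 0 < nu &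
  forall g K d D X x0 rho M, gpair g K d D X -> 0 < rho -> 0 < M ->
  cube x0 (2 * rho) `<=` K -> (forall x, cube x0 (2 * rho) x -> d x <= M) ->
  vol ([set x | 0 < d x] `&` cube x0 (2 * rho)) <= nu * rho ^+ n ->
  (forall x, cube x0 rho x -> {for x, continuous d}) ->
  forall x, cube x0 rho x -> d x <= lam * M.
Proof.
(* Chosen to close the recursion: [64 * n * cE2 * tau] is at most [lam ^ 2 / (4 * 8 ^ n)]. *)
move=> l0; pose tau := lam ^+ 2 / (8 ^+ n * (256 * n%:R * cE2 + 1)).
have D0 : 0 < 256 * n%:R * cE2 + 1 := ltr_wpDl (mulr_ge0 (mulr_ge0 (ler0n _ _) (ler0n _ _)) (ltW cE2_gt0)) ltr01.
have tau0 : 0 < tau by exact: (divr_gt0 (exprn_gt0 _ l0) (mulr_gt0 (exprn_gt0 _ (ltr0Sn _ _)) D0)).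
exists ((2 * tau) ^+ n / 2); first by rewrite divr_gt0// exprn_gt0// mulr_gt0.
move=> g K d D X x0 rho M gp r0 M0 QK dM vA cd.
have [_ [md _ _ _] _] := gp.
pose z j : R := 2^-1 ^+ j; have z0 j : 0 < z j by rewrite exprn_gt0// invr_gt0.
have z1 j : z j <= 1 by rewrite exprn_ile1// ?invr_ge0// invf_le1// ler1n.
have zS j : z j.+1 = z j / 2 by rewrite /z exprSr.
pose k j := lam * M * (1 - z j).
pose r j := rho * (3 / 2 + z j / 2).
(* The scale of the isoperimetric inequality. The squared gap between levels is of order [z j ^ 2]
   and the cutoff gradient of order [1 / z j], so a scale of order [z j ^ 3] balances them. *)
pose s j := tau * rho * z j ^+ 3.
pose a j := (2 * s j) ^+ n / 2.
pose A j := [set x | k j < d x] `&` cube x0 (r j).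
have mA j : measurable (A j) by apply: measurable_gtcut => //; exact: measurable_cube.
have iA j : intb (\1_(A j) : _ -> R) by exact: (intb_ind (mA j) (@subIsetr _ _ _)).
have rr j : rho < r j <= 2 * rho.
  have := z0 j; have := z1 j => h1 h2; rewrite /r; apply/andP; split; nra.
have k0 j : 0 <= k j by rewrite !mulr_ge0 ?subr_ge0// ltW.
have s0 j : 0 < s j by rewrite /s; posit.
have aS j : a j.+1 = a j / 8 ^+ n.
  rewrite /a /s zS (_ : 2 * (tau * rho * (z j / 2) ^+ 3) = 2 * (tau * rho * z j ^+ 3) / 8); last by field.
  by rewrite expr_div_n; field; rewrite expf_neq0.
have key j : vol (A j) <= a j.
  elim: j => [|j IH].
    have A0 : A 0%N = [set x | 0 < d x] `&` cube x0 (2 * rho).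
      by rewrite /A /k /r /z expr0 subrr mulr0 (_ : rho * _ = 2 * rho)//; field.
    rewrite A0 /a /s /z expr0 expr1n mulr1 (_ : (2 * (tau * rho)) ^+ n / 2 = (2 * tau) ^+ n / 2 * rho ^+ n)//.
    by rewrite mulrA exprMn; ring.
  have gp' := gpair_aff (- k j) gp (normr1 R).
  have ab : r j.+1 < r j by rewrite /r zS; have := z0 j; nra.
  have a0 : 0 <= r j.+1 by have /andP[/ltW h _] := rr j.+1; rewrite (le_trans (ltW r0)).
  have [e [ce e01 e1 e0 eL]] := exists_cutoff x0 a0 ab.
  set L := 4 / _ in eL.
  have LE : L = 16 / (rho * z j).
    have dr : r j - r j.+1 = rho * z j / 4 by rewrite /r zS; field.
      by rewrite /L dr; field; rewrite !gt_eqF.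
  have L0 : 0 < L by rewrite LE divr_gt0// mulr_gt0.
  have rjK : cube x0 (r j) `<=` K by apply: subset_trans QK; apply: cube_mono; have /andP[] := rr j.
  have eK x : ~ K x -> e x = 0 by move=> nK; apply: e0 => /rjK.
  have nz x : e x != 0 -> cube x0 (r j) x.
    by move=> ex; apply: contrapT => /e0 h; rewrite h eqxx in ex.
  have dAj x : e x != 0 -> 0 < 1 * d x - k j -> A j x.
    by move=> ex; rewrite mul1r subr_gt0 => h; split => //; exact: nz.
  have AjK x : A j x -> K x /\ 1 * d x - k j <= M.
    move=> [h1 h2]; split; first exact: rjK.
    have : d x <= M by apply: dM; apply: cube_mono h2; have /andP[] := rr j.
    by have := k0 j; lra.
  have EI := energy_int gp' ce eK e01 eL L0 M0 (iA j) dAj AjK.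
  have [_ dp' _] := gp'.
  have [_ _ _ TE] := energy_field dp' ce q1 eK.
  set I := (X in X <= _) in EI.
  have I0 : 0 <= I by apply: Rintegral_ge0.
  pose Lam := (lam * M * (z j / 2)) ^+ 2.
  have Lam0 : 0 < Lam by rewrite /Lam; posit.
  have mf : measurable_fun [set: _] (fun x => psq (1 * d x - k j) * e x ^+ q).
    apply: measurable_funM; last by apply: measurable_funX; exact: C1_measurable.
    apply: measurable_funX; apply: measurable_maxr => //.
    by apply: measurable_funB => //; exact: measurable_funM.
  have fE x : A j.+1 x -> Lam <= psq (1 * d x - k j) * e x ^+ q.
    move=> [h1 h2]; rewrite (e1 x h2).1 expr1n mulr1 /Lam /psq.
    have h : lam * M * (z j / 2) <= 1 * d x - k j.
      by rewrite mul1r; move: h1; rewrite /= /k zS; lra.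
    have h0 : 0 <= lam * M * (z j / 2) by posit.
    rewrite (pos_id (le_trans h0 h)).
    by rewrite lerXn2r// nnegrE// (le_trans h0).
  have fE' x : Lam / 2 < psq (1 * d x - k j) * e x ^+ q -> A j x.
    move=> h; have h0 : 0 < psq (1 * d x - k j) * e x ^+ q by rewrite (lt_trans _ h)// divr_gt0.
    apply: dAj; first by apply: contraTneq h0 => ->; rewrite exp0q mulr0 ltxx.
    by rewrite -pos_gt0 lt_neqAle pos_ge0 andbT eq_sym; apply: contraTneq h0; rewrite /psq => ->; rewrite expr2 !mul0r ltxx.
  have vE' : 2 * vol (A j) <= (2 * s j) ^+ n by move: IH; rewrite /a; lra.
  have := isoperimetric mf Lam0 (s0 j) I0 TE (iA j.+1) (iA j) fE fE' vE' => iso.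
  rewrite aS -(ler_pM2l Lam0); apply: (le_trans iso).
  apply: (@le_trans _ _ (4 * (n%:R * s j * (cE2 * (M ^+ 2 * L) * a j)))).
    apply: ler_wpM2l => //; apply: ler_wpM2l; first by posit.
    by apply: (le_trans EI); apply: ler_wpM2l => //; posit.
  have aj0 : 0 <= a j by rewrite /a; posit.
  have -> : 4 * (n%:R * s j * (cE2 * (M ^+ 2 * L) * a j)) = (64 * n%:R * cE2 * tau * M ^+ 2 * z j ^+ 2) * a j.
    by rewrite LE /s; field; rewrite !gt_eqF.
  have -> : Lam * (a j / 8 ^+ n) = (lam ^+ 2 / (8 ^+ n * 4)) * M ^+ 2 * z j ^+ 2 * a j.
    by rewrite /Lam; field; rewrite expf_neq0.
  apply: ler_wpM2r => //; apply: ler_wpM2r; first by posit.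
  apply: ler_wpM2r; first by posit.
  have e8 : 0 < (8 : R) ^+ n by rewrite exprn_gt0.
  rewrite /tau mulrA ler_pdivrMr ?mulr_gt0//.
  rewrite (_ : lam ^+ 2 / _ * _ = lam ^+ 2 * (64 * n%:R * cE2 + 1 / 4)); last by field; rewrite gt_eqF.
  by rewrite mulrC ler_wpM2l ?sqr_ge0// lerDl divr_ge0.
(* If [d x] exceeded [lam * M], continuity would place one fixed cube inside every [A j], although
   their volumes tend to 0. *)
move=> x Qx; rewrite leNgt; apply/negP => dx.
have ex0 : 0 < (d x - lam * M) / 2 by rewrite divr_gt0// subr_gt0.
have /continuous_epsP/(_ _ ex0)[dl dl0 hdl] := cd x Qx.
pose dd := Num.min (dl / 2) (rho / 2).
have dd0 : 0 < dd by rewrite lt_min !divr_gt0.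
have sub j : cube x dd `<=` A j.
  move=> y; rewrite /cube/= => yx; split.
    have yd : `|y - x| < dl by rewrite (le_lt_trans yx)// /dd gt_min; apply/orP; left; lra.
    have := hdl _ yd; rewrite (addrC x) subrK ler_norml => /andP[+ _].
    have : k j <= lam * M by rewrite /k; apply: ler_piMr; [posit|rewrite gerBl ltW].
    by rewrite /=; lra.
  have : dd <= rho / 2 by rewrite ge_min lexx orbT.
  have := ler_normD (y - x) (x - x0); rewrite addrA subrK.
  move: Qx; rewrite /cube/= => Qx h1 h2.
  by rewrite (le_trans h1)// /r; have := z0 j; nra.
have dn0 : 0 < (2 * dd) ^+ n by posit.
have [j hj] := half_small ((2 * (tau * rho)) ^+ n) dn0.
have : (2 * dd) ^+ n <= a j.
  rewrite -(vol_cube x (ltW dd0)); apply: le_trans (key j).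
  by apply: vol_le => //; exact: intb_cube.
apply/negP; rewrite -ltNge; apply: le_lt_trans hj.
rewrite /a /s mulrA exprMn -/(z j).
have t0 : 0 <= (2 * (tau * rho)) ^+ n by posit.
rewrite -mulrA ler_wpM2l// -exprM.
have h : (z j) ^+ (3 * n) <= z j.
  by rewrite -[leRHS]expr1 ler_wiXn2l ?(ltW (z0 _))// muln_gt0.
by have := z0 j; lra.
Qed.

End degiorgi.

(** * Expansion of positivity *)

Section harnack.
Context {R : realType}.
Variable n : nat.
Hypothesis n0 : (0 < n)%N.
Local Notation mu := (@lebesgue_rV R n).
Variables (m c0 C0 : R) (q : nat).
Hypotheses (m1 : 1 < m) (q1 : (1 < q)%N) (c00 : 0 < c0) (C00 : 0 <= C0).
Implicit Types (g : R -> R) (d : 'rV[R]_n -> R) (D X : 'rV[R]_n -> 'rV[R]_n) (K : set 'rV[R]_n).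
Local Notation gpair := (gpair m c0 C0 q).
Let cE1 := energy_const n q c0 C0.
Let cE1_ge0 : 0 <= cE1. Proof. exact: energy_const_ge0. Qed.

Let exp0q : 0 ^+ q = 0 :> R. Proof. by rewrite expr0n; case: (q) q1. Qed.

Let exp0q1 : 0 ^+ q.-1 = 0 :> R.
Proof. by rewrite expr0n; case: (q) q1 => // -[]. Qed.

(* De Giorgi's isoperimetric inequality between the levels [k / 2] and [k]: the
   gradient of the ramp of [d] is estimated by [s] where it is at most [s] and by
   the energy of [2 k - d] elsewhere. *)
Lemma shrink_step (nu th : R) : 0 < nu -> 0 < th -> exists2 c, 0 < c &
  forall g K d D X x0 rho M k, gpair g K d D X -> 0 < rho -> 0 < k -> k <= M ->
  cube x0 (4 * rho) `<=` K -> (forall x, cube x0 (4 * rho) x -> 0 <= d x) ->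
  th * rho ^+ n <= vol ([set x | M <= d x] `&` cube x0 (2 * rho)) ->
  nu * rho ^+ n <= vol ([set x | d x < k / 2] `&` cube x0 (2 * rho)) ->
  c * rho ^+ n <= vol ([set x | d x < k] `&` cube x0 (2 * rho)) -
    vol ([set x | d x < k / 2] `&` cube x0 (2 * rho)).
Proof.
move=> nu0 th0; pose B := 16 * n%:R * 8 ^+ n : R.
have B0 : 0 < B by rewrite /B !mulr_gt0 ?ltr0n ?exprn_gt0.
pose C4 := 8 * 8 ^+ n * cE1 / c0.
have c00' := ltW c00.
have C40 : 0 <= C4 by rewrite /C4; posit.
(* With this value the energy term takes at most half of [nu * th]; the other half bounds the volume
   between the levels from below. *)
pose ep := nu * th / (2 * (B * C4 + 1)).
have ep0 : 0 < ep by rewrite /ep; posit.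
(* By the lower growth exponent [m - 1 > 0], dilation by [l] multiplies [g] by at least [1 / ep].
   The threshold [s] below is [l] times the natural gradient size [2 * k * L]. *)
pose l := 1 + ep^-1 `^ (m - 1)^-1.
have l1 : 1 <= l by rewrite lerDl powR_ge0.
have l0 : 0 < l by exact: lt_le_trans l1.
have lm : ep^-1 <= l `^ (m - 1).
  have m10 : 0 < m - 1 by rewrite subr_gt0.
  have -> : ep^-1 = (ep^-1 `^ (m - 1)^-1) `^ (m - 1).
    by rewrite -powRrM mulVf ?gt_eqF// powRr1// invr_ge0 ltW.
  by apply: powR_mono; [exact: ltW|exact: powR_ge0|rewrite lerDr].
pose T := 4 * l; have T0 : 0 < T by rewrite mulr_gt0.
exists (nu * th / (2 * B * T)); first by posit.
move=> g K d D X x0 rho M k gp r0 k0 kM QK d0 vB vA.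
have [og dp hb] := gp; have [md mD mX hPhi] := dp.
have r20 : 0 < 2 * rho by posit.
have r2' : 2 * rho < 4 * rho by lra.
pose Q := cube x0 (2 * rho).
have QK' : Q `<=` K by apply: subset_trans QK; apply: cube_mono; exact: ltW.
have mQ : measurable Q by exact: measurable_cube.
have [e [ce e01 e1 e0 eL]] := exists_cutoff x0 (ltW r20) r2'.
set L := 4 / _ in eL.
have LE : L = 2 / rho by rewrite /L (_ : 4 * rho - 2 * rho = 2 * rho); [field; rewrite gt_eqF|ring].
have L0 : 0 < L by rewrite LE; posit.
have eK x : ~ K x -> e x = 0 by move=> nK; apply: e0 => /QK.
pose a := k / 2; pose b := k / 4.
have abE : a + 2 * b = k by rewrite /a /b; field.
have kh : k / 2 < k by rewrite ltr_pdivrMr// ltr_pMr// ltr1n.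
have b0 : 0 <= b by rewrite /b; posit.
have [La hR] := C11_ramp a b.
move: (hPhi _ _ _ e hR ce eK) => /[let] F' [i1 _ _ TE].
have absN1 : `|-1| = 1 :> R by rewrite normrN normr1.
(* The pair of [2 * k - d]: since [d] is nonnegative, its positive part is at most [2 * k], and it
   is at least [k] where [d < k]. *)
have gp2 := gpair_aff (2 * k) gp absN1.
have [_ dp2 hb2] := gp2.
move: (energy_field dp2 ce q1 eK) => /[let] F2 [_ i2 E2 _].
pose s := T * k / rho; have s0 : 0 < s by rewrite /s; posit.
have gs0 : 0 < g s by have [h _ _ _] := og; exact: h.
pose G2 := g (2 * k * L) * (2 * k * L).
have G20 : 0 <= G2 by rewrite /G2 mulr_ge0 ?(orlicz_ge0 og)//; posit.
pose A := [set x | k / 2 <= d x] `&` ([set x | d x < k] `&` Q).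
pose Ak := [set x | d x < k] `&` Q.
pose Ak2 := [set x | d x < k / 2] `&` Q.
have mAk : measurable Ak by exact: measurable_ltcut.
have mAk2 : measurable Ak2 by exact: measurable_ltcut.
have mA : measurable A by exact: measurable_gecut.
have iA : intb (\1_A : _ -> R) by exact: (intb_ind mA (fun x Ax => Ax.2.2)).
have iAk : intb (\1_Ak : _ -> R) by exact: (intb_ind mAk (@subIsetr _ _ _)).
have iAk2 : intb (\1_Ak2 : _ -> R) by exact: (intb_ind mAk2 (@subIsetr _ _ _)).
have i4 := @intb_cube R n x0 (4 * rho).
have volA : vol A = vol Ak - vol Ak2.
  rewrite /vol -RintegralB//; apply: eq_Rintegral => x _; rewrite !indicE.
  have [Qx|nQ] := EM (Q x); last first.
    by rewrite !memNset ?subrr// => -[//] => _ [].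
  have [h1|h1] := ltP (d x) (k / 2).
    rewrite [x \in A]memNset; last by move=> [/=]; rewrite leNgt h1.
    by rewrite !mem_set ?subrr//; split => //=; exact: lt_trans h1 kh.
  rewrite [x \in Ak2]memNset; last by move=> [/=]; rewrite ltNge h1.
  rewrite subr0; congr (nat_of_bool _)%:R; apply/idP/idP => /set_mem; last first.
    by move=> h; apply/mem_set.
  by move=> [_ h]; apply/mem_set.
pose c2 := (c0 * k * g s)^-1; have c20 : 0 < c2 by rewrite /c2; posit.
have ptw x : `|F' x| * \1_Q x <= 2 * b * (s * \1_A x +
    c2 * (dotv (-1 *: X x) (F2 x) + cE1 * (2 * k) * G2 * \1_(cube x0 (4 * rho)) x)).
  have k20 : 0 < 2 * k by posit.
  have [Q4|nQ4] := EM (cube x0 (4 * rho) x); last first.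
    have e0x := e0 x nQ4.
    have F20 : F2 x = 0 by rewrite /F2 e0x exp0q exp0q1 !mulr0 !scale0r addr0.
    rewrite F20 dotv0r !indicE [x \in cube _ _]memNset// [x \in Q]memNset; last first.
      by move=> /(cube_mono (ltW r2')).
    by rewrite [x \in A]memNset ?mulr0 ?add0r ?mulr0 ?addr0 ?mulr0// => -[_ [_ /(cube_mono (ltW r2'))]].
  have [h1 h2] := hb2 x (QK x Q4).
  have vM : 0 <= pos (-1 * d x + 2 * k) <= 2 * k.
    by rewrite pos_ge0/= /pos ge_max (ltW k20)/= mulN1r gerDr oppr_le0; exact: d0.
  have [P1 _] := energy_ptw (ltW m1) q1 og c00 C00 vM (e01 x) (eL x) L0 k20 h1 h2.
  rewrite -/(F2 x) -/cE1 -/G2 in P1.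
  rewrite [\1_(cube _ _) x]indicE mem_set// mulr1.
  have gD0 : 0 <= g `|D x| by exact: orlicz_ge0 og _.
  have ND : `|-1 *: D x| = `|D x| by rewrite normrZ absN1 mul1r.
  rewrite ND in P1.
  have W0 : 0 <= dotv (-1 *: X x) (F2 x) + cE1 * (2 * k) * G2.
    apply: le_trans P1; have := pos_ge0 (-1 * d x + 2 * k) => h.
    by have /andP[e0x _] := e01 x; posit.
  have b20 : 0 <= 2 * b by posit.
  have [Qx|nQ] := EM (Q x); last first.
    rewrite [\1_Q x]indicE memNset// mulr0; apply: mulr_ge0 => //; apply: addr_ge0; posit.
  rewrite [\1_Q x]indicE mem_set// mulr1.
  have FE : `|F' x| = ramp' a b (d x) * `|D x|.
    have [ex gx] := e1 x Qx; rewrite /F' ex gx scaler0 addr0 mulr1 normrZ ger0_norm//.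
    by have /andP[] := ramp'_bound a (d x) b0.
  have /andP[rp0 rp1] := ramp'_bound a (d x) b0.
  have [Ax|nA] := EM (A x); last first.
    rewrite FE (_ : ramp' a b (d x) = 0) ?mul0r.
      by rewrite indicE memNset// mulr0 add0r mulr_ge0// mulr_ge0// ltW.
    have [h|h] := leP (d x) a; first exact: (ramp0 b0 h).2.
    have [h'|h'] := leP (a + 2 * b) (d x); first exact: (ramp1 b0 h').2.
    by case: nA; split => /=; [exact: ltW|split => //=; rewrite -abE].
  rewrite indicE mem_set// mulr1 FE; apply: ler_pM => //.
  have [/= dk [/= dk' _]] := Ax.
  have hD : `|D x| <= s + g `|D x| * `|D x| / g s.
    have [h|h] := leP `|D x| s.
      by rewrite (le_trans h)// lerDl divr_ge0 ?mulr_ge0// ltW.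
    rewrite (@le_trans _ _ (g `|D x| * `|D x| / g s))// ?lerDr ?(ltW s0)//.
    rewrite ler_pdivlMr// mulrC ler_wpM2r//.
    by apply: (orlicz_mono (ltW m1) og); exact: ltW.
  apply: (le_trans hD); rewrite lerD2l.
  have -> : g `|D x| * `|D x| / g s = c2 * (c0 * k * 1 * (g `|D x| * `|D x|)).
    by rewrite /c2; field; rewrite !gt_eqF.
  apply: ler_wpM2l; first exact: ltW.
  apply: le_trans P1; apply: ler_wpM2r; first exact: mulr_ge0.
  rewrite (e1 x Qx).1 expr1n !mulr1; apply: ler_wpM2l => //.
  rewrite /pos le_max; apply/orP; right.
  by rewrite mulN1r mulr_natl mulr2n addrA lerDr addrC subr_ge0 ltW.
have i3 : intb (fun x => `|F' x| * \1_Q x).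
  apply: (intb_mul_bounded (B := 1) i1); first exact: measurable_indic.
  by move=> x; rewrite ger0_norm// indicE; case: (_ \in _).
set I := \int[mu]_x (`|F' x| * \1_Q x).
have I0 : 0 <= I by apply: Rintegral_ge0 => x _; rewrite mulr_ge0.
have IB : I <= 2 * b * (s * vol A + c2 * (cE1 * (2 * k) * G2 * vol (cube x0 (4 * rho)))).
  have j1 : intb (fun x => dotv (-1 *: X x) (F2 x) + cE1 * (2 * k) * G2 * \1_(cube x0 (4 * rho)) x).
    by apply: intbD => //; exact: intbZ.
  have j2 := intbZ c2 j1; have j3 := intbD (intbZ s iA) j2.
  have -> : 2 * b * (s * vol A + c2 * (cE1 * (2 * k) * G2 * vol (cube x0 (4 * rho)))) =
    \int[mu]_x (2 * b * (s * \1_A x + c2 * (dotv (-1 *: X x) (F2 x) + cE1 * (2 * k) * G2 * \1_(cube x0 (4 * rho)) x))).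
    rewrite [RHS]RintegralZl//; congr (_ * _).
    rewrite [RHS]RintegralD//; last exact: intbZ.
    rewrite [in RHS]RintegralZl//; congr (_ + _).
    rewrite [RHS]RintegralZl//; congr (_ * _).
    rewrite [RHS]RintegralD//; last exact: intbZ.
    by rewrite E2 add0r RintegralZl.
  by apply: le_Rintegral => //; exact: intbZ j3.
have TE' h : (\int[mu]_x (`|ramp a b (d (x + h)%R) * e (x + h)%R - ramp a b (d x) * e x| *
       (\1_Q x * \1_Q (x + h)%R))%:E <= (n%:R * `|h| * I)%:E)%E.
  by apply: TE => //; exact: convex_cube.
have mf : measurable_fun [set: _] (fun x => ramp a b (d x) * e x).
  apply: measurable_funM; last exact: C1_measurable.
  have mp c : measurable_fun [set: _] (fun x => psq (d x - c)).
    by apply: measurable_funX; apply: measurable_maxr => //; exact: measurable_funB.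
  have mp2 c c' : measurable_fun [set: _] (fun x => psq (d x - c - c')).
    by apply: measurable_funX; apply: measurable_maxr => //; apply: measurable_funB => //; exact: measurable_funB.
  apply: measurable_funD; last exact: mp2.
  by apply: measurable_funB => //; exact: measurable_funM.
pose lam := 2 * b ^+ 2; have lam0 : 0 <= lam by rewrite /lam; posit.
pose BM := [set x | M <= d x] `&` Q.
have mBM : measurable BM by exact: measurable_gecut.
have fA x : Ak2 x -> ramp a b (d x) * e x <= 0.
  by move=> [h _]; rewrite (ramp0 b0 _).1 ?mul0r//; exact: ltW.
have fB x : BM x -> 0 + lam <= ramp a b (d x) * e x.
  move=> [h Qx]; rewrite (e1 x Qx).1 mulr1 add0r (ramp1 b0 _).1//.
  by rewrite abE; exact: le_trans kM h.
have AQ : Ak2 `<=` cube x0 (2 * rho) by move=> x [].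
have BQ : BM `<=` cube x0 (2 * rho) by move=> x [].
have PO := poincare mf lam0 r20 I0 TE' mAk2 mBM AQ BQ fA fB.
rewrite -volA.
have rn0 : 0 < rho ^+ n by posit.
have v1 : lam * (nu * rho ^+ n) * (th * rho ^+ n) <= lam * vol Ak2 * vol BM.
  apply: ler_pM => //; [by posit|by posit|by apply: ler_wpM2l].
have gk : g (2 * k * L) / g s <= ep.
  have [_ _ h _] := og; have sE : s = l * (2 * k * L).
    by rewrite /s /T LE; field; rewrite gt_eqF.
  have kL0 : 0 <= 2 * k * L by posit.
  have := h l (2 * k * L) l1 kL0; rewrite -sE => h1.
  rewrite ler_pdivrMr// -ler_pdivrMl// (le_trans _ h1)// ler_wpM2r// (orlicz_ge0 og)//.
have IB2 : I <= k ^+ 2 / (2 * rho) * rho ^+ n * (T * (vol A / rho ^+ n) + C4 * ep).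
  apply: (le_trans IB); rewrite vol_cube; last by posit.
  rewrite (_ : 2 * (4 * rho) = 8 * rho); last by ring.
  rewrite exprMn.
  have -> : 2 * b * (s * vol A + c2 * (cE1 * (2 * k) * G2 * (8 ^+ n * rho ^+ n))) =
     k ^+ 2 / (2 * rho) * rho ^+ n * (T * (vol A / rho ^+ n) + C4 * (g (2 * k * L) / g s)).
    rewrite /b /s /c2 /G2 LE /C4; field; rewrite !gt_eqF//.
  apply: ler_wpM2l; first by posit.
  by rewrite lerD2l; apply: ler_wpM2l.
have n0' : (0 : R) < n%:R by rewrite ltr0n.
have fin : nu * th <= B * (T * (vol A / rho ^+ n) + C4 * ep).
  have P2 : (4 * (2 * rho)) ^+ n * (n%:R * (2 * (2 * rho)) * I) <=
     (4 * (2 * rho)) ^+ n * (n%:R * (2 * (2 * rho)) * (k ^+ 2 / (2 * rho) * rho ^+ n * (T * (vol A / rho ^+ n) + C4 * ep))).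
    by apply: ler_wpM2l; [posit|apply: ler_wpM2l => //; posit].
  have := le_trans v1 (le_trans PO P2).
  rewrite (_ : 4 * (2 * rho) = 8 * rho); last by ring.
  rewrite (exprMn n 8) /lam /b => h.
  have w0 : 0 < k ^+ 2 * rho ^+ n ^+ 2 / 8 by posit.
  rewrite -(ler_pM2l w0).
  rewrite (_ : _ * (nu * th) = 2 * (k / 4) ^+ 2 * (nu * rho ^+ n) * (th * rho ^+ n)); last by field.
  apply: (le_trans h); rewrite le_eqVlt; apply/orP; left; apply/eqP.
  by rewrite /B; field; rewrite !gt_eqF.
have epE : B * (C4 * ep) <= nu * th / 2.
  rewrite /ep (_ : B * _ = nu * th / 2 * (B * C4 / (B * C4 + 1))); last first.
    by field; rewrite !gt_eqF//; posit.
  apply: ler_piMr; first by posit.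
  have h : 0 < B * C4 + 1 by posit.
  by rewrite ler_pdivrMr// mul1r lerDl.
rewrite mulrAC ler_pdivrMr; last by posit.
move: fin; rewrite mulrDr => fin.
have : nu * th / 2 <= B * (T * (vol A / rho ^+ n)).
  by rewrite -(lerD2r (nu * th / 2)) -splitr (le_trans fin)// lerD2l.
rewrite (_ : B * _ = B * T * vol A / rho ^+ n); last by ring.
rewrite ler_pdivlMr// (_ : _ * rho ^+ n = nu * th * rho ^+ n / 2); last by field.
by rewrite ler_pdivrMr// (_ : B * T * _ * 2 = vol A * (2 * B * T))//; ring.
Qed.

(** [shrink_step] takes at least [c * rho ^ n] off the sublevel set at each halving of the level
    until its volume is at most [nu * rho ^ n]; then [degiorgi] for [k J - d] excludes values below
    half the level. *)
Lemma expansion (th : R) : 0 < th -> exists2 dl, 0 < dl &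
  forall g K d D X x0 rho M, gpair g K d D X -> 0 < rho -> 0 < M ->
  cube x0 (4 * rho) `<=` K -> (forall x, cube x0 (4 * rho) x -> 0 <= d x) ->
  th * rho ^+ n <= vol ([set x | M <= d x] `&` cube x0 (2 * rho)) ->
  (forall x, cube x0 rho x -> {for x, continuous d}) ->
  forall x, cube x0 rho x -> dl * M <= d x.
Proof.
move=> th0.
have half : (0 : R) < 1 / 2 by rewrite divr_gt0.
have [nu nu0 hnu] := degiorgi n0 m1 q1 c00 C00 half.
have [c cc0 hc] := shrink_step nu0 th0.
(* The first sublevel set has volume at most [(4 * rho) ^ n], so it cannot lose [c * rho ^ n] as
   often as [J] times. *)
pose J := Num.bound (4 ^+ n / c).
have hJ : 4 ^+ n < J%:R * c.
  by rewrite -ltr_pdivrMr//; apply: archi_boundP; rewrite divr_ge0 ?exprn_ge0// ltW.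
exists (2^-1 ^+ J / 2); first by posit.
move=> g K d D X x0 rho M gp r0 M0 QK d0 vB cd.
have [_ [md _ _ _] _] := gp.
pose Q := cube x0 (2 * rho); pose k j : R := 2^-1 ^+ j * M.
have k0 j : 0 < k j by rewrite /k; posit.
have kM j : k j <= M.
  by rewrite /k ler_piMl ?(ltW M0)// exprn_ile1// ?invr_ge0// invf_le1// ler1n.
have kS j : k j.+1 = k j / 2 by rewrite /k exprS; field.
pose A j := [set x | d x < k j] `&` Q.
have mA j : measurable (A j) by apply: measurable_ltcut => //; exact: measurable_cube.
have iA j : intb (\1_(A j) : _ -> R) by exact: (intb_ind (mA j) (@subIsetr _ _ _)).
have rn0 : 0 < rho ^+ n by posit.
have step j : vol (A j) <= nu * rho ^+ n \/ vol (A j) <= (4 ^+ n - j%:R * c) * rho ^+ n.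
  elim: j => [|j IH].
    right; rewrite mul0r subr0 -exprMn (_ : 4 * rho = 2 * (2 * rho)); last by ring.
    rewrite -(vol_cube x0 (_ : 0 <= 2 * rho)); last by posit.
    by apply: vol_le => //; [exact: intb_cube|move=> x []].
  have [h|h] := leP (vol (A j.+1)) (nu * rho ^+ n); [by left|right].
  have AS : vol (A j.+1) <= vol (A j).
    by apply: vol_le => // x [h1 h2]; split => //; move: h1; rewrite /= kS; have := k0 j; lra.
  case: IH => [h'|h']; first by have := le_lt_trans h' (lt_le_trans h AS); rewrite ltxx.
  have h1 : nu * rho ^+ n <= vol ([set x | d x < k j / 2] `&` cube x0 (2 * rho)).
    by rewrite -kS ltW.
  have := hc g K d D X x0 rho M (k j) gp r0 (k0 j) (kM j) QK d0 vB h1.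
  rewrite -kS -/Q -/(A j) -/(A j.+1) => h2.
  have -> : (4 ^+ n - j.+1%:R * c) * rho ^+ n = (4 ^+ n - j%:R * c) * rho ^+ n - c * rho ^+ n.
    by rewrite -[j.+1%:R]natr1; ring.
  lra.
have vJ : vol (A J) <= nu * rho ^+ n.
  case: (step J) => // h; have := vol_ge0 (A J) => h1.
  have := le_trans h1 h; rewrite pmulr_lge0// subr_ge0.
  by move=> /(lt_le_trans hJ); rewrite ltxx.
have absN1 : `|-1| = 1 :> R by rewrite normrN normr1.
have gp2 := gpair_aff (k J) gp absN1.
have QK2 : cube x0 (2 * rho) `<=` K by apply: subset_trans QK; apply: cube_mono; lra.
have dM x : cube x0 (2 * rho) x -> -1 * d x + k J <= k J.
  move=> h; have : 0 <= d x by apply: d0; apply: cube_mono h; lra.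
  by lra.
have vA : vol ([set x | 0 < -1 * d x + k J] `&` cube x0 (2 * rho)) <= nu * rho ^+ n.
  rewrite (_ : _ `&` _ = A J)//; apply/seteqP; split => x [h1 h2]; split => //; move: h1 => /=; lra.
have cd' x : cube x0 rho x -> {for x, continuous (fun x => -1 * d x + k J)}.
  move=> h; apply: continuousD; last exact: cst_continuous.
  by apply: continuousM; [exact: cst_continuous|exact: cd].
move=> x Qx; have := hnu _ _ _ _ _ _ _ _ gp2 r0 (k0 J) QK2 dM vA cd' x Qx.
by rewrite -/(k J) mulrAC /k; lra.
Qed.

End harnack.

(** * Harnack's inequality on cubes *)

Section harnack_inequality.
Context {R : realType}.
Variable n : nat.
Hypothesis n0 : (0 < n)%N.
Variables (m c0 C0 : R) (q : nat).
Hypotheses (m1 : 1 < m) (q1 : (1 < q)%N) (c00 : 0 < c0) (C00 : 0 <= C0).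
Implicit Types (g : R -> R) (d : 'rV[R]_n -> R) (D X : 'rV[R]_n -> 'rV[R]_n) (K : set 'rV[R]_n).

Lemma cube_trans (x0 x1 : 'rV[R]_n) (r s t : R) : `|x1 - x0| <= s -> r + s <= t ->
  cube x1 r `<=` cube x0 t.
Proof.
move=> h1 h2 y; rewrite /cube/= => h.
have := ler_normD (y - x1) (x1 - x0); rewrite addrA subrK => h3; lra.
Qed.

(* The oscillation is controlled from a maximum point [x1] of
   [(2 r0 - |x - x0|)^N d x], where [2^-N] is the loss of one doubling of the
   cube in [expansion]: [d] is comparable to its maximum on a fixed fraction of
   a cube about [x1], and this cube is then doubled until it contains [cube x0 r0]. *)
Lemma harnack : exists2 C, 1 <= C & forall g K d D X x0 r0,
  gpair m c0 C0 q g K d D X -> 0 < r0 -> cube x0 (40 * r0) `<=` K ->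
  (forall x, cube x0 (40 * r0) x -> 0 <= d x /\ {for x, continuous d}) ->
  forall x y, cube x0 r0 x -> cube x0 r0 y -> d x <= C * d y.
Proof.
(* Density 1: a lower bound on the cube of radius [s], of volume [(2 * s) ^ n], expands with
   [rho = 2 * s] to the doubled cube. *)
have [dl2 dl20 h2] := expansion n0 m1 q1 c00 C00 (@ltr01 R).
have [N' hN'] := half_small 1 dl20.
(* The successor makes [N] positive, so that the weight vanishes on the boundary and a positive
   maximum of [w] is attained inside. *)
pose N := N'.+1; have hN : 2^-1 ^+ N < dl2.
  apply: le_lt_trans hN'; rewrite mul1r /N exprS ler_piMl ?exprn_ge0 ?invr_ge0//.
  by rewrite invf_le1// ler1n.
pose c2 : R := 2^-1 ^+ N; have c20 : 0 < c2 by rewrite /c2; posit.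
(* If [d] exceeded [M / 2] only on a small part of the cube about [x1], [degiorgi] would bound
   [d x1 - M / 2] by [lam * 2 ^ N * M = M / 4], although it equals [M / 2]. *)
pose lam : R := 1 / (4 * 2 ^+ N); have lam0 : 0 < lam by rewrite /lam; posit.
have [nu nu0 h1] := degiorgi n0 m1 q1 c00 C00 lam0.
(* [degiorgi] is used at radius [r / 2] and [expansion] at radius [2 * r], whence the factor
   [4 ^ n]. *)
have th0 : 0 < nu / 4 ^+ n by posit.
have [dl1 dl10 h3] := expansion n0 m1 q1 c00 C00 th0.
exists (1 + 8 ^+ N * 2 / dl1); first by rewrite lerDl; posit.
move=> g K d D X x0 r0 gp r00 QK dQ x y Qx Qy.
have [n1 n2 n3] : [/\ r0 + 2 * r0 <= 4 * r0, 2 * r0 + 38 * r0 <= 40 * r0 & 8 * (4 * r0) <= 38 * r0].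
  by split; lra.
have dy0 : 0 <= d y by apply: (dQ y _).1; apply: cube_mono Qy; lra.
have C0' : 0 <= 8 ^+ N * 2 / dl1 by posit.
have [dx0|dx0] := leP (d x) 0; first by rewrite (le_trans dx0)// mulr_ge0// addr_ge0.
pose w z := (2 * r0 - `|z - x0|) ^+ N * d z.
have cw : {within cube x0 (2 * r0), continuous w}.
  apply: continuous_in_subspaceT => z /set_mem Qz.
  have cd : {for z, continuous d} by apply: (dQ z _).2; apply: cube_mono Qz; lra.
  have c0z : {for z, continuous (fun z : 'rV[R]_n => z - x0)}.
    by apply: (@continuousB _ _ _ id (cst x0)); [move=> A|exact: cst_continuous].
  have c1z : {for z, continuous (fun z : 'rV[R]_n => `|z - x0|)}.
    by apply: (continuous_comp c0z); exact: norm_continuous.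
  have c2z : {for z, continuous (fun z : 'rV[R]_n => 2 * r0 - `|z - x0|)}.
    by apply: continuousB; [exact: cst_continuous|exact: c1z].
  have c3z : {for z, continuous (fun z : 'rV[R]_n => (2 * r0 - `|z - x0|) ^+ N)}.
    exact: (@continuous_comp _ _ _ _ (fun t : R => t ^+ N) z c2z (@exprn_continuous R N _)).
  exact: (continuousM c3z cd).
have [x1 /set_mem Qx1 hx1] : exists2 c, c \in cube x0 (2 * r0) &
    forall t, t \in cube x0 (2 * r0) -> w t <= w c.
  apply: EVT_max_rV => //; last exact: cube_compact.
  by exists x0; rewrite /cube/= subrr normr0 mulr_ge0// ltW.
have wx : r0 ^+ N * d x <= w x1.
  have Q2x : cube x0 (2 * r0) x by apply: cube_mono Qx; lra.
  apply: le_trans (hx1 x (mem_set Q2x)); rewrite /w ler_wpM2r ?(ltW dx0)//.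
  have a1 : r0 <= 2 * r0 - `|x - x0| by rewrite lerBrDr mulr_natl mulr2n lerD2l; exact: Qx.
  by apply: lerXn2r; rewrite ?nnegrE ?(le_trans (ltW r00) a1) ?(ltW r00).
have dx10 : 0 <= d x1 by apply: (dQ x1 _).1; apply: cube_mono Qx1; lra.
pose r := (2 * r0 - `|x1 - x0|) / 2; pose M := d x1.
have r2E : 2 * r0 - `|x1 - x0| = 2 * r by rewrite /r; field.
have r_ge0 : 0 <= r by rewrite /r divr_ge0// subr_ge0.
have wx1 : w x1 = (2 * r) ^+ N * M by rewrite /w r2E.
have wx1_gt0 : 0 < w x1 by apply: lt_le_trans wx; posit.
have M0 : 0 < M.
  rewrite lt_neqAle eq_sym dx10 andbT; apply: contraTneq wx1_gt0.
  by rewrite wx1 => ->; rewrite mulr0 ltxx.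
have rr0 : r <= r0 by rewrite /r ler_pdivrMr// [r0 * _]mulrC gerBl.
have r38 c : 0 <= c -> c <= 38 -> c * r <= 38 * r0 by move=> c_ge0 c38; exact: ler_pM.
have r1 : r <= 38 * r0 by rewrite -[leLHS]mul1r r38// ler1n.
have r8 : 4 * (2 * r) <= 38 * r0 by rewrite mulrA -natrM r38// ler_nat.
have r2r : 2 * (r / 2) = r by field.
have hx10 : `|x1 - x0| <= 2 * r0 by exact: Qx1.
have sub s : s <= 38 * r0 -> cube x1 s `<=` cube x0 (40 * r0).
  by move=> hs; apply: (cube_trans hx10); rewrite addrC (le_trans _ n2)// lerD2l.
have d_ge0 s z : s <= 38 * r0 -> cube x1 s z -> 0 <= d z.
  by move=> hs /(sub s hs)/dQ[].
have d_cont s z : s <= 38 * r0 -> cube x1 s z -> {for z, continuous d}.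
  by move=> hs /(sub s hs)/dQ[].
have rN : 0 < r.
  rewrite lt_neqAle r_ge0 andbT eq_sym; apply: contraTneq wx1_gt0.
  by rewrite wx1 => ->; rewrite mulr0 expr0n mul0r ltxx.
have [md dp hb] := gp; have [mdd _ _ _] := dp.
(* The weight is [(2 * r) ^ N] at [x1] and at least [r ^ N] on the cube of radius [r], so maximality
   of [w] costs only the factor [2 ^ N]. *)
have up z : cube x1 r z -> d z <= 2 ^+ N * M.
  move=> Qz; have := ler_normD (z - x1) (x1 - x0); rewrite addrA subrK => hz.
  have Qz' : `|z - x1| <= r by exact: Qz.
  have rz0 : r <= 2 * r0 - `|z - x0|.
    have -> : 2 * r0 = 2 * r + `|x1 - x0| by rewrite -r2E subrK.
    by rewrite lerBrDr mulr_natl mulr2n -addrA lerD2l (le_trans hz)// lerD2r.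
  have Q2z : cube x0 (2 * r0) z by rewrite /cube/= -subr_ge0 (le_trans r_ge0).
  have := hx1 z (mem_set Q2z); rewrite wx1 /w exprMn.
  have rz : r ^+ N <= (2 * r0 - `|z - x0|) ^+ N.
    by apply: lerXn2r; rewrite ?nnegrE// (le_trans r_ge0).
  have dz0 : 0 <= d z by exact: (d_ge0 r z r1 Qz).
  have rN0 : 0 < r ^+ N by posit.
  move=> h; rewrite -(ler_pM2l rN0) [leRHS](_ : _ = 2 ^+ N * r ^+ N * M); last by ring.
  by apply: le_trans h; apply: ler_wpM2r.
have dens : nu * (r / 2) ^+ n < vol ([set z | 0 < 1 * d z + - (M / 2)] `&` cube x1 (2 * (r / 2))).
  rewrite ltNge; apply/negP => vA.
  have gp' := gpair_aff (- (M / 2)) gp (normr1 R).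
  have r20 : 0 < r / 2 by posit.
  have BM0 : 0 < 2 ^+ N * M by posit.
  have QK1 : cube x1 (2 * (r / 2)) `<=` K by rewrite r2r; apply: subset_trans QK; exact: sub.
  have dM z : cube x1 (2 * (r / 2)) z -> 1 * d z + - (M / 2) <= 2 ^+ N * M.
    by rewrite r2r => /up; apply: le_trans; rewrite mul1r gerDl oppr_le0 divr_ge0// ltW.
  have cd z : cube x1 (r / 2) z -> {for z, continuous (fun z => 1 * d z + - (M / 2))}.
    move=> Qz; apply: continuousD; last exact: cst_continuous.
    apply: continuousM; first exact: cst_continuous.
    by apply: (d_cont _ z _ Qz); rewrite (le_trans _ r1)// ler_pdivrMr// ler_peMr// ler1n.
  have Qxx : cube x1 (r / 2) x1 by rewrite /cube/= subrr normr0 ltW.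
  have := h1 _ _ _ _ _ _ _ _ gp' r20 BM0 QK1 dM vA cd x1 Qxx.
  rewrite -/M (_ : lam * _ = M / 4); first by lra.
  by rewrite /lam; field; rewrite expf_neq0.
have M2 : 0 < M / 2 by posit.
have low1 z : cube x1 (2 * r) z -> dl1 * (M / 2) <= d z.
  have r20 : 0 < 2 * r by posit.
  apply: (h3 _ _ _ _ _ _ _ _ gp r20 M2).
  - by apply: subset_trans QK; exact: sub.
  - by move=> u Qu; exact: (d_ge0 _ u r8 Qu).
  - have -> : nu / 4 ^+ n * (2 * r) ^+ n = nu * (r / 2) ^+ n.
      have -> : 2 * r = 4 * (r / 2) by field.
      by rewrite (exprMn n 4); field; rewrite expf_neq0.
    apply: (le_trans (ltW dens)); apply: vol_le.
    + apply: (@intb_ind _ _ _ x1 (2 * (r / 2))); last exact: subIsetr.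
      apply: (measurable_gtcut (d := fun z => 1 * d z + - (M / 2))); last exact: measurable_cube.
      by apply: measurable_funD => //; exact: measurable_funM.
    + apply: (@intb_ind _ _ _ x1 (2 * (2 * r))); last exact: subIsetr.
      by apply: measurable_gecut => //; exact: measurable_cube.
    + move=> u [/= u1 u2]; split; first by move: u1; rewrite /= mul1r subr_gt0 => /ltW.
      by apply: cube_mono u2; rewrite r2r mulrA -natrM ler_peMl// ler1n.
  - by move=> u Qu; apply: (d_cont _ u _ Qu); rewrite r38// ler_nat.
have double s k : 0 < s -> 8 * s <= 38 * r0 -> 0 < k -> (forall z, cube x1 s z -> k <= d z) ->
    forall z, cube x1 (2 * s) z -> c2 * k <= d z.
  move=> s0 s8 k0 hk z Qz.
  apply: (@le_trans _ _ (dl2 * k)); first by rewrite ler_wpM2r ?ltW.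
  have s20 : 0 < 2 * s by posit.
  have s8' : 4 * (2 * s) <= 38 * r0 by rewrite mulrA -natrM.
  apply: (h2 _ _ _ _ _ _ _ _ gp s20 k0 _ _ _ _ z Qz).
  - by apply: subset_trans QK; exact: sub.
  - by move=> u Qu; exact: (d_ge0 _ u s8' Qu).
  - rewrite mul1r -(vol_cube x1 (ltW s0)); apply: vol_le; first exact: intb_cube.
      apply: (@intb_ind _ _ _ x1 (2 * (2 * s))); last exact: subIsetr.
      by apply: measurable_gecut => //; exact: measurable_cube.
    by move=> u Qu; split; [exact: hk|apply: cube_mono Qu; rewrite mulrA -natrM ler_peMl ?ler1n// ltW].
  - by move=> u Qu; apply: (d_cont _ u _ Qu); rewrite (le_trans _ s8)// ler_pM2r// ler_nat.
have iterd j : 2 ^+ j * r <= 4 * r0 -> forall z, cube x1 (2 ^+ j.+1 * r) z -> c2 ^+ j * (dl1 * (M / 2)) <= d z.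
  elim: j => [_|j IH hj]; first by move=> z; rewrite expr1 expr0 mul1r; exact: low1.
  have hj' : 2 ^+ j * r <= 4 * r0.
    by apply: le_trans hj; rewrite ler_wpM2r// ler_weXn2l// ler1n.
  have := IH hj'; rewrite [c2 ^+ j.+1]exprS -[c2 * _ * _]mulrA => hI z.
  rewrite [2 ^+ j.+2]exprS -[2 * _ * r]mulrA; move: z.
  apply: (double _ _ _ _ _ hI).
  - exact: (mulr_gt0 (exprn_gt0 _ (ltr0Sn _ 1)) rN).
  - by rewrite (le_trans (ler_wpM2l _ hj)).
  - exact: (mulr_gt0 (exprn_gt0 _ c20) (mulr_gt0 dl10 M2)).
have [j0 hj0] : exists j : nat, 4 * r0 <= 2 ^+ j * r.
  have [j hj] := half_small (4 * r0) rN.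
  exists j; move: hj; by rewrite exprVn ltr_pdivrMr ?exprn_gt0// [r * _]mulrC => /ltW.
have [j hj jmin] := ex_minnP (ex_intro (fun j => 4 * r0 <= 2 ^+ j * r) j0 hj0).
have jp : (0 < j)%N.
  rewrite lt0n; apply/eqP => jz; move: hj; rewrite jz expr0 mul1r => /le_trans/(_ rr0).
  by rewrite ger_pMl// lern1.
have hj1 : 2 ^+ j.-1 * r <= 4 * r0.
  rewrite leNgt; apply/negP => /ltW /jmin; rewrite leqNgt prednK// leqnn//.
have yQ : cube x1 (2 ^+ j * r) y.
  move: Qy; rewrite /cube/= => Qy'; have := ler_normD (y - x0) (x0 - x1).
  rewrite addrA subrK [`|x0 - _|]distrC => h; rewrite (le_trans h)// (le_trans _ hj)//.
  by rewrite (le_trans _ n1)// lerD.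
have low := iterd j.-1 hj1 y; rewrite prednK// in low; have {}low := low yQ.
(* The loss over [j - 1] doublings is the [N]-th power of the inverse dilation. As
   [2 ^ (j - 1) * r <= 4 * r0], it is compensated by the weight [(2 * r) ^ N] at the maximum, and
   [r] disappears. *)
have E2 : c2 ^+ j.-1 = ((2 ^+ j.-1) ^+ N)^-1 by rewrite /c2 -exprM mulnC exprM exprVn exprVn.
have j1p : 0 < 2 ^+ j.-1 :> R by posit.
have jN : (2 ^+ j.-1 * r) ^+ N <= (4 * r0) ^+ N.
  by apply: lerXn2r => //; rewrite nnegrE; apply: mulr_ge0; rewrite ?ltW.
have r0N : 0 < r0 ^+ N by posit.
have fin : d x <= 8 ^+ N * 2 / dl1 * (c2 ^+ j.-1 * (dl1 * (M / 2))).
  rewrite -(ler_pM2l r0N); apply: (le_trans wx); rewrite wx1 E2.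
  have -> : r0 ^+ N * (8 ^+ N * 2 / dl1 * (((2 ^+ j.-1) ^+ N)^-1 * (dl1 * (M / 2)))) =
     (8 * r0) ^+ N / (2 ^+ j.-1) ^+ N * M.
    by rewrite (exprMn N 8); field; rewrite !gt_eqF// exprn_gt0.
  apply: ler_wpM2r; first exact: ltW.
  rewrite ler_pdivlMr ?exprn_gt0// -exprMn.
  have b2 : 2 * r * 2 ^+ j.-1 <= 8 * r0.
    by rewrite -mulrA [r * _]mulrC (_ : 8 * r0 = 2 * (4 * r0)) ?ler_pM2l//; ring.
  have b0 : 0 <= 2 * r * 2 ^+ j.-1 := mulr_ge0 (mulr_ge0 (ler0n _ 2) r_ge0) (ltW j1p).
  by apply: lerXn2r; rewrite ?nnegrE ?(le_trans b0 b2).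
by apply: (le_trans fin); rewrite mulrDl mul1r ler_wpDl// ler_wpM2l.
Qed.

End harnack_inequality.

(** * Growth and ellipticity of the flux *)

Section flux_inequalities.
Context {R : realType}.
Variable n : nat.
Hypothesis n0 : (0 < n)%N.
Variables (H : 'rV[R]_n -> R) (p : R).
Hypotheses (p1 : 1 < p) (nH : is_norm H) (dH : forall xi, xi != 0 -> differentiable H xi)
  (cA : C1_punctured (flux H p)) (sA : structure_conditions (flux H p) p).
Local Notation A := (flux H p).
Implicit Types (x y xi zeta eta v w : 'rV[R]_n).

Let p0 : 0 < p. Proof. exact: lt_trans p1. Qed.
Let p10 : 0 < p - 1. Proof. by rewrite subr_gt0. Qed.

Lemma powR_compare (K s t a : R) : 1 <= K -> 0 < s -> s / K <= t -> t <= K * s ->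
  t `^ a <= K `^ `|a| * s `^ a.
Proof.
move=> K1 s0 st tK; have K0 : 0 < K by exact: lt_le_trans K1.
have t0 : 0 < t by apply: lt_le_trans st; rewrite divr_gt0.
have [s0' K0' t0'] : [/\ 0 <= s, 0 <= K & 0 <= t] by split; exact: ltW.
have [a0|a0] := leP 0 a.
  by rewrite ger0_norm// -powRM//; apply: powR_mono.
rewrite ltr0_norm// -[X in t `^ X]opprK powRN -[X in s `^ X]opprK (powRN s) ler_pdivlMr ?powR_gt0//.
rewrite mulrC ler_pdivrMr ?powR_gt0// -powRM//.
apply: powR_mono; rewrite ?oppr_ge0 ?(ltW a0)//.
by rewrite mulrC -ler_pdivrMr.
Qed.

Lemma norm_ge0 x : 0 <= H x. Proof. by have [h _ _ _] := nH. Qed.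

Lemma normZ (a : R) x : H (a *: x) = `|a| * H x. Proof. by have [_ _ h _] := nH. Qed.

Lemma norm_triangle x y : H (x + y) <= H x + H y. Proof. by have [_ _ _ h] := nH. Qed.

Lemma norm_zero : H 0 = 0. Proof. by rewrite -(scale0r 0) normZ normr0 mul0r. Qed.

Lemma norm_gt0 x : x != 0 -> 0 < H x.
Proof.
move=> xn; rewrite lt_neqAle norm_ge0 andbT eq_sym; apply: contra_neq xn.
by have [_ h _ _] := nH; exact: h.
Qed.

(** A Lipschitz constant of [H] for the sup norm. *)
Definition norm_bound : R := \sum_i H (delta_mx ord0 i).

Lemma norm_bound_ge0 : 0 <= norm_bound. Proof. by apply: sumr_ge0 => i _; exact: norm_ge0. Qed.

Lemma norm_le x : H x <= norm_bound * `|x|.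
Proof.
rewrite [in H x](row_sum_delta x) /norm_bound mulr_suml.
elim: (index_enum 'I_n) => [|i s IH]; first by rewrite !big_nil norm_zero.
rewrite !big_cons (le_trans (norm_triangle _ _))// lerD//.
by rewrite normZ mulrC ler_wpM2l ?norm_ge0// rV_coord_le.
Qed.

Lemma norm_lip x y : `|H x - H y| <= norm_bound * `|x - y|.
Proof.
have h u v : H u - H v <= norm_bound * `|u - v|.
  have := norm_triangle (u - v) v; rewrite subrK; have := norm_le (u - v); lra.
rewrite ler_norml h andbT; have := h y x; rewrite distrC; lra.
Qed.

Lemma norm_continuous' : continuous H.
Proof.
move=> x; apply/continuous_epsP => e e0.
have B0 : 0 < norm_bound + 1 by rewrite ltr_wpDl// norm_bound_ge0.
exists (e / (norm_bound + 1)); first by rewrite divr_gt0.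
move=> y; rewrite ltr_pdivlMr// => ye; rewrite (le_trans (norm_lip _ _))//.
by rewrite addrAC subrr add0r (le_trans _ (ltW ye))// mulrC ler_wpM2l// lerDl ler01.
Qed.

Lemma norm_lower : exists2 b, 0 < b & forall x, b * `|x| <= H x.
Proof.
pose e1 : 'rV[R]_n := delta_mx ord0 (Ordinal n0).
have ne1 : `|e1| = 1.
  apply/eqP; rewrite eq_le; apply/andP; split.
    by apply/rV_norm_leP => // i; rewrite mxE eqxx/=; case: (_ == _); rewrite ?normr1 ?normr0.
  by have := rV_coord_le e1 (Ordinal n0); rewrite mxE !eqxx normr1.
pose S := [set x : 'rV[R]_n | `|x| = 1].
have cS : compact S.
  apply: (subclosed_compact _ (@cube_compact R n 0 1)).
    rewrite (_ : S = (fun x => `|x|) @^-1` [set 1])//; apply: preimage_closed; last exact: closed_eq.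
    by move=> x _; exact: norm_continuous.
  by move=> x; rewrite /S/cube/= subr0 => ->.
have [c cS' hc] : exists2 c, c \in S & forall t, t \in S -> H c <= H t.
  apply: EVT_min_rV => //; first by exists e1.
  by apply: continuous_subspaceT; exact: norm_continuous'.
have c0 : c != 0 by move: cS' => /set_mem/= c1; rewrite -normr_eq0 c1 oner_eq0.
exists (H c); first exact: norm_gt0.
move=> x; have [->|xn] := eqVneq x 0; first by rewrite normr0 mulr0 norm_ge0.
have nx : 0 < `|x| by rewrite normr_gt0.
rewrite -ler_pdivlMr// mulrC -[`|x|^-1]ger0_norm ?invr_ge0// -normZ; apply: hc.
by apply/mem_set; rewrite /S/= normrZ ger0_norm ?invr_ge0// mulVf// gt_eqF.
Qed.

Lemma is_derive_powRp (t : R) : 0 < t -> is_derive t (1:R) (fun t => t `^ p / p) (t `^ (p - 1)).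
Proof.
move=> t0; have h := is_deriveZ p^-1 (is_derive1_powR p t0).
rewrite (_ : (fun t => t `^ p / p) = p^-1 \*: (@powR R ^~ p)); last first.
  by apply/funext => s; rewrite /= mulrC.
apply: (is_derive_eq h); by rewrite /GRing.scale/= mulrA mulVf ?mul1r// gt_eqF.
Qed.

Lemma flux_off0 x : x != 0 -> A x = H x `^ (p - 1) *: grad H x.
Proof. by move=> xn; have [_ E] := grad_comp (dH xn) (is_derive_powRp (norm_gt0 xn)); exact: E. Qed.

Lemma flux_diff x : x != 0 -> differentiable (fun xi => H xi `^ p / p) x.
Proof. by move=> xn; have [] := grad_comp (dH xn) (is_derive_powRp (norm_gt0 xn)). Qed.

(** As [p > 1], [H ^ p] is of higher than first order at the origin; the radius [d] solves
    [B ^ p * d ^ (p - 1) = e * p]. *)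
Lemma flux0 : A 0 = 0.
Proof.
have [_ //] : differentiable (fun xi => H xi `^ p / p) 0 /\ grad (fun xi => H xi `^ p / p) 0 = 0.
apply: differentiable_epsP => e e0.
have B0 : 0 < norm_bound + 1 by rewrite ltr_wpDl// norm_bound_ge0.
pose B := norm_bound + 1; pose d := (e * p / B `^ p) `^ (p - 1)^-1.
have d0 : 0 < d by rewrite powR_gt0// divr_gt0 ?powR_gt0// mulr_gt0.
exists d => // v vd; rewrite add0r norm_zero powR0 ?gt_eqF// mul0r subr0 dotv0r subr0.
rewrite ger0_norm; last by rewrite divr_ge0 ?powR_ge0// ltW.
rewrite ler_pdivrMr//; apply: (@le_trans _ _ ((B * `|v|) `^ p)).
  apply: powR_mono; rewrite ?(ltW p0) ?norm_ge0// (le_trans (norm_le _))// ler_wpM2r// /B lerDl//.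
rewrite powRM ?(ltW B0)// -[`|v| `^ p]mulr_powRB1//.
rewrite mulrCA [leRHS](_ : _ = `|v| * (e * p)); last by ring.
apply: ler_wpM2l => //; rewrite mulrC -ler_pdivlMr ?powR_gt0//.
have -> : e * p / B `^ p = d `^ (p - 1).
  by rewrite /d -powRrM mulVf ?gt_eqF// powRr1// divr_ge0 ?powR_ge0// mulr_ge0// ltW.
by apply: powR_mono; [exact: ltW| |exact: ltW].
Qed.

Lemma grad_norm_bound x : x != 0 -> `|grad H x| <= norm_bound.
Proof.
move=> xn; apply/rV_norm_leP; first exact: norm_bound_ge0.
move=> i; apply/ler_addgt0Pr => e e0.
have [d d0 hd] := differentiable_eps (dH xn) e0.
pose v : 'rV[R]_n := (d / 2) *: delta_mx ord0 i.
have nd : `|delta_mx ord0 i : 'rV[R]_n| <= 1.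
  by apply/rV_norm_leP => // j; rewrite mxE eqxx/=; case: (_ == _); rewrite ?normr1 ?normr0.
have d20 : 0 < d / 2 by rewrite divr_gt0.
have nv : `|v| <= d / 2 by rewrite normrZ gtr0_norm// ler_piMr// ltW.
have := hd v (le_lt_trans nv (_ : d / 2 < d)); rewrite /v dotvZl dotv_delta -/v => h.
have {}h : `|d / 2 * grad H x ord0 i| <= (norm_bound + e) * (d / 2).
  have h1 := norm_lip (x + v) x; rewrite addrAC subrr add0r in h1.
  have := ler_normB (H (x + v) - H x) (H (x + v) - H x - d / 2 * grad H x ord0 i).
  rewrite opprB addrC subrK => /le_trans; apply; rewrite mulrDl lerD//.
    by rewrite (le_trans h1)// ler_wpM2l// norm_bound_ge0.
  by apply: le_trans (h _) _; [lra|rewrite ler_wpM2l// ltW].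
by move: h; rewrite normrM gtr0_norm// [leLHS]mulrC ler_pM2r.
Qed.

Lemma flux_growth x : `|A x| <= norm_bound * norm_bound `^ (p - 1) * `|x| `^ (p - 1).
Proof.
have [->|xn] := eqVneq x 0.
  by rewrite flux0 !normr0 !mulr_ge0 ?powR_ge0// norm_bound_ge0.
rewrite flux_off0// normrZ ger0_norm ?powR_ge0// mulrC -mulrA; apply: ler_pM => //.
- exact: powR_ge0.
- exact: grad_norm_bound.
- rewrite -powRM ?norm_bound_ge0//; apply: powR_mono; rewrite ?norm_ge0 ?(ltW p10)//.
  exact: norm_le.
Qed.

Lemma flux_continuous : continuous A.
Proof.
move=> x; have [->|xn] := eqVneq x 0; last by apply: differentiable_continuous; have [] := cA xn.
apply/continuous_epsP => e e0; pose C := norm_bound * norm_bound `^ (p - 1) + 1.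
have C0 : 0 < C by rewrite ltr_wpDl// mulr_ge0 ?powR_ge0// norm_bound_ge0.
exists ((e / C) `^ (p - 1)^-1); first by rewrite powR_gt0// divr_gt0.
move=> y ye; rewrite add0r flux0 subr0 (le_trans (flux_growth y))//.
apply: (@le_trans _ _ (C * `|y| `^ (p - 1))); first by rewrite ler_wpM2r ?powR_ge0// lerDl.
rewrite mulrC -ler_pdivlMr//.
have -> : e / C = ((e / C) `^ (p - 1)^-1) `^ (p - 1).
  by rewrite -powRrM mulVf ?gt_eqF// powRr1// divr_ge0// ltW.
by apply: powR_mono; rewrite ?(ltW p10)// ltW.
Qed.

(** The increments of [H ^ p / p] at [t *: x] and at [x] are proportional. Negative [t] is included
    because the coefficient of a radial solution may have either sign. *)
Lemma flux_scale (t : R) x : t != 0 -> x != 0 -> A (t *: x) = (`|t| `^ p / t) *: A x.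
Proof.
move=> tn xn; pose f := fun xi => H xi `^ p / p.
have [_ //] : differentiable f (t *: x) /\ grad f (t *: x) = (`|t| `^ p / t) *: A x.
apply: differentiable_epsP => e e0.
have tp : 0 < `|t| by rewrite normr_gt0.
have tpp : 0 < `|t| `^ p by rewrite powR_gt0.
have e1 : 0 < e * `|t| / `|t| `^ p by rewrite divr_gt0// mulr_gt0.
have [d d0 hd] := differentiable_eps (flux_diff xn) e1.
exists (d * `|t|); first by rewrite mulr_gt0.
move=> v vd; have vE : t *: x + v = t *: (x + t^-1 *: v).
  by rewrite scalerDr scalerA mulfV// scale1r.
have fE y : f (t *: y) = `|t| `^ p * f y.
  by rewrite /f normZ powRM ?norm_ge0// mulrA.
have nv : `|t^-1 *: v| = `|v| / `|t| by rewrite normrZ normfV mulrC.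
rewrite vE !fE dotvZr.
have -> : dotv v (A x) = t * dotv (t^-1 *: v) (A x) by rewrite dotvZl mulrA mulfV// mul1r.
rewrite (_ : _ - _ = `|t| `^ p * (f (x + t^-1 *: v) - f x - dotv (t^-1 *: v) (A x))); last by field.
rewrite normrM ger0_norm ?(ltW tpp)// -ler_pdivlMl//.
have vd' : `|t^-1 *: v| < d by rewrite nv ltr_pdivrMr.
apply: (le_trans (hd _ vd')); rewrite nv le_eqVlt; apply/orP; left; apply/eqP.
by field; rewrite !gt_eqF.
Qed.

(** The triangle inequality bounds the difference quotients of [H] in direction [y] by [H y]: the
    gradient lies in the dual unit ball. *)
Lemma grad_norm_le x y : x != 0 -> dotv y (grad H x) <= H y.
Proof.
move=> xn; have [->|yn] := eqVneq y 0; first by rewrite dotv0l norm_ge0.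
have ny : 0 < `|y| by rewrite normr_gt0.
apply/ler_addgt0Pr => e e0.
have [d d0 hd] := differentiable_eps (dH xn) (divr_gt0 e0 ny).
pose s := d / 2 / `|y|; have s0 : 0 < s by rewrite /s !divr_gt0.
have sy : `|s *: y| < d by rewrite normrZ gtr0_norm// /s divfK ?gt_eqF//; lra.
have := hd _ sy; rewrite dotvZl ler_norml => /andP[h _].
have h2 := norm_triangle x (s *: y); rewrite normZ gtr0_norm// in h2.
rewrite normrZ gtr0_norm// in h.
have E : e / `|y| * (s * `|y|) = s * e by field; rewrite gt_eqF.
rewrite E in h; rewrite -(ler_pM2l s0) mulrDr; lra.
Qed.

Lemma grad_norm_euler x : x != 0 -> dotv x (grad H x) = H x.
Proof.
move=> xn; apply/eqP; rewrite eq_le grad_norm_le//=.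
have nx : 0 < `|x| by rewrite normr_gt0.
apply/ler_addgt0Pr => e e0.
have [d d0 hd] := differentiable_eps (dH xn) (divr_gt0 e0 nx).
pose s := Num.min (d / 2 / `|x|) 1; have s0 : 0 < s by rewrite lt_min ltr01 !divr_gt0.
have sd : s <= d / 2 / `|x| by rewrite ge_min lexx.
have sy : `|s *: x| < d.
  by rewrite normrZ gtr0_norm//; move: sd; rewrite ler_pdivlMr//; lra.
have := hd _ sy; rewrite dotvZl ler_norml => /andP[_ h].
have E2 : H (x + s *: x) = (1 + s) * H x.
  by rewrite -{1}(scale1r x) -scalerDl normZ gtr0_norm// addr_gt0.
rewrite E2 normrZ gtr0_norm// in h.
have E : e / `|x| * (s * `|x|) = s * e by field; rewrite gt_eqF.
rewrite E in h; rewrite -(ler_pM2l s0) mulrDr.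
by move: h; rewrite mulrDl mul1r; lra.
Qed.

(** By Euler's relation and [grad_norm_le] the expression is at least [(H x ^ (p - 1) - H y ^ (p -
    1)) * (H x - H y)]. It serves on segments through the origin, where [A] need not be
    differentiable. *)
Lemma flux_monotone x y : 0 <= dotv (A x - A y) (x - y).
Proof.
have Axx z : dotv (A z) z = H z `^ (p - 1) * H z.
  have [->|zn] := eqVneq z 0; first by rewrite dotv0r norm_zero mulr0.
  by rewrite flux_off0// dotvC dotvZr grad_norm_euler.
have Axy z w : dotv (A z) w <= H z `^ (p - 1) * H w.
  have [->|zn] := eqVneq z 0; first by rewrite flux0 dotv0l mulr_ge0 ?powR_ge0 ?norm_ge0.
  by rewrite flux_off0// dotvC dotvZr ler_wpM2l ?powR_ge0// grad_norm_le.
have E (a b u v : 'rV[R]_n) : dotv (a - b) (u - v) = dotv a u - dotv a v - (dotv b u - dotv b v).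
  by rewrite dotvBl !dotvBr.
move: (Axx x) (Axx y) (Axy x y) (Axy y x); move: (A x) (A y) => a b hx hy h1 h2.
rewrite E hx hy.
have h : 0 <= (H x `^ (p - 1) - H y `^ (p - 1)) * (H x - H y).
  have [xy|/ltW xy] := leP (H x) (H y).
    by apply: mulr_le0; rewrite subr_le0//; apply: powR_mono; rewrite ?norm_ge0// ltW.
  by apply: mulr_ge0; rewrite subr_ge0//; apply: powR_mono; rewrite ?norm_ge0// ltW.
rewrite mulrBl !mulrBr in h; lra.
Qed.

(** The scalar mean value theorem for the pairing with a fixed [w]. The intermediate point depends
    on [w], so norms of differences are bounded coordinate by coordinate. *)
Lemma flux_mvt zeta eta w : (forall s : R, 0 <= s <= 1 -> zeta + s *: eta != 0) ->
  exists2 s : R, 0 <= s <= 1 &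
    dotv (A (zeta + eta) - A zeta) w = dotv (eta *m jacobian A (zeta + s *: eta)) w.
Proof.
move=> hz; pose h := fun x => dotv (A x) w.
have dh x : x != 0 -> differentiable h x.
  move=> xn; apply: (@differentiable_comp _ _ _ _ A (dotvr w)); first by have [] := cA xn.
  by apply: linear_differentiable; exact: dotv_continuous.
have [s s01 E] := @mvt_line _ _ h zeta eta (fun s s01 => dh _ (hz s s01)).
exists s => //; transitivity (h (zeta + eta) - h zeta); first exact: dotvBl.
rewrite E -derive_dotv; last exact/dh/hz.
have [dAx _] := cA (hz s s01).
rewrite -deriveEjacobian// !deriveE//; last exact/dh/hz.
rewrite (_ : h = dotvr w \o A)// diff_comp//=; last by apply: linear_differentiable; exact: dotv_continuous.
by rewrite diff_lin//; exact: dotv_continuous.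
Qed.

Lemma enorm_le_norm x : enorm x <= n%:R * `|x|.
Proof.
rewrite /enorm -[leRHS]ger0_norm ?mulr_ge0// -sqrtr_sqr ler_wsqrtr//.
rewrite big_ord1; apply: (@le_trans _ _ (\sum_(i < n) `|x| ^+ 2)).
  apply: ler_sum => i _; rewrite -[leLHS]real_normK ?num_real//.
  by rewrite lerXn2r ?nnegrE// rV_coord_le.
rewrite sumr_const card_ord -[leLHS]mulr_natl exprMn ler_wpM2r ?sqr_ge0//.
by rewrite -natrX ler_nat expnS expn1 leq_pmulr.
Qed.

Lemma norm_le_enorm x : `|x| <= enorm x.
Proof.
apply/rV_norm_leP; first exact: sqrtr_ge0.
move=> i; rewrite /enorm -sqrtr_sqr ler_wsqrtr// big_ord1 (bigD1 i)//= lerDl.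
by apply: sumr_ge0 => j _; exact: sqr_ge0.
Qed.

(** Passage from the Euclidean to the sup norm; the factor [n] to the power [|p - 2|] serves both
    signs of [p - 2]. *)
Lemma jacobian_bounds : exists L1 L2 : R, [/\ 0 < L1, 0 < L2 & forall xi eta, xi != 0 ->
  L1 * `|xi| `^ (p - 2) * `|eta| ^+ 2 <= dotv (eta *m jacobian A xi) eta /\
  `|eta *m jacobian A xi| <= L2 * `|xi| `^ (p - 2) * `|eta|].
Proof.
have [l1 [l2 [l10 l20 h]]] := sA.
have nR1 : 1 <= n%:R :> R by rewrite ler1n.
have nR0 : 0 < n%:R :> R by rewrite ltr0n.
pose N : R := n%:R `^ `|p - 2|; have N0 : 0 < N by rewrite powR_gt0.
exists (l1 / N), (n%:R * l2 * N); split; first by rewrite divr_gt0.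
  by rewrite !mulr_gt0.
move=> xi eta xn; have [h1 h2] := h xi xn.
have nx : 0 < `|xi| by rewrite normr_gt0.
have c1 : enorm xi `^ (p - 2) <= N * `|xi| `^ (p - 2).
  apply: powR_compare => //; last exact: enorm_le_norm.
  by rewrite ler_pdivrMr// (le_trans (norm_le_enorm _))// ler_peMr// sqrtr_ge0.
have ne0 : 0 < enorm xi by exact: lt_le_trans (norm_le_enorm xi).
have c2 : `|xi| `^ (p - 2) <= N * enorm xi `^ (p - 2).
  apply: powR_compare => //.
    by rewrite ler_pdivrMr// mulrC enorm_le_norm.
  by rewrite (le_trans (norm_le_enorm _))// ler_peMl// ltW.
split.
  apply: le_trans (h1 eta); apply: ler_pM => //.
  - by rewrite mulr_ge0 ?powR_ge0// divr_ge0// ltW.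
  - rewrite mulrAC -mulrA ler_wpM2l ?(ltW l10)// ler_pdivrMr// mulrC//.
  - by rewrite lerXn2r ?nnegrE ?norm_le_enorm// sqrtr_ge0.
have Jij i j : `|jacobian A xi i j| <= enorm (jacobian A xi).
  rewrite /enorm -sqrtr_sqr ler_wsqrtr// (bigD1 i)//= (bigD1 j)//= -addrA lerDl.
  by rewrite addr_ge0//; repeat (apply: sumr_ge0 => ? _); exact: sqr_ge0.
apply/rV_norm_leP; first by rewrite !mulr_ge0 ?powR_ge0// ltW.
move=> j; rewrite mxE (le_trans (ler_norm_sum _ _ _))//.
apply: (@le_trans _ _ (\sum_(i < n) (l2 * N * `|xi| `^ (p - 2) * `|eta|))).
  apply: ler_sum => i _; rewrite normrM mulrC; apply: ler_pM => //; last exact: rV_coord_le.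
  by rewrite (le_trans (Jij i j))// (le_trans h2)// -mulrA ler_wpM2l// ltW.
by rewrite sumr_const card_ord -[leLHS]mulr_natl !mulrA.
Qed.

End flux_inequalities.

(** * Ellipticity of differences of the flux *)

Section ellipticity.
Context {R : realType}.
Variable n : nat.
Hypothesis n0 : (0 < n)%N.
Variables (H : 'rV[R]_n -> R) (p : R).
Hypotheses (p1 : 1 < p) (nH : is_norm H) (dH : forall xi, xi != 0 -> differentiable H xi)
  (cA : C1_punctured (flux H p)) (sA : structure_conditions (flux H p) p).
Local Notation A := (flux H p).
Implicit Types (x y xi zeta eta v w : 'rV[R]_n).

Let p0 : 0 < p. Proof. exact: lt_trans p1. Qed.
Let p10 : 0 < p - 1. Proof. by rewrite subr_gt0. Qed.

Lemma flux_mono_dir x eta (t : R) : 0 <= t -> 0 <= dotv (A (x + t *: eta) - A x) eta.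
Proof.
rewrite le_eqVlt => /predU1P[<-|t0]; first by rewrite scale0r addr0 subrr dotv0l.
have := flux_monotone p1 nH dH (x + t *: eta) x.
have -> : x + t *: eta - x = t *: eta by rewrite addrAC subrr add0r.
by move: (A _ - A _) => a; rewrite dotvZr pmulr_rge0.
Qed.

(** If a point of the first quarter of the segment is within [|eta| / 8] of the origin, then the
    last quarter, at distance at least [|eta| / 2] from that point, stays away from the origin. *)
Lemma far_subinterval zeta eta : exists2 a : R, 0 <= a <= 3 / 4 &
  forall s : R, 0 <= s <= 1 -> `|eta| / 8 <= `|zeta + a *: eta + s *: (4^-1 *: eta)|.
Proof.
have eta0 : 0 <= `|eta| by [].
have [h|] := EM (forall s : R, 0 <= s <= 1 -> `|eta| / 8 <= `|zeta + 0 *: eta + s *: (4^-1 *: eta)|).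
  by exists 0 => //; rewrite lexx divr_ge0.
move=> /existsNP[s0 /not_implyP[/andP[s00 s01] /negP]]; rewrite -ltNge scale0r addr0 => hs.
exists (3 / 4); first by rewrite lexx divr_ge0.
move=> s /andP[s0' s1].
have E : zeta + (3 / 4) *: eta + s *: (4^-1 *: eta) = (zeta + s0 *: (4^-1 *: eta)) + (3 / 4 + (s - s0) / 4) *: eta.
  by apply/rowP => i; rewrite !mxE; field.
have c0 : 0 <= 3 / 4 + (s - s0) / 4 by lra.
have := lerB_normD ((3 / 4 + (s - s0) / 4) *: eta) (zeta + s0 *: (4^-1 *: eta)).
rewrite E [X in _ -> _ <= `|X|]addrC normrZ ger0_norm// => h.
apply: le_trans h; have : 1 / 2 * `|eta| <= (3 / 4 + (s - s0) / 4) * `|eta| by rewrite ler_wpM2r//; lra.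
by lra.
Qed.

(** If [|zeta| >= 2 |eta|], the segment avoids the origin and the mean value theorem applies.
    Otherwise [|zeta| + |eta|] is comparable to [|eta|]: the lower bound uses the mean value theorem
    on the quarter from [far_subinterval] and monotonicity on the rest, the upper bound is the
    growth of [A]. *)
Lemma flux_elliptic : exists c C : R, [/\ 0 < c, 0 < C & forall zeta eta,
  c * ((`|zeta| + `|eta|) `^ (p - 2) * `|eta| ^+ 2) <= dotv (A (zeta + eta) - A zeta) eta /\
  `|A (zeta + eta) - A zeta| <= C * ((`|zeta| + `|eta|) `^ (p - 2) * `|eta|)].
Proof.
have [L1 [L2 [L10 L20 J]]] := jacobian_bounds n0 sA.
(* In the second case [W <= 3 |eta|], and the points used have norm at least [|eta| / 8], hence at
   least [W / 24]. *)
pose N : R := 24 `^ `|p - 2|; have N0 : 0 < N by rewrite powR_gt0.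
pose B := norm_bound H * norm_bound H `^ (p - 1).
have B0 : 0 <= B by rewrite mulr_ge0 ?powR_ge0// norm_bound_ge0.
exists (L1 / (4 * N)), (L2 * N + 6 * B); split; [by posit|by posit|].
move=> zeta eta; have [->|en] := eqVneq eta 0.
  by rewrite addr0 subrr dotv0l normr0 expr2 !mulr0.
have ep : 0 < `|eta| by rewrite normr_gt0.
have zp : 0 <= `|zeta| by [].
set W := `|zeta| + `|eta|; have W0 : 0 < W by rewrite ltr_wpDl.
have P0 : 0 <= W `^ (p - 2) by exact: powR_ge0.
have cmp xi : W / 24 <= `|xi| -> `|xi| <= W ->
    [/\ xi != 0, `|xi| `^ (p - 2) <= N * W `^ (p - 2) & W `^ (p - 2) <= N * `|xi| `^ (p - 2)].
  move=> h1 h2; have xp : 0 < `|xi| by apply: lt_le_trans h1; rewrite divr_gt0.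
  have c24 : (1 : R) <= 24 by rewrite ler1n.
  split; [by rewrite -normr_gt0|by apply: powR_compare => //; lra|by apply: powR_compare => //; lra].
have low xi : W / 24 <= `|xi| -> `|xi| <= W ->
    L1 / N * (W `^ (p - 2) * `|eta| ^+ 2) <= dotv (eta *m jacobian A xi) eta.
  move=> h1 h2; have [xn _ h3] := cmp xi h1 h2; have [h4 _] := J xi eta xn.
  apply: le_trans h4; rewrite mulrA; apply: ler_wpM2r; first exact: sqr_ge0.
  by rewrite -mulrA; apply: ler_wpM2l; [exact: ltW|rewrite mulrC ler_pdivrMr// mulrC].
have [h|h] := leP (2 * `|eta|) `|zeta|.
  have seg (s : R) : 0 <= s <= 1 -> W / 24 <= `|zeta + s *: eta| /\ `|zeta + s *: eta| <= W.
    move=> /andP[s0 s1].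
    have se : `|s *: eta| <= `|eta| by rewrite normrZ ger0_norm// ler_piMl.
    have := lerB_normD zeta (s *: eta); have := ler_normD zeta (s *: eta).
    by rewrite /W; split; lra.
  have nz (s : R) : 0 <= s <= 1 -> zeta + s *: eta != 0.
    by move=> /seg[h1 h2]; have [] := cmp _ h1 h2.
  split.
    have [s /seg[h1 h2] ->] := flux_mvt cA eta nz.
    apply: le_trans (low _ h1 h2); apply: ler_wpM2r; first by posit.
    by rewrite ler_wpM2l ?(ltW L10)// lef_pV2 ?posrE ?mulr_gt0// ler_peMl ?(ltW N0)// ler1n.
  apply: (@le_trans _ _ (L2 * N * (W `^ (p - 2) * `|eta|))); last first.
    by apply: ler_wpM2r; [posit|rewrite lerDl; posit].
  apply/rV_norm_leP; first by posit.
  move=> i; have [s /seg[h1 h2] E] := flux_mvt cA (delta_mx ord0 i) nz.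
  move: E; rewrite dotvC dotv_delta => ->; rewrite dotvC dotv_delta.
  have [xn h3 _] := cmp _ h1 h2; have [_ h4] := J _ eta xn.
  rewrite (le_trans (rV_coord_le _ _))// (le_trans h4)// mulrA.
  by apply: ler_wpM2r => //; rewrite -mulrA; apply: ler_wpM2l => //; exact: ltW.
have We : W <= 3 * `|eta| by rewrite /W; lra.
split.
  have [a /andP[a0 a1] ha] := far_subinterval zeta eta.
  have a34 : 0 <= 3 / 4 - a by rewrite subr_ge0.
  have seg (s : R) : 0 <= s <= 1 -> W / 24 <= `|zeta + a *: eta + s *: (4^-1 *: eta)| /\
      `|zeta + a *: eta + s *: (4^-1 *: eta)| <= W.
    move=> s01; have := ha s s01 => h1; split; first by lra.
    have /andP[s0 s1] := s01.
    rewrite scalerA -addrA -scalerDl (le_trans (ler_normD _ _))// lerD2l normrZ ler_piMl//.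
    by rewrite ger0_norm; lra.
  have nz (s : R) : 0 <= s <= 1 -> zeta + a *: eta + s *: (4^-1 *: eta) != 0.
    by move=> /seg[h1 h2]; have [] := cmp _ h1 h2.
  have [s /seg[h1 h2] E] := flux_mvt cA eta nz.
  have lw := low _ h1 h2; rewrite -scalemxAl dotvZl in E.
  have m1 := flux_mono_dir zeta eta a0.
  have m2 := flux_mono_dir (zeta + a *: eta + 4^-1 *: eta) eta a34.
  have E1 : zeta + a *: eta + 4^-1 *: eta + (3 / 4 - a) *: eta = zeta + eta.
    by apply/rowP => i; rewrite !mxE; field.
  rewrite E1 in m2.
  have E2 (u1 u2 u3 u4 : 'rV[R]_n) : dotv (u1 - u4) eta = dotv (u1 - u2) eta + dotv (u2 - u3) eta + dotv (u3 - u4) eta.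
    by rewrite !dotvBl; ring.
  rewrite (E2 _ (A (zeta + a *: eta + 4^-1 *: eta)) (A (zeta + a *: eta))).
  apply: (@le_trans _ _ (dotv (A (zeta + a *: eta + 4^-1 *: eta) - A (zeta + a *: eta)) eta)); last first.
    by rewrite -[X in X <= _]add0r -[X in X <= _]addr0; exact: (lerD (lerD m2 (lexx _)) m1).
  rewrite E (_ : L1 / (4 * N) * _ = 4^-1 * (L1 / N * (W `^ (p - 2) * `|eta| ^+ 2))); last first.
    by field; rewrite gt_eqF.
  by apply: ler_wpM2l.
have WW : W `^ (p - 1) = W `^ (p - 2) * W.
  rewrite -(mulr_powRB1 (ltW W0) p10) mulrC (_ : p - 1 - 1 = p - 2)//; ring.
have gr xi : `|xi| <= W -> `|A xi| <= B * (W `^ (p - 2) * W).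
  move=> h1; rewrite (le_trans (flux_growth p1 nH dH _))// -/B ler_wpM2l// -WW.
  by apply: powR_mono; rewrite // ltW.
rewrite (le_trans (ler_normB _ _))//.
have g1 : `|A (zeta + eta)| <= B * (W `^ (p - 2) * W) by apply: gr; exact: ler_normD.
have g2 : `|A zeta| <= B * (W `^ (p - 2) * W) by apply: gr; rewrite lerDl.
have g3 : B * (W `^ (p - 2) * W) <= B * (W `^ (p - 2) * (3 * `|eta|)).
  by apply: ler_wpM2l => //; apply: ler_wpM2l.
have g4 : 0 <= L2 * N * (W `^ (p - 2) * `|eta|) by posit.
apply: (le_trans (lerD (le_trans g1 g3) (le_trans g2 g3))).
by rewrite [leLHS](_ : _ = 6 * B * (W `^ (p - 2) * `|eta|)) ?mulrDl ?lerDr//; ring.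
Qed.

(* Where [|zeta|] is comparable to [kappa], the difference [A (zeta + eta) - A zeta]
   is comparable to [gkap kappa |eta|], with constants that do not depend on
   [kappa]: this makes Harnack's inequality for the difference of a solution and a
   radial solution independent of the latter. *)
Definition gkap (kappa t : R) : R := (kappa + t) `^ (p - 2) * t.

Lemma flux_kappa (Lam : R) : 1 <= Lam -> exists c C : R, [/\ 0 < c, 0 < C &
  forall kappa zeta eta, kappa / Lam <= `|zeta| -> `|zeta| <= Lam * kappa -> 0 <= kappa ->
  c * (gkap kappa `|eta| * `|eta|) <= dotv (A (zeta + eta) - A zeta) eta /\
  `|A (zeta + eta) - A zeta| <= C * gkap kappa `|eta|].
Proof.
move=> L1; have [c [C [c0 C0 h]]] := flux_elliptic.
have L0 : 0 < Lam by exact: lt_le_trans L1.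
pose N : R := Lam `^ `|p - 2|; have N0 : 0 < N by rewrite powR_gt0.
exists (c / N), (C * N); split; [by posit|by posit|].
move=> kappa zeta eta h1 h2 k0; have [h3 h4] := h zeta eta.
have [en|en] := eqVneq eta 0.
  by rewrite en addr0 subrr dotv0l /gkap normr0 !mulr0.
have ep : 0 < `|eta| by rewrite normr_gt0.
have W0 : 0 < kappa + `|eta| by rewrite ltr_wpDl.
have V0 : 0 < `|zeta| + `|eta| by rewrite ltr_wpDl.
have e1 : `|eta| / Lam <= `|eta| by rewrite ler_pdivrMr// ler_peMr// ltW.
have e2 : `|eta| <= Lam * `|eta| by rewrite ler_peMl// ltW.
have c1 : (`|zeta| + `|eta|) `^ (p - 2) <= N * (kappa + `|eta|) `^ (p - 2).
  by apply: powR_compare => //; rewrite ?mulrDl ?mulrDr lerD.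
have c2 : (kappa + `|eta|) `^ (p - 2) <= N * (`|zeta| + `|eta|) `^ (p - 2).
  apply: powR_compare => //; rewrite ?mulrDl ?mulrDr lerD//.
    by rewrite ler_pdivrMr// mulrC.
  by rewrite mulrC -ler_pdivrMr.
split.
  apply: le_trans h3.
  rewrite (_ : c / N * _ = c * ((kappa + `|eta|) `^ (p - 2) / N * `|eta| ^+ 2)); last by rewrite /gkap; ring.
  apply: ler_wpM2l; first exact: ltW.
  by apply: ler_wpM2r; [exact: sqr_ge0|rewrite ler_pdivrMr// mulrC].
rewrite (le_trans h4)// -mulrA; apply: ler_wpM2l; first exact: ltW.
by rewrite /gkap mulrA ler_wpM2r// ltW.
Qed.

(** For [p <= 2] the function grows between the powers [p - 1] and 1, for [p > 2] between 1 and
    [p - 1]. The power [n - 1] dominates the upper one in both cases, as [n] is at least 2 and at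
    least [p]. *)
Lemma gkap_orlicz kappa : (2 <= n)%N -> p <= n%:R -> 0 <= kappa -> orlicz (Num.min p 2) n (gkap kappa).
Proof.
move=> n2 pn k0; split.
- by move=> t t0; rewrite /gkap mulr_gt0// powR_gt0// ltr_wpDl.
- by rewrite /gkap mulr0.
- move=> l t l1 t0; have l0 : 0 < l by exact: lt_le_trans l1.
  move: t0; rewrite le_eqVlt => /predU1P[<-|t0]; first by rewrite /gkap !mulr0.
  have W0 : 0 < kappa + t by rewrite ltr_wpDl.
  have W1 : 0 < kappa + l * t by rewrite ltr_wpDl// mulr_gt0.
  have tl : kappa + t <= kappa + l * t by rewrite lerD2l ler_peMl// ltW.
  have [p2|p2] := leP p 2.
    have -> : l `^ (p - 1) = l `^ (p - 2) * l.
      rewrite -(mulr_powRB1 (ltW l0) p10) mulrC (_ : p - 1 - 1 = p - 2)//; ring.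
    rewrite /gkap (_ : l `^ (p - 2) * l * _ = (l `^ (p - 2) * (kappa + t) `^ (p - 2)) * (l * t)); last by ring.
    rewrite ler_wpM2r ?mulr_ge0 ?(ltW t0) ?(ltW l0)// -powRM ?(ltW l0) ?(ltW W0)//.
    rewrite -[p - 2]opprK powRN (powRN (kappa + _)) lef_pV2 ?posrE ?powR_gt0 ?mulr_gt0//.
    apply: powR_mono; rewrite ?oppr_ge0 ?subr_le0 ?(ltW W1)//.
    by rewrite mulrDr lerD2r ler_peMl.
  have -> : (2 - 1 : R) = 1 by ring.
  rewrite powRr1 ?(ltW l0)// /gkap mulrCA ler_wpM2r ?mulr_ge0 ?(ltW t0) ?(ltW l0)//.
  by apply: powR_mono; rewrite ?subr_ge0 ?(ltW p2) ?(ltW W0).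
- move=> l t l1 t0; have l0 : 0 < l by exact: lt_le_trans l1.
  move: t0; rewrite le_eqVlt => /predU1P[<-|t0]; first by rewrite /gkap !mulr0.
  have W0 : 0 < kappa + t by rewrite ltr_wpDl.
  have W1 : 0 < kappa + l * t by rewrite ltr_wpDl// mulr_gt0.
  have tl : kappa + t <= kappa + l * t by rewrite lerD2l ler_peMl// ltW.
  have nE : l ^+ n.-1 = l `^ (n%:R - 1).
    rewrite -powR_mulrn ?(ltW l0)//; congr (_ `^ _).
    by rewrite -[in RHS](prednK (ltnW n2)) -natr1 addrK.
  rewrite nE; have [p2|p2] := leP p 2.
    apply: (@le_trans _ _ (l * gkap kappa t)).
      rewrite /gkap [leRHS]mulrCA ler_wpM2r ?mulr_ge0 ?(ltW t0) ?(ltW l0)//.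
      rewrite -[p - 2]opprK powRN (powRN (kappa + t)) lef_pV2 ?posrE ?powR_gt0//.
      by apply: powR_mono; rewrite ?oppr_ge0 ?subr_le0 ?(ltW W0).
    rewrite ler_wpM2r ?mulr_ge0 ?powR_ge0 ?(ltW t0)//.
    rewrite -[leLHS]powRr1 ?(ltW l0)// ler_powR//.
    have : (2 : R) <= n%:R by rewrite ler_nat.
    by lra.
  apply: (@le_trans _ _ (l `^ (p - 1) * gkap kappa t)); last first.
    by rewrite ler_wpM2r ?mulr_ge0 ?powR_ge0 ?(ltW t0)// ler_powR// lerD2r.
  have -> : l `^ (p - 1) = l `^ (p - 2) * l.
    rewrite -(mulr_powRB1 (ltW l0) p10) mulrC (_ : p - 1 - 1 = p - 2)//; ring.
  rewrite /gkap (_ : l `^ (p - 2) * l * _ = (l `^ (p - 2) * (kappa + t) `^ (p - 2)) * (l * t)); last by ring.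
  rewrite ler_wpM2r ?mulr_ge0 ?(ltW t0) ?(ltW l0)// -powRM ?(ltW l0) ?(ltW W0)//.
  apply: powR_mono; rewrite ?subr_ge0 ?(ltW p2) ?(ltW W1)//.
  by rewrite mulrDr lerD2r ler_peMl.
Qed.

End ellipticity.

(** * The dual norm and radial solutions *)

Section dual_norm.
Context {R : realType}.
Variable n : nat.
Hypothesis n0 : (0 < n)%N.
Variables (H : 'rV[R]_n -> R).
Hypotheses (nH : is_norm H) (uH : uniformly_convex H) (dH : forall xi, xi != 0 -> differentiable H xi).
Implicit Types (x y xi zeta eta v w : 'rV[R]_n).

Lemma dual_witness x : exists xi, H xi <= 1 /\ forall zeta, H zeta <= 1 -> dotv x zeta <= dotv x xi.
Proof.
have [b b0 hb] := norm_lower n0 nH.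
have cH := norm_continuous' nH.
pose S := [set xi | H xi <= 1].
have cS : compact S.
  apply: (subclosed_compact _ (@cube_compact R n 0 b^-1)).
    rewrite (_ : S = H @^-1` [set t | t <= 1])//; apply: preimage_closed; last exact: closed_le.
    by move=> x' _; exact: cH.
  move=> xi; rewrite /S/cube/= subr0 => h; rewrite -[leRHS]mulr1 mulrC ler_pdivlMr// mulrC.
  exact: le_trans (hb xi) h.
have [c /set_mem cS' hc] : exists2 c, c \in S & forall t, t \in S -> dotvr x t <= dotvr x c.
  apply: EVT_max_rV => //; first by exists 0; rewrite /S/= norm_zero.
  by apply: continuous_subspaceT; exact: dotv_continuous.
by exists c; split => // zeta /mem_set/hc; rewrite /dotvr dotvC [leRHS]dotvC.
Qed.

(** A chosen maximizer on the unit ball of [H]. Uniform convexity makes the choice continuous off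
    the origin ([dual_arg_continuous]), and there it is the gradient of [dual_norm]. *)
Definition dual_arg x : 'rV[R]_n := projT1 (cid (dual_witness x)).

Definition dual_norm x : R := dotv x (dual_arg x).

Local Notation xi_ := dual_arg.
Local Notation N := dual_norm.

Lemma dual_arg_le x : H (xi_ x) <= 1.
Proof. by rewrite /dual_arg; case: cid => xi []. Qed.

Lemma dual_norm_max x zeta : H zeta <= 1 -> dotv x zeta <= N x.
Proof. by rewrite /dual_norm /dual_arg; case: cid => xi [] /= _; apply. Qed.

Lemma dual_norm_holder x zeta : dotv x zeta <= N x * H zeta.
Proof.
have [->|zn] := eqVneq zeta 0; first by rewrite dotv0r norm_zero// mulr0.
have hz := norm_gt0 nH zn.
rewrite -ler_pdivrMr// mulrC -dotvZr; apply: dual_norm_max.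
by rewrite (normZ nH) ger0_norm ?invr_ge0 ?(ltW hz)// mulVf ?gt_eqF.
Qed.

Lemma dotv_gt0 x : x != 0 -> `|x| ^+ 2 <= dotv x x /\ 0 < dotv x x.
Proof.
move=> xn; suff h : `|x| ^+ 2 <= dotv x x by split => //; apply: lt_le_trans h; rewrite exprn_gt0// normr_gt0.
have s0 : 0 <= dotv x x by apply: sumr_ge0 => i _; rewrite -expr2 sqr_ge0.
rewrite -[leRHS]sqr_sqrtr// lerXn2r ?nnegrE ?sqrtr_ge0//.
apply/rV_norm_leP => [|i]; first exact: sqrtr_ge0.
rewrite -sqrtr_sqr ler_wsqrtr// /dotv (bigD1 i)//= -expr2 lerDl.
by apply: sumr_ge0 => j _; rewrite -expr2 sqr_ge0.
Qed.

Lemma dual_norm_gt0 x : x != 0 -> 0 < N x.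
Proof.
move=> xn; have [_ h] := dotv_gt0 xn; have := lt_le_trans h (dual_norm_holder x x).
by rewrite pmulr_lgt0// norm_gt0.
Qed.

Lemma dual_norm0 : N 0 = 0. Proof. exact: dotv0l. Qed.

Lemma dual_norm_ge0 x : 0 <= N x.
Proof. by have [->|/dual_norm_gt0/ltW//] := eqVneq x 0; rewrite dual_norm0. Qed.

Lemma dual_arg_norm x : x != 0 -> H (xi_ x) = 1.
Proof.
move=> xn; apply/eqP; rewrite eq_le dual_arg_le/=.
by have := dual_norm_holder x (xi_ x); rewrite -/(N x) ler_pMr// dual_norm_gt0.
Qed.

Lemma dual_arg_neq0 x : x != 0 -> xi_ x != 0.
Proof.
by move=> /dual_arg_norm h; apply/eqP => h'; move: h; rewrite h' norm_zero// => /eqP; rewrite eq_sym oner_eq0.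
Qed.

Lemma dual_bounds : exists b B : R, [/\ 0 < b, 0 < B,
  forall x, b * `|x| <= N x <= B * `|x|,
  forall x, x != 0 -> b <= `|xi_ x| & forall x, `|xi_ x| <= B].
Proof.
have [b b0 hb] := norm_lower n0 nH; have B0 := norm_bound_ge0 nH.
pose B := norm_bound H + 1; have Bp : 0 < B by rewrite ltr_wpDl.
have HB x : H x <= B * `|x| by rewrite (le_trans (norm_le nH x))// ler_wpM2r// lerDl ler01.
have xiB x : `|xi_ x| <= b^-1.
  rewrite -[leRHS]mulr1 mulrC ler_pdivlMr// mulrC.
  exact: le_trans (hb _) (dual_arg_le x).
have b1 : 0 <= b^-1 by rewrite invr_ge0 ltW.
have n1 : 1 <= n%:R :> R by rewrite ler1n.
exists B^-1, (n%:R * b^-1); split.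
- by rewrite invr_gt0.
- by rewrite mulr_gt0 ?ltr0n// invr_gt0.
- move=> x; apply/andP; split; last first.
    by rewrite (le_trans (ler_norm _))// (le_trans (dotv_bound _ _))// mulrAC ler_wpM2r// ler_wpM2l.
  have [->|xn] := eqVneq x 0; first by rewrite normr0 mulr0 dual_norm_ge0.
  have [h _] := dotv_gt0 xn; have h2 := le_trans h (dual_norm_holder x x).
  have nx : 0 < `|x| by rewrite normr_gt0.
  have := le_trans h2 (ler_wpM2l (dual_norm_ge0 x) (HB x)).
  by rewrite expr2 mulrA ler_pM2r// => h3; rewrite ler_pdivrMl// mulrC.
- move=> x xn; rewrite -[leLHS]mulr1 ler_pdivrMl// -(dual_arg_norm xn); exact: HB.
- by move=> x; rewrite (le_trans (xiB x))// ler_peMl.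
Qed.

Lemma dual_norm_lip : exists2 B : R, 0 < B & forall x y, `|N x - N y| <= B * `|x - y|.
Proof.
have [b [B [b0 B0 _ _ xiB]]] := dual_bounds.
exists (n%:R * B) => [|x y]; first by rewrite mulr_gt0 ?ltr0n.
have h u v : N u - N v <= n%:R * B * `|u - v|.
  have h1 := dual_norm_max v (dual_arg_le u).
  rewrite (@le_trans _ _ (dotv (u - v) (xi_ u)))//; first by rewrite dotvBl lerD2l lerN2.
  by rewrite (le_trans (ler_norm _))// (le_trans (dotv_bound _ _))// mulrAC ler_wpM2r// ler_wpM2l.
by rewrite ler_norml h andbT; have := h y x; rewrite distrC; lra.
Qed.

Lemma dual_norm_continuous : continuous N.
Proof.
have [B B0 h] := dual_norm_lip; move=> x; apply/continuous_epsP => e e0.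
exists (e / B) => [|y]; first by rewrite divr_gt0.
rewrite ltr_pdivlMr// => ye; rewrite (le_trans (h _ _))//.
by rewrite addrAC subrr add0r mulrC ltW.
Qed.

(** Were the maximizers at [x] and [x + y] far apart, their midpoint would lie well inside the unit
    ball; then [dotv x] at the maximizer of [x + y] would fall short of [N x] by [2 * dl * N x],
    more than a small [y] can make up for. *)
Lemma dual_arg_continuous x : x != 0 -> {for x, continuous xi_}.
Proof.
move=> xn; have [bb [B [_ B0 _ _ xiB]]] := dual_bounds.
have [b b0 hb] := norm_lower n0 nH.
have nx : 0 < `|x| by rewrite normr_gt0.
have Nx := dual_norm_gt0 xn.
apply/continuous_epsP => e e0.
have [dl dl0 hdl] := uH (mulr_gt0 b0 e0).
have nB : 0 < n%:R * B by rewrite mulr_gt0 ?ltr0n.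
(* The bound by [|x|] keeps [x + y] off the origin, where a maximizer need not lie on the unit
   sphere of [H]. *)
pose r := Num.min `|x| (dl * N x / (n%:R * B)).
have r0 : 0 < r by rewrite lt_min nx divr_gt0// mulr_gt0.
exists r => // y; rewrite lt_min => /andP[y1 y2].
have yn : x + y != 0.
  by apply: contraTneq y1 => /eqP; rewrite addr_eq0 => /eqP ->; rewrite normrN ltxx.
rewrite leNgt; apply/negP => he.
set z := x + y in yn he *.
have Hz : b * e <= H (xi_ z - xi_ x) by apply: le_trans (hb _); rewrite ler_wpM2l// ltW.
have hm := hdl _ _ (dual_arg_norm yn) (dual_arg_norm xn) Hz.
have h1 : dotv x (xi_ z) <= N x * (1 - 2 * dl).
  have := le_trans (dual_norm_holder x (2^-1 *: (xi_ z + xi_ x))) (ler_wpM2l (ltW Nx) hm).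
  by rewrite dotvZr dotvDr -/(N x); lra.
have bnd zeta : `|zeta| <= B -> `|dotv y zeta| <= n%:R * B * `|y|.
  by move=> h; rewrite (le_trans (dotv_bound _ _))// mulrAC ler_wpM2r// ler_wpM2l.
have h2 : N x - n%:R * B * `|y| <= N z.
  have := dual_norm_max z (dual_arg_le x); rewrite dotvDl -/(N x).
  by have := bnd _ (xiB x); rewrite ler_norml => /andP[]; lra.
have h3 : N z <= dotv x (xi_ z) + n%:R * B * `|y|.
  rewrite {1}/dual_norm {1}/z dotvDl lerD2l (le_trans (ler_norm _))//; exact/bnd/xiB.
have : n%:R * B * `|y| < dl * N x by rewrite mulrC -ltr_pdivlMr.
by lra.
Qed.

(** An envelope argument: the increment of [N] along [v] lies between the pairings of [v] with the
    maximizers at [x] and at [x + v], and these are close. *)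
Lemma dual_norm_grad x : x != 0 -> differentiable N x /\ grad N x = xi_ x.
Proof.
move=> xn; apply: differentiable_epsP => e e0.
have n1 : 0 < n%:R :> R by rewrite ltr0n.
have e1 : 0 < e / n%:R by rewrite divr_gt0.
have /continuous_epsP/(_ _ e1)[d d0 hd] := dual_arg_continuous xn.
exists d => // v vd.
have h1 := dual_norm_max (x + v) (dual_arg_le x); rewrite dotvDl -/(N x) in h1.
have h2 := dual_norm_max x (dual_arg_le (x + v)).
have h3 : N (x + v) = dotv x (xi_ (x + v)) + dotv v (xi_ (x + v)) by rewrite -dotvDl.
rewrite ger0_norm; last by lra.
apply: (@le_trans _ _ (dotv v (xi_ (x + v) - xi_ x))); first by rewrite dotvBr; lra.
rewrite (le_trans (ler_norm _))// (le_trans (dotv_bound _ _))//.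
rewrite mulrAC ler_wpM2r//; have := hd v vd; rewrite ler_pdivlMr// mulrC//.
Qed.

Lemma dual_norm_C1on : C1on [set x | x != 0] N.
Proof.
move=> x xn; split; first exact: (dual_norm_grad xn).1.
apply: near_eq_cont (dual_arg_continuous xn).
have : nbhs x [set x | x != 0].
  apply: open_nbhs_nbhs; split => //.
  rewrite (_ : mkset _ = ~` [set 0]); first by apply: closed_openC; apply: compact_closed; [exact: norm_hausdorff|exact: compact_set1].
  by apply/seteqP; split => z /=; [move=> /eqP|move=> /eqP].
by apply: filterS => y yn; rewrite (dual_norm_grad yn).2.
Qed.

Lemma open_neq0 : open [set x : 'rV[R]_n | x != 0].
Proof.
rewrite (_ : mkset _ = ~` [set 0]); first by apply: closed_openC; apply: compact_closed; [exact: norm_hausdorff|exact: compact_set1].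
by apply/seteqP; split => z /=; [move=> /eqP|move=> /eqP].
Qed.

(* Lagrange multipliers: [dual_arg x] maximizes [dotv x] on the unit ball of [H]. *)
Lemma dual_duality x : x != 0 -> x = N x *: grad H (xi_ x).
Proof.
move=> xn; have xin := dual_arg_neq0 xn; have Nx := dual_norm_gt0 xn.
have h v : dotv v x <= N x * dotv v (grad H (xi_ x)).
  apply/ler_addgt0Pr => e e0.
  pose e1 := e / (N x * (`|v| + 1)).
  have D0 : 0 < `|v| + 1 by rewrite ltr_wpDl.
  have e10 : 0 < e1 by rewrite divr_gt0// mulr_gt0.
  have [d d0 hd] := differentiable_eps (dH xin) e10.
  pose s := d / (`|v| + 1); have s0 : 0 < s by rewrite divr_gt0.
  have sv : `|s *: v| < d.
    by rewrite normrZ gtr0_norm// /s mulrAC ltr_pdivrMr// ltr_pM2l// ltrDl.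
  have := hd _ sv; rewrite dotvZl ler_norml => /andP[_ h1].
  have h2 := dual_norm_holder x (xi_ x + s *: v).
  rewrite dotvDr -/(N x) dotvZr dotvC in h2.
  rewrite (dual_arg_norm xn) normrZ gtr0_norm// in h1.
  have h3 : H (xi_ x + s *: v) <= 1 + s * dotv v (grad H (xi_ x)) + e1 * (s * `|v|) by lra.
  have h4 := le_trans h2 (ler_wpM2l (ltW Nx) h3).
  have h5 : N x * (e1 * (s * `|v|)) <= s * e.
    have -> : N x * (e1 * (s * `|v|)) = s * e * (`|v| / (`|v| + 1)).
      by rewrite /e1; field; rewrite !gt_eqF.
    by apply: ler_piMr; [posit|rewrite ler_pdivrMr// mul1r lerDl ltW].
  by rewrite -(ler_pM2l s0) mulrDr; lra.
apply/rowP => i; have h1 := h (delta_mx ord0 i); have h2 := h (- delta_mx ord0 i).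
rewrite !dotvNl !dotv_delta in h2; rewrite !dotv_delta in h1.
by rewrite mxE; apply/eqP; rewrite eq_le h1/=; lra.
Qed.

Lemma dual_normZ (t : R) x : 0 < t -> N (t *: x) = t * N x.
Proof.
have h s y : 0 < s -> s * N y <= N (s *: y).
  by move=> s0; have := dual_norm_max (s *: y) (dual_arg_le y); rewrite dotvZl.
move=> t0; apply/eqP; rewrite eq_le h// andbT.
have := h t^-1 (t *: x); rewrite invr_gt0 => /(_ t0).
by rewrite scalerA mulVf ?gt_eqF// scale1r ler_pdivrMl.
Qed.

Lemma dual_norm_level (r : R) : 0 < r -> exists2 x, N x = r & x != 0.
Proof.
move=> r0; pose e1 : 'rV[R]_n := const_mx 1.
have en : e1 != 0 by apply/eqP => /rowP/(_ (Ordinal n0))/eqP; rewrite !mxE oner_eq0.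
have ne := dual_norm_gt0 en.
exists ((r / N e1) *: e1); first by rewrite dual_normZ ?divr_gt0// divfK// gt_eqF.
by rewrite scaler_eq0 negb_or en gt_eqF// divr_gt0.
Qed.

End dual_norm.

(** * Radial solutions *)

Section radial.
Context {R : realType}.
Variable n : nat.
Hypothesis n0 : (0 < n)%N.
Variables (H : 'rV[R]_n -> R) (p : R).
Hypotheses (p1 : 1 < p) (pn : p <= n%:R) (nH : is_norm H) (uH : uniformly_convex H)
  (dH : forall xi, xi != 0 -> differentiable H xi).
Local Notation A := (flux H p).
Local Notation mu := (@lebesgue_rV R n).
Local Notation N := (dual_norm n0 nH).
Local Notation xi_ := (dual_arg n0 nH).
Implicit Types (x : 'rV[R]_n).

Let p10 : 0 < p - 1. Proof. by rewrite subr_gt0. Qed.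

(** The exponent for which [s ^ (n - 1) * (s ^ (- rexp)) ^ (p - 1)] is constant. It equals 1 exactly
    when [p = n], the logarithmic case of [rgam]. *)
Definition rexp : R := (n%:R - 1) / (p - 1).

Lemma rexp_ge1 : 1 <= rexp.
Proof. by rewrite /rexp ler_pdivlMr// mul1r lerD2r. Qed.

Definition rgam (s : R) : R := if rexp == 1 then - ln s else s `^ (1 - rexp) / (rexp - 1).

Lemma is_derive_rgam (s : R) : 0 < s -> is_derive s (1:R) rgam (- (s `^ (- rexp))).
Proof.
move=> s0; have [r1|r1] := boolP (rexp == 1); rewrite /rgam ?r1 ?(negPf r1).
  rewrite (eqP r1); have h := is_deriveN (is_derive1_ln s0).
  rewrite powRN powRr1 ?(ltW s0)//; exact: h.
have r0 : rexp - 1 != 0 by rewrite subr_eq0.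
have h := is_deriveZ (rexp - 1)^-1 (is_derive1_powR (1 - rexp) s0).
rewrite (_ : (fun s => s `^ (1 - rexp) / (rexp - 1)) = (rexp - 1)^-1 \*: (@powR R ^~ (1 - rexp))); last first.
  by apply/funext => t; rewrite /= mulrC.
apply: (is_derive_eq h); rewrite /GRing.scale/= (_ : 1 - rexp - 1 = - rexp); last by ring.
by rewrite mulrA (_ : (rexp - 1)^-1 * (1 - rexp) = -1) ?mulN1r//; field.
Qed.

Lemma rgam_decr (s t : R) : 0 < s -> s < t -> rgam t < rgam s.
Proof.
move=> s0 st; rewrite -subr_lt0.
have [||c + ->] := @MVT R rgam (fun s => - (s `^ (- rexp))) s t st.
- by move=> x; rewrite in_itv/= => /andP[sx _]; apply: is_derive_rgam; exact: lt_trans sx.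
- apply: continuous_in_subspaceT => x /set_mem; rewrite /= in_itv/= => /andP[sx _].
  apply: differentiable_continuous; apply/derivable1_diffP.
  by have [] := is_derive_rgam (lt_le_trans s0 sx).
rewrite in_itv/= => /andP[sc _]; rewrite nmulr_rlt0 ?subr_gt0// oppr_lt0 powR_gt0//.
exact: lt_trans sc.
Qed.

(** By monotonicity one radius suffices: [exp(-B)] in the logarithmic case, otherwise the point
    where the power, of negative exponent since [rexp > 1], takes the value [|B| + 1]. *)
Lemma rgam_infty (B : R) : exists2 s0, 0 < s0 & forall s, 0 < s -> s <= s0 -> B <= rgam s.
Proof.
have mono s s0 : 0 < s -> s <= s0 -> rgam s0 <= rgam s.
  by move=> sp; rewrite le_eqVlt => /predU1P[->//|h]; exact/ltW/rgam_decr.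
suff [s0 s00 h] : exists2 s0, 0 < s0 & B <= rgam s0.
  by exists s0 => // s sp ss; exact: le_trans (mono _ _ sp ss).
have [r1|r1] := boolP (rexp == 1); rewrite /rgam ?r1 ?(negPf r1).
  by exists (expR (- B)); rewrite ?expR_gt0// expRK opprK.
have r0 : 0 < rexp - 1 by rewrite lt_neqAle eq_sym subr_eq0 r1 subr_ge0 rexp_ge1.
pose C := (`|B| + 1) * (rexp - 1); have C0 : 0 < C by rewrite mulr_gt0// ltr_wpDl.
exists (C `^ (1 - rexp)^-1); first by rewrite powR_gt0.
have nz : 1 - rexp != 0 by rewrite subr_eq0 eq_sym.
rewrite -powRrM mulVf// powRr1 ?(ltW C0)// /C mulfK ?gt_eqF//.
by rewrite (le_trans (ler_norm _))// lerDl.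
Qed.

Definition radial x : R := rgam (N x).

Lemma powR_cont (a s : R) : 0 < s -> {for s, continuous (fun t : R => t `^ a)}.
Proof.
move=> s0; apply: differentiable_continuous; apply/derivable1_diffP.
by have [] := is_derive1_powR a s0.
Qed.

Lemma radial_C1on : C1on [set x | x != 0] radial.
Proof.
apply: (C1on_comp (phi' := fun s => - (s `^ (- rexp))) (@open_neq0 R n) (dual_norm_C1on n0 nH uH)) => x xn.
  by apply: is_derive_rgam; exact: dual_norm_gt0.
by apply: continuousN; apply: powR_cont; exact: dual_norm_gt0.
Qed.

Lemma radial_grad x : x != 0 -> grad radial x = - (N x `^ (- rexp)) *: xi_ x.
Proof.
move=> xn; have [dN gN] := dual_norm_grad n0 nH uH xn.
by have [_ ->] := grad_comp dN (is_derive_rgam (dual_norm_gt0 n0 nH xn)); rewrite gN.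
Qed.

Definition wrad (a b : R) x : R := a + b * radial x.

Lemma wrad_C1on a b : C1on [set x | x != 0] (wrad a b).
Proof.
have o := @open_neq0 R n.
apply: (C1on_eq o _ (C1onD o (C1on_cst a) (C1onM o (C1on_cst b) radial_C1on))) => //.
Qed.

Lemma wrad_grad a b x : x != 0 -> grad (wrad a b) x = (- b * N x `^ (- rexp)) *: xi_ x.
Proof.
move=> xn; have [dr _] := radial_C1on xn.
have -> : wrad a b = (fun=> a) \+ (fun x => b * radial x) by [].
rewrite gradD; [|exact: differentiable_cst|].
  by rewrite grad_cst add0r gradZ// radial_grad// scalerA; congr (_ *: _); ring.
by case: (C1onM (@open_neq0 R n) (C1on_cst b) radial_C1on xn).
Qed.

(** By [flux_scale] the flux is a multiple of [A (xi_ x)], which equals [grad H (xi_ x)], that is,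
    [x] divided by [N x]; by the choice of [rexp] the scalar factor contributes [N x] to the power
    [1 - n]. *)
Lemma wrad_flux a b : exists c : R, forall x, x != 0 ->
  A (grad (wrad a b) x) = c *: (N x `^ (- n%:R) *: x).
Proof.
have [->|bn] := eqVneq b 0.
  by exists 0 => x xn; rewrite wrad_grad// oppr0 mul0r !scale0r flux0.
exists (`|b| `^ p / - b) => x xn; rewrite wrad_grad//.
have Nx := dual_norm_gt0 n0 nH xn.
have Np : 0 < N x `^ (- rexp) by rewrite powR_gt0.
have xin := dual_arg_neq0 n0 nH xn.
have tn : - b * N x `^ (- rexp) != 0 by rewrite mulf_neq0 ?oppr_eq0// gt_eqF.
rewrite (flux_scale p1 nH dH tn xin) (flux_off0 p1 nH dH xin).
rewrite (dual_arg_norm n0 nH xn) powR1 scale1r.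
have -> : grad H (xi_ x) = (N x)^-1 *: x.
  by rewrite [X in _ = _ *: X](dual_duality n0 nH dH xn) scalerA mulVf ?scale1r// gt_eqF.
rewrite !scalerA; congr (_ *: _).
rewrite normrM normrN (ger0_norm (ltW Np)) powRM ?(ltW Np)//.
have -> : (N x `^ (- rexp)) `^ p = N x `^ (- n%:R) * N x * N x `^ (- rexp).
  rewrite -powRrM -[X in _ * X * _]powRr1 ?(ltW Nx)//.
  have pD u v : N x `^ (u + v) = N x `^ u * N x `^ v by rewrite powRD// (gt_eqF Nx) /= implybT.
  rewrite -!pD; congr (_ `^ _).
  rewrite /rexp; field; rewrite gt_eqF//.
by field; rewrite bn !gt_eqF.
Qed.

(** The partial derivatives of [z * x_i * N ^ (-n)] have integral 0. In their sum over [i] the terms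
    without a derivative of [z] cancel, because the pairing of [x] with [grad N] is [N x], and the
    integrand remains. *)
Lemma wrad_div_free (K : set 'rV[R]_n) z : compact K -> ~ K 0 -> C1 z ->
  (forall x, ~ K x -> z x = 0) ->
  \int[mu]_x dotv (N x `^ (- n%:R) *: x) (grad z x) = 0.
Proof.
move=> cK K0 cz zK; have o := @open_neq0 R n.
pose V x := N x `^ (- n%:R).
have clK : closed K by apply: compact_closed => //; exact: norm_hausdorff.
have KU : K `<=` [set x | x != 0] by move=> x Kx; apply/eqP => x0; apply: K0; rewrite -x0.
have dV x : x != 0 -> is_derive (N x) (1:R) (fun t : R => t `^ (- n%:R)) (- n%:R * N x `^ (- n%:R - 1)).
  by move=> xn; apply: is_derive1_powR; exact: dual_norm_gt0.
have cV : C1on [set x | x != 0] V.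
  apply: (@C1on_comp R n _ (fun t : R => t `^ (- n%:R)) (fun t => - n%:R * t `^ (- n%:R - 1)) _ o (dual_norm_C1on n0 nH uH)).
  move=> x xn; by apply: continuousM; [exact: cst_continuous|apply: powR_cont; exact: dual_norm_gt0].
have gV x : x != 0 -> grad V x = (- n%:R * N x `^ (- n%:R - 1)) *: xi_ x.
  move=> xn; have [dN gN] := dual_norm_grad n0 nH uH xn.
  by have [_ ->] := grad_comp dN (dV x xn); rewrite gN.
have czU : C1on [set x | x != 0] z by apply: (C1onW (@subsetT _ _)); exact/C1onT.
pose h i := (z \* (fun x => x ord0 i)) \* V.
have chU i : C1on [set x | x != 0] (h i).
  exact: (C1onM o (C1onM o czU (C1on_coord i)) cV).
have hK i x : ~ K x -> h i x = 0 by move=> /zK h0; rewrite /h/= h0 !mul0r.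
have ch i : C1 (h i) by exact: C1on_glue o clK KU (chU i) (hK i).
have [r r0 Kr] := compact_sub_cube cK.
have hr i x : r < `|x| -> h i x = 0.
  by move=> xr; apply: hK => /Kr; rewrite /cube/= subr0 leNgt xr.
have ii i : intb (partial i (h i)).
  have [_ pc] := ch i; apply: (@intb_Cc _ _ _ r); first exact: pc.
  exact: partial_out (hr i).
transitivity (\int[mu]_x \sum_i partial i (h i) x); last first.
  by rewrite Rint_sum// big1// => i _; exact: integral_partial0 (ch i) (hr i).
apply: eq_Rintegral => x _.
have [Kx|nK] := EM (K x); last first.
  rewrite (grad_out clK zK nK) dotv0r big1// => i _.
  have := grad_out clK (hK i) nK => /rowP/(_ i); by rewrite !mxE.
have xn := KU x Kx; have Nx := dual_norm_gt0 n0 nH xn.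
have pE i : partial i (h i) x = V x * (x ord0 i * grad z x ord0 i) + z x * V x -
    z x * (n%:R * N x `^ (- n%:R - 1)) * (x ord0 i * xi_ x ord0 i).
  have [dc gc] := grad_coord i x.
  have dz : differentiable z x by exact: C1_diff.
  have [dVx _] := cV x xn.
  have := gradM (differentiableM dz dc) dVx => /rowP/(_ i).
  rewrite -/(h i) mxE => ->; rewrite mxE [X in X + _]mxE [X in _ + X]mxE (gradM dz dc) gc gV//.
  by rewrite mulrfctE !mxE !eqxx/= mulr1; ring.
under [RHS]eq_bigr do rewrite pE.
rewrite sumrB big_split/= -!mulr_sumr sumr_const card_ord.
rewrite -/(dotv x (grad z x)) -/(dotv x (xi_ x)) -/(N x) dotvZl -/(V x).
have -> : V x = N x `^ (- n%:R - 1) * N x.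
  rewrite /V -[X in _ * X]powRr1 ?(ltW Nx)// -powRD ?(gt_eqF Nx) ?implybT//; congr (_ `^ _); ring.
by rewrite -mulr_natr; ring.
Qed.

End radial.

(** * Comparison and Harnack's inequality for solutions *)

Section pair_of_approximation.
Context {R : realType}.
Variable n : nat.
Local Notation mu := (@lebesgue_rV R n).
Implicit Types (u v w d : 'rV[R]_n -> R) (F G D X : 'rV[R]_n -> 'rV[R]_n) (U K : set 'rV[R]_n).

Lemma C1on_bound U K v : C1on U v -> K `<=` U -> compact K ->
  exists2 B, 0 <= B & forall x, K x -> `|grad v x| <= B.
Proof. by move=> cv KU cK; apply: compact_bound => // x /KU/cv[]. Qed.

(** [W0_comp] places every [Phi d * eta] in the closure [W0]; the weight, which is at least 1 and
    dominates [X], lets the equation and the translation estimate pass to the limit. *)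
Lemma diffpair_approx U K w u v G d D X (C : R) :
  open U -> compact K -> K `<=` U -> (forall x, U x -> {for x, continuous u}) ->
  C1on U v -> measurable_fun [set: _] G -> measurable_fun [set: _] w -> (forall x, 1 <= w x) ->
  intb (fun x => w x * (1 + `|G x|) * \1_K x) -> sapprox K w u G ->
  measurable_fun [set: _] d -> measurable_fun [set: _] D -> measurable_fun [set: _] X ->
  (forall x, K x -> d x = u x - v x) -> (forall x, K x -> D x = G x - grad v x) ->
  0 <= C -> (forall x, `|X x| <= C * w x) ->
  (forall g, C1 g -> (forall x, ~ K x -> g x = 0) ->
    intb (fun x => dotv (X x) (grad g x)) /\ \int[mu]_x dotv (X x) (grad g x) = 0) ->
  diffpair K d D X.
Proof.
move=> oU cK KU cu cv mG mw w1 iw apx md mD mX dE DE C0 XC hX.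
have w0 x : 0 <= w x by exact: le_trans (w1 x).
have clK : closed K by apply: compact_closed => //; exact: norm_hausdorff.
split => // Phi Phi' L eta cPhi ce eK; have [L0 dP lP] := cPhi.
have [cP cP'] := C11_continuous cPhi.
have WF := W0_comp oU cK KU cu cv mG mw w0 iw apx md mD dE DE dP lP L0 ce eK.
have cd x : K x -> {for x, continuous (fun x => u x - v x)}.
  by move=> Kx; apply: continuousB; [exact/cu/KU|exact: C1on_cont cv (KU _ Kx)].
have [B1 B10 hB1] : exists2 B, 0 <= B & forall x, K x -> `|eta x| <= B.
  exact: compact_bound cK (fun x _ => C1_continuous ce (x := x)).
have [B2 B20 hB2] := compact_bound cK (fun x _ => C1_grad_continuous ce (x := x)).
have [B3 B30 hB3] : exists2 B, 0 <= B & forall x, K x -> `|Phi' (u x - v x)| <= B.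
  apply: (compact_bound (g := fun x => Phi' (u x - v x)) cK) => x Kx.
  exact: (@continuous_comp _ _ _ (fun x => u x - v x) Phi' _ (cd x Kx) (cP' _)).
have [B5 B50 hB5] : exists2 B, 0 <= B & forall x, K x -> `|Phi (u x - v x)| <= B.
  apply: (compact_bound (g := fun x => Phi (u x - v x)) cK) => x Kx.
  exact: (@continuous_comp _ _ _ (fun x => u x - v x) Phi _ (cd x Kx) (cP _)).
have [B4 B40 hB4] := C1on_bound cv KU cK.
move=> F; pose B := B3 * B1 * (1 + B4) + B5 * B2.
have BB : 0 <= B by rewrite /B; posit.
have FB x : `|F x| <= B * ((1 + `|G x|) * \1_K x).
  rewrite indicE; have [Kx|nK] := EM (K x); last first.
    by rewrite memNset// !mulr0 /F eK// (grad_out clK eK nK) mulr0 scale0r scaler0 addr0 normr0.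
  rewrite mem_set// mulr1 /F dE// DE// (le_trans (ler_normD _ _))// !normrZ.
  set y := `|G x|; have y0 : 0 <= y by exact: normr_ge0.
  have hGv : `|G x - grad v x| <= y + B4 by rewrite (le_trans (ler_normB _ _))// lerD// hB4.
  have t1 : `|Phi' (u x - v x)| * `|eta x| * `|G x - grad v x| <= B3 * B1 * (y + B4).
    by apply: ler_pM => //; apply: ler_pM => //; [exact: hB3|exact: hB1].
  have t2 : `|Phi (u x - v x)| * `|grad eta x| <= B5 * B2.
    by apply: (ler_pM (normr_ge0 _) (normr_ge0 _)); [exact: hB5|exact: hB2].
  rewrite (le_trans (lerD t1 t2))// -subr_ge0.
  rewrite (_ : _ - _ = B3 * B1 * (1 + B4 * y) + B5 * B2 * y); last by rewrite /B; ring.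
  by posit.
have mF : measurable_fun [set: _] F.
  have mP' : measurable_fun [set: R] Phi' by exact: continuous_measurable_fun.
  have mP : measurable_fun [set: R] Phi by exact: continuous_measurable_fun.
  apply: measurable_addrV; apply: measurable_scale => //.
  - by apply: measurable_funM; [exact: (measurableT_comp mP' md)|exact: C1_measurable].
  - exact: (measurableT_comp mP md).
  - exact: C1_measurable_grad.
have FW x : `|F x| <= B * (w x * (1 + `|G x|) * \1_K x).
  rewrite (le_trans (FB x))// ler_wpM2l// -mulrA ler_peMl// mulr_ge0// addr_ge0//.
have iF : intb (fun x => `|F x|).
  apply: (intb_le _ (intbZ B iw)); first exact: measurable_fun_normrV.
  by move=> x; rewrite normr_id.
have iXF : intb (fun x => dotv (X x) (F x)).
  apply: (intb_le _ (intbZ (n%:R * C * B) iw)); first exact: measurable_dotv.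
  move=> x; rewrite (le_trans (dotv_bound _ _))//.
  have -> : n%:R * C * B * (w x * (1 + `|G x|) * \1_K x) =
    n%:R * (C * w x) * (B * ((1 + `|G x|) * \1_K x)) by ring.
  by apply: ler_pM; rewrite ?mulr_ge0// ler_wpM2l.
split => //; first exact: (W0_test WF mw w0 mX mF C0 XC iXF hX).
move=> S h mS cS.
have mf : measurable_fun [set: _] (fun x => Phi (d x) * eta x).
  apply: measurable_funM; last exact: C1_measurable.
  apply: (measurableT_comp _ md); exact: continuous_measurable_fun.
have := W0_translation h WF cK mw w1 mf _ mF mS cS.
move=> /(_ _)/le_trans; apply; first by move=> x /eK ->; rewrite mulr0.
have iFS : intb (fun x => `|F x| * \1_S x).
  apply: (intb_le _ iF); first by apply: measurable_funM; [exact: measurable_fun_normrV|exact: measurable_indic].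
  by move=> x; rewrite normrM normr_id ler_piMr// indicE; case: (_ \in _); rewrite ?normr1 ?normr0.
rewrite [leRHS]EFinM -(intbE iFS) integral_mkcond; apply: lee_wpmul2l; first by rewrite lee_fin mulr_ge0.
rewrite le_eqVlt; apply/orP; left; apply/eqP; apply: eq_integral => x _.
by rewrite patchE indicE; case: ifP; rewrite ?mulr1 ?mulr0.
Qed.

End pair_of_approximation.

(** * The difference of a solution and a radial solution *)

Section pair_of_solution.
Context {R : realType}.
Variable n : nat.
Hypothesis n0 : (0 < n)%N.
Local Notation mu := (@lebesgue_rV R n).
Variables (H : 'rV[R]_n -> R) (p : R).
Hypotheses (p1 : 1 < p) (pn : p <= n%:R) (nH : is_norm H) (uH : uniformly_convex H)
  (dH : forall xi, xi != 0 -> differentiable H xi)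
  (cA : C1_punctured (flux H p)) (sA : structure_conditions (flux H p) p).
Local Notation A := (flux H p).
Local Notation wrad := (wrad n0 p nH).
Implicit Types (u w d : 'rV[R]_n -> R) (U K : set 'rV[R]_n).

Lemma measurable_restr U K (F : 'rV[R]_n -> 'rV[R]_n) : open U -> compact K -> K `<=` U ->
  (forall x, U x -> {for x, continuous F}) -> measurable_fun [set: _] (restr K F).
Proof.
move=> oU cK KU cF; have mK := compact_measurable_rV cK; apply/measurable_fun_rVP => i.
under eq_fun do rewrite restrE; apply/(measurable_restrictT _ mK).
apply: (measurable_funS (open_measurable_rV oU)) => //.
apply: (continuous_measurable_rV oU) => x Ux.
apply: (@continuous_comp _ _ _ F (fun y : 'rV[R]_n => y ord0 i)); first exact: cF.
exact: coord_continuous.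
Qed.

(** The weight [(1 + |G|) ^ (p - 1)] is the growth of the flux, so it dominates [X] up to a
    constant. The equation for [X] is that for [u], extended to C^1 functions by [C1_test], minus
    that for the radial solution, which holds because [K] avoids the origin. *)
Lemma solution_pair U K u (a b : R) : open U -> ~ U 0 -> compact K -> K `<=` U ->
  solution A p U u -> exists d D X, diffpair K d D X /\
    forall x, K x -> [/\ d x = u x - wrad a b x &
      X x = A (grad (wrad a b) x + D x) - A (grad (wrad a b) x)].
Proof.
move=> oU U0 cK KU [cu [G W1 hA]].
have U00 : U `<=` [set x | x != 0] by move=> x Ux; apply/eqP => x0; apply: U0; rewrite -x0.
have K0 : ~ K 0 by move/KU.
set v := wrad a b.
have cv0 : C1on [set x | x != 0] v := wrad_C1on n0 p nH uH a b.
have cv : C1on U v by exact: C1onW cv0.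
have clK : closed K by apply: compact_closed => //; exact: norm_hausdorff.
have mK := compact_measurable_rV cK.
have [r r0 [K1 [cK1 K1U KK1 apx]]] := sobolev_approx p1 oU cu W1 cK KU.
have [_ LG _] := W1.
have [mG0 iG0] := Lp_loc_restr (ltW p1) LG cK1 K1U.
set G0 := restr K1 G in apx mG0 iG0 *.
have KK : K `<=` K1 by move=> x Kx; apply: KK1 Kx _ _; rewrite /cube/= subrr normr0 ltW.
have p10 : 0 <= p - 1 by rewrite subr_ge0 ltW.
have cAA := flux_continuous p1 nH dH cA.
pose d := (fun x => u x - v x) \_ K.
pose D := restr K (fun x => G0 x - grad v x).
pose X := restr K (fun x => A (G0 x) - A (grad v x)).
have mA0 : measurable_fun [set: _] (fun x => A (G0 x)).
  apply/measurable_fun_rVP => i.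
  apply: (measurableT_comp (f := fun y => A y ord0 i) _ mG0).
  apply: (continuous_measurable_rV openT) => y _.
  by apply: (@continuous_comp _ _ _ A (fun y : 'rV[R]_n => y ord0 i)); [exact: cAA|exact: coord_continuous].
have mrB (F1 F2 : 'rV[R]_n -> 'rV[R]_n) : measurable_fun [set: _] F1 ->
    (forall x, U x -> {for x, continuous F2}) -> measurable_fun [set: _] (restr K (fun x => F1 x - F2 x)).
  move=> /measurable_fun_rVP m1 /(measurable_restr oU cK KU)/measurable_fun_rVP m2.
  apply/measurable_fun_rVP => i; under eq_fun do rewrite restrE.
  rewrite (_ : _ \_ K = fun x => ((fun x => F1 x ord0 i) \_ K) x - ((fun x => F2 x ord0 i) \_ K) x); last first.
    by apply/funext => x; rewrite !patchE; case: ifP => _; rewrite ?subr0// rV_coordB.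
  apply: measurable_funB; first by apply/(measurable_restrictT _ mK)/measurable_funTS.
  by have := m2 i; under eq_fun do rewrite restrE.
have cgv x : U x -> {for x, continuous (fun x => A (grad v x))}.
  by move=> Ux; apply: (@continuous_comp _ _ _ (grad v) A); [case: (cv x Ux)|exact: cAA].
have mD : measurable_fun [set: _] D by exact: (mrB G0 (grad v) mG0 (fun x Ux => (cv x Ux).2)).
have mX : measurable_fun [set: _] X by exact: (mrB _ _ mA0 cgv).
have md : measurable_fun [set: _] d.
  apply/(measurable_restrictT _ mK); apply: (measurable_funS (open_measurable_rV oU)) => //.
  by apply: (continuous_measurable_rV oU) => x Ux; apply: continuousB; [exact: cu|exact: C1on_cont cv Ux].
have inK x : K x -> (x \in K) by move=> Kx; rewrite mem_set.
have DE x : K x -> D x = G0 x - grad v x by move=> /inK Kx; rewrite /D /restr Kx.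
have XE x : K x -> X x = A (G0 x) - A (grad v x) by move=> /inK Kx; rewrite /X /restr Kx.
have dE x : K x -> d x = u x - v x by move=> /inK Kx; rewrite /d patchE Kx.
exists d, D, X; split; last first.
  move=> x Kx; split; first exact: dE.
  have -> : grad v x + D x = G0 x by rewrite (DE x Kx) addrC subrK.
  exact: XE.
pose w := wgt p G0.
have w1 x : 1 <= w x.
  by rewrite /w /wgt -[leLHS](powRr0 (1 + `|G0 x|)) ler_powR// lerDl.
have mw : measurable_fun [set: _] w.
  by apply: measurable_powR_fun; apply: measurable_funD => //; exact: measurable_fun_normrV.
have p0 : 0 <= p by rewrite ltW// (lt_trans ltr01).
have wE x : w x * (1 + `|G0 x|) <= 2 `^ p * (1 + `|G0 x| `^ p).
  rewrite /w /wgt mulrC mulr_powRB1 ?addr_ge0//; last by rewrite (lt_trans ltr01).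
  by have := powR_add_le p0 (@ler01 R) (normr_ge0 (G0 x)); rewrite powR1.
have iw : intb (fun x => w x * (1 + `|G0 x|) * \1_K x).
  apply: (intb_le _ (intbZ (2 `^ p) (intbD (intb_indic cK) iG0))).
    apply: measurable_funM; last exact: measurable_indic.
    by apply: measurable_funM => //; apply: measurable_funD => //; exact: measurable_fun_normrV.
  move=> x; have w0 : 0 <= w x by exact: le_trans (w1 x).
  rewrite ger0_norm; last by rewrite !mulr_ge0// addr_ge0.
  rewrite indicE; have [Kx|nK] := boolP (x \in K); first by rewrite mulr1; exact: wE.
  by rewrite mulr0 add0r; apply: mulr_ge0; exact: powR_ge0.
pose C1 := norm_bound H * norm_bound H `^ (p - 1).
have C10 : 0 <= C1 by rewrite mulr_ge0 ?powR_ge0// norm_bound_ge0.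
have AG x : `|A (G0 x)| <= C1 * w x.
  rewrite (le_trans (flux_growth p1 nH dH _))// ler_wpM2l// /w /wgt.
  by apply: powR_mono => //; rewrite lerDr.
have [C2 C20 hC2] := compact_bound cK (fun x Kx => cgv x (KU x Kx)).
have XC x : `|X x| <= (C1 + C2) * w x.
  have w0 : 0 <= w x by exact: le_trans (w1 x).
  have [Kx|nK] := EM (K x); last by rewrite /X /restr memNset// normr0 mulr_ge0// addr_ge0.
  rewrite XE// (le_trans (ler_normB _ _))// mulrDl lerD//.
  by rewrite (le_trans (hC2 x Kx))// ler_peMr.
apply: (diffpair_approx (C := C1 + C2) oU cK KU cu cv mG0 mw w1 iw apx md mD mX dE DE _ XC).
  exact: addr_ge0.
move=> g cg gK.
have iA : intb (fun x => `|A (G0 x)|).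
  apply: (intb_le _ (intbZ C1 (intbD (intb_indic cK1) iG0))); first exact: measurable_fun_normrV.
  move=> x; rewrite normr_id (le_trans (flux_growth p1 nH dH _))// ler_wpM2l//.
  rewrite indicE /G0 /restr; case: ifP => [Kx|_]; last first.
    by rewrite normr0 powR0 ?add0r ?powR_ge0// gt_eqF// subr_gt0.
  have [y1|y1] := leP `|G x| 1.
    by rewrite (le_trans (powR_mono p10 (normr_ge0 _) y1))// powR1 lerDl powR_ge0.
  by rewrite (@le_trans _ _ (`|G x| `^ p))// ?lerDr// ler_powR ?(ltW y1)// gerBl.
have [i1 E1] : intb (fun x => dotv (A (G0 x)) (grad g x)) /\ \int[mu]_x dotv (A (G0 x)) (grad g x) = 0.
  apply: (C1_test (Y := fun x => A (G x)) r0 cK cK1 K1U KK1 mA0 iA _ hA cg gK).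
  by move=> x K1x; rewrite /G0 /restr mem_set.
have ggK x : ~ K x -> grad g x = 0 by move=> nK; exact: grad_out clK gK nK.
have [B B0 hB] := compact_bound cK (fun x _ => C1_grad_continuous cg (x := x)).
have iX : intb (fun x => dotv (X x) (grad g x)).
  apply: (intb_le _ (intbZ (n%:R * (C1 + C2) * B) iw)).
    by apply: measurable_dotv => //; exact: C1_measurable_grad.
  move=> x; have w0 : 0 <= w x by exact: le_trans (w1 x).
  rewrite indicE; have [Kx|nK] := EM (K x); last by rewrite ggK// dotv0r normr0 memNset// !mulr0.
  rewrite mem_set// mulr1 (le_trans (dotv_bound _ _))//.
  have -> : n%:R * (C1 + C2) * B * (w x * (1 + `|G0 x|)) = n%:R * ((C1 + C2) * w x) * (B * (1 + `|G0 x|)) by ring.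
  apply: ler_pM; [by apply: mulr_ge0|exact: normr_ge0|by apply: ler_wpM2l; [|exact: XC]|].
  by rewrite (le_trans (hB x Kx))// ler_peMr// lerDl.
split => //.
have [c hc] := wrad_flux n0 p1 nH uH dH a b.
have E2 := wrad_div_free n0 nH uH cK K0 cg gK.
have hE x : dotv (A (G0 x)) (grad g x) - dotv (X x) (grad g x) =
    c * dotv (dual_norm n0 nH x `^ (- n%:R) *: x) (grad g x).
  have [Kx|nK] := EM (K x); last by rewrite ggK// !dotv0r subrr mulr0.
  by rewrite XE// -dotvBl opprB addrC subrK -/v hc ?dotvZl//; exact: (U00 _ (KU x Kx)).
have : \int[mu]_x (dotv (A (G0 x)) (grad g x) - dotv (X x) (grad g x)) = 0.
  under eq_Rintegral do rewrite hE.
  (* For nonzero [c], integrability of the divergence-free field against [grad g] is recovered by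
     dividing the left side of [hE] by [c]. *)
  have [c0|c0] := eqVneq c 0; first by rewrite c0; under eq_Rintegral => x _ do rewrite mul0r; rewrite Rintegral_cst// mul0r.
  rewrite RintegralZl// ?E2 ?mulr0//.
  have := intbZ c^-1 (intbB i1 iX); congr (intb _).
  by apply/funext => x; rewrite hE mulKf.
by rewrite RintegralB// E1 sub0r => /eqP; rewrite oppr_eq0 => /eqP.
Qed.

End pair_of_solution.

(** * The maximum principle for differences of solutions *)

Section maximum_principle.
Context {R : realType}.
Variable n : nat.
Hypothesis n0 : (0 < n)%N.
Local Notation mu := (@lebesgue_rV R n).
Implicit Types (d eta : 'rV[R]_n -> R) (D X : 'rV[R]_n -> 'rV[R]_n) (K : set 'rV[R]_n).

(* The test function [psq (d - ep) * eta] has field [2 pos (d - ep) D]: testing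
   with it forces [D = 0] where [d > ep], so the compactly supported continuous
   function [psq (d - ep) * eta] is translation invariant, hence zero. *)
Lemma diffpair_max K d D X eta (ep : R) x0 : compact K -> diffpair K d D X ->
  (forall x, K x -> D x != 0 -> 0 < dotv (X x) (D x)) ->
  C1 eta -> (forall x, ~ K x -> eta x = 0) ->
  (forall x, K x -> ep < d x -> eta x = 1 /\ grad eta x = 0) ->
  K x0 -> {for x0, continuous d} -> d x0 <= ep.
Proof.
move=> cK [md mD mX hd] pos_XD ce eK e1 K0 cd0; rewrite leNgt; apply/negP => d0.
have clK : closed K by apply: compact_closed => //; exact: norm_hausdorff.
pose Phi t : R := 1 * psq (1 * t + - ep); pose Phi' t : R := 1 * (1 * (2 * pos (1 * t + - ep))).
have cP : C11 Phi Phi' (`|1| * 1 ^+ 2 * 2) := C11_aff 1 (- ep) 1 C11_psq.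
have [cPhi _] := C11_continuous cP.
have PE t : Phi t = psq (t - ep) by rewrite /Phi !mul1r.
have P'E t : Phi' t = 2 * pos (t - ep) by rewrite /Phi' !mul1r.
have := hd _ _ _ eta cP ce eK; move=> /[let] F [iF iXF XF0 TE].
have FE x : F x = if x \in K then Phi' (d x) *: D x else 0.
  rewrite /F; case: ifPn => [/set_mem Kx|/negP nK]; last first.
    have {}nK : ~ K x by move=> /mem_set.
    by rewrite eK// (grad_out clK eK nK) mulr0 scale0r scaler0 addr0.
  have [dx|dx] := leP (d x) ep.
    by rewrite PE P'E /psq pos_out ?subr_le0// mulr0 mul0r expr0n/= !scale0r addr0.
  by have [-> ->] := e1 x Kx dx; rewrite mulr1 scaler0 addr0.
have P'0 t : 0 <= Phi' t by rewrite P'E mulr_ge0// pos_ge0.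
have XFx x : 0 <= dotv (X x) (F x) /\ (dotv (X x) (F x) = 0 -> F x = 0).
  rewrite FE; case: ifPn => [/set_mem Kx|_]; last by rewrite dotv0r.
  rewrite dotvZr; have [D0|D0] := eqVneq (D x) 0; first by rewrite D0 dotv0r mulr0 scaler0.
  have h := pos_XD x Kx D0; rewrite mulr_ge0 ?(ltW h)//; split => // /eqP.
  by rewrite mulf_eq0 (gt_eqF h) orbF => /eqP ->; rewrite scale0r.
have mXF := intb_measurable iXF.
(* The integrand [dotv (X x) (F x)] is nonnegative with integral 0, so it vanishes almost
   everywhere, and the field with it. *)
have ae0 : ae_eq mu [set: _] (fun x => (`|F x|)%:E) (cst 0%E).
  have : ae_eq mu [set: _] (fun x => (dotv (X x) (F x))%:E) (cst 0%E).
    apply/ae_eq_integral_abs => //; first exact/measurable_EFinP.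
    under eq_integral => x _ do rewrite abse_EFin ger0_norm ?(XFx x).1//.
    by rewrite (intbE iXF) XF0.
  apply: filterS => x h _; have := h Logic.I => /= -[/(XFx x).2 ->]; by rewrite normr0.
have F0 S : measurable S -> \int[mu]_x (`|F x| * \1_S x) = 0.
  move=> mS; have i : intb (fun x => `|F x| * \1_S x).
    apply: (intb_le _ iF); first by apply: measurable_funM; [exact: intb_measurable iF|exact: measurable_indic].
    by move=> x; rewrite normrM normr_id ler_piMr// indicE; case: (_ \in _); rewrite ?normr1 ?normr0.
  rewrite /Rintegral (_ : integral _ _ _ = 0%E)//.
  rewrite -[RHS](integral0 mu [set: 'rV[R]_n]); apply: ae_eq_integral => //.
  - by apply/measurable_EFinP; exact: intb_measurable i.
  - by apply: filterS ae0 => x h _; have := h Logic.I => /= -[->]; rewrite mul0r.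
pose f x := Phi (d x) * eta x.
have f0 : 0 < f x0.
  by rewrite /f (e1 x0 K0 d0).1 mulr1 PE /psq exprn_gt0// pos_gt0 subr_gt0.
have cf : {for x0, continuous f}.
  apply: continuousM; last exact: C1_continuous.
  exact: (@continuous_comp _ _ _ d Phi _ cd0 (cPhi _)).
have c0 : 0 < f x0 / 2 by rewrite divr_gt0.
have /continuous_epsP/(_ _ c0)[del del0 hdel] := cf.
have [r r0 Kr] := compact_sub_cube cK.
pose rho := del / 2; have rho0 : 0 < rho by rewrite divr_gt0.
(* Long enough for translation by [h] to carry the cube of radius [rho] about [x0] off the
   support. *)
pose l := r + `|x0| + rho + 1.
pose h : 'rV[R]_n := const_mx l.
have hl : l <= `|h|.
  by have := rV_coord_le h (Ordinal n0); rewrite mxE; exact: le_trans (ler_norm _).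
have out y : cube x0 rho y -> f (y + h) = 0.
  rewrite /cube/= => yx; rewrite /f eK ?mulr0// => /Kr; rewrite /cube/= subr0 => yr.
  have y1 : `|y| <= `|x0| + rho by rewrite -[y](subrK x0) (le_trans (ler_normD _ _))// addrC lerD2l.
  have := lerB_normD h y; rewrite [h + y]addrC; rewrite /l in hl; lra.
have near_x0 y : cube x0 rho y -> f x0 / 2 <= f y.
  rewrite /cube/= => yx; have := hdel (y - x0); rewrite [x0 + _]addrC subrK ler_norml.
  have ylt : `|y - x0| < del by rewrite (le_lt_trans yx)// /rho; lra.
  by move=> /(_ ylt)/andP[]; lra.
have hS := TE setT h measurableT (@convex_setrVT _ _).
rewrite F0// mulr0 in hS.
have : ((f x0 / 2)%:E * mu (cube x0 rho) <= 0)%E.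
  apply: le_trans hS.
  have <- : (\int[mu]_(x in cube x0 rho) (f x0 / 2)%:E = (f x0 / 2)%:E * mu (cube x0 rho))%E.
    by rewrite integral_cst//; exact: measurable_cube.
  rewrite integral_mkcond.
  have mf : measurable_fun [set: _] f.
    apply: measurable_funM; last exact: C1_measurable.
    by apply: (measurableT_comp _ md); exact: continuous_measurable_fun.
  apply: ge0_le_integral => //.
  - by move=> x _; apply: erestrict_ge0 => y _; rewrite lee_fin ltW.
  - by apply/(measurable_restrictT _ (measurable_cube _ _)); exact: measurable_cst.
  - apply/measurable_EFinP; apply: measurable_funM; last first.
      by rewrite (_ : (fun _ => _) = cst 1)//; apply/funext => x; rewrite !indicE !in_setT mulr1.
    apply: measurableT_comp => //; apply: measurable_funB => //.
    exact: (measurableT_comp mf (measurable_rV_shift h)).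
  - move=> y _; rewrite !indicE !in_setT !mulr1 -/(f y) -/(f (y + h)) patchE.
    case: ifPn => [/set_mem yx|_]; last by rewrite lee_fin.
    rewrite lee_fin out// sub0r normrN (le_trans (near_x0 y yx))//; exact: ler_norm.
by rewrite cube_measure ?(ltW rho0)// -EFinM lee_fin leNgt mulr_gt0// exprn_gt0// mulr_gt0.
Qed.

End maximum_principle.

(** * Comparison on annuli *)

Section comparison.
Context {R : realType}.
Variable n : nat.
Hypothesis n0 : (0 < n)%N.
Variables (H : 'rV[R]_n -> R) (p : R).
Hypotheses (p1 : 1 < p) (pn : p <= n%:R) (nH : is_norm H) (uH : uniformly_convex H)
  (dH : forall xi, xi != 0 -> differentiable H xi)
  (cA : C1_punctured (flux H p)) (sA : structure_conditions (flux H p) p).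
Local Notation A := (flux H p).
Local Notation N := (dual_norm n0 nH).
Local Notation wrad := (wrad n0 p nH).
Implicit Types (u w d : 'rV[R]_n -> R) (U K : set 'rV[R]_n).

Lemma flux_smonotone zeta eta : eta != 0 -> 0 < dotv (A (zeta + eta) - A zeta) eta.
Proof.
move=> en; have [c [C [c0 C0 h]]] := flux_kappa n0 p1 nH dH cA sA (lexx 1).
have [|||h1 _] := h `|zeta| zeta eta; rewrite ?invr1 ?mulr1 ?mul1r//.
apply: lt_le_trans h1; have e0 : 0 < `|eta| by rewrite normr_gt0.
by rewrite mulr_gt0// mulr_gt0// /gkap mulr_gt0// powR_gt0// ltr_wpDl.
Qed.

Lemma dual_norm_neq0 x : (x != 0) = (0 < N x).
Proof.
apply/idP/idP; first exact: dual_norm_gt0.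
by apply: contraTneq => ->; rewrite dual_norm0 ltxx.
Qed.

Lemma annulus_compact (r1 r2 : R) : compact [set x | r1 <= N x <= r2].
Proof.
have [b [B [b0 B0 hN _ _]]] := dual_bounds n0 nH.
have cN := @dual_norm_continuous R n n0 H nH.
apply: (subclosed_compact _ (@cube_compact R n 0 (r2 / b))).
  rewrite (_ : mkset _ = (N @^-1` [set t | r1 <= t]) `&` (N @^-1` [set t | t <= r2])).
    apply: closedI; (apply: preimage_closed; first by move=> x _; exact: cN); [exact: closed_ge|exact: closed_le].
  by apply/seteqP; split => x /=; [move=> /andP[]|move=> [-> ->]].
move=> x /= /andP[_ h]; rewrite /cube/= subr0 ler_pdivlMr// mulrC.
by have /andP[h1 _] := hN x; exact: le_trans h1 h.
Qed.

(** [phi] is positive in the open annulus, hence at least [2 * b] on the compact set [E]; the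
    normalized ramp of [phi] is constant from that value on and vanishes for [phi <= 0]. *)
Lemma annulus_cutoff (r1 r2 : R) (E : set 'rV[R]_n) : 0 < r1 -> r1 <= r2 -> compact E ->
  E `<=` [set x | r1 < N x < r2] ->
  exists eta : 'rV[R]_n -> R, [/\ C1 eta, forall x, ~ (r1 <= N x <= r2) -> eta x = 0 &
    forall x, E x -> eta x = 1 /\ grad eta x = 0].
Proof.
move=> r10 r12 cE Esub; have oN := @open_neq0 R n.
have cN := dual_norm_C1on n0 nH uH.
pose phi x := (N x - r1) * (r2 - N x).
have cphi : C1on [set x | x != 0] phi.
  apply: (C1onM oN); first exact: (C1onB oN cN (C1on_cst r1)).
  exact: (C1onB oN (C1on_cst r2) cN).
have [b b0 hb] : exists2 b, 0 < b & forall x, E x -> 2 * b <= phi x.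
  have [->|/set0P E0] := eqVneq E set0; first by exists 1.
  have cpE : {within E, continuous phi}.
    apply: continuous_in_subspaceT => x /set_mem/Esub/= /andP[h _].
    by apply: (C1on_cont cphi); rewrite /= dual_norm_neq0 (lt_trans r10).
  have [c /set_mem cE' hc] := EVT_min_rV E0 cE cpE.
  exists (phi c / 2); last by move=> x /mem_set/hc; rewrite mulrC divfK.
  by have /andP[h1 h2] := Esub _ cE'; rewrite /phi divr_gt0// mulr_gt0// subr_gt0.
have [L cL] := C11_ramp 0 b; have bb0 := ltW b0.
pose eta x := (2 * b ^+ 2)^-1 * ramp 0 b (phi x).
have D0 : 0 < 2 * b ^+ 2 by rewrite mulr_gt0// exprn_gt0.
have etaK x : ~ [set x | r1 <= N x <= r2] x -> eta x = 0.
  move=> h; rewrite /eta (ramp0 bb0 _).1 ?mulr0// /phi.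
  have [h1|h1] := leP r1 (N x); last by apply: mulr_le0_ge0; lra.
  have [h2|h2] := leP (N x) r2; first by case: h; rewrite /= h1.
  by apply: mulr_ge0_le0; lra.
have KU : [set x | r1 <= N x <= r2] `<=` [set x | x != 0].
  by move=> x /= /andP[h _]; rewrite dual_norm_neq0 (lt_le_trans r10).
have ceta : C1on [set x | x != 0] eta.
  exact: (C1onM oN (C1on_cst _) (C11_C1on oN cL cphi)).
exists eta; split => //.
  apply: C1on_glue oN _ KU ceta etaK; apply: compact_closed; [exact: norm_hausdorff|exact: annulus_compact].
move=> x Ex; have h := hb x Ex; have xn : x != 0.
  by have /andP[h1 _] := Esub _ Ex; rewrite dual_norm_neq0 (lt_trans r10).
have h' : 0 + 2 * b <= phi x by rewrite add0r.
have [r1E r'E] := ramp1 bb0 h'.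
split; first by rewrite /eta r1E mulVf// gt_eqF.
have [_ dP _] := cL; have [dphi _] := cphi x xn.
have [dr gr] := grad_comp dphi (dP (phi x)).
by rewrite /eta (gradZ _ dr) gr r'E scale0r scaler0.
Qed.

(** By the boundary condition the set where [s * (u - wrad a b)] is at least [ep] is compact in the
    open annulus, so a cutoff can be 1 on it and [diffpair_max] applies. The sign [s] covers
    comparison from above and from below. *)
Lemma annulus_comparison U u (a b r1 r2 s : R) : open U -> ~ U 0 -> solution A p U u ->
  0 < r1 -> `|s| = 1 -> (forall x, r1 <= N x <= r2 -> U x) ->
  (forall x, N x = r1 \/ N x = r2 -> s * (u x - wrad a b x) <= 0) ->
  forall x, r1 <= N x <= r2 -> s * (u x - wrad a b x) <= 0.
Proof.
move=> oU U0 su r10 s1 KU hb x0 Kx0; apply/ler_addgt0Pr => ep ep0; rewrite add0r.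
set K := [set x | r1 <= N x <= r2] in KU.
have cK : compact K by exact: annulus_compact.
have r12 : r1 <= r2 by have /andP[] := Kx0; exact: le_trans.
have clK : closed K by apply: compact_closed => //; exact: norm_hausdorff.
have [d [D [X [hd hdX]]]] := solution_pair n0 p1 nH uH dH cA a b oU U0 cK KU su.
have [cu _] := su.
have U00 : U `<=` [set x | x != 0] by move=> x Ux; apply/eqP => x0'; apply: U0; rewrite -x0'.
have cv := C1onW U00 (wrad_C1on n0 p nH uH a b).
have cd x : U x -> {for x, continuous (fun x => s * (u x - wrad a b x))}.
  move=> Ux; apply: continuousM; first exact: cst_continuous.
  by apply: continuousB; [exact: cu|exact: C1on_cont cv Ux].
pose V := [set x | U x /\ s * (u x - wrad a b x) < ep].
have oV : open V.
  rewrite openE => x [Ux xe]; rewrite /interior.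
  have h1 : \forall y \near x, U y by exact: open_nbhs_nbhs.
  have h2 : \forall y \near x, s * (u y - wrad a b y) < ep.
    exact: (cvgr_lt _ (cd x Ux) _ xe).
  by apply: filterS2 h1 h2.
have cE : compact (K `\` V).
  by apply: (subclosed_compact _ cK) => [|x []//]; rewrite setDE; apply: closedI => //; exact: open_closedC.
have Esub : K `\` V `<=` [set x | r1 < N x < r2].
  move=> x [Kx nV]; have Ux := KU x Kx; move: (Kx) => /= /andP[h1 h2].
  rewrite !lt_neqAle h1 h2 !andbT; apply/andP; split; apply/eqP => h; apply: nV; split => //;
    apply: le_lt_trans ep0; apply: hb; [left|right] => //.
have [eta [ce eK e1]] := annulus_cutoff r10 r12 cE Esub.
have hd' := diffpair_aff s 0 hd.
have dE x : K x -> s * d x + 0 = s * (u x - wrad a b x) by move=> Kx; rewrite addr0 (hdX x Kx).1.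
rewrite -(dE x0 Kx0); have [->//|epn] := EM (s * d x0 + 0 <= ep); last exfalso.
have dx0 : ep < s * d x0 + 0 by rewrite ltNge; apply/negP.
have Ex0 : (K `\` V) x0 by split => // -[_]; rewrite -dE// ltNge ltW.
apply: epn; apply: (diffpair_max n0 cK hd' _ ce eK) => //.
- move=> x Kx; rewrite scaler_eq0 negb_or => /andP[sn Dn].
  rewrite dotvZl dotvZr mulrA -expr2 (_ : s ^+ 2 = 1) ?mul1r; last by rewrite -(real_normK (num_real s)) s1 expr1n.
  by rewrite (hdX x Kx).2; exact: flux_smonotone.
- by move=> x Kx xe; apply: e1; split => // -[_]; rewrite -dE// ltNge ltW.
- have Nx := Esub _ Ex0.
  have cN := @dual_norm_continuous R n n0 H nH.
  have nK : \forall y \near x0, K y.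
    have : \forall y \near x0, r1 < N y < r2.
      have /= /andP[l1 l2] := Nx.
      have h1 : \forall y \near x0, r1 < N y by exact: (cvgr_gt _ (cN x0) _ l1).
      have h2 : \forall y \near x0, N y < r2 by exact: (cvgr_lt _ (cN x0) _ l2).
      by apply: filterS2 h1 h2 => y -> ->.
    by apply: filterS => y /andP[h1 h2]; rewrite /K/= !ltW.
  apply: near_eq_cont (cd x0 (KU _ Kx0)).
  by apply: filterS nK => y Ky; rewrite -dE.
Qed.

End comparison.

(** * Chains of cubes around the origin *)

Section chain.
Context {R : realType}.
Variable n : nat.
Hypothesis n2 : (2 <= n)%N.
Variables (d : 'rV[R]_n -> R) (C rho : R) (M : nat).
Hypotheses (C0 : 0 <= C) (rho0 : 0 < rho) (M0 : (0 < M)%N).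
Hypothesis local : forall x0 x y : 'rV[R]_n, rho <= `|x0| <= M%:R * rho ->
  cube x0 (rho / 80) x -> cube x0 (rho / 80) y -> d x <= C * d y.
Implicit Types (x y z : 'rV[R]_n).

(** The common coordinate, of size at least [rho], keeps the whole segment away from the origin. Its
    length is at most [2 * M * rho], that is, [160 * M] steps of [rho / 80]. *)
Lemma chain_segment i x y : x ord0 i = y ord0 i -> rho <= `|x ord0 i| ->
  `|x| <= M%:R * rho -> `|y| <= M%:R * rho -> d x <= C ^+ (160 * M) * d y.
Proof.
move=> xy xi xM yM; set m := (160 * M)%N.
have m0 : 0 < m%:R :> R by rewrite ltr0n muln_gt0.
pose pt (k : nat) := x + (k%:R / m%:R) *: (y - x).
have ptM k : (k <= m)%N -> rho <= `|pt k| <= M%:R * rho.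
  move=> km; apply/andP; split.
    apply: le_trans xi (le_trans _ (rV_coord_le (pt k) i)).
    by rewrite /pt !mxE xy subrr mulr0 addr0.
  pose t : R := k%:R / m%:R; have t0 : 0 <= t by rewrite divr_ge0.
  have t1 : t <= 1 by rewrite ler_pdivrMr// mul1r ler_nat.
  have -> : pt k = (1 - t) *: x + t *: y by rewrite /pt -/t; apply/rowP => j; rewrite !mxE; ring.
  apply: (le_trans (ler_normD _ _)); rewrite (normrZ (1 - t)) (normrZ t) (ger0_norm t0) ger0_norm ?subr_ge0//.
  have h1 : (1 - t) * `|x| <= (1 - t) * (M%:R * rho) by rewrite ler_wpM2l// subr_ge0.
  have h2 : t * `|y| <= t * (M%:R * rho) by rewrite ler_wpM2l.
  by rewrite (le_trans (lerD h1 h2))// -mulrDl subrK mul1r.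
suff h k : (k <= m)%N -> d x <= C ^+ k * d (pt k).
  have := h m (leqnn m); rewrite /pt divff ?gt_eqF// scale1r addrC subrK; exact.
elim: k => [_|k IH km]; first by rewrite expr0 mul1r /pt mul0r scale0r addr0.
apply: (le_trans (IH (ltnW km))); rewrite exprSr -mulrA; apply: ler_wpM2l; first exact: exprn_ge0.
apply: (local (ptM k (ltnW km))); first by rewrite /cube/= subrr normr0 divr_ge0// ltW.
rewrite /cube/= /pt addrAC opprD addrA subrr add0r -scaleNr addrC -scalerDl -mulrBl -natr1 addrAC subrr add0r.
rewrite normrZ ger0_norm ?divr_ge0// mul1r ler_pdivrMl//.
rewrite (le_trans (ler_normB _ _))// (le_trans (lerD yM xM))// /m natrM.
by rewrite -subr_ge0 (_ : _ - _ = 0)//; field.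
Qed.

(** Each point is joined to the constant vector [e] by two segments: the first keeps a largest
    coordinate and changes the others to [s], the second keeps one of these and changes the former.
    This second coordinate exists because [n >= 2]. Two points need four segments. *)
Lemma chain_sphere x y : rho <= `|x| <= M%:R * rho -> rho <= `|y| <= M%:R * rho ->
  d x <= C ^+ (160 * M) * (C ^+ (160 * M) * (C ^+ (160 * M) * (C ^+ (160 * M) * d y))).
Proof.
pose s := M%:R * rho; pose e : 'rV[R]_n := const_mx s.
have s0 : 0 <= s by rewrite mulr_ge0// ltW.
have rs : rho <= s by rewrite /s ler_peMl ?(ltW rho0)// ler1n.
have eM : `|e| <= s by apply/rV_norm_leP => // i; rewrite mxE ger0_norm.
have step z : rho <= `|z| <= s -> exists z' i j, [/\ z ord0 i = z' ord0 i, rho <= `|z ord0 i|,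
    z' ord0 j = e ord0 j, rho <= `|z' ord0 j| & `|z'| <= s].
  move=> /andP[z1 z2].
  have zn : mx_norm z != 0 by apply: lt0r_neq0; exact: lt_le_trans z1.
  have [[a i] /= E] := mx_norm_neq0 zn.
  have {}E : `|z| = `|z ord0 i| by move: E; rewrite (ord1 a).
  have [j ji] : exists j : 'I_n, j != i.
    have [->|i0] := eqVneq i (Ordinal (ltnW n2)); last by exists (Ordinal (ltnW n2)); rewrite eq_sym.
    by exists (Ordinal n2).
  exists (\row_k if k == i then z ord0 i else s), i, j.
  rewrite !mxE eqxx (negPf ji) -E (ger0_norm s0); split => //.
  by apply/rV_norm_leP => // k; rewrite mxE; case: ifP => _; rewrite -?E// ger0_norm.
move=> hx hy; have [x' [i [j [x1 x2 x3 x4 x5]]]] := step x hx.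
have [y' [k [l [y1 y2 y3 y4 y5]]]] := step y hy.
have CC : 0 <= C ^+ (160 * M) by exact: exprn_ge0.
have /andP[_ hx2] := hx; have /andP[_ hy2] := hy.
apply: (le_trans (chain_segment x1 x2 hx2 x5)); apply: ler_wpM2l => //.
apply: (le_trans (chain_segment x3 x4 x5 eM)); apply: ler_wpM2l => //.
have el : rho <= `|e ord0 l| by rewrite -y3.
apply: (le_trans (chain_segment (esym y3) el eM y5)); apply: ler_wpM2l => //.
by apply: (chain_segment (esym y1) _ y5 hy2); rewrite -y1.
Qed.

End chain.

(** * Harnack's inequality on spheres of the dual norm *)

Section sphere.
Context {R : realType}.
Variable n : nat.
Hypothesis n0 : (0 < n)%N.
Hypothesis n2 : (2 <= n)%N.
Variables (H : 'rV[R]_n -> R) (p : R).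
Hypotheses (p1 : 1 < p) (pn : p <= n%:R) (nH : is_norm H) (uH : uniformly_convex H)
  (dH : forall xi, xi != 0 -> differentiable H xi)
  (cA : C1_punctured (flux H p)) (sA : structure_conditions (flux H p) p).
Local Notation A := (flux H p).
Local Notation N := (dual_norm n0 nH).
Local Notation wrad := (wrad n0 p nH).
Implicit Types (u w d : 'rV[R]_n -> R) (U K : set 'rV[R]_n).

(** On the shell the gradient of [wrad a b] is comparable to [kappa = |b| * r ^ (- q)], with a
    factor [Lam] independent of [a], [b] and [r]; [flux_kappa] then gives constants with the same
    independence. *)
Lemma solution_gpair (theta : R) : 0 < theta -> theta <= 1 -> exists c0 C0 : R, [/\ 0 < c0, 0 <= C0 &
  forall U K u (a b r : R), open U -> ~ U 0 -> solution A p U u -> compact K -> K `<=` U ->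
    0 < r -> (forall x, K x -> theta * r <= N x <= r / theta) ->
    exists kappa d D X, gpair (Num.min p 2) c0 C0 n (gkap p kappa) K d D X /\
      forall x, K x -> d x = u x - wrad a b x].
Proof.
move=> th0 th1; have [b1 [B1 [b10 B10 _ hb hB]]] := dual_bounds n0 nH.
have T1 : 1 <= theta^-1 by rewrite invf_ge1.
set q := rexp n p; pose T := theta^-1 `^ `|- q|.
have T0 : 1 <= T by rewrite /T -(powRr0 theta^-1) ler_powR.
have Tp : 0 < T by exact: lt_le_trans T0.
have ib1 : 0 < b1^-1 by rewrite invr_gt0.
pose Lam := T * (B1 + b1^-1 + 1).
have L1 : 1 <= Lam.
  by rewrite /Lam -[leLHS]mulr1; apply: ler_pM => //; rewrite lerDr addr_ge0// ltW.
have [c [C [c0 C0 h]]] := flux_kappa n0 p1 nH dH cA sA L1.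
exists c, C; split => //; first exact: ltW.
move=> U K u a b r oU U0 su cK KU r0 Kr.
have [d [D [X [hd hX]]]] := solution_pair n0 p1 nH uH dH cA a b oU U0 cK KU su.
pose kappa := `|b| * r `^ (- q).
have k0 : 0 <= kappa by rewrite mulr_ge0// powR_ge0.
exists kappa, d, D, X; split; last by move=> x /hX[].
split => //; first exact: gkap_orlicz.
move=> x Kx; have [_ ->] := hX x Kx.
have xn : x != 0 by apply/eqP => x0; apply: U0; rewrite -x0; exact: KU.
have Nx := dual_norm_gt0 n0 nH xn.
have /andP[Kr1 Kr2] := Kr x Kx.
have e1 : N x `^ (- q) <= T * r `^ (- q).
  apply: powR_compare => //; first by rewrite invrK mulrC.
  by rewrite mulrC.
have e2 : r `^ (- q) <= T * N x `^ (- q).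
  apply: powR_compare => //; first by rewrite invrK -ler_pdivlMr.
  by rewrite ler_pdivlMl.
have zE : `|grad (wrad a b) x| = `|b| * N x `^ (- q) * `|dual_arg n0 nH x|.
  by rewrite wrad_grad// normrZ normrM normrN (ger0_norm (powR_ge0 _ _)).
have xi1 := hb x xn; have xi2 := hB x.
move: zE xi1 xi2; move: (grad _ x) => z; move: `|dual_arg _ _ _| => xi zE xi1 xi2.
have bb := normr_ge0 b; have Nq := powR_ge0 (N x) (- q); have rq := powR_ge0 r (- q).
have xi0 : 0 <= xi by rewrite (le_trans (ltW b10)).
apply: h => //.
- rewrite ler_pdivrMr ?(lt_le_trans ltr01 L1)// zE /kappa -!mulrA; apply: ler_wpM2l => //.
  apply: (le_trans e2); rewrite mulrC; apply: ler_wpM2l => //.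
  rewrite /Lam mulrA [xi * T]mulrC -mulrA -[leLHS]mulr1; apply: ler_wpM2l; first exact: ltW.
  have : 1 <= xi * b1^-1 by rewrite ler_pdivlMr// mul1r.
  rewrite !mulrDr mulr1 => h1; have := mulr_ge0 xi0 (ltW B10); lra.
- rewrite zE /kappa /Lam.
  have -> : T * (B1 + b1^-1 + 1) * (`|b| * r `^ (- q)) = `|b| * (T * r `^ (- q)) * (B1 + b1^-1 + 1) by ring.
  apply: ler_pM => //; [by rewrite mulr_ge0|by rewrite ler_wpM2l|].
  by rewrite (le_trans xi2)// -addrA lerDl addr_ge0// ltW.
Qed.

Lemma sphere_harnack : exists C k : R, [/\ 1 <= C, 1 < k &
  forall U u (a b r : R), open U -> ~ U 0 -> solution A p U u -> 0 < r ->
    (forall x, r / k <= N x <= k * r -> U x /\ 0 <= u x - wrad a b x) ->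
    forall x y, N x = r -> N y = r -> u x - wrad a b x <= C * (u y - wrad a b y)].
Proof.
have [b1 [B1 [b10 B10 hN _ _]]] := dual_bounds n0 nH.
(* Bounds the ratio of the two norms: [{N = r}] lies in the shell [rho <= |x| <= M * rho] with
   [rho = r / B1]. *)
pose M := (Num.truncn (B1 / b1)).+1.
have MB : B1 / b1 <= M%:R by apply: ltW; exact: truncnS_gt.
have M1 : 1 <= M%:R :> R by rewrite ler1n.
have M0 : 0 < M%:R :> R by exact: lt_le_trans M1.
pose th : R := (4 * M%:R)^-1.
have th0 : 0 < th by rewrite invr_gt0 mulr_gt0.
have th1 : th <= 1 by rewrite invf_le1 ?mulr_gt0//; lra.
have [c0 [C0 [c00 C00 hpair]]] := solution_gpair th0 th1.
have m1 : 1 < Num.min p 2 by rewrite lt_min p1 ltr1n.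
have [C C1 hC] := harnack n0 m1 n2 c00 C00.
have Cp : 0 <= C by exact: le_trans C1.
pose CC := C ^+ (160 * M).
have CC1 : 1 <= CC by exact: exprn_ege1.
exists (CC * (CC * (CC * CC))), (4 * M%:R); split; last 1 first.
- move=> U u a b r oU U0 su r0 hU x y Nx Ny.
  pose rho := r / B1; have rho0 : 0 < rho by rewrite divr_gt0.
  pose K := [set x : 'rV[R]_n | rho / 4 <= `|x| <= 4 * M%:R * rho].
  have KN z : K z -> th * r <= N z <= r / th.
    rewrite /K/= => /andP[z1 z2]; have /andP[hN1 hN2] := hN z; apply/andP; split.
      apply: le_trans hN1; apply: (@le_trans _ _ (b1 * (rho / 4))); last by rewrite ler_pM2l.
      rewrite /th /rho invfM -subr_ge0.
      have -> : b1 * (r / B1 / 4) - 4^-1 * M%:R^-1 * r = r / 4 * (b1 / B1 - M%:R^-1) by ring.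
      apply: mulr_ge0; first by rewrite divr_ge0// ltW.
      by rewrite subr_ge0 -[leRHS]invf_div lef_pV2// posrE divr_gt0.
    apply: (le_trans hN2); rewrite /th invrK; apply: (@le_trans _ _ (B1 * (4 * M%:R * rho))).
      by rewrite ler_pM2l.
    by rewrite /rho le_eqVlt; apply/orP; left; apply/eqP; field; rewrite gt_eqF.
  have KU z : K z -> U z /\ 0 <= u z - wrad a b z.
    by move=> /KN h; apply: hU; move: h; rewrite /th invrK [r * _]mulrC [_^-1 * r]mulrC.
  have cK : compact K.
    apply: (subclosed_compact _ (@cube_compact R n 0 (4 * M%:R * rho))).
      rewrite (_ : K = (Num.norm @^-1` [set t | rho / 4 <= t]) `&` (Num.norm @^-1` [set t | t <= 4 * M%:R * rho])).
        apply: closedI; (apply: preimage_closed; first by move=> z _; exact: norm_continuous); [exact: closed_ge|exact: closed_le].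
      by apply/seteqP; split => z; rewrite /K/=; [move=> /andP[]|move=> [-> ->]].
    by move=> z /andP[_ z2]; rewrite /cube/= subr0.
  have [kap [d [D [X [hd hdE]]]]] := hpair U K u a b r oU U0 su cK (fun z h => (KU z h).1) r0 KN.
  have [cu _] := su.
  have U00 : U `<=` [set x | x != 0] by move=> z Uz; apply/eqP => x0'; apply: U0; rewrite -x0'.
  have cv := C1onW U00 (wrad_C1on n0 p nH uH a b).
  have ins (x0 z : 'rV[R]_n) : rho <= `|x0| <= M%:R * rho -> cube x0 (rho / 2) z ->
      rho / 4 < `|z| /\ `|z| < 4 * M%:R * rho.
    rewrite /cube/= => /andP[h1 h2] h3.
    have h4 := ler_distD x0 z 0; have h5 := ler_distD z x0 0.
    rewrite !subr0 in h4 h5; rewrite [`|x0 - z|]distrC in h5.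
    have hM : rho <= M%:R * rho by rewrite ler_peMl// ltW.
    by split; lra.
  have insK (x0 z : 'rV[R]_n) : rho <= `|x0| <= M%:R * rho -> cube x0 (rho / 2) z -> K z.
    by move=> h1 h2; have [h3 h4] := ins x0 z h1 h2; rewrite /K/= !ltW.
  (* [harnack] requires the cube of 40 times the radius, here [rho / 2], to lie in [K]. *)
  have local (x0 x' y' : 'rV[R]_n) : rho <= `|x0| <= M%:R * rho ->
      cube x0 (rho / 80) x' -> cube x0 (rho / 80) y' -> d x' <= C * d y'.
    move=> hx0 hx hy; have e40 : 40 * (rho / 80) = rho / 2 by field.
    apply: (hC _ K d D X x0 (rho / 80) hd) => //; rewrite ?e40.
    - by rewrite divr_gt0.
    - by move=> z; exact: insK.
    - move=> z hz; have Kz := insK x0 z hx0 hz; have [Uz pz] := KU z Kz.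
      split; first by rewrite hdE.
      have cz : {for z, continuous (fun x => u x - wrad a b x)}.
        by apply: continuousB; [exact: cu|exact: C1on_cont cv Uz].
      apply: near_eq_cont cz; have [h3 h4] := ins x0 z hx0 hz.
      have n1 : \forall w \near z, rho / 4 < `|w| by exact: (cvgr_gt _ (@norm_continuous _ _ z) _ h3).
      have n3 : \forall w \near z, `|w| < 4 * M%:R * rho by exact: (cvgr_lt _ (@norm_continuous _ _ z) _ h4).
      by apply: filterS2 n1 n3 => w w1 w2; rewrite -hdE//= /K/= !ltW.
  have sph z : N z = r -> rho <= `|z| <= M%:R * rho.
    move=> Nz; have /andP[hN1 hN2] := hN z; rewrite Nz in hN1 hN2.
    rewrite /rho ler_pdivrMr// mulrC hN2/=.
    rewrite -(ler_pM2l b10) (le_trans hN1)//.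
    rewrite (_ : b1 * _ = r * (M%:R * b1 / B1)); last by ring.
    by rewrite ler_peMr ?(ltW r0)// ler_pdivlMr// mul1r -ler_pdivrMr.
  have Kx z : N z = r -> K z.
    move=> /sph h; apply: (insK z) => //; rewrite /cube/= subrr normr0 divr_ge0// ltW//.
  have := chain_sphere n2 Cp rho0 (ltn0Sn _) local (sph x Nx) (sph y Ny).
  by rewrite !hdE ?mulrA//; exact: Kx.
- rewrite -[leLHS]mulr1; apply: ler_pM => //; rewrite -[leLHS]mulr1; apply: ler_pM => //.
  by rewrite -[leLHS]mulr1; apply: ler_pM.
- lra.
Qed.

End sphere.

(** * Behaviour at the origin *)

Section asymptotics.
Context {R : realType}.
Variable n : nat.
Hypothesis n0 : (0 < n)%N.
Hypothesis n2 : (2 <= n)%N.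
Variables (H : 'rV[R]_n -> R) (p : R).
Hypotheses (p1 : 1 < p) (pn : p <= n%:R) (nH : is_norm H) (uH : uniformly_convex H)
  (dH : forall xi, xi != 0 -> differentiable H xi)
  (cA : C1_punctured (flux H p)) (sA : structure_conditions (flux H p) p).
Local Notation A := (flux H p).
Local Notation N := (dual_norm n0 nH).
Local Notation wrad := (wrad n0 p nH).
Local Notation Ga := (rgam n p).
Variables (U : set 'rV[R]_n) (u : 'rV[R]_n -> R) (r0 : R).
Hypotheses (oU : open U) (U0 : ~ U 0) (su : solution A p U u) (r00 : 0 < r0)
  (hU : forall x, 0 < N x <= r0 -> U x) (u0 : forall x, U x -> 0 < u x).
Implicit Types (x y : 'rV[R]_n).

Lemma wradE a b x : wrad a b x = a + b * Ga (N x). Proof. by []. Qed.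

Lemma level_profile : exists m M : R -> R, forall r, 0 < r <= r0 ->
  [/\ exists2 x, N x = r & u x = m r, forall x, N x = r -> m r <= u x,
      forall x, N x = r -> u x <= M r & 0 < m r].
Proof.
have hr (r : R) : exists mM : R * R, 0 < r <= r0 ->
    [/\ exists2 x, N x = r & u x = mM.1, forall x, N x = r -> mM.1 <= u x,
      forall x, N x = r -> u x <= mM.2 & 0 < mM.1].
  have [/andP[rp rr]|nr] := boolP (0 < r <= r0); last by exists (0, 0).
  pose L := [set x | r <= N x <= r].
  have LE x : N x = r -> x \in L by move=> h; rewrite mem_set// /L/= h lexx.
  have LN x : x \in L -> N x = r by move=> /set_mem/= /le_anti.
  have LU x : x \in L -> U x by move=> /LN h; apply: hU; rewrite h rp.
  have cL : compact L by exact: annulus_compact.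
  have [e eN _] := dual_norm_level n0 nH rp.
  have L0 : L !=set0 by exists e; exact/set_mem/LE.
  have cu : {within L, continuous u}.
    by apply: continuous_in_subspaceT => x /LU; exact: su.1.
  have [x1 L1 h1] := EVT_min_rV L0 cL cu; have [x2 L2 h2] := EVT_max_rV L0 cL cu.
  exists (u x1, u x2) => _; split => /=.
  - by exists x1; rewrite ?LN.
  - by move=> x /LE/h1.
  - by move=> x /LE/h2.
  - exact/u0/LU.
have [f hf] := choice hr.
by exists (fun r => (f r).1), (fun r => (f r).2).
Qed.

Lemma radial_below (a b r1 r2 : R) : 0 < r1 -> r2 <= r0 ->
  (forall x, N x = r1 \/ N x = r2 -> a + b * Ga (N x) <= u x) ->
  forall x, r1 <= N x <= r2 -> a + b * Ga (N x) <= u x.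
Proof.
move=> r10 r20 hb x hx.
have := @annulus_comparison R n n0 H p p1 nH uH dH cA sA U u a b r1 r2 (-1) oU U0 su r10.
rewrite normrN1 => /(_ erefl) h; rewrite -subr_le0 -opprB -mulN1r; apply: h hx.
  by move=> y /andP[y1 y2]; apply: hU; rewrite (lt_le_trans r10 y1) (le_trans y2).
by move=> y /hb; rewrite wradE mulN1r opprB subr_le0.
Qed.

Lemma radial_above (a b r1 r2 : R) : 0 < r1 -> r2 <= r0 ->
  (forall x, N x = r1 \/ N x = r2 -> u x <= a + b * Ga (N x)) ->
  forall x, r1 <= N x <= r2 -> u x <= a + b * Ga (N x).
Proof.
move=> r10 r20 hb x hx.
have := @annulus_comparison R n n0 H p p1 nH uH dH cA sA U u a b r1 r2 1 oU U0 su r10.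
rewrite normr1 => /(_ erefl) h; rewrite -subr_le0 -[leLHS]mul1r; apply: h hx.
  by move=> y /andP[y1 y2]; apply: hU; rewrite (lt_le_trans r10 y1) (le_trans y2).
by move=> y /hb; rewrite wradE mul1r subr_le0.
Qed.

Lemma rgam_small (B r : R) : 0 < r -> exists s, [/\ 0 < s, s <= r & forall t, 0 < t -> t <= s -> B <= Ga t].
Proof.
move=> rp; have [s s0 hs] := rgam_infty p1 pn B.
exists (Num.min r s); split; first by rewrite lt_min rp.
  by rewrite ge_min lexx.
by move=> t t0 ts; apply: hs => //; rewrite (le_trans ts)// ge_min lexx orbT.
Qed.

(** Comparison with [m r' + t * (Ga r' - Ga (N x))], which is at most 0 close to the origin because
    [Ga] is unbounded; there positivity of [u] suffices as boundary condition. The slope [t] is such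
    that only [e] is lost at radius [r]. *)
Lemma level_min_mono (m M : R -> R) : (forall r, 0 < r <= r0 ->
  [/\ exists2 x, N x = r & u x = m r, forall x, N x = r -> m r <= u x,
      forall x, N x = r -> u x <= M r & 0 < m r]) ->
  forall r r', 0 < r -> r <= r' -> r' <= r0 -> m r' <= m r.
Proof.
move=> hm r r' rp; rewrite le_eqVlt => /predU1P[->//|rr'] r'0.
have r'p := lt_trans rp rr'.
have hG := rgam_decr n p rp rr'.
have [|[x Nx ux] _ _ _] := hm r; first by rewrite rp (le_trans (ltW rr')).
have [|_ mr' _ mr'0] := hm r'; first by rewrite r'p.
apply/ler_addgt0Pr => e e0; pose t := e / (Ga r - Ga r').
have D0 : 0 < Ga r - Ga r' by rewrite subr_gt0.
have t0 : 0 < t by rewrite divr_gt0.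
have [s [sp sr hs]] := rgam_small (Ga r' + m r' / t) rp.
have := @radial_below (m r' + t * Ga r') (- t) s r' sp r'0 _ x.
rewrite Nx sr (ltW rr') ux => /(_ _ isT) h; rewrite -lerBlDr; apply: le_trans (h _) => {h}.
  have -> : e = t * (Ga r - Ga r') by rewrite /t divfK// gt_eqF.
  by rewrite le_eqVlt; apply/orP; left; apply/eqP; ring.
move=> y [Ny|Ny]; last by rewrite Ny mulNr addrK; exact: mr'.
have Uy : U y by apply: hU; rewrite Ny sp/= (le_trans sr)// (le_trans (ltW rr')).
apply: le_trans (ltW (u0 Uy)); rewrite Ny mulNr -addrA -opprB -[X in _ - X]mulrBr subr_le0.
by rewrite mulrC -ler_pdivrMr// lerBrDl; exact: hs.
Qed.

(* [q r] is the slope of the chord of [m] between [r] and [r0], as a function of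
   [Ga]; by comparison [m] is concave in [Ga], so the slopes decrease to [ga]. *)
Lemma radial_limit : exists ga a : R, [/\ 0 <= ga,
  forall x, 0 < N x <= r0 -> wrad a ga x <= u x &
  forall e, 0 < e -> exists r1, [/\ 0 < r1, r1 <= r0 & forall x, 0 < N x <= r1 ->
    u x - wrad a ga x <= e * Ga (N x)]].
Proof.
have [m [M hm]] := level_profile; have mono := level_min_mono hm.
have r0r0 : 0 < r0 <= r0 by rewrite r00 lexx.
have rle r : 0 < r < r0 -> 0 < r <= r0 by move=> /andP[-> /ltW].
have dG r : 0 < r < r0 -> 0 < Ga r - Ga r0 by move=> /andP[h1 h2]; rewrite subr_gt0 rgam_decr.
pose q r := (m r - m r0) / (Ga r - Ga r0).
pose S := [set t | exists2 r, 0 < r < r0 & t = q r].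
have lbS : lbound S 0.
  move=> t [r hr ->]; have := dG r hr; have /andP[h1 h2] := hr => h3.
  by rewrite divr_ge0 ?(ltW h3)// subr_ge0 mono// ltW.
have hr2 : 0 < r0 / 2 < r0 by rewrite divr_gt0//= ltr_pdivrMr// mulr_natr mulr2n ltrDl.
have infS : has_inf S by split; [exists (q (r0 / 2)); exists (r0 / 2)|exists 0].
have S0 := infS.1.
pose ga := inf S; pose a := m r0 - ga * Ga r0.
have mq r : 0 < r < r0 -> m r = m r0 + q r * (Ga r - Ga r0).
  by move=> hr; rewrite /q divfK ?gt_eqF ?dG// addrC subrK.
have ga0 : 0 <= ga by exact: lb_le_inf.
have low x : 0 < N x <= r0 -> wrad a ga x <= u x.
  rewrite wradE /a => hx; have [_ h _ _] := hm _ hx; apply: le_trans (h x erefl).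
  move: hx => /andP[N0]; rewrite le_eqVlt => /predU1P[->|Nr]; first by rewrite subrK.
  have hx : 0 < N x < r0 by rewrite N0.
  have gq : ga <= q (N x) by apply: ge_inf infS.2 _ _; exists (N x).
  rewrite (mq _ hx) -addrA lerD2l addrC -mulrBr ler_wpM2r//; exact/ltW/dG.
exists ga, a; split => // e e0.
have [C [k [C1 k1 hH]]] := sphere_harnack n0 n2 p1 pn nH uH dH cA sA.
have Cp : 0 < C by exact: lt_le_trans C1. have kp : 0 < k by exact: lt_trans k1.
have e1 : 0 < e / (2 * C) by rewrite divr_gt0// mulr_gt0.
(* At [r1] the slope is within [e / (2 * C)] of its infimum; by [qr] below this persists for smaller
   radii. *)
have [_ [r1 hr1 ->] q1] := inf_adherent e1 infS; have /andP[r1p r1r] := hr1.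
(* For radii up to [s] one has [Ga r - Ga r0 <= 2 * Ga r]; the final radius [s / k] leaves room for
   the shell around [{N = r}] in [sphere_harnack]. *)
have [s [sp sr hs]] := rgam_small `|Ga r0| r1p.
have skp : 0 < s / k by rewrite divr_gt0.
exists (s / k); split => //.
  by rewrite ler_pdivrMr// (le_trans sr)// (le_trans (ltW r1r))// ler_peMr ?ltW.
move=> x /andP[N0 Ns]; set r := N x in N0 Ns *.
have Nk : r * k <= s by rewrite -ler_pdivlMr.
have rs : r <= s by apply: le_trans Nk; rewrite ler_peMr// ltW.
have rr1 : r <= r1 by exact: le_trans sr.
have hr : 0 < r < r0 by rewrite N0 (le_lt_trans rr1).
(* The chord of [m] from [r] to [r0] is a radial solution below [u] on both spheres, hence also at
   the minimum point of the sphere of radius [r1] in between. *)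
have qr : q r <= q r1.
  have [|[y Ny uy] _ _ _] := hm r1; first exact: rle.
  have := @radial_below (m r0 - q r * Ga r0) (q r) r r0 N0 (lexx _) _ y.
  rewrite Ny rr1 (ltW r1r) uy (mq r1 hr1) => h.
  have : m r0 - q r * Ga r0 + q r * Ga r1 <= m r0 + q r1 * (Ga r1 - Ga r0).
    apply: h => // z [Nz|Nz]; rewrite Nz; last by have [_ h _ _] := hm _ r0r0; rewrite subrK; exact: h.
    have [_ h _ _] := hm _ (rle r hr); apply: le_trans (h z Nz).
    by rewrite (mq r hr) le_eqVlt; apply/orP; left; apply/eqP; ring.
  by rewrite -addrA lerD2l addrC -mulrBr ler_pM2r// dG.
have [|[y Ny uy] _ _ _] := hm r; first exact: rle.
have hreg z : r / k <= N z <= k * r -> U z /\ 0 <= u z - wrad a ga z.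
  move=> /andP[z1 z2]; have hz : 0 < N z <= r0.
    rewrite (lt_le_trans _ z1) ?divr_gt0//= (le_trans z2)// mulrC (le_trans Nk)//.
    by rewrite (le_trans sr)// ltW.
  by split; [exact: hU|rewrite subr_ge0; exact: low].
(* Harnack's inequality against the minimum point [y] carries the bound for [m r] over to the whole
   sphere. *)
have := hH U u a ga r oU U0 su N0 hreg x y erefl Ny.
move=> h; apply: (le_trans h); rewrite uy wradE Ny /a (mq r hr).
have -> : m r0 + q r * (Ga r - Ga r0) - (m r0 - ga * Ga r0 + ga * Ga r) = (q r - ga) * (Ga r - Ga r0) by ring.
have G0 := dG r hr; have Gs := hs r N0 rs.
have d1 : q r - ga <= e / (2 * C) by rewrite lerBlDl (le_trans qr)// ltW.
have G2 : Ga r - Ga r0 <= 2 * Ga r by rewrite mulr_natl mulr2n lerD2l (le_trans (ler_norm _))// normrN.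
have -> : e * Ga r = C * (e / (2 * C) * (2 * Ga r)) by field; rewrite gt_eqF.
rewrite ler_pM2l//; apply: ler_pM => //; last exact: ltW.
by rewrite subr_ge0; apply: ge_inf infS.2 _ _; exists r.
Qed.

(** Comparison from above with small multiples of [Ga] makes [u] bounded, so the minima have a
    finite supremum [c], which they approach by monotonicity. The shift by [c - e / C] makes the
    minimum small on each small sphere, and Harnack's inequality does the same for the maximum. *)
Lemma radial_limit0 (a : R) :
  (forall e, 0 < e -> exists r1, [/\ 0 < r1, r1 <= r0 & forall x, 0 < N x <= r1 ->
    u x <= a + e * Ga (N x)]) ->
  exists2 c : R, 0 < c & forall e, 0 < e -> exists2 r1, 0 < r1 & forall x, 0 < N x <= r1 ->
    `|u x - c| <= e.
Proof.
move=> hs; have [m [M hm]] := level_profile; have mono := level_min_mono hm.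
have r0r0 : 0 < r0 <= r0 by rewrite r00 lexx.
have [_ _ hM _] := hm _ r0r0.
have bounded x : 0 < N x <= r0 -> u x <= Num.max (M r0) a.
  move=> /andP[N0 Nr]; apply/ler_addgt0Pr => e e0; set B := Num.max _ _.
  have aB : a <= B by rewrite le_max lexx orbT.
  have MB : M r0 <= B by rewrite le_max lexx.
  pose D := `|Ga (N x) - Ga r0| + 1; have D0 : 0 < D by rewrite ltr_wpDl.
  pose t := e / D; have t0 : 0 < t by rewrite divr_gt0.
  (* Half of the slope [t]: the remaining [t / 2 * Ga s] outweighs [t * Ga r0] once [s] is small. *)
  have [r1 [r1p r1r h1]] := hs (t / 2) (divr_gt0 t0 (ltr0Sn _ 1)).
  have [s1 [s1p s1r hs1]] := rgam_small (2 * Ga r0) N0.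
  have [s [sp ss1 hss]] : exists s, [/\ 0 < s, s <= s1 & s <= r1].
    by exists (Num.min s1 r1); rewrite lt_min s1p r1p !ge_min !lexx orbT.
  have := @radial_above (B - t * Ga r0) t s r0 sp (lexx _) _ x.
  rewrite (le_trans ss1 s1r) Nr => /(_ _ isT)/le_trans; apply.
    move=> y [Ny|Ny]; rewrite Ny; last by rewrite subrK (le_trans (hM y Ny)).
    have := h1 y; rewrite Ny sp hss => /(_ isT)/le_trans; apply.
    have hg := hs1 s sp ss1.
    have : t * (2 * Ga r0) <= t * Ga s by rewrite ler_pM2l.
    lra.
  rewrite -addrA lerD2l addrC -mulrBr /t mulrAC ler_pdivrMr// ler_pM2l//.
  by rewrite /D (le_trans (ler_norm _))// lerDl.
pose S := [set t | exists2 r, 0 < r <= r0 & t = m r].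
have Sm : S (m r0) by exists r0.
have ubS : ubound S (Num.max (M r0) a).
  by move=> t [r hr ->]; have [[x Nx <-] _ _ _] := hm r hr; apply: bounded; rewrite Nx.
have supS : has_sup S by split; [exists (m r0)|exists (Num.max (M r0) a)].
pose c := sup S.
have mc r : 0 < r <= r0 -> m r <= c by move=> hr; apply: ub_le_sup supS.2 _ _; exists r.
have c0 : 0 < c by have [_ _ _ h] := hm _ r0r0; exact: lt_le_trans h (mc _ r0r0).
exists c => // e e0.
have [C [k [C1 k1 hH]]] := sphere_harnack n0 n2 p1 pn nH uH dH cA sA.
have Cp : 0 < C by exact: lt_le_trans C1. have kp : 0 < k by exact: lt_trans k1.
have e1 : 0 < e / C by rewrite divr_gt0.
have [_ [r1 /andP[r1p r1r] ->] q1] := sup_adherent e1 supS.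
rewrite -/c in q1.
have low x : 0 < N x <= r1 -> c - e / C <= u x.
  move=> /andP[N0 Nr]; have hx : 0 < N x <= r0 by rewrite N0 (le_trans Nr).
  have [_ h _ _] := hm _ hx; apply: le_trans (h x erefl); rewrite (le_trans (ltW q1))//.
  exact: mono.
exists (r1 / k); first by rewrite divr_gt0.
move=> x /andP[N0]; rewrite ler_pdivlMr// => Nk; set r := N x in N0 Nk.
have rr1 : r <= r1 by apply: le_trans Nk; rewrite ler_peMr// ltW.
have hr : 0 < r <= r0 by rewrite N0 (le_trans rr1).
have [[y Ny uy] _ _ _] := hm r hr.
have hreg z : r / k <= N z <= k * r -> U z /\ 0 <= u z - wrad (c - e / C) 0 z.
  move=> /andP[z1 z2]; have hz : 0 < N z <= r1.
    by rewrite (lt_le_trans _ z1) ?divr_gt0//= (le_trans z2)// mulrC.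
  have /andP[hz1 hz2] := hz; split; first by apply: hU; rewrite hz1 (le_trans hz2).
  by rewrite wradE mul0r addr0 subr_ge0; exact: low.
have := hH U u (c - e / C) 0 r oU U0 su N0 hreg x y erefl Ny.
rewrite !wradE !mul0r !addr0 uy => h.
have h1 : C * (m r - (c - e / C)) <= e.
  rewrite mulrC -ler_pdivlMr//; have := mc r hr; lra.
have eC : e / C <= e by rewrite ler_pdivrMr// ler_peMr// ltW.
have eC0 := ltW e1.
have hl := low x; rewrite -/r N0 rr1 in hl; have {}hl := hl isT.
by rewrite ler_norml; apply/andP; split; lra.
Qed.

Lemma punctured_near r1 : 0 < r1 -> \forall x \near (0 : 'rV[R]_n)^', 0 < N x <= r1.
Proof.
move=> r1p; have [b [B [b0 B0 hN _ _]]] := dual_bounds n0 nH.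
apply/nbhs_ballP; exists (r1 / B) => /=; first by rewrite divr_gt0.
move=> x; rewrite ball_rVE sub0r normrN ltr_pdivlMr// mulrC => xr xn.
by rewrite dual_norm_gt0//=; have /andP[_ h] := hN x; rewrite (le_trans h)// ltW.
Qed.

Lemma solution_asymptotics : exists2 ga : R, 0 <= ga &
  (u x / Ga (N x)) @[x --> (0 : 'rV[R]_n)^'] --> ga /\
  (ga = 0 -> exists2 c : R, 0 < c & u x @[x --> (0 : 'rV[R]_n)^'] --> c).
Proof.
have [ga [a [ga0 low up]]] := radial_limit; exists ga => //; split; last first.
  move=> g0; have [|c c0 hc] := radial_limit0 (a := a).
    move=> e /up[r1 [r1p r1r h]]; exists r1; split => // x /h.
    by rewrite wradE g0 mul0r addr0 lerBlDl.
  exists c => //; apply/cvgrPdist_le => e /hc[r1 r1p h].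
  by apply: filterS (punctured_near r1p) => x /h; rewrite distrC.
apply/cvgrPdist_le => e e0; have e2 : 0 < e / 2 by rewrite divr_gt0.
have [r1 [r1p r1r h]] := up _ e2.
have [s [sp sr hs]] := rgam_small (`|a| / (e / 2) + 1) r1p.
apply: filterS (punctured_near sp) => x /andP[N0 Ns].
have G1 := hs _ N0 Ns; have G0 : 0 < Ga (N x) by apply: lt_le_trans G1; rewrite ltr_wpDl// divr_ge0// ltW.
have hx : 0 < N x <= r1 by rewrite N0 (le_trans Ns).
have hx0 : 0 < N x <= r0 by rewrite N0 (le_trans Ns)// (le_trans sr).
have h1 := low x hx0; have h2 := h x hx; rewrite !wradE in h1 h2.
have -> : ga - u x / Ga (N x) = (ga * Ga (N x) - u x) / Ga (N x) by field; rewrite gt_eqF.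
rewrite normrM normfV (gtr0_norm G0) ler_pdivrMr//.
have ha : `|a| <= e / 2 * Ga (N x).
  by rewrite mulrC -ler_pdivrMr// (le_trans _ G1)// lerDl.
move: ha; rewrite !ler_norml => /andP[ha1 ha2]; apply/andP; split; lra.
Qed.

End asymptotics.

Theorem corollary1p9 (R : realType) (n : nat) (p : R)
    (Omega : set 'rV[R]_n) (H : 'rV[R]_n -> R) :
  (2 <= n)%N -> 1 < p -> p <= n%:R ->
  is_domain Omega ->
  isolated (boundary ((Some : _ -> one_point_compactification 'rV[R]_n)
                        @` Omega)) (Some 0) ->
  is_norm H -> uniformly_convex H ->
  (forall xi, xi != 0 -> differentiable H xi) ->
  C1_punctured (flux H p) ->
  structure_conditions (flux H p) p ->
  regular0 (flux H p) p Omega.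
Proof.
move=> n2 p1 pn _ _ nH uH dH cA sA u v; have n0 : (0 < n)%N := ltnW n2.
set N := dual_norm n0 nH; set g := fun x => rgam n p (N x).
have asym w : positive_germs (flux H p) p Omega w -> [/\
    \forall x \near (0 : 'rV[R]_n)^', 0 < w x & exists2 ga : R, 0 <= ga &
    (w x / g x) @[x --> (0 : 'rV[R]_n)^'] --> ga /\
    (ga = 0 -> exists2 c : R, 0 < c & w x @[x --> (0 : 'rV[R]_n)^'] --> c)].
  move=> [U [[oU U0 nU] _ _ sw w0]]; split; first by apply: filterS nU => x; exact: w0.
  have [b [B [b0 B0 hN _ _]]] := dual_bounds n0 nH.
  have /nbhs_ballP[e /= e0 he] := nU.
  (* Where [N x <= b * e / 2] the sup norm is below [e], so these points off the origin lie in the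
     domain of the germ. *)
  apply: (solution_asymptotics n2 p1 pn uH dH cA sA oU U0 sw (r0 := b * e / 2) _ _ w0).
    by rewrite divr_gt0// mulr_gt0.
  move=> x /andP[Nx Nr]; apply: he; last by rewrite (dual_norm_neq0 n0 nH).
  rewrite ball_rVE sub0r normrN -(ltr_pM2l b0); have /andP[h _] := hN x.
  by rewrite (le_lt_trans h)// (le_lt_trans Nr)// ltr_pdivrMr// ltr_pMr ?mulr_gt0// ltr1n.
move=> /asym[upos [gu gu0 [hu hu0]]] /asym[vpos [gv gv0 [hv hv0]]].
have gpos : \forall x \near (0 : 'rV[R]_n)^', 0 < g x.
  have [s s0 hs] := rgam_infty p1 pn 1.
  apply: filterS (punctured_near n0 nH s0) => x /andP[h1 h2].
  exact: lt_le_trans (hs _ h1 h2).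
have toE (f : 'rV[R]_n -> R) (l : R) : f x @[x --> (0 : 'rV[R]_n)^'] --> l ->
    (f x)%:E @[x --> (0 : 'rV[R]_n)^'] --> l%:E.
  by move=> hf; apply: cvg_EFin => //; exact: nearW.
(* If [gv] is nonzero, [g] cancels from the quotient of [u / g] and [v / g], and the limit is
   finite. *)
have [gv00|gvn] := eqVneq gv 0; last first.
  exists (gu / gv)%:E; first by rewrite lee_fin divr_ge0.
  have h : (u x / g x) * (v x / g x)^-1 @[x --> (0 : 'rV[R]_n)^'] --> gu / gv.
    by apply: cvgM => //; apply: cvgV.
  apply: toE; refine (cvg_trans (near_eq_cvg _) h).
  apply: filterS2 gpos vpos => x gx vx /=.
  by field; rewrite !gt_eqF.
have [cv cv0 hcv] := hv0 gv00.
(* If both coefficients vanish, both solutions have positive finite limits. *)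
have [gu00|gun] := eqVneq gu 0.
  have [cu cu0 hcu] := hu0 gu00.
  exists (cu / cv)%:E; first by rewrite lee_fin divr_ge0// ltW.
  by apply: toE; apply: cvgM => //; apply: cvgV; rewrite ?gt_eqF.
(* Now [u] is at least [gu / 2 * g] near the origin while [v] stays below [cv + 1]. *)
exists +oo%E => //; apply/cvgeyPge => B.
have gup : 0 < gu by rewrite lt_neqAle eq_sym gun.
have h1 : \forall x \near (0 : 'rV[R]_n)^', gu / 2 < u x / g x.
  by apply: (cvgr_gt _ hu); rewrite ltr_pdivrMr// ltr_pMr// ltr1n.
have h2 : \forall x \near (0 : 'rV[R]_n)^', v x < cv + 1 by apply: (cvgr_lt _ hcv); rewrite ltrDl.
have h3 : \forall x \near (0 : 'rV[R]_n)^', `|B| * (cv + 1) / (gu / 2) <= g x.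
  have [s s0 hs] := rgam_infty p1 pn (`|B| * (cv + 1) / (gu / 2)).
  by apply: filterS (punctured_near n0 nH s0) => x /andP[h4 h5]; exact: hs.
near=> x.
have k1 : gu / 2 < u x / g x by near: x; exact: h1.
have k2 : v x < cv + 1 by near: x; exact: h2.
have k3 : `|B| * (cv + 1) / (gu / 2) <= g x by near: x; exact: h3.
have k4 : 0 < g x by near: x; exact: gpos.
have k5 : 0 < v x by near: x; exact: vpos.
rewrite lee_fin (le_trans (ler_norm B))// ler_pdivlMr//.
apply: (@le_trans _ _ (`|B| * (cv + 1))); first by rewrite ler_wpM2l// ltW.
rewrite ler_pdivrMr in k3; last by rewrite divr_gt0.
apply: (le_trans k3); rewrite ltr_pdivlMr// in k1; rewrite mulrC; exact: ltW.
Unshelve. all: by end_near.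
Qed.
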